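(* Let $k_1,k_2,k_3$ and $m_1,m_2,m_3$ be the continuous solutions on $\mathbb{T}=\{(x,\xi)\in\mathbb{R}^2:0\le\xi\le x\le1\}$ of the controller and observer kernel equations given in the context, and let $p_i(x)=-\mu m_i(x,0)$ for $i=1,2,3$. Consider the plant $$\partial_t u_1+\gamma_1\partial_x u_1=\sigma_{11}u_1+\sigma_{12}u_2+\alpha(x)w,$$ $$\partial_t u_2+\gamma_2\partial_x u_2=\sigma_{21}u_1+\sigma_{22}u_2+\alpha(x)w,$$ $$\partial_t w-\mu\partial_x w=\theta_1(x)u_1+\theta_2(x)u_2,$$ for $t>0$, $x\in(0,1)$, with $$u_i(t,0)=q_iw(t,0)\ (i=1,2),\qquad w(t,1)=\rho_1u_1(t,1)+\rho_2u_2(t,1)+U(t),$$ and measured output $y(t)=w(t,0)$, together with the observer $$\partial_t\hat u_1+\gamma_1\partial_x\hat u_1=\sigma_{11}\hat u_1+\sigma_{12}\hat u_2+\alpha(x)\hat w-p_1(x)[y(t)-\hat w(t,0)],$$ $$\partial_t\hat u_2+\gamma_2\partial_x\hat u_2=\sigma_{21}\hat u_1+\sigma_{22}\hat u_2+\alpha(x)\hat w-p_2(x)[y(t)-\hat w(t,0)],$$ $$\partial_t\hat w-\mu\partial_x\hat w=\theta_1(x)\hat u_1+\theta_2(x)\hat u_2-p_3(x)[y(t)-\hat w(t,0)],$$ $$\hat u_i(t,0)=q_iy(t)\ (i=1,2),\qquad \hat w(t,1)=\rho_1\hat u_1(t,1)+\rho_2\hat u_2(t,1)+U(t).$$ For given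 initial data $(u_1^0,u_2^0,w^0,\hat u_1^0,\hat u_2^0,\hat w^0)\in(L^2([0,1]))^6$ and the control law $$U(t)=-\rho_1u_1(t,1)-\rho_2u_2(t,1)+\int_0^1\big[k_1(1,\xi)\hat u_1(t,\xi)+k_2(1,\xi)\hat u_2(t,\xi)+k_3(1,\xi)\hat w(t,\xi)\big]\,d\xi,$$ the $(u_1,u_2,w,\hat u_1,\hat u_2,\hat w)$-system is exponentially stable in the sense of the $L^2$ norm.
   Context: Coefficients. Let $g,a,C_f,H^*,V^*>0$ be physical constants (gravity, sediment parameter, friction, steady water depth and velocity), with Froude number $Fr=V^*/\sqrt{gH^*}$ either $<1$ (subcritical) or $>1$ (supercritical). Let $\lambda_1<0<\lambda_2<\lambda_3$ be the eigenvalues of $$\begin{pmatrix}V^*&H^*&0\\ g&V^*&g\\ 0&aV^{*2}&0\end{pmatrix}.$$ For $\{i,j,k\}=\{1,2,3\}$ put $r_k=C_f\frac{V^*}{H^*}\frac{\lambda_k}{(\lambda_k-\lambda_i)(\lambda_k-\lambda_j)}$ and $\alpha_k=(3V^*-2\lambda_k)r_k$. Set $\mu=-\lambda_1>0$, $\gamma_1=\lambda_2>0$, $\gamma_2=\lambda_3>0$, $\sigma_{11}=\sigma_{21}=\alpha_2$, $\sigma_{12}=\sigma_{22}=\alpha_3$, and, for $x\in[0,1]$, $\alpha(x)=\alpha_1e^{\alpha_1x/\mu}$, $\theta_j(x)=\alpha_{j+1}e^{\alpha_1x/\mu}$ for $j=1,2$. The numbers $q_1,q_2,\rho_1,\rho_2$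 are real constants, and $U(t)$ is a scalar boundary control input. Controller kernel equations, on $\mathbb{T}$: $$\mu\partial_xk_1-\gamma_1\partial_\xi k_1=\sigma_{11}k_1+\sigma_{21}k_2+\theta_1(\xi)k_3,$$ $$\mu\partial_xk_2-\gamma_2\partial_\xi k_2=\sigma_{12}k_1+\sigma_{22}k_2+\theta_2(\xi)k_3,$$ $$\mu\partial_xk_3+\mu\partial_\xi k_3=\alpha(\xi)k_1+\alpha(\xi)k_2,$$ with $k_1(x,x)=-\frac{\theta_1(x)}{\gamma_1+\mu}$, $k_2(x,x)=-\frac{\theta_2(x)}{\gamma_2+\mu}$, $\mu k_3(x,0)=q_1\gamma_1k_1(x,0)+q_2\gamma_2k_2(x,0)$. Observer kernel equations, on $\mathbb{T}$: $$\gamma_1\partial_xm_1-\mu\partial_\xi m_1=\sigma_{11}m_1+\sigma_{12}m_2+\alpha(x)m_3,$$ $$\gamma_2\partial_xm_2-\mu\partial_\xi m_2=\sigma_{21}m_1+\sigma_{22}m_2+\alpha(x)m_3,$$ $$\mu\partial_xm_3+\mu\partial_\xi m_3=-\theta_1(x)m_1-\theta_2(x)m_2,$$ with $m_1(x,x)=\frac{\alpha(x)}{\gamma_1+\mu}$, $m_2(x,x)=\frac{\alpha(x)}{\gamma_2+\mu}$, $m_3(1,\xi)=\rho_1m_1(1,\xi)+\rho_2m_2(1,\xi)$. Kernel solutions are understood along characteristics. Exponential stability in the $L^2$ norm: there exist $C,\nu>0$, independent of the initial data, such that the $L^2([0,1])$ norm of the full (six-component) state at time $t\ge0$ is at most $Ce^{-\nu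 t}$ times its norm at time $0$. Solutions are weak ($L^2$) solutions. *)

(* Defs.v *)
From HB Require Import structures.
From mathcomp Require Import all_boot all_order all_algebra.
From mathcomp Require Import all_classical all_reals all_analysis.

Set Implicit Arguments.
Unset Strict Implicit.
Unset Printing Implicit Defensive.

Import Order.TTheory GRing.Theory Num.Theory.
Import numFieldNormedType.Exports.

Local Open Scope classical_set_scope.
Local Open Scope ring_scope.

Definition sve_matrix (R : realType) (g a H V : R) : 'M[R]_3 :=
  \matrix_(i < 3, j < 3)
    nth 0 (nth [::] [:: [:: V; H; 0];
                        [:: g; V; g];
                        [:: 0; a * V ^+ 2; 0]] i) j.

Definition froude (R : realType) (g H V : R) : R := V / Num.sqrt (g * H).

Definition r_coef (R : realType) (Cf H V lk li lj : R) : R :=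
  Cf * (V / H) * (lk / ((lk - li) * (lk - lj))).

Definition alpha_coef (R : realType) (Cf H V lk li lj : R) : R :=
  (3 * V - 2 * lk) * r_coef Cf H V lk li lj.

Record coefs (R : realType) := Coefs {
  mu : R; gamma1 : R; gamma2 : R;
  sigma11 : R; sigma12 : R; sigma21 : R; sigma22 : R;
  alpha : R -> R; theta1 : R -> R; theta2 : R -> R }.

Definition sve_coefs (R : realType) (Cf H V l1 l2 l3 : R) : coefs R :=
  let a1 := alpha_coef Cf H V l1 l2 l3 in
  let a2 := alpha_coef Cf H V l2 l1 l3 in
  let a3 := alpha_coef Cf H V l3 l1 l2 in
  let mu := - l1 in
  {| mu := mu; gamma1 := l2; gamma2 := l3;
     sigma11 := a2; sigma12 := a3; sigma21 := a2; sigma22 := a3;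
     alpha := fun x => a1 * expR (a1 * x / mu);
     theta1 := fun x => a2 * expR (a1 * x / mu);
     theta2 := fun x => a3 * expR (a1 * x / mu) |}.

Definition triangle (R : realType) : set (R * R) :=
  [set z | 0 <= z.2 /\ z.2 <= z.1 /\ z.1 <= 1].

(* [d1 * D_x K + d2 * D_xi K = F] on the triangle, integrated along the
   characteristic lines (the triangle is convex, so the whole characteristic
   segment lies in it). *)
Definition along_characteristics (R : realType) (d1 d2 : R)
    (K F : R * R -> R) : Prop :=
  forall x xi s : R, 0 <= s ->
    triangle (x, xi) -> triangle (x + s * d1, xi + s * d2) ->
    K (x + s * d1, xi + s * d2) =
      K (x, xi) +
      \int[lebesgue_measure]_(tau in `[0, s]) F (x + tau * d1, xi + tau * d2).

Definition controller_kernels (R : realType) (c : coefs R) (q1 q2 : R)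
    (k1 k2 k3 : R * R -> R) : Prop :=
  [/\ [/\ {within @triangle R, continuous k1},
          {within @triangle R, continuous k2} &
          {within @triangle R, continuous k3}],
      [/\ along_characteristics (mu c) (- gamma1 c) k1
            (fun z => sigma11 c * k1 z + sigma21 c * k2 z
                      + theta1 c z.2 * k3 z),
          along_characteristics (mu c) (- gamma2 c) k2
            (fun z => sigma12 c * k1 z + sigma22 c * k2 z
                      + theta2 c z.2 * k3 z) &
          along_characteristics (mu c) (mu c) k3
            (fun z => alpha c z.2 * k1 z + alpha c z.2 * k2 z)] &
      forall x : R, 0 <= x <= 1 ->
      [/\ k1 (x, x) = - (theta1 c x / (gamma1 c + mu c)),
          k2 (x, x) = - (theta2 c x / (gamma2 c + mu c)) &
          mu c * k3 (x, 0) =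
            q1 * gamma1 c * k1 (x, 0) + q2 * gamma2 c * k2 (x, 0)]].

Definition observer_kernels (R : realType) (c : coefs R) (rho1 rho2 : R)
    (m1 m2 m3 : R * R -> R) : Prop :=
  [/\ [/\ {within @triangle R, continuous m1},
          {within @triangle R, continuous m2} &
          {within @triangle R, continuous m3}],
      [/\ along_characteristics (gamma1 c) (- mu c) m1
            (fun z => sigma11 c * m1 z + sigma12 c * m2 z
                      + alpha c z.1 * m3 z),
          along_characteristics (gamma2 c) (- mu c) m2
            (fun z => sigma21 c * m1 z + sigma22 c * m2 z
                      + alpha c z.1 * m3 z) &
          along_characteristics (mu c) (mu c) m3
            (fun z => - (theta1 c z.1 * m1 z) - theta2 c z.1 * m2 z)] &
      forall x : R, 0 <= x <= 1 ->
      [/\ m1 (x, x) = alpha c x / (gamma1 c + mu c),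
          m2 (x, x) = alpha c x / (gamma2 c + mu c) &
          m3 (1, x) = rho1 * m1 (1, x) + rho2 * m2 (1, x)]].

Definition observer_gain (R : realType) (c : coefs R) (m : R * R -> R) : R -> R :=
  fun x => - mu c * m (x, 0).

Definition in_L2 (R : realType) (D : set R) (f : R -> R) : Prop :=
  f \_ D \in Lfun (@lebesgue_measure R) 2%:E.

Definition L2norm (R : realType) (f : R -> R) : R :=
  fine ('N[@lebesgue_measure R]_2%:E[EFin \o (f \_ `[0, 1])]).

Definition state_norm (R : realType) (s : seq (R -> R)) : R :=
  Num.sqrt (\sum_(f <- s) L2norm f ^+ 2).

(* A scalar unknown of a hyperbolic system: its values [bulk t x] inside the
   domain, where [bulk t] only matters as an element of L^2(0,1), together with
   its boundary traces at [x = 0] and [x = 1], functions of time which the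
   values of [bulk t] do not determine pointwise. *)
Record unknown (R : realType) := Unknown {
  bulk :> R -> R -> R;
  trace0 : R -> R;
  trace1 : R -> R }.

(* [C([0, +oo); L^2(0,1))], in a jointly measurable representative, with traces
   in [L^2_loc([0, +oo))]. *)
Definition L2_regular (R : realType) (z : unknown R) : Prop :=
  [/\ measurable_fun ([set tx | 0 <= tx.1 /\ 0 <= tx.2 <= 1] : set (R * R))
        (fun tx => z tx.1 tx.2),
      forall t : R, 0 <= t -> in_L2 `[0, 1] (z t),
      forall t : R, 0 <= t ->
        L2norm (z s \- z t) @[s --> within [set s | 0 <= s] (nbhs t)] --> (0 : R),
      forall T : R, 0 <= T -> in_L2 `[0, T] (trace0 z) &
      forall T : R, 0 <= T -> in_L2 `[0, T] (trace1 z)].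

Definition dt (R : realType) (phi : R -> R -> R) (t x : R) : R :=
  derive1 (phi ^~ x) t.

Definition dx (R : realType) (phi : R -> R -> R) (t x : R) : R :=
  derive1 (phi t) x.

(* The restrictions of these functions to [[0, T] x [0, 1]] are exactly the
   functions of class C^1 up to the boundary. *)
Definition C1_test (R : realType) (phi : R -> R -> R) : Prop :=
  [/\ forall t x : R, derivable (phi ^~ x) t 1 /\ derivable (phi t) x 1,
      continuous (fun tx : R * R => dt phi tx.1 tx.2) &
      continuous (fun tx : R * R => dx phi tx.1 tx.2)].

(* Weak L^2 solution of [D_t z + v D_x z = f] on [(0, +oo) x (0, 1)] with
   initial value [z0]: the equation multiplied by a test function and
   integrated by parts on [[0, T] x [0, 1]], keeping all boundary terms. *)
Definition weak_transport (R : realType) (v : R) (f : R -> R -> R)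
    (z0 : R -> R) (z : unknown R) : Prop :=
  L2_regular z /\
  forall (T : R) (phi : R -> R -> R), 0 <= T -> C1_test phi ->
    \int[lebesgue_measure]_(x in `[0, 1]) (phi T x * z T x)
    - \int[lebesgue_measure]_(x in `[0, 1]) (phi 0 x * z0 x)
    + v * \int[lebesgue_measure]_(t in `[0, T])
            (phi t 1 * trace1 z t - phi t 0 * trace0 z t)
    = \int[lebesgue_measure]_(t in `[0, T])
        \int[lebesgue_measure]_(x in `[0, 1])
          ((dt phi t x + v * dx phi t x) * z t x + phi t x * f t x).

Definition plant_solution (R : realType) (c : coefs R) (q1 q2 rho1 rho2 : R)
    (U : R -> R) (u10 u20 w0 : R -> R) (u1 u2 w : unknown R) : Prop :=
  [/\ weak_transport (gamma1 c)
        (fun t x => sigma11 c * u1 t x + sigma12 c * u2 t x + alpha c x * w t x)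
        u10 u1,
      weak_transport (gamma2 c)
        (fun t x => sigma21 c * u1 t x + sigma22 c * u2 t x + alpha c x * w t x)
        u20 u2,
      weak_transport (- mu c)
        (fun t x => theta1 c x * u1 t x + theta2 c x * u2 t x)
        w0 w &
      {ae @lebesgue_measure R, forall t : R, 0 < t ->
        [/\ trace0 u1 t = q1 * trace0 w t,
            trace0 u2 t = q2 * trace0 w t &
            trace1 w t = rho1 * trace1 u1 t + rho2 * trace1 u2 t + U t]}].

Definition observer_solution (R : realType) (c : coefs R) (q1 q2 rho1 rho2 : R)
    (p1 p2 p3 : R -> R) (U y : R -> R) (u10 u20 w0 : R -> R)
    (u1 u2 w : unknown R) : Prop :=
  [/\ weak_transport (gamma1 c)
        (fun t x => sigma11 c * u1 t x + sigma12 c * u2 t x + alpha c x * w t x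
                    - p1 x * (y t - trace0 w t))
        u10 u1,
      weak_transport (gamma2 c)
        (fun t x => sigma21 c * u1 t x + sigma22 c * u2 t x + alpha c x * w t x
                    - p2 x * (y t - trace0 w t))
        u20 u2,
      weak_transport (- mu c)
        (fun t x => theta1 c x * u1 t x + theta2 c x * u2 t x
                    - p3 x * (y t - trace0 w t))
        w0 w &
      {ae @lebesgue_measure R, forall t : R, 0 < t ->
        [/\ trace0 u1 t = q1 * y t,
            trace0 u2 t = q2 * y t &
            trace1 w t = rho1 * trace1 u1 t + rho2 * trace1 u2 t + U t]}].

(* The boundary values fed back are those of the plant, the integral is over the
   observer state. *)
Definition control_law (R : realType) (rho1 rho2 : R) (k1 k2 k3 : R * R -> R)
    (u1 u2 uh1 uh2 wh : unknown R) : R -> R :=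
  fun t => - rho1 * trace1 u1 t - rho2 * trace1 u2 t
    + \int[lebesgue_measure]_(xi in `[0, 1])
        (k1 (1, xi) * uh1 t xi + k2 (1, xi) * uh2 t xi + k3 (1, xi) * wh t xi).

(* Main.v *)
Require Import Defs.
From HB Require Import structures.
From mathcomp Require Import all_boot all_order all_algebra.
From mathcomp Require Import all_classical all_reals all_analysis.
From mathcomp Require Import measurable_realfun.
From mathcomp Require Import ring lra.

(** The reason for the stability is a cascade: the observation error does not
    see the control, it decays by itself, and the observer is a stable system
    driven by the decaying error.

    Write [U1 = u1 - uh1], [U2 = u2 - uh2], [W = w - wh] for the error and
    [tau] for the trace of [W] at [0], which is the innovation
    [y - wh(t, 0)]. The inflow traces of [U1] and [U2] are zero, because the
    observer is fed with the measured output, and [W(t, 1)] is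
    [rho1 U1(t, 1) + rho2 U2(t, 1)], because the control cancels out. The
    observer kernels define new unknowns by [W = beta + M3 beta] and
    [Ui = ai + Mi beta], where [Mi] is the Volterra operator with kernel
    [mi]. The kernel equations, their diagonal values and the gains [pi] are
    what is needed for [beta] and [tau] to disappear from the equations of
    [a1] and [a2]: these form a pair of transport equations with zero inflow,
    whose couplings only look upstream. What is present at time zero is swept
    out of the interval, so the pair decays at any rate; rate 2 is chosen.
    Its outgoing traces then decay; they enter [beta] at [x = 1], whose
    source is a combination of [a1] and [a2]; hence [beta] and its outgoing
    trace [tau] decay too, at rate 1 (lemmas [cascade_decay] and
    [error_decay]).

    The controller kernels similarly define
    [psi = wh - K1 uh1 - K2 uh2 - K3 wh]. Its equation retains only multiples
    of [tau], and the feedback law makes its inflow at [x = 1] equal to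
    [- rho1 U1(t, 1) - rho2 U2(t, 1)]: it decays at rate 1/2. Once [psi] is
    known to decay, [wh] is recovered from [psi], [uh1], [uh2] by a Volterra
    equation, and [uh1], [uh2] are again a pair of transport equations with
    decaying inflow and source: they decay at rate 1/4 ([controller_decay]).
    The halving of rates pays for the passage between decay of a norm at each
    time and square-integrability in time against an exponential
    ([closed_loop_decay] puts the pieces together).

    Two difficulties are due to weak solutions and to kernels that are only
    continuous. The first is that transforming the unknowns requires the
    equation satisfied by [K z] when [z] solves a transport equation. It is
    obtained by transposition: a test function for [K z] becomes, through the
    adjoint of [K], a test function for [z]. It is again of class C1 because
    a kernel is differentiable along its characteristics, and integrating
    over the labels of characteristics turns this into differentiability of
    the integral ([kernel_extension], [adjoint_test], [vol_sol]). The same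
    remark, with the Neumann series, gives a kernel with the same regularity
    for the inverse of the identity plus [M3] ([resolvent]).

    The second is that a weak solution cannot be multiplied by itself. The
    estimates are obtained by duality instead: the weak form is tested with
    functions constant along the characteristics ([weak_transported]), and an
    L2 norm is the supremum of the pairings with smooth functions supported
    inside the interval ([L2_dual]). This bounds both the state and the
    outgoing trace ([transport_norm], [transport_trace]). The weight
    [expR (- (lam * x))] with large [lam] makes Volterra operators small
    ([wnorm_vol_le]), and so makes the bounded couplings harmless
    ([coupled_decay]). *)

Set Implicit Arguments.
Unset Strict Implicit.
Unset Printing Implicit Defensive.

Import Order.TTheory GRing.Theory Num.Theory.
Import numFieldNormedType.Exports.

Local Open Scope classical_set_scope.
Local Open Scope ring_scope.

(** * Rules for continuity and integrability *)
Lemma cont_comp (A B C : topologicalType) (f : A -> B) (g : B -> C) :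
  continuous f -> continuous g -> continuous (fun x => g (f x)).
Proof. by move=> cf cg x; apply: continuous_comp; [exact: cf|exact: cg]. Qed.

Lemma cont_pair (A B C : topologicalType) (f : A -> B) (g : A -> C) :
  continuous f -> continuous g -> continuous (fun x => (f x, g x)).
Proof. by move=> cf cg x; apply: cvg_pair; [exact: cf|exact: cg]. Qed.

Lemma cont_fst (A B : topologicalType) : continuous (fun p : A * B => p.1).
Proof. by move=> [a b]; exact: cvg_fst. Qed.

Lemma cont_snd (A B : topologicalType) : continuous (fun p : A * B => p.2).
Proof. by move=> [a b]; exact: cvg_snd. Qed.

Lemma cont_11 (A B C : topologicalType) : continuous (fun p : (A * B) * C => p.1.1).
Proof. exact: (cont_comp (@cont_fst _ _) (@cont_fst _ _)). Qed.

Lemma cont_12 (A B C : topologicalType) : continuous (fun p : (A * B) * C => p.1.2).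
Proof. exact: (cont_comp (@cont_fst _ _) (@cont_snd _ _)). Qed.

Lemma cont_id (A : topologicalType) : continuous (fun p : A => p).
Proof. by move=> p; exact: cvg_id. Qed.

Section ContinuityRules.
Context {R : realType} {A : topologicalType}.
Implicit Types f g : A -> R.

Lemma contD f g : continuous f -> continuous g -> continuous (fun x => f x + g x).
Proof. by move=> cf cg x; apply: cvgD; [exact: cf|exact: cg]. Qed.

Lemma contN f : continuous f -> continuous (fun x => - f x).
Proof. by move=> cf x; apply: cvgN; exact: cf. Qed.

Lemma contM f g : continuous f -> continuous g -> continuous (fun x => f x * g x).
Proof. by move=> cf cg x; apply: cvgM; [exact: cf|exact: cg]. Qed.

Lemma cont_cst (c : R) : continuous (fun _ : A => c).
Proof. exact: cst_continuous. Qed.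

Lemma cont_min f g : continuous f -> continuous g ->
  continuous (fun x => Num.min (f x) (g x)).
Proof. exact: min_fun_continuous. Qed.

Lemma cont_max f g : continuous f -> continuous g ->
  continuous (fun x => Num.max (f x) (g x)).
Proof. exact: max_fun_continuous. Qed.

End ContinuityRules.

Lemma contMl (R : realType) (c : R) : continuous ( *%R c).
Proof. by move=> x; apply: cvgM; [exact: cvg_cst|exact: cvg_id]. Qed.

Lemma contDl (R : realType) (c : R) : continuous ( +%R c).
Proof. by move=> x; apply: cvgD; [exact: cvg_cst|exact: cvg_id]. Qed.

Ltac cont :=
  repeat lazymatch goal with
  | |- continuous (fun _ => _ + _) => apply: contD
  | |- continuous (fun _ => - _) => apply: contN
  | |- continuous (fun _ => _ * _) => apply: contM
  | |- continuous (fun _ => Num.min _ _) => apply: cont_min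
  | |- continuous (fun _ => Num.max _ _) => apply: cont_max
  | |- continuous (fun _ => (_, _)) => apply: cont_pair
  | |- continuous (fun x => x) => exact: cont_id
  | |- continuous fst => exact: cont_fst
  | |- continuous ( *%R _) => exact: contMl
  | |- continuous ( +%R _) => exact: contDl
  | |- continuous -%R => apply: contN
  | |- continuous snd => exact: cont_snd
  | |- continuous (fun x => fst x) => exact: cont_fst
  | |- continuous (fun x => snd x) => exact: cont_snd
  | |- continuous (fun x => fst (fst x)) => exact: cont_11
  | |- continuous (fun x => snd (fst x)) => exact: cont_12
  | |- continuous (fun _ => ?c) => exact: cont_cst
  end; try assumption.

Section IntegrabilityRules.
Context {R : realType}.
Notation mu := (@lebesgue_measure R).
Variables (D : set R) (mD : measurable D).
Implicit Types f g : R -> R.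

Lemma intD f g : mu.-integrable D (EFin \o f) -> mu.-integrable D (EFin \o g) ->
  mu.-integrable D (EFin \o (fun x => f x + g x)).
Proof.
by move=> fi gi; rewrite [X in integrable _ _ X](_ : _ = (fun x => (f x)%:E + (g x)%:E)%E);
  [exact: integrableD|apply/funext => x; rewrite /= EFinD].
Qed.

Lemma intZ (c : R) f : mu.-integrable D (EFin \o f) ->
  mu.-integrable D (EFin \o (fun x => c * f x)).
Proof.
by move=> fi; rewrite [X in integrable _ _ X](_ : _ = (fun x => c%:E * (f x)%:E)%E);
  [exact: integrableZl|apply/funext => x; rewrite /= EFinM].
Qed.

Lemma intN f : mu.-integrable D (EFin \o f) ->
  mu.-integrable D (EFin \o (fun x => - f x)).
Proof.
by move=> fi; rewrite (_ : (fun x => - f x) = (fun x => -1 * f x));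
  [exact: intZ|apply/funext => x; rewrite mulN1r].
Qed.

Lemma intB f g : mu.-integrable D (EFin \o f) -> mu.-integrable D (EFin \o g) ->
  mu.-integrable D (EFin \o (fun x => f x - g x)).
Proof. by move=> fi gi; apply: intD => //; exact: intN. Qed.

Lemma RintD f g : mu.-integrable D (EFin \o f) -> mu.-integrable D (EFin \o g) ->
  \int[mu]_(x in D) (f x + g x) = \int[mu]_(x in D) f x + \int[mu]_(x in D) g x.
Proof. exact: RintegralD. Qed.

Lemma RintB f g : mu.-integrable D (EFin \o f) -> mu.-integrable D (EFin \o g) ->
  \int[mu]_(x in D) (f x - g x) = \int[mu]_(x in D) f x - \int[mu]_(x in D) g x.
Proof. exact: RintegralB. Qed.

Lemma RintZ (c : R) f : mu.-integrable D (EFin \o f) ->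
  \int[mu]_(x in D) (c * f x) = c * \int[mu]_(x in D) f x.
Proof. exact: RintegralZl. Qed.

Lemma Rint_le f g : mu.-integrable D (EFin \o f) -> mu.-integrable D (EFin \o g) ->
  (forall x, D x -> f x <= g x) ->
  \int[mu]_(x in D) f x <= \int[mu]_(x in D) g x.
Proof. exact: le_Rintegral. Qed.

End IntegrabilityRules.

(** * Primitives of continuous functions and their dependence on parameters *)
Section Primitives.
Context {R : realType}.
Implicit Types (f g : R -> R) (a b c x y : R).
Notation mu := (@lebesgue_measure R).

Lemma continuous_int f a b : continuous f -> mu.-integrable `[a, b] (EFin \o f).
Proof.
move=> cf; apply: continuous_compact_integrable; first exact: segment_compact.
exact: continuous_subspaceT.
Qed.

Lemma Rintegral_split f a b c : mu.-integrable `[a, b] (EFin \o f) ->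
  a <= c -> c <= b ->
  \int[mu]_(t in `[a, b]) f t =
  \int[mu]_(t in `[a, c]) f t + \int[mu]_(t in `[c, b]) f t.
Proof.
move=> fi ac cb; rewrite -(Rintegral_itv_obnd_cbnd (r := c) (b := BRight b)).
  by rewrite -(Rintegral_itvB fi) ?bnd_simp// addrC subrK.
by apply: integrableS fi => //; apply: subset_itvr; rewrite bnd_simp.
Qed.

Definition prim f x : R :=
  if 0 <= x then \int[mu]_(t in `[0, x]) f t else - \int[mu]_(t in `[x, 0]) f t.

Lemma prim_itv f a b : continuous f -> a <= b ->
  \int[mu]_(t in `[a, b]) f t = prim f b - prim f a.
Proof.
move=> cf ab; rewrite /prim.
have fi x y := @continuous_int f x y cf.
have [b0|b0] := leP 0 b; have [a0|a0] := leP 0 a.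
- by rewrite (Rintegral_split (fi 0 b) a0 ab); lra.
- by rewrite (Rintegral_split (fi a b) (ltW a0) b0); lra.
- by move: (le_lt_trans a0 (le_lt_trans ab b0)); rewrite ltxx.
- by rewrite (Rintegral_split (fi a 0) ab (ltW b0)); lra.
Qed.

Lemma prim0 f : prim f 0 = 0.
Proof. by rewrite /prim lexx set_itv1 Rintegral_set1. Qed.

Lemma is_derive_prim f x : continuous f -> is_derive x 1 (prim f) (f x).
Proof.
move=> cf; pose a := - `|x| - 1.
have ax : a < x by rewrite /a; move: (ler_normr `|x| (- x)) (ler_norm (- x)); rewrite normrN; lra.
have [] := @continuous_FTC1_closed _ f a x (x + 1) _ (continuous_int _ _ cf) ax (cf x).
  by rewrite ltrDl.
move=> dF F'.
have dI : is_derive x 1 (fun y => \int[mu]_(t in `[a, y]) f t + prim f a) (f x).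
  have dI : is_derive x 1 (fun y => \int[mu]_(t in `[a, y]) f t) (f x).
    by rewrite -F' derive1E; exact: derivableP.
  by rewrite -[f x]addr0; apply: (is_deriveD dI); exact: is_derive_cst.
apply: near_eq_is_derive dI.
near=> y; rewrite (@prim_itv f a y) ?subrK//.
by apply/ltW; near: y; exact: lt_nbhsr.
Unshelve. all: by end_near. Qed.

Lemma continuous_is_derive f f' : (forall x, is_derive x 1 f (f' x)) -> continuous f.
Proof.
move=> df x; apply: differentiable_continuous; apply/derivable1_diffP.
by have [] := df x.
Qed.

Lemma is_derive_cst_eq f f' a b :
  (forall x, is_derive x 1 f (f' x)) -> (forall x, f' x = 0) -> f a = f b.
Proof.
move=> df f0; wlog ab : a b / a <= b.
  by move=> H; case: (leP a b) => [/H//|/ltW/H].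
have cf : {within `[a, b], continuous f}.
  by apply: continuous_subspaceT; exact: continuous_is_derive df.
have [c _] := @MVT_segment _ f f' a b ab (fun x _ => df x) cf.
by rewrite f0 mul0r => /eqP; rewrite subr_eq0 => /eqP.
Qed.

Lemma prim_unique f F a b : continuous f -> (forall x, is_derive x 1 F (f x)) ->
  prim f b - prim f a = F b - F a.
Proof.
move=> cf dF.
suff : (prim f b - F b = prim f a - F a) by lra.
apply: (@is_derive_cst_eq (prim f \- F) (fun x => f x - f x)).
- by move=> x; apply: is_deriveB; exact: is_derive_prim.
- by move=> x; rewrite subrr.
Qed.

Lemma continuous_prim f : continuous f -> continuous (prim f).
Proof. by move=> cf; apply: continuous_is_derive => x; exact: is_derive_prim. Qed.

Lemma ler_norm_Rint f a b M : a <= b -> mu.-integrable `[a, b] (EFin \o f) ->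
  (forall t, a <= t <= b -> `|f t| <= M) ->
  `|\int[mu]_(t in `[a, b]) f t| <= M * (b - a).
Proof.
move=> ab fi fM; apply: (le_trans (le_normr_Rintegral _ fi)) => //.
have -> : M * (b - a) = \int[mu]_(t in `[a, b]) M.
  rewrite Rintegral_cst//= lebesgue_measure_itv/= lte_fin.
  by case: ltP => //= ba; rewrite (@le_anti _ _ a b) ?ab ?ba// subrr.
apply: le_Rintegral => //.
- by move: fi => /integrable_norm.
- by apply: continuous_int; exact: cst_continuous.
Qed.

Lemma ler_norm_prim f x M : continuous f ->
  (forall t, `|t| <= `|x| -> `|f t| <= M) -> `|prim f x| <= M * `|x|.
Proof.
move=> cf fM; rewrite /prim; have [x0|x0] := leP 0 x.
- have := ler_norm_Rint (M := M) x0 (continuous_int 0 x cf).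
  rewrite subr0 (ger0_norm x0) => -> //.
  by move=> t /andP[t0 tx]; apply: fM; rewrite (ger0_norm t0) (ger0_norm x0).
- have := ler_norm_Rint (M := M) (ltW x0) (continuous_int x 0 cf).
  rewrite normrN sub0r (ltr0_norm x0) => -> //.
  by move=> t /andP[t0 tx]; apply: fM; rewrite (ler0_norm tx) (ltr0_norm x0) lerN2.
Qed.

Lemma primB f g x : continuous f -> continuous g ->
  prim (f \- g) x = prim f x - prim g x.
Proof.
move=> cf cg; rewrite /prim; case: ifPn => _; rewrite RintegralB ?opprB//; try lra;
  exact: continuous_int.
Qed.

Lemma primZ c f x : continuous f -> prim (fun t => c * f t) x = c * prim f x.
Proof.
move=> cf; rewrite /prim; case: ifPn => _; rewrite RintegralZl//; try lra;
  exact: continuous_int.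
Qed.

End Primitives.

Section ParametricPrimitives.
Context {R : realType} {T : topologicalType}.

Lemma continuous_section2 (G : T -> R -> R) p :
  continuous (fun q : T * R => G q.1 q.2) -> continuous (G p).
Proof.
move=> cG; apply: (cont_comp (f := fun y : R => (p, y)) (g := fun q : T * R => G q.1 q.2)) => //.
by apply: cont_pair; [exact: cst_continuous|exact: cont_id].
Qed.

Lemma unif_near (G : T -> R -> R) p Y e :
  continuous (fun q : T * R => G q.1 q.2) -> 0 < e ->
  \forall q \near p, forall y, `|y| <= Y -> `|G q y - G p y| <= e.
Proof.
move=> cG e0.
have /compact_near_coveringP/(_ _ (nbhs p)
  (fun q y => `|G q y - G p y| <= e) _) := @segment_compact R (- Y) Y.
move=> H; have : \forall q \near p, `[- Y, Y] `<=` (fun y => `|G q y - G p y| <= e).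
  apply: H => y _.
  have e2 : 0 < e / 2 by lra.
  have h1 : \forall z \near (y, p), `|G p y - G z.2 z.1| < e / 2.
    have : continuous (fun z : R * T => G z.2 z.1).
      apply: (cont_comp (f := fun z : R * T => (z.2, z.1)) (g := fun q : T * R => G q.1 q.2)) => //.
      by apply: cont_pair; [exact: cont_snd|exact: cont_fst].
    by move/(_ (y, p))/cvgrPdist_lt => /(_ _ e2).
  have h2 : \forall z \near (y, p), `|G p y - G p z.1| < e / 2.
    have : continuous (fun z : R * T => G p z.1).
      apply: (cont_comp (f := fst) (g := G p)); first exact: cont_fst.
      exact: continuous_section2.
    by move/(_ (y, p))/cvgrPdist_lt => /(_ _ e2).
  near=> z.
  have z1 : `|G p y - G z.2 z.1| < e / 2 by near: z.
  have z2 : `|G p y - G p z.1| < e / 2 by near: z.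
  have -> : G z.2 z.1 - G p z.1 = (G p y - G p z.1) - (G p y - G z.2 z.1) by ring.
  apply: (le_trans (ler_normB _ _)); lra.
apply: filterS => q Hq y yY; apply: Hq => /=; rewrite in_itv/=.
by move: yY; rewrite ler_norml.
Unshelve. all: by end_near. Qed.

(** The compactness of the interval of integration makes the convergence of the
    integrands uniform. *)
Lemma continuous_prim_param (G : T -> R -> R) :
  continuous (fun q : T * R => G q.1 q.2) ->
  continuous (fun q : T * R => prim (G q.1) q.2).
Proof.
move=> cG [p y]; apply/cvgrPdist_le => e e0 /=.
pose Y := `|y| + 1; have Y0 : 0 < Y by rewrite /Y ltr_pwDr.
have cGp q := @continuous_section2 G q cG.
have e2 : 0 < e / 2 by lra.
have e3 : 0 < e / 2 / Y by rewrite divr_gt0.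
have h1 := unif_near p Y cG e3.
have h1' : \forall z \near (p, y), forall x, `|x| <= Y -> `|G z.1 x - G p x| <= e / 2 / Y.
  exact: (@cvg_fst _ _ (nbhs p) (nbhs y) _ _ h1).
have h2 : \forall z \near (p, y), `|prim (G p) y - prim (G p) z.2| <= e / 2.
  have : continuous (fun z : T * R => prim (G p) z.2).
    apply: (cont_comp (f := snd) (g := prim (G p))); first exact: cont_snd.
    exact: continuous_prim.
  by move/(_ (p, y))/cvgrPdist_le => /(_ _ e2).
have h3 : \forall z \near (p, y), `|z.2| <= Y.
  apply: (@cvg_snd _ _ (nbhs p) (nbhs y) _ (fun u => `|u| <= Y)).
  near=> u; have : `|y - u| <= 1 by near: u; apply: cvgr_dist_le.
  move=> yu; rewrite /Y (_ : u = y - (y - u)); last by ring.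
  by apply: (le_trans (ler_normB _ _)); rewrite lerD2l.
near=> z.
have z1 : forall x, `|x| <= Y -> `|G z.1 x - G p x| <= e / 2 / Y by near: z.
have z2 : `|prim (G p) y - prim (G p) z.2| <= e / 2 by near: z.
have z3 : `|z.2| <= Y by near: z.
have -> : prim (G p) y - prim (G z.1) z.2 =
  (prim (G p) y - prim (G p) z.2) - (prim (G z.1) z.2 - prim (G p) z.2) by ring.
apply: (le_trans (ler_normB _ _)).
suff : `|prim (G z.1) z.2 - prim (G p) z.2| <= e / 2 by lra.
rewrite -primB//; apply: (le_trans (ler_norm_prim (M := e / 2 / Y) _ _)).
- by move=> t; apply: cvgB; exact: cGp.
- by move=> t tz; apply: z1; exact: le_trans z3.
- by rewrite -[leRHS](divfK (lt0r_neq0 Y0)) ler_wpM2l // ltW.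
Unshelve. all: by end_near. Qed.

End ParametricPrimitives.

(** * Differentiation *)
Section Derivatives.
Context {R : realType}.
Implicit Types (f : R -> R) (phi : R -> R -> R) (a b x y s t : R).

Lemma is_derive_cvg f x l :
  (h^-1 * (f (x + h) - f x)) @[h --> 0^'] --> l <-> is_derive x 1 f l.
Proof.
have E : (fun h : R => h^-1 *: (f (h *: 1 + x) - f x)) =
         (fun h => h^-1 * (f (x + h) - f x)).
  by apply/funext => h; rewrite /GRing.scale/= mulr1 [h + x]addrC.
split => [H|[df <-]]; last by rewrite -E; exact: df.
apply: DeriveDef; first by rewrite /derivable E; apply/cvg_ex; exists l; exact: H.
by rewrite /derive; apply/cvg_lim => //; rewrite E.
Qed.

Lemma mean_value f (f' : R -> R) a b : (forall x : R, is_derive x 1 f (f' x)) ->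
  exists2 c, `|c - a| <= `|b - a| & f b - f a = f' c * (b - a).
Proof.
move=> df; have cf : continuous f := continuous_is_derive df.
have cfw x y : {within `[x, y], continuous f} by exact: continuous_subspaceT.
have [ab|ba] := leP a b.
  have [c] := @MVT_segment _ f f' a b ab (fun x _ => df x) (cfw _ _).
  rewrite in_itv/= => /andP[ac cb] fE; exists c => //.
  by rewrite !ger0_norm ?subr_ge0// lerB.
have [c] := @MVT_segment _ f f' b a (ltW ba) (fun x _ => df x) (cfw _ _).
rewrite in_itv/= => /andP[bc ca] fE; exists c.
  by rewrite !ler0_norm ?subr_le0 ?opprB ?lerB // ltW.
by rewrite -[LHS]opprB fE; ring.
Qed.

Lemma near0_ball (x : R) (P : R -> Prop) : (\forall y \near x, P y) ->
  exists2 d : R, 0 < d & forall h, `|h| < d -> P (x + h).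
Proof.
move=> /nbhs_ballP[d /= d0 H]; exists d => // h hd; apply: H.
by rewrite /ball/= opprD addNKr normrN.
Qed.

Lemma is_derive_prim_param (G G' : R -> R -> R) (p y : R) :
  (forall q s : R, is_derive q 1 (G ^~ s) (G' q s)) ->
  continuous (fun q : R * R => G q.1 q.2) ->
  continuous (fun q : R * R => G' q.1 q.2) ->
  is_derive p 1 (fun q => prim (G q) y) (prim (G' p) y).
Proof.
move=> dG cG cG'; apply/is_derive_cvg/cvgrPdist_le => e e0.
pose e' := e / (`|y| + 1); have y1 : 0 < `|y| + 1 by rewrite ltr_pwDr.
have e'0 : 0 < e' by rewrite divr_gt0.
have cGq q := @continuous_section2 _ _ G q cG.
have cG'q q := @continuous_section2 _ _ G' q cG'.
have [d d0 H] := near0_ball (unif_near p `|y| cG' e'0).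
near=> h.
have h0 : h != 0 by near: h; exact: nbhs_dnbhs_neq.
have hd : `|h| < d by near: h; exact: dnbhs0_lt.
rewrite -primB// -primZ; last by move=> t; apply: cvgB; exact: cGq.
rewrite -primB//; last first.
  by move=> t; apply: cvgM; [exact: cvg_cst|apply: cvgB; exact: cGq].
apply: (le_trans (ler_norm_prim (M := e') _ _)).
- move=> t; apply: cvgB; first exact: cG'q.
  by apply: cvgM; [exact: cvg_cst|apply: cvgB; exact: cGq].
- move=> s sy /=; have [c] := mean_value p (p + h) (fun q => dG q s).
  rewrite [p + h - p]addrC addKr => ch ->.
  rewrite [G' c s * h]mulrC mulKf// distrC.
  by have := H (c - p) (le_lt_trans ch hd) s sy; rewrite [p + _]addrC subrK.
- rewrite /e' -mulrA -[leRHS]mulr1 ler_wpM2l ?(ltW e0)// mulrC ler_pdivrMr// mul1r.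
  by rewrite lerDl.
Unshelve. all: by end_near. Qed.

Lemma C1_testI phi (d1 d2 : R -> R -> R) :
  (forall t x : R, is_derive t 1 (phi ^~ x) (d1 t x)) ->
  (forall t x : R, is_derive x 1 (phi t) (d2 t x)) ->
  continuous (fun p : R * R => d1 p.1 p.2) ->
  continuous (fun p : R * R => d2 p.1 p.2) ->
  [/\ C1_test phi, dt phi = d1 & dx phi = d2].
Proof.
move=> h1 h2 c1 c2.
have E1 : dt phi = d1.
  by apply/funext => t; apply/funext => x; rewrite /dt derive1E; have [_ ->] := h1 t x.
have E2 : dx phi = d2.
  by apply/funext => t; apply/funext => x; rewrite /dx derive1E; have [_ ->] := h2 t x.
by split => //; split; rewrite ?E1 ?E2.
Qed.

Lemma C1_test_dt phi t x : C1_test phi -> is_derive t 1 (phi ^~ x) (dt phi t x).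
Proof.
by move=> [/(_ t x)[d _] _ _]; rewrite /dt derive1E; exact: derivableP.
Qed.

Lemma C1_test_dx phi t x : C1_test phi -> is_derive x 1 (phi t) (dx phi t x).
Proof.
by move=> [/(_ t x)[_ d] _ _]; rewrite /dx derive1E; exact: derivableP.
Qed.

Lemma C1_test_increment phi t x e : C1_test phi -> 0 < e ->
  exists2 d : R, 0 < d & forall h k, `|h| < d -> `|k| < d ->
    `|phi (t + h) (x + k) - phi t x - (dt phi t x * h + dx phi t x * k)|
      <= e * (`|h| + `|k|).
Proof.
move=> Cphi e0; have [_ c1 c2] := Cphi.
have cdt : exists2 d : R, 0 < d & forall h k, `|h| < d -> `|k| < d ->
    `|dt phi t x - dt phi (t + h) (x + k)| <= e.
  have /cvgrPdist_le/(_ _ e0) := c1 (t, x).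
  move=> /nbhs_ballP[d /= d0 H]; exists d => // h k hd kd.
  by apply: (H (t + h, x + k)); split; rewrite /ball/= opprD addNKr normrN.
have cdx : exists2 d : R, 0 < d & forall h k, `|h| < d -> `|k| < d ->
    `|dx phi t x - dx phi (t + h) (x + k)| <= e.
  have /cvgrPdist_le/(_ _ e0) := c2 (t, x).
  move=> /nbhs_ballP[d /= d0 H]; exists d => // h k hd kd.
  by apply: (H (t + h, x + k)); split; rewrite /ball/= opprD addNKr normrN.
case: cdt => d1 d10 H1; case: cdx => d2 d20 H2.
exists (Num.min d1 d2); first by rewrite lt_min d10.
move=> h k; rewrite !lt_min => /andP[hd1 hd2] /andP[kd1 kd2].
have [c] := mean_value t (t + h) (fun s => C1_test_dt s (x + k) Cphi).
rewrite [t + h - t]addrC addKr => ch Eh.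
have [c'] := mean_value x (x + k) (fun s => C1_test_dx t s Cphi).
rewrite [x + k - x]addrC addKr => ck Ek.
have -> : phi (t + h) (x + k) - phi t x - (dt phi t x * h + dx phi t x * k) =
  - (dt phi t x - dt phi c (x + k)) * h - (dx phi t x - dx phi t c') * k.
  transitivity ((phi (t + h) (x + k) - phi t (x + k)) + (phi t (x + k) - phi t x)
    - (dt phi t x * h + dx phi t x * k)); first by ring.
  by rewrite Eh Ek; ring.
apply: (le_trans (ler_normB _ _)); rewrite !normrM normrN mulrDr lerD// ler_wpM2r//.
  have := H1 (c - t) k (le_lt_trans ch hd1) kd1.
  by rewrite [t + (c - t)]addrC subrK.
have := H2 0 (c' - x) _ (le_lt_trans ck kd2).
by rewrite [x + (c' - x)]addrC subrK normr0 addr0; exact.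
Qed.

Lemma C1_test_continuous phi : C1_test phi -> continuous (fun p : R * R => phi p.1 p.2).
Proof.
move=> Cphi [t x]; apply/cvgrPdist_le => e e0.
have [d d0 H] := C1_test_increment t x Cphi ltr01.
pose K := `|dt phi t x| + `|dx phi t x| + 2.
have K0 : 0 < K by rewrite /K ltr_wpDl// addr_ge0.
pose r := Num.min d (e / K).
have r0 : 0 < r by rewrite lt_min d0 divr_gt0.
apply/(@nbhs_ballP R (R * R)%type); exists r => //= -[t' x'] [/= ht hx].
have := H (t' - t) (x' - x); rewrite ![_ + (_ - _)]addrC !subrK.
have hr1 : `|t' - t| < r by rewrite distrC; exact: ht.
have hr2 : `|x' - x| < r by rewrite distrC; exact: hx.
move: (hr1) (hr2); rewrite !lt_min => /andP[h1 h1'] /andP[h2 h2'] /(_ h1 h2).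
move: h1' h2'; rewrite !ltr_pdivlMr// mul1r.
set A := t' - t; set B := x' - x; set D := phi t' x' - phi t x => hA hB hD.
have -> : phi t x - phi t' x' = - (D - (dt phi t x * A + dx phi t x * B))
   - (dt phi t x * A + dx phi t x * B) by rewrite /D; ring.
apply: (le_trans (ler_normB _ _)); rewrite normrN.
apply: (le_trans (lerD hD (ler_normD _ _))); rewrite !normrM.
have n1 : 0 <= `|dt phi t x| := normr_ge0 _.
have n2 : 0 <= `|dx phi t x| := normr_ge0 _.
have [AB|BA] := leP `|A| `|B|.
  apply: le_trans (ltW hB); rewrite /K; move: AB (ler_wpM2l n1 AB); clear.
  set a := `|A|; set b := `|B|; set p := `|dt phi t x|; set q := `|dx phi t x|; lra.
apply: le_trans (ltW hA); rewrite /K; move: BA (ler_wpM2l n2 (ltW BA)); clear.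
set a := `|A|; set b := `|B|; set p := `|dt phi t x|; set q := `|dx phi t x|; lra.
Qed.

(** Continuous partial derivatives give an increment estimate that is uniform
    near the point, hence a derivative along any differentiable curve and not
    only along the axes. *)
Lemma is_derive_chain phi (a b : R -> R) (a' b' s : R) : C1_test phi ->
  is_derive s 1 a a' -> is_derive s 1 b b' ->
  is_derive s 1 (fun s => phi (a s) (b s))
    (dt phi (a s) (b s) * a' + dx phi (a s) (b s) * b').
Proof.
move=> Cphi /is_derive_cvg da /is_derive_cvg db; apply/is_derive_cvg.
set D1 := dt _ _ _; set D2 := dx _ _ _.
pose A h := a (s + h) - a s; pose B h := b (s + h) - b s.
have l1 : (D1 * (h^-1 * A h) + D2 * (h^-1 * B h)) @[h --> 0^'] --> D1 * a' + D2 * b'.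
  by apply: cvgD; apply: cvgM => //; exact: cvg_cst.
rewrite -[X in _ --> X]addr0.
rewrite (_ : (fun h => _) = fun h => (D1 * (h^-1 * A h) + D2 * (h^-1 * B h)) +
   (h^-1 * (phi (a (s + h)) (b (s + h)) - phi (a s) (b s) - (D1 * A h + D2 * B h)))); last first.
  by apply/funext => h; ring.
apply: cvgD => //.
apply/cvgr0Pnorm_le => e e0.
pose K := `|a'| + `|b'| + 2.
have K0 : 0 < K by rewrite /K ltr_wpDl// addr_ge0.
have [d d0 H] := C1_test_increment (a s) (b s) Cphi (divr_gt0 e0 K0).
have nA : \forall h \near 0^', `|a' - h^-1 * A h| <= 1 by move/cvgrPdist_le: da => /(_ _ ltr01).
have nB : \forall h \near 0^', `|b' - h^-1 * B h| <= 1 by move/cvgrPdist_le: db => /(_ _ ltr01).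
near=> h.
have h0 : h != 0 by near: h; exact: nbhs_dnbhs_neq.
have hh : 0 < `|h| by rewrite normr_gt0.
have hK : `|h| < d / K by near: h; apply: dnbhs0_lt; rewrite divr_gt0.
have hA : `|A h| <= (`|a'| + 1) * `|h|.
  rewrite -ler_pdivrMr// mulrC -normfV -normrM.
  have : `|a' - h^-1 * A h| <= 1 by near: h.
  move=> ha; rewrite (_ : h^-1 * A h = a' - (a' - h^-1 * A h)); last by ring.
  by apply: (le_trans (ler_normB _ _)); rewrite lerD2l.
have hB : `|B h| <= (`|b'| + 1) * `|h|.
  rewrite -ler_pdivrMr// mulrC -normfV -normrM.
  have : `|b' - h^-1 * B h| <= 1 by near: h.
  move=> ha; rewrite (_ : h^-1 * B h = b' - (b' - h^-1 * B h)); last by ring.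
  by apply: (le_trans (ler_normB _ _)); rewrite lerD2l.
have na : 0 <= `|a'| := normr_ge0 _.
have nb : 0 <= `|b'| := normr_ge0 _.
have hKd : `|h| * K < d by rewrite -ltr_pdivlMr.
have := H (A h) (B h).
have -> : a s + A h = a (s + h) by rewrite /A; ring.
have -> : b s + B h = b (s + h) by rewrite /B; ring.
move=> HH; have {HH} := HH _ _.
rewrite normrM normfV ler_pdivrMl// => HH; apply: (le_trans (HH _ _)).
- by apply: le_lt_trans hKd; apply: (le_trans hA); rewrite mulrC ler_wpM2l// /K; lra.
- by apply: le_lt_trans hKd; apply: (le_trans hB); rewrite mulrC ler_wpM2l// /K; lra.
- rewrite [leRHS]mulrC -mulrA ler_wpM2l ?(ltW e0)// mulrC ler_pdivrMr//.
  by apply: (le_trans (lerD hA hB)); rewrite -mulrDl mulrC ler_wpM2l// /K; lra.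
Unshelve. all: by end_near. Qed.

End Derivatives.

(** * Kernels on the triangle *)
Section Kernels.
Context {R : realType}.
Implicit Types (k F : R * R -> R) (x xi : R).
Notation mu := (@lebesgue_measure R).

Definition clamp (x : R) : R := Num.max 0 (Num.min x 1).

(** A retraction of the plane onto the triangle, used to extend continuous
    functions from the triangle to the plane. *)
Definition retract (z : R * R) : R * R :=
  (clamp z.1, Num.max 0 (Num.min z.2 (clamp z.1))).

Lemma retract_triangle z : triangle (retract z).
Proof.
rewrite /triangle/retract/clamp/=; case: z => x xi /=.
split; first by rewrite le_max lexx.
split; last by rewrite ge_max ler01 ge_min lexx orbT.
by rewrite ge_max ge_min lexx orbT andbT le_max lexx.
Qed.

Lemma retract_id z : triangle z -> retract z = z.
Proof.
case: z => x xi [/= h0 [h1 h2]].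
have x0 : 0 <= x := le_trans h0 h1.
rewrite /retract/clamp/=.
by rewrite (min_idPl h2) (max_idPr x0) (min_idPl h1) (max_idPr h0).
Qed.

Lemma retract_continuous : continuous retract.
Proof. rewrite /retract /clamp; cont. Qed.

Lemma continuous_retract k : {within @triangle R, continuous k} ->
  continuous (fun z => k (retract z)).
Proof.
move=> /subspace_continuousP ck z.
have H := ck _ (retract_triangle z).
move=> A hA.
have hA' : nbhs (retract z) (fun y => triangle y -> A (k y)) := H A hA.
have hB : nbhs z (fun y => triangle (retract y) -> A (k (retract y))) :=
  retract_continuous hA'.
by apply: filterS hB => y; apply; exact: retract_triangle.
Qed.

Lemma triangle_segment (d1 d2 x xi s tau : R) : 0 <= tau <= s ->
  triangle (x, xi) -> triangle (x + s * d1, xi + s * d2) ->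
  triangle (x + tau * d1, xi + tau * d2).
Proof.
move=> /andP[t0 ts] T1 T2; have s0 := le_trans t0 ts.
case: T1 T2 => /= a1 [a2 a3] [/= b1 [b2 b3]].
have [s00|s_gt0] := leP s 0.
  have -> : tau = 0 by apply/le_anti; rewrite t0 (le_trans ts).
  by rewrite !mul0r !addr0; split.
pose r := tau / s; have r0 : 0 <= r by rewrite divr_ge0.
have r1 : r <= 1 by rewrite ler_pdivrMr// mul1r.
have tE : tau = r * s by rewrite divfK// gt_eqF.
clearbody r.
have H (a v : R) : 0 <= a -> 0 <= a + v -> 0 <= a + r * v.
  move=> a0 av; rewrite (_ : a + r * v = (1 - r) * a + r * (a + v)); last by ring.
  by rewrite addr_ge0// mulr_ge0// subr_ge0.
rewrite /triangle/= tE -!mulrA; move: (s * d1) (s * d2) b1 b2 b3 => u v b1 b2 b3.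
split; first exact: H.
split; rewrite -subr_ge0.
  by rewrite (_ : _ - _ = (x - xi) + r * (u - v)) ?H//; lra.
by rewrite (_ : _ - _ = (1 - x) + r * (- u)) ?H//; lra.
Qed.

Lemma along_segment (d1 d2 : R) k F (c y : R) (f := fun zeta => F (retract (y + c * zeta, zeta)))
    (x xi s : R) : d2 != 0 -> d1 = c * d2 -> x = y + c * xi ->
  {within @triangle R, continuous F} ->
  along_characteristics d1 d2 k F -> 0 <= s ->
  triangle (x, xi) -> triangle (x + s * d1, xi + s * d2) ->
  k (x + s * d1, xi + s * d2) - k (x, xi) =
    d2^-1 * (prim f (xi + s * d2) - prim f xi).
Proof.
move=> d20 d1E xE cF kF s0 T1 T2; rewrite (kF _ _ _ s0 T1 T2) addrC addKr.
have cFr := continuous_retract cF.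
have cf : continuous f.
  by apply: (cont_comp (f := fun zeta => (y + c * zeta, zeta)) (g := fun z => F (retract z))) => //; cont.
have cf2 : continuous (fun tau : R => f (xi + tau * d2)).
  by apply: (cont_comp (f := fun tau : R => xi + tau * d2) (g := f)) => //; cont.
transitivity (\int[mu]_(tau in `[0, s]) f (xi + tau * d2)).
  apply: eq_Rintegral => tau; rewrite inE/= in_itv/= => /andP[t0 ts].
  rewrite /f; have -> : y + c * (xi + tau * d2) = x + tau * d1 by rewrite xE d1E; ring.
  rewrite retract_id//.
  by apply: triangle_segment T1 T2; rewrite t0.
have dP (t : R) : is_derive t 1 (fun tau : R => d2^-1 * prim f (xi + tau * d2)) (f (xi + t * d2)).
  have -> : f (xi + t * d2) = d2^-1 * (f (xi + t * d2) * d2).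
    by rewrite mulrCA mulVf ?mulr1.
  apply: is_deriveZ.
  apply: (is_derive1_comp (f := prim f) (g := fun tau : R => xi + tau * d2)).
    exact: is_derive_prim.
  by apply: is_derive_eq; rewrite ?scaler0 /GRing.scale/=; ring.
by rewrite prim_itv// (prim_unique _ _ cf2 dP) mul0r addr0 mulrBr.
Qed.

(** Every characteristic meets the edge of the triangle from the origin to
    [(1, 1)] or to [(1, 0)]; integrating the extended right-hand side from
    there extends the kernel to the plane, differentiably along the
    characteristics. *)
Lemma kernel_extension (d1 d2 c kappa : R) k F : d2 != 0 -> d1 = c * d2 ->
  (forall x xi, triangle (x, xi) ->
    triangle ((x - c * xi) * (1 + c * kappa), (x - c * xi) * kappa)) ->
  {within @triangle R, continuous k} -> {within @triangle R, continuous F} ->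
  along_characteristics d1 d2 k F ->
  exists g : R -> R -> R,
    [/\ continuous (fun p : R * R => g p.1 p.2),
        forall xi y : R, is_derive xi 1 (g ^~ y) (d2^-1 * F (retract (y + c * xi, xi))) &
        forall x xi, triangle (x, xi) -> k (x, xi) = g xi (x - c * xi)].
Proof.
move=> d20 d1E anchor ck cF kF.
pose f y zeta := F (retract (y + c * zeta, zeta)).
have cf2 : continuous (fun p : R * R => f p.1 p.2).
  by apply: (cont_comp (f := fun p : R * R => (p.1 + c * p.2, p.2))
    (g := fun z => F (retract z))); [cont|exact: continuous_retract].
have cf y : continuous (f y) := continuous_section2 cf2.
have cP := continuous_prim_param cf2.
pose a y := k (retract (y * (1 + c * kappa), y * kappa)).
exists (fun xi y => a y + d2^-1 * (prim (f y) xi - prim (f y) (y * kappa))).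
split.
- cont.
  + apply: (cont_comp (f := fun p : R * R => (p.2 * (1 + c * kappa), p.2 * kappa))
    (g := fun z => k (retract z))); [cont|exact: continuous_retract].
  + by apply: (cont_comp (f := fun p : R * R => (p.2, p.1))
      (g := fun z => prim (f z.1) z.2)); [cont|].
  + by apply: (cont_comp (f := fun p : R * R => (p.2, p.2 * kappa))
      (g := fun z => prim (f z.1) z.2)); [cont|].
- move=> xi y; rewrite -[X in is_derive _ _ _ X]add0r.
  apply: is_deriveD; apply: is_deriveZ; rewrite -[F _]subr0.
  by apply: is_deriveB; exact: is_derive_prim.
- move=> x xi T1; have T0 := anchor _ _ T1.
  set y := x - c * xi in T0 *; rewrite /a retract_id//.
  have xE : x = y + c * xi by rewrite /y subrK.
  have yE : y * (1 + c * kappa) = y + c * (y * kappa) by ring.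
  pose s := (xi - y * kappa) / d2.
  have sE2 : xi = y * kappa + s * d2 by rewrite /s divfK// addrC subrK.
  have sE1 : x = y * (1 + c * kappa) + s * d1 by rewrite xE d1E sE2; ring.
  have [s0|s0] := leP 0 s.
    have := @along_segment d1 d2 k F c y _ _ s d20 d1E yE cF kF s0 T0.
    by rewrite -sE2 -sE1 => /(_ T1); rewrite -/(f y) => <-; rewrite addrC subrK.
  have s0' : 0 <= - s by rewrite oppr_ge0 ltW.
  have := @along_segment d1 d2 k F c y _ _ (- s) d20 d1E xE cF kF s0' T1.
  have -> : xi + - s * d2 = y * kappa by rewrite {1}sE2; ring.
  have -> : x + - s * d1 = y * (1 + c * kappa) by rewrite {1}sE1; ring.
  move=> /(_ T0); rewrite -/(f y) => H.
  by rewrite -[in RHS]opprB mulrN -H; ring.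
Qed.

End Kernels.

(** * The adjoint of a Volterra operator, applied to test functions *)
Section AdjointTest.
Context {R : realType}.
Implicit Types (k F : R * R -> R) (phi : R -> R -> R) (x xi t : R).
Notation mu := (@lebesgue_measure R).

Lemma prim_shift (h : R -> R) (s a b : R) : continuous h ->
  prim h (b - s) - prim h (a - s) = prim (fun x => h (x - s)) b - prim (fun x => h (x - s)) a.
Proof.
move=> ch.
have chs : continuous (fun x : R => h (x - s)).
  by apply: (cont_comp (f := fun x : R => x - s) (g := h)) => //; cont.
apply/esym; apply: (prim_unique (F := fun x : R => prim h (x - s))) => // x.
rewrite -[h _]mulr1.
apply: (is_derive1_comp (f := prim h) (g := fun tau : R => tau - s)).
  exact: is_derive_prim.
by apply: is_derive_eq; rewrite subr0.
Qed.

(** The kernel need not be differentiable in [xi] at fixed [x], but it is at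
    a fixed label [y = x - c * xi] of the characteristic: after this
    substitution the adjoint integral can be differentiated under the
    integral sign, and the moving ends [x = xi] and [x = 1] contribute the
    last two terms. *)
Lemma adjoint_test (d1 d2 c kappa : R) k F phi : d2 != 0 -> d1 = c * d2 ->
  (forall x xi, triangle (x, xi) ->
    triangle ((x - c * xi) * (1 + c * kappa), (x - c * xi) * kappa)) ->
  {within @triangle R, continuous k} -> {within @triangle R, continuous F} ->
  along_characteristics d1 d2 k F -> C1_test phi ->
  exists Phi : R -> R -> R, C1_test Phi /\
    forall t xi, 0 <= xi -> xi <= 1 ->
      Phi t xi = \int[mu]_(x in `[xi, 1]) (k (x, xi) * phi t x) /\
      dt Phi t xi + d2 * dx Phi t xi =
        \int[mu]_(x in `[xi, 1]) (k (x, xi) * (dt phi t x + d1 * dx phi t x))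
        + \int[mu]_(x in `[xi, 1]) (F (x, xi) * phi t x)
        + (d1 - d2) * k (xi, xi) * phi t xi - d1 * k (1, xi) * phi t 1.
Proof.
move=> d20 d1E anchor ck cF kF Cphi.
have [g [cg dg gE]] := kernel_extension d20 d1E anchor ck cF kF.
pose h xi y := d2^-1 * F (retract (y + c * xi, xi)).
have ch : continuous (fun p : R * R => h p.1 p.2).
  rewrite /h; cont; apply: (cont_comp (f := fun p : R * R => (p.2 + c * p.1, p.1))
    (g := fun z => F (retract z))); [cont|exact: continuous_retract].
have cphi := C1_test_continuous Cphi; have [_ cdt cdx] := Cphi.
(* In [G], [y] is the label of a characteristic, which replaces [x = y + c * xi]. *)
pose G (p : R * R) y := g p.2 y * phi p.1 (y + c * p.2).
pose Gt (p : R * R) y := g p.2 y * dt phi p.1 (y + c * p.2).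
pose Gx (p : R * R) y := h p.2 y * phi p.1 (y + c * p.2) + g p.2 y * (c * dx phi p.1 (y + c * p.2)).
have cg3 : continuous (fun q : (R * R) * R => g q.1.2 q.2).
  by apply: (cont_comp (f := fun q : (R * R) * R => (q.1.2, q.2)) (g := fun z => g z.1 z.2)) => //; cont.
have ch3 : continuous (fun q : (R * R) * R => h q.1.2 q.2).
  by apply: (cont_comp (f := fun q : (R * R) * R => (q.1.2, q.2)) (g := fun z => h z.1 z.2)) => //; cont.
have c3 (u : R -> R -> R) : continuous (fun p : R * R => u p.1 p.2) ->
    continuous (fun q : (R * R) * R => u q.1.1 (q.2 + c * q.1.2)).
  by move=> cu; apply: (cont_comp (f := fun q : (R * R) * R => (q.1.1, q.2 + c * q.1.2))
    (g := fun z => u z.1 z.2)) => //; cont.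
have cG : continuous (fun q : (R * R) * R => G q.1 q.2) by apply: contM => //; exact: c3.
have cGt : continuous (fun q : (R * R) * R => Gt q.1 q.2) by apply: contM => //; exact: c3.
have cGx : continuous (fun q : (R * R) * R => Gx q.1 q.2).
  apply: contD; first by apply: contM ch3 _; exact: c3.
  by apply: contM cg3 _; apply: contM; [exact: cont_cst|exact: c3].
have dGt (xi y t : R) : is_derive t 1 (fun t => G (t, xi) y) (Gt (t, xi) y).
  rewrite /G /Gt /=. apply: is_deriveZ; exact: C1_test_dt.
have dGx (t y xi : R) : is_derive xi 1 (fun xi => G (t, xi) y) (Gx (t, xi) y).
  have dphi : is_derive xi 1 (fun xi => phi t (y + c * xi)) (dx phi t (y + c * xi) * c).
    apply: (is_derive1_comp (f := phi t) (g := fun xi : R => y + c * xi)).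
      exact: C1_test_dx.
    by apply: is_derive_eq; rewrite /GRing.scale/=; ring.
  apply: is_derive_eq (is_deriveM (dg xi y) dphi) _.
  by rewrite /Gx /h /GRing.scale/=; ring.
have csec (u : R * R -> R -> R) : continuous (fun q : (R * R) * R => u q.1 q.2) ->
  (forall xi, continuous (fun q : R * R => u (q.1, xi) q.2)) *
  (forall t, continuous (fun q : R * R => u (t, q.1) q.2)).
  move=> cu; split => z.
    by apply: (cont_comp (f := fun q : R * R => ((q.1, z), q.2)) (g := fun q => u q.1 q.2)) => //; cont.
  by apply: (cont_comp (f := fun q : R * R => ((z, q.1), q.2)) (g := fun q => u q.1 q.2)) => //; cont.
pose b1 xi := 1 - c * xi; pose b2 xi := xi - c * xi.
pose Phi t xi := prim (G (t, xi)) (b1 xi) - prim (G (t, xi)) (b2 xi).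
pose D1 t xi := prim (Gt (t, xi)) (b1 xi) - prim (Gt (t, xi)) (b2 xi).
pose D2 t xi := (prim (Gx (t, xi)) (b1 xi) - c * G (t, xi) (b1 xi))
   - (prim (Gx (t, xi)) (b2 xi) + (1 - c) * G (t, xi) (b2 xi)).
have cb (u : (R * R) * R -> R) (b : R -> R) : continuous u -> continuous b ->
    continuous (fun p : R * R => u (p, b p.2)).
  move=> cu cb; apply: (cont_comp (f := fun p : R * R => (p, b p.2)) (g := u)) => //.
  by apply: cont_pair; [exact: cont_id|apply: (cont_comp (f := snd) (g := b)) => //; exact: cont_snd].
have cb1 : continuous b1 by rewrite /b1; cont.
have cb2 : continuous b2 by rewrite /b2; cont.
have db1 xi : is_derive xi 1 b1 (- c).
  by rewrite /b1; apply: is_derive_eq; rewrite /GRing.scale/=; ring.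
have db2 xi : is_derive xi 1 b2 (1 - c).
  by rewrite /b2; apply: is_derive_eq; rewrite /GRing.scale/=; ring.
have [CPhi E1 E2] : [/\ C1_test Phi, dt Phi = D1 & dx Phi = D2].
  apply: C1_testI.
  - move=> t xi; have [ct _] := csec _ cG; have [ct' _] := csec _ cGt.
    by apply: is_deriveB; apply: (is_derive_prim_param (G := fun t => G (t, xi))
      (G' := fun t => Gt (t, xi))) => // q s; exact: dGt.
  - move=> t xi; have [_ ct] := csec _ cG; have [_ ct'] := csec _ cGx.
    have [CH H1 H2] : [/\ C1_test (fun xi z => prim (G (t, xi)) z),
       dt (fun xi z => prim (G (t, xi)) z) = (fun xi z => prim (Gx (t, xi)) z) &
       dx (fun xi z => prim (G (t, xi)) z) = (fun xi z => G (t, xi) z)].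
      apply: C1_testI => //.
      + by move=> s z; apply: (is_derive_prim_param (G := fun s => G (t, s))
          (G' := fun s => Gx (t, s))) => // q s'; exact: dGx.
      + by move=> s z; apply: is_derive_prim; exact: continuous_section2.
      + by apply: (continuous_prim_param (G := fun s => Gx (t, s))).
    apply: is_deriveB.
      apply: is_derive_eq (is_derive_chain CH (is_derive_id _ _) (db1 xi)) _.
      by rewrite H1 H2; ring.
    apply: is_derive_eq (is_derive_chain CH (is_derive_id _ _) (db2 xi)) _.
    by rewrite H1 H2; ring.
  - have cP := continuous_prim_param cGt.
    apply: contD; last apply: contN.
      exact: (cb _ _ cP cb1).
    exact: (cb _ _ cP cb2).
  - have cP := continuous_prim_param cGx.
    apply: contD; last apply: contN; apply: contD.
    + exact: (cb _ _ cP cb1).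
    + apply: contN; apply: contM; first exact: cont_cst.
      exact: (cb _ _ cG cb1).
    + exact: (cb _ _ cP cb2).
    + apply: contM; first exact: cont_cst.
      exact: (cb _ _ cG cb2).
exists Phi; split => // t xi xi0 xi1; rewrite E1 E2.
have back (u : R * R -> R -> R) : continuous (fun q : (R * R) * R => u q.1 q.2) ->
    prim (u (t, xi)) (b1 xi) - prim (u (t, xi)) (b2 xi) =
    \int[mu]_(x in `[xi, 1]) u (t, xi) (x - c * xi).
  move=> cu; have cut : continuous (u (t, xi)) := continuous_section2 cu.
  rewrite prim_shift// prim_itv//.
  by apply: (cont_comp (f := fun x : R => x - c * xi) (g := u (t, xi))) => //; cont.
have tri x : x \in `[xi, 1] -> triangle (x, xi).
  by rewrite in_itv/= => /andP[h1 h2]; split => //.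
split.
  rewrite /Phi back//; apply: eq_Rintegral => x; rewrite inE/= => /tri xT.
  by rewrite /G/= subrK -gE.
have ->  : D1 t xi + d2 * D2 t xi =
   (D1 t xi + d2 * (prim (Gx (t, xi)) (b1 xi) - prim (Gx (t, xi)) (b2 xi)))
   + (d1 - d2) * G (t, xi) (b2 xi) - d1 * G (t, xi) (b1 xi).
  by rewrite /D2 d1E; ring.
have E3 : G (t, xi) (b1 xi) = k (1, xi) * phi t 1.
  by rewrite /G/= /b1 subrK -gE.
have E4 : G (t, xi) (b2 xi) = k (xi, xi) * phi t xi.
  by rewrite /G/= /b2 subrK -gE.
rewrite E3 E4 -!mulrA; congr (_ + _ - _).
rewrite /D1 !back//.
have ix (u : R * R -> R -> R) : continuous (fun q : (R * R) * R => u q.1 q.2) ->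
    mu.-integrable `[xi, 1] (EFin \o (fun x => u (t, xi) (x - c * xi))).
  move=> cu; apply: continuous_int.
  apply: (cont_comp (f := fun x : R => x - c * xi) (g := u (t, xi))); first by cont.
  exact: continuous_section2.
have cFx : continuous (fun x : R => F (retract (x, xi)) * phi t x).
  apply: contM; last by have := continuous_section2 (p := t) cphi.
  apply: (cont_comp (f := fun x : R => (x, xi)) (g := fun z => F (retract z))); first by cont.
  exact: continuous_retract.
have iF := continuous_int xi 1 cFx.
transitivity (\int[mu]_(x in `[xi, 1]) (Gt (t, xi) (x - c * xi) + d2 * Gx (t, xi) (x - c * xi))).
  have iGx := ix _ cGx; have iGt := ix _ cGt.
  have iZ : mu.-integrable `[xi, 1] (EFin \o (fun x => d2 * Gx (t, xi) (x - c * xi))).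
    by apply: intZ iGx.
  rewrite (RintegralD _ iGt iZ)//.
  by rewrite (RintegralZl _ _ iGx).
have cA : continuous (fun x : R => g xi (x - c * xi) * (dt phi t x + d1 * dx phi t x)).
  apply: contM.
    by apply: (cont_comp (f := fun x : R => (xi, x - c * xi)) (g := fun z => g z.1 z.2)) => //; cont.
  apply: contD; first by have := continuous_section2 (p := t) cdt.
  by apply: contM; [exact: cont_cst|have := continuous_section2 (p := t) cdx].
have -> : \int[mu]_(x in `[xi, 1]) (k (x, xi) * (dt phi t x + d1 * dx phi t x)) =
   \int[mu]_(x in `[xi, 1]) (g xi (x - c * xi) * (dt phi t x + d1 * dx phi t x)).
  by apply: eq_Rintegral => x; rewrite inE/= => /tri xT; rewrite -gE.
have -> : \int[mu]_(x in `[xi, 1]) (F (x, xi) * phi t x) =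
   \int[mu]_(x in `[xi, 1]) (F (retract (x, xi)) * phi t x).
  by apply: eq_Rintegral => x; rewrite inE/= => /tri xT; rewrite retract_id.
rewrite -(RintegralD _ (continuous_int _ _ cA) iF)//.
apply: eq_Rintegral => x _; rewrite /Gt /Gx /h /= subrK d1E.
set u := g _ _; set v := F _; set a := phi _ _; set b := dt _ _ _; set e := dx _ _ _.
transitivity (u * b + (d2 * d2^-1) * (v * a) + d2 * (u * (c * e))); first by ring.
by rewrite mulfV//; ring.
Qed.

End AdjointTest.

(** * Square-integrable functions on an interval *)
Section L2.
Context {R : realType}.
Notation mu := (@lebesgue_measure R).
Implicit Types (f g h : R -> R) (a b c : R).

Lemma int_dominated (D : set R) f g : measurable D ->
  measurable_fun D f -> mu.-integrable D (EFin \o g) ->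
  (forall x, D x -> `|f x| <= g x) -> mu.-integrable D (EFin \o f).
Proof.
move=> mD mf ig fg; apply: (@le_integrable _ _ _ mu D mD (EFin \o f) (EFin \o g)) => //.
  exact/measurable_EFinP.
by move=> x Dx /=; rewrite lee_fin (le_trans (fg x Dx))// ler_norm.
Qed.

Lemma int_measurable (D : set R) f : mu.-integrable D (EFin \o f) -> measurable_fun D f.
Proof. by move=> /measurable_int/measurable_EFinP. Qed.

Definition L2on (D : set R) f :=
  measurable_fun D f /\ mu.-integrable D (EFin \o (fun x => f x ^+ 2)).

Section OnSegment.
Variables (l r : R).
Let D : set R := `[l, r]%classic.
Let mD : measurable D. Proof. exact: measurable_itv. Qed.

Lemma int_cst c : mu.-integrable D (EFin \o (fun=> c)).
Proof. by apply: continuous_int; exact: cst_continuous. Qed.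

Lemma L2on_int f : L2on D f -> mu.-integrable D (EFin \o f).
Proof.
move=> [mf f2]; apply: (int_dominated mD mf (intD mD (int_cst 1) f2)) => x _.
by rewrite ler_norml; apply/andP; split; nra.
Qed.

Lemma L2on_intM f g : L2on D f -> L2on D g ->
  mu.-integrable D (EFin \o (fun x => f x * g x)).
Proof.
move=> [mf f2] [mg g2].
apply: (int_dominated mD _ (intD mD f2 g2)); first exact: measurable_funM.
by move=> x _; rewrite ler_norml; apply/andP; split; nra.
Qed.

Lemma L2onD f g : L2on D f -> L2on D g -> L2on D (fun x => f x + g x).
Proof.
move=> [mf f2] [mg g2]; split; first exact: measurable_funD.
apply: (int_dominated mD _ (intZ mD 2 (intD mD f2 g2))).
  by apply: measurable_funX; exact: measurable_funD.
by move=> x _; rewrite ger0_norm ?sqr_ge0// -subr_ge0 (_ : _ - _ = (f x - g x) ^+ 2) ?sqr_ge0//; ring.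
Qed.

Lemma L2onZ c f : L2on D f -> L2on D (fun x => c * f x).
Proof.
move=> [mf f2]; split; first by apply: measurable_funM.
apply: (int_dominated mD _ (intZ mD (c ^+ 2) f2)).
  by apply: measurable_funX; exact: measurable_funM.
by move=> x _; rewrite ger0_norm ?sqr_ge0// exprMn.
Qed.

Lemma L2onN f : L2on D f -> L2on D (fun x => - f x).
Proof.
by move=> /(L2onZ (-1)); congr (L2on D _); apply/funext => x; rewrite mulN1r.
Qed.

Lemma L2onB f g : L2on D f -> L2on D g -> L2on D (fun x => f x - g x).
Proof. by move=> hf hg; apply: L2onD => //; exact: L2onN. Qed.

Lemma continuous_measurable f : continuous f -> measurable_fun D f.
Proof. by move=> cf; apply: int_measurable; exact: continuous_int. Qed.

Lemma continuous_segment_bounded f : continuous f ->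
  exists2 M, 0 <= M & forall x, l <= x <= r -> `|f x| <= M.
Proof.
move=> cf; have := continuous_compact (continuous_subspaceT cf) (@segment_compact R l r).
move=> /compact_bounded[M [_ /(_ (`|M| + 1))H]]; exists (`|M| + 1) => //.
move=> x xlr; apply: H; first by rewrite (le_lt_trans (ler_norm M))// ltrDl.
by exists x.
Qed.

Lemma int_contM f g : continuous f -> mu.-integrable D (EFin \o g) ->
  mu.-integrable D (EFin \o (fun x => f x * g x)).
Proof.
move=> cf ig; have [M M0 fM] := continuous_segment_bounded cf.
apply: (int_dominated mD _ (intZ mD M (integrable_norm ig))).
  by apply: measurable_funM; [exact: continuous_measurable|exact: int_measurable].
by move=> x xD; rewrite normrM ler_wpM2r// fM.
Qed.

Lemma L2on_contM f g : continuous f -> L2on D g -> L2on D (fun x => f x * g x).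
Proof.
move=> cf [mg g2]; split.
  by apply: measurable_funM => //; exact: continuous_measurable.
rewrite (_ : (fun x => _) = (fun x => (f x * f x) * g x ^+ 2)).
  by apply: int_contM => //; apply: contM.
by apply/funext => x; rewrite exprMn.
Qed.

Lemma L2on_cont f : continuous f -> L2on D f.
Proof.
move=> cf; split; first exact: continuous_measurable.
by apply: continuous_int => x; apply: cvgM; exact: cf.
Qed.

Lemma cauchy_schwarz f g : L2on D f -> L2on D g ->
  `|\int[mu]_(x in D) (f x * g x)| <=
  Num.sqrt (\int[mu]_(x in D) (f x ^+ 2)) * Num.sqrt (\int[mu]_(x in D) (g x ^+ 2)).
Proof.
move=> hf hg; have hfg := L2on_intM hf hg.
have [_ f2] := hf; have [_ g2] := hg.
set A := \int[mu]_(x in D) (f x ^+ 2); set B := \int[mu]_(x in D) (g x ^+ 2).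
set C := \int[mu]_(x in D) (f x * g x).
have A0 : 0 <= A by apply: Rintegral_ge0 => x _; exact: sqr_ge0.
have B0 : 0 <= B by apply: Rintegral_ge0 => x _; exact: sqr_ge0.
have H (s t : R) : 0 <= s ^+ 2 * A + (2 * s * t) * C + t ^+ 2 * B.
  have : 0 <= \int[mu]_(x in D) ((s * f x + t * g x) ^+ 2).
    by apply: Rintegral_ge0 => x _; exact: sqr_ge0.
  rewrite (_ : \int[mu]_(x in D) ((s * f x + t * g x) ^+ 2) =
    \int[mu]_(x in D) (s ^+ 2 * f x ^+ 2 + (2 * s * t) * (f x * g x) + t ^+ 2 * g x ^+ 2)); last first.
    by apply: eq_Rintegral => x _; ring.
  rewrite (RintD mD (intD mD (intZ mD _ f2) (intZ mD _ hfg)) (intZ mD _ g2)).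
  by rewrite (RintD mD (intZ mD _ f2) (intZ mD _ hfg)) !RintZ.
rewrite -sqrtrM// -sqrtr_sqr ler_wsqrtr//.
have [B00|Bn0] := eqVneq B 0.
  suff -> : C = 0 by rewrite expr0n mulr_ge0.
  apply/eqP; rewrite -sqrf_eq0 -[_ == _]negbK; apply/negP => Cn0.
  have C0 : 0 < C ^+ 2 by rewrite lt_def Cn0 sqr_ge0.
  have := H 1 (- (A + 1) / (2 * C ^+ 2) * C); rewrite B00.
  have -> : 1 ^+ 2 * A + 2 * 1 * (- (A + 1) / (2 * C ^+ 2) * C) * C +
      (- (A + 1) / (2 * C ^+ 2) * C) ^+ 2 * 0 = A - (A + 1).
    by field; rewrite -sqrf_eq0.
  by lra.
have Bp : 0 < B by rewrite lt_def Bn0.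
have := H B (- C).
have -> : B ^+ 2 * A + 2 * B * - C * C + (- C) ^+ 2 * B = B * (A * B - C ^+ 2) by ring.
by rewrite pmulr_rge0// subr_ge0.
Qed.

Definition l2norm (S : set R) f : R := Num.sqrt (\int[mu]_(x in S) (f x ^+ 2)).

Lemma l2norm_ge0 (S : set R) f : 0 <= l2norm S f.
Proof. exact: sqrtr_ge0. Qed.

Lemma l2norm_sqr (S : set R) f : l2norm S f ^+ 2 = \int[mu]_(x in S) (f x ^+ 2).
Proof. by rewrite sqr_sqrtr// Rintegral_ge0// => x _; exact: sqr_ge0. Qed.

Lemma l2normD f g : L2on D f -> L2on D g ->
  l2norm D (fun x => f x + g x) <= l2norm D f + l2norm D g.
Proof.
move=> hf hg; have hfg := L2on_intM hf hg; have [_ f2] := hf; have [_ g2] := hg.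
rewrite -(@ler_pXn2r _ 2)// ?nnegrE ?addr_ge0 ?l2norm_ge0//.
rewrite l2norm_sqr sqrrD !l2norm_sqr.
have -> : \int[mu]_(x in D) ((f x + g x) ^+ 2) =
    \int[mu]_(x in D) (f x ^+ 2 + 2 * (f x * g x) + g x ^+ 2).
  by apply: eq_Rintegral => x _; ring.
rewrite (RintD mD (intD mD f2 (intZ mD _ hfg)) g2) (RintD mD f2 (intZ mD _ hfg)) RintZ//.
have := le_trans (ler_norm _) (cauchy_schwarz hf hg).
rewrite -/(l2norm D f) -/(l2norm D g); lra.
Qed.

Lemma l2normZ c f : L2on D f -> l2norm D (fun x => c * f x) = `|c| * l2norm D f.
Proof.
move=> [_ f2]; rewrite /l2norm -sqrtr_sqr -sqrtrM ?sqr_ge0// -RintZ//.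
by congr Num.sqrt; apply: eq_Rintegral => x _; rewrite exprMn.
Qed.

Lemma l2norm_le f g : L2on D f -> L2on D g -> (forall x, D x -> `|f x| <= `|g x|) ->
  l2norm D f <= l2norm D g.
Proof.
move=> [_ f2] [_ g2] fg; apply: ler_wsqrtr; apply: (Rint_le mD f2 g2) => x Dx.
by rewrite -real_normK ?num_real// -[leRHS]real_normK ?num_real// ler_pXn2r ?nnegrE ?fg.
Qed.

Lemma eq_l2norm f g : (forall x, D x -> f x = g x) -> l2norm D f = l2norm D g.
Proof.
by move=> fg; congr Num.sqrt; apply: eq_Rintegral => x; rewrite inE => /fg ->.
Qed.

Lemma eq_L2on f g : (forall x, D x -> f x = g x) -> L2on D f -> L2on D g.
Proof.
move=> fg [mf f2]; split.
  by apply: eq_measurable_fun mf => x; rewrite inE => /fg.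
apply: eq_integrable f2 => // x; rewrite inE => /fg /= -> //.
Qed.

End OnSegment.
End L2.

(** * Norms in L2 by duality with smooth functions *)
Section Duality.
Context {R : realType}.
Notation mu := (@lebesgue_measure R).
Implicit Types (f g h : R -> R) (a b c : R).

Lemma Rint_dominated_cvg (D : set R) (f_ : nat -> R -> R) f g : measurable D ->
  (forall n, measurable_fun D (f_ n)) -> mu.-integrable D (EFin \o g) ->
  (forall x, D x -> f_ n x @[n --> \oo] --> f x) ->
  (forall n x, D x -> `|f_ n x| <= g x) ->
  \int[mu]_(x in D) f_ n x @[n --> \oo] --> \int[mu]_(x in D) f x.
Proof.
move=> mD mf ig fc fg.
have mf' : measurable_fun D f := measurable_fun_cvg mf fc.
have h1 n : measurable_fun D (EFin \o f_ n) by exact/measurable_EFinP.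
have h2 : measurable_fun D (EFin \o f) by exact/measurable_EFinP.
have h3 : {ae mu, forall x, D x -> (EFin \o f_ n) x @[n --> \oo] --> (EFin \o f) x}.
  by apply: aeW => x Dx; apply: cvg_EFin; [exact: nearW|exact: fc].
have h4 : {ae mu, forall x, forall n, D x -> (`|(EFin \o f_ n) x| <= (EFin \o g) x)%E}.
  by apply: aeW => x n Dx /=; rewrite lee_fin fg.
have [fi _ H] := @dominated_convergence _ _ R mu D mD _ _ _ h1 h2 h3 ig h4.
apply: fine_cvg; rewrite /Rintegral fineK//; exact: integrable_fin_num.
Qed.

Lemma clamp_bnd (x : R) : 0 <= clamp x <= 1.
Proof. by rewrite /clamp le_max lexx/= ge_max ler01 ge_min lexx orbT. Qed.

Lemma clamp_eq0 (x : R) : x <= 0 -> clamp x = 0.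
Proof. by move=> x0; rewrite /clamp (max_idPl _)// ge_min x0. Qed.

Lemma clamp_eq1 (x : R) : 1 <= x -> clamp x = 1.
Proof. by move=> x1; rewrite /clamp (min_idPr x1) (max_idPr ler01). Qed.

Lemma continuous_clamp : continuous (@clamp R).
Proof. by rewrite /clamp; cont. Qed.

(** A continuous function is a bounded pointwise limit, inside an interval, of
    [C^1] functions that vanish outside: cut it off, then average it over
    [[x, x + 1 / N]]. *)
Lemma smooth_approximation (l r : R) g : continuous g ->
  exists (chi chi' : nat -> R -> R) (G : R),
  [/\ forall n (x : R), is_derive x 1 (chi n) (chi' n x), forall n, continuous (chi' n),
      forall n x, x <= l \/ r <= x -> chi n x = 0, forall n x, `|chi n x| <= G &
      forall x, l < x -> x < r -> chi n x @[n --> \oo] --> g x].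
Proof.
move=> cg; have [G G0 gG] := continuous_segment_bounded l r cg.
pose N n : R := n.+1%:R; have N0 n : 0 < N n by [].
pose z n x := clamp (N n * Num.min (x - l) (r - x) - 2).
have cz n : continuous (z n).
  apply: (cont_comp (f := fun x : R => N n * Num.min (x - l) (r - x) - 2) (g := @clamp R)).
    by cont.
  exact: continuous_clamp.
pose u n x := g x * z n x.
have cu n : continuous (u n) by apply: contM => //; exact: cz.
have u0 n x : x <= l + (N n)^-1 \/ r <= x -> u n x = 0.
  move=> H; rewrite /u /z clamp_eq0 ?mulr0// subr_le0.
  case: H => H.
    apply: (@le_trans _ _ (N n * (N n)^-1)); last by rewrite mulfV// ?ler1n// gt_eqF.
    by rewrite ler_pM2l// ge_min lerBlDl H.
  apply: (@le_trans _ _ (N n * 0)); last by rewrite mulr0.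
  by rewrite ler_pM2l// ge_min !subr_le0 H orbT.
have uG n x : `|u n x| <= G.
  have [xl|xl] := leP x l; first by rewrite u0 ?normr0//; left; rewrite (le_trans xl)// lerDl invr_ge0 ltW.
  have [rx|rx] := leP r x; first by rewrite u0 ?normr0//; right.
  rewrite /u normrM -[leRHS]mulr1; apply: ler_pM => //.
    by apply: gG; rewrite !ltW.
  by have /andP[a b] := clamp_bnd (N n * Num.min (x - l) (r - x) - 2); rewrite ger0_norm.
have xN n x : x <= x + (N n)^-1 by rewrite lerDl invr_ge0 ltW.
pose chi n x := N n * (prim (u n) (x + (N n)^-1) - prim (u n) x).
have chiE n x : chi n x = N n * \int[mu]_(y in `[x, x + (N n)^-1]) u n y.
  by rewrite prim_itv.
exists chi, (fun n x => N n * (u n (x + (N n)^-1) - u n x)), G; split.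
- move=> n x; apply: is_deriveZ; apply: is_deriveB; last exact: is_derive_prim.
  rewrite -[u n _]mulr1.
  apply: (is_derive1_comp (f := prim (u n)) (g := fun x : R => x + (N n)^-1)).
    exact: is_derive_prim.
  by apply: is_derive_eq; rewrite addr0.
- move=> n; apply: contM; first exact: cont_cst.
  apply: contD; last exact: contN.
  by apply: (cont_comp (f := fun x : R => x + (N n)^-1) (g := u n)) => //; cont.
- move=> n x H; rewrite chiE (_ : \int[mu]_(y in _) u n y = \int[mu]_(y in `[x, x + (N n)^-1]) 0).
    by rewrite Rintegral_cst//= mul0r mulr0.
  apply: eq_Rintegral => y; rewrite inE/= in_itv/= => /andP[xy yx].
  apply: u0; case: H => H; [left|right]; last exact: le_trans xy.
  by rewrite (le_trans yx)// lerD2r.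
- move=> n x; rewrite chiE normrM gtr0_norm//.
  have := ler_norm_Rint (M := G) (xN n x) (continuous_int _ _ (cu n)).
  rewrite [x + _ - x]addrC addKr => H; rewrite mulrC -ler_pdivlMr//; apply: H.
  by move=> t _; exact: uG.
- move=> x lx xr; apply/cvgrPdist_le => e e0.
  have := cg x => /cvgrPdist_le/(_ e e0)/near0_ball[d d0 gd].
  pose m := Num.min d (Num.min ((x - l) / 4) ((r - x) / 4)).
  have m0 : 0 < m by rewrite !lt_min d0 !divr_gt0 ?subr_gt0.
  near=> n.
  have Nm : (N n)^-1 < m.
    rewrite invf_plt ?posrE//.
    apply: (@lt_le_trans _ _ n%:R); last by rewrite ler_nat.
    by near: n; exact: nbhs_infty_gtr.
  move: Nm; rewrite !lt_min => /and3P[Nd Nl Nr].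
  have N1 : N n * (N n)^-1 = 1 by rewrite mulfV// gt_eqF.
  have z1 y : x <= y -> y <= x + (N n)^-1 -> z n y = 1.
    move=> xy yx; apply: clamp_eq1.
    suff : N n * (3 * (N n)^-1) <= N n * Num.min (y - l) (r - y).
      by rewrite mulrCA N1; lra.
    rewrite ler_pM2l// le_min; move: Nl Nr yx; clear -xy.
    by set w := (N n)^-1; clearbody w => *; apply/andP; split; lra.
  have hi : mu.-integrable `[x, x + (N n)^-1] (EFin \o (fun y => u n y - g x)).
    by apply: continuous_int; apply: contD; [exact: cu|exact: cont_cst].
  have -> : g x - chi n x = - (N n * \int[mu]_(y in `[x, x + (N n)^-1]) (u n y - g x)).
    rewrite RintB//; first last.
    - by apply: continuous_int; exact: cst_continuous.
    - by apply: continuous_int; exact: cu.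
    rewrite chiE Rintegral_cst//= lebesgue_measure_itv/= lte_fin ltrDl invr_gt0 N0/=.
    by rewrite mulrBr [x + _ - x]addrC addKr mulrCA N1; ring.
  rewrite normrN normrM gtr0_norm//.
  have := ler_norm_Rint (M := e) (xN n x) hi.
  rewrite [x + _ - x]addrC addKr => H; rewrite mulrC -ler_pdivlMr//; apply: H.
  move=> y /andP[xy yx]; rewrite /u z1// mulr1 distrC.
  have := gd (y - x); rewrite [x + (y - x)]addrC subrK; apply.
  by rewrite ger0_norm ?subr_ge0// (le_lt_trans _ Nd)// lerBlDl.
Unshelve. all: by end_near. Qed.

Section OnSegment.
Variables (l r : R).
Let D : set R := `[l, r]%classic.
Let mD : measurable D. Proof. exact: measurable_itv. Qed.

Lemma Rint_open f : mu.-integrable D (EFin \o f) ->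
  \int[mu]_(x in D) f x = \int[mu]_(x in `]l, r[) f x.
Proof.
move=> fi; rewrite Rintegral_itv_bndo_bndc; last first.
  by apply: integrableS fi => //; exact: subset_itv_oo_cc.
rewrite Rintegral_itv_obnd_cbnd//.
by apply: integrableS fi => //; apply: subset_itvr; rewrite bnd_simp.
Qed.

Lemma L2_dual_continuous h B : L2on D h ->
  (forall chi chi' : R -> R, (forall x : R, is_derive x 1 chi (chi' x)) ->
    continuous chi' -> (forall x, x <= l \/ r <= x -> chi x = 0) ->
    \int[mu]_(x in D) (h x * chi x) <= B * l2norm D chi) ->
  forall g, continuous g -> \int[mu]_(x in D) (h x * g x) <= B * l2norm D g.
Proof.
move=> hh H g cg; have [chi [chi' [G [dchi cchi' chi0 chiG chig]]]] := smooth_approximation l r cg.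
have cchi n : continuous (chi n) := continuous_is_derive (dchi n).
have Hn n := H _ _ (dchi n) (cchi' n) (chi0 n).
have Dop x : (`]l, r[%classic : set R) x -> l < x < r by rewrite /= in_itv.
have sD : `]l, r[%classic `<=` D by exact: subset_itv_oo_cc.
have mo : measurable (`]l, r[%classic : set R) by exact: measurable_itv.
have iS u : mu.-integrable D (EFin \o u) -> mu.-integrable `]l, r[ (EFin \o u).
  by move=> ui; apply: integrableS ui.
have mS u : mu.-integrable D (EFin \o u) -> measurable_fun (`]l, r[%classic : set R) u.
  by move=> /iS ui; exact: int_measurable.
have c1 : \int[mu]_(x in D) (h x * chi n x) @[n --> \oo] --> \int[mu]_(x in D) (h x * g x).
  have hn n : mu.-integrable D (EFin \o (fun x => h x * chi n x)).
    by apply: L2on_intM => //; exact: L2on_cont.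
  rewrite (Rint_open (L2on_intM hh (L2on_cont _ _ cg))).
  under eq_fun do rewrite Rint_open//.
  apply: (@Rint_dominated_cvg _ _ _ (fun x => G * `|h x|)) => //.
  - by move=> n; exact: mS.
  - by apply: iS; apply: intZ => //; apply: integrable_norm; exact: L2on_int.
  - by move=> x /Dop/andP[lx xr]; apply: cvgM; [exact: cvg_cst|exact: chig].
  - by move=> n x _; rewrite normrM mulrC ler_wpM2r.
have c2 : \int[mu]_(x in D) (chi n x ^+ 2) @[n --> \oo] --> \int[mu]_(x in D) (g x ^+ 2).
  have hn n : mu.-integrable D (EFin \o (fun x => chi n x ^+ 2)).
    by have [] := @L2on_cont _ l r _ (cchi n).
  have hg : mu.-integrable D (EFin \o (fun x => g x ^+ 2)).
    by have [] := @L2on_cont _ l r _ cg.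
  rewrite (Rint_open hg).
  under eq_fun do rewrite Rint_open//.
  apply: (@Rint_dominated_cvg _ _ _ (fun=> G ^+ 2)) => //.
  - by move=> n; exact: mS.
  - by apply: iS; exact: int_cst.
  - by move=> x /Dop/andP[lx xr]; apply: cvgM; exact: chig.
  - by move=> n x _; rewrite normrX ler_pXn2r// nnegrE; exact: le_trans (chiG n x).
have c3 : B * l2norm D (chi n) @[n --> \oo] --> B * l2norm D g.
  apply: cvgM; first exact: cvg_cst.
  exact: (continuous_cvg _ (@sqrt_continuous R _) c2).
apply: (ler_cvg_to c1 c3); exact: nearW.
Qed.

End OnSegment.
End Duality.

Section Duality2.
Context {R : realType}.
Notation mu := (@lebesgue_measure R).
Implicit Types (f g h : R -> R) (a b c : R).

Definition clip (M x : R) : R := Num.max (- M) (Num.min x M).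

Lemma continuous_clip M : continuous (clip M).
Proof. by rewrite /clip; cont. Qed.

Lemma clip_cases M x : 0 <= M ->
  [\/ x <= - M /\ clip M x = - M, M <= x /\ clip M x = M |
      (- M <= x) && (x <= M) /\ clip M x = x].
Proof.
move=> M0; rewrite /clip; have [xM|Mx] := leP x M; last first.
  by constructor 2; rewrite (max_idPr _) ?(ltW Mx)//; lra.
have [h|h] := leP (- M) x; first by constructor 3.
by constructor 1; rewrite ltW.
Qed.

Section OnSegment.
Variables (l r : R).
Let D : set R := `[l, r]%classic.
Let mD : measurable D. Proof. exact: measurable_itv. Qed.

(** Testing [h] against its truncation would give the bound at once; the
    truncation is not continuous, but it is the limit of continuous functions
    that are bounded by [M] too. *)
Lemma L2_dual_clip h B M : L2on D h -> 0 <= M -> 0 <= B ->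
  (forall g, continuous g -> \int[mu]_(x in D) (h x * g x) <= B * l2norm D g) ->
  l2norm D (clip M \o h) <= B.
Proof.
move=> hh M0 B0 H; set hM := clip M \o h.
have [mh h2] := hh.
have mhM : measurable_fun D hM.
  apply: measurableT_comp mh; apply: continuous_measurable_fun; exact: continuous_clip.
have hMM x : `|clip M x| <= M.
  by case: (clip_cases x M0) => -[h1 ->]; [rewrite normrN ger0_norm|rewrite ger0_norm|rewrite ler_norml].
have LhM : L2on D hM.
  split => //; apply: (int_dominated mD _ (int_cst l r (M ^+ 2))).
    exact: measurable_funX.
  by move=> x _; rewrite normrX ler_pXn2r ?nnegrE//; exact: hMM.
have [||g_ [cg ig gh]] := @approximation_continuous_integrable R D hM mD.
- by rewrite /D /= lebesgue_measure_itv/=; case: ifP => // _; rewrite -EFinB ltry.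
- exact: L2on_int.
have key : \int[mu]_(x in D) (h x * hM x) <= B * l2norm D hM.
  apply/ler_addgt0Pl => e e0.
  pose K := B + l2norm D h + 1.
  have K0 : 0 < K by rewrite /K ltr_wpDl// addr_ge0// l2norm_ge0.
  pose e' := (e / K) ^+ 2 / (2 * M + 1).
  have M1 : 0 < 2 * M + 1 by lra.
  have e'0 : 0 < e' by rewrite divr_gt0// exprn_gt0// divr_gt0.
  have [n gn] : exists n, \int[mu]_(x in D) `|hM x - g_ n x| <= e'.
    have gh' : \int[mu]_(z in D) `|hM z - g_ n z| @[n --> \oo] --> 0.
      by apply: fine_cvg; exact: gh.
    have /cvgrPdist_le/(_ e' e'0)[n _ /(_ n (leqnn n))] /= := gh'.
    rewrite sub0r normrN => Hn; exists n; apply: le_trans Hn; exact: ler_norm.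
  pose g := clip M \o g_ n.
  have cgg : continuous g.
    by apply: (cont_comp (f := g_ n) (g := clip M)) => //; exact: continuous_clip.
  have Lg : L2on D g := L2on_cont _ _ cgg.
  have Ld : L2on D (fun x => hM x - g x) by exact: L2onB.
  have dn : l2norm D (fun x => hM x - g x) <= e / K.
    rewrite -(@ler_pXn2r _ 2)// ?nnegrE ?l2norm_ge0 ?divr_ge0 ?(ltW K0) ?(ltW e0)// l2norm_sqr.
    have ia : mu.-integrable D (EFin \o (fun x => `|hM x - g_ n x|)).
      by apply: integrable_norm; apply: intB => //; exact: L2on_int.
    apply: (@le_trans _ _ (\int[mu]_(x in D) ((2 * M + 1) * `|hM x - g_ n x|))).
      apply: Rint_le => //; [by case: Ld|exact: intZ|move=> x _].
      have d1 : `|hM x - g x| <= 2 * M.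
        by apply: (le_trans (ler_normB _ _)); rewrite mulr_natl mulr2n; apply: lerD; exact: hMM.
      have d2 : `|hM x - g x| <= `|hM x - g_ n x|.
        have : `|hM x| <= M := hMM (h x).
        rewrite /g/= ler_norml => /andP[a1 a2].
        case: (clip_cases (g_ n x) M0) => -[h1 ->] //.
          by rewrite !ger0_norm; lra.
        by rewrite !ler0_norm; lra.
      rewrite -real_normK ?num_real// expr2; apply: ler_pM => //; lra.
    by rewrite RintZ// -ler_pdivlMl// mulrC.
  have -> : \int[mu]_(x in D) (h x * hM x) =
     \int[mu]_(x in D) (h x * g x) + \int[mu]_(x in D) (h x * (hM x - g x)).
    rewrite -RintD//; [|exact: L2on_intM..].
    by apply: eq_Rintegral => x _; ring.
  have t1 := H g cgg.
  have t2 := le_trans (ler_norm _) (cauchy_schwarz hh Ld).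
  have t3 : l2norm D g <= l2norm D hM + e / K.
    rewrite (@eq_l2norm _ _ _ g (fun x => hM x + - (hM x - g x))); last by move=> x _; ring.
    apply: (le_trans (l2normD LhM (L2onN Ld))); rewrite lerD2l.
    by apply: le_trans dn; apply: l2norm_le => //; [exact: L2onN|move=> x _; rewrite normrN].
  rewrite -/(l2norm D h) -/(l2norm D _) in t2.
  have t4 : l2norm D h * l2norm D (fun x => hM x - g x) <= l2norm D h * (e / K).
    by rewrite ler_wpM2l// l2norm_ge0.
  have t5 : B * l2norm D g <= B * l2norm D hM + B * (e / K) by rewrite -mulrDr ler_wpM2l.
  have t6 : B * (e / K) + l2norm D h * (e / K) <= e.
    by rewrite -mulrDl mulrCA -[leRHS]mulr1 ler_pM2l// ler_pdivrMr// mul1r /K lerDl.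
  move: t1 t2 t4 t5 t6; lra.
have key2 : l2norm D hM ^+ 2 <= \int[mu]_(x in D) (h x * hM x).
  rewrite l2norm_sqr; apply: Rint_le => //; [by case: LhM|exact: L2on_intM|].
  move=> x _; rewrite /hM/= expr2; case: (clip_cases (h x) M0) => -[h1 ->] //; nra.
have := le_trans key2 key; rewrite expr2.
have := l2norm_ge0 D hM; rewrite le_eqVlt => /predU1P[<-//|p].
by rewrite ler_pM2r.
Qed.

(** Smooth functions with support inside the interval approximate continuous
    ones, hence truncations of [h]; the truncations converge to [h]. *)
Lemma L2_dual h B : L2on D h -> 0 <= B ->
  (forall chi chi' : R -> R, (forall x : R, is_derive x 1 chi (chi' x)) ->
    continuous chi' -> (forall x, x <= l \/ r <= x -> chi x = 0) ->
    \int[mu]_(x in D) (h x * chi x) <= B * l2norm D chi) ->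
  l2norm D h <= B.
Proof.
move=> hh B0 H.
have Hc := L2_dual_continuous hh H.
have [mh h2] := hh.
rewrite -(@ler_pXn2r _ 2)// ?nnegrE ?l2norm_ge0// l2norm_sqr.
have c1 : \int[mu]_(x in D) (clip n%:R (h x) ^+ 2) @[n --> \oo] --> \int[mu]_(x in D) (h x ^+ 2).
  apply: (Rint_dominated_cvg mD _ h2).
  - move=> n; apply: measurable_funX; apply: measurableT_comp mh.
    by apply: continuous_measurable_fun; exact: continuous_clip.
  - move=> x _; apply: cvg_near_cst; near=> n.
    have hn : `|h x| < n%:R by near: n; exact: nbhs_infty_gtr.
    case: (clip_cases (h x) (ler0n R n)) => -[h1 ->] //; move: hn; rewrite ltr_norml => /andP[]; lra.
  - move=> n x _; rewrite normrX -[leRHS]real_normK ?num_real//.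
    rewrite ler_pXn2r// ?nnegrE//; have n0 := ler0n R n.
    case: (clip_cases (h x) n0) => -[h1 ->] //.
      by rewrite normrN (ger0_norm n0) ler0_norm; lra.
    by rewrite (ger0_norm n0) ger0_norm; lra.
apply: (ler_cvg_to c1 (cvg_cst (B ^+ 2))); apply: nearW => n.
have := L2_dual_clip hh (ler0n R n) B0 Hc.
by rewrite -(@ler_pXn2r _ 2)// ?nnegrE ?l2norm_ge0// l2norm_sqr.
Unshelve. all: by end_near. Qed.

End OnSegment.
End Duality2.

(** * Joint measurability and Fubini's theorem on bounded intervals *)
Section Joint.
Context {R : realType}.
Notation mu := (@lebesgue_measure R).

(** A jointly continuous function is the limit of functions that only depend on
    the first variable through its integer part at scale [1 / N]. *)
Lemma continuous2_measurable (K : R * R -> R) : continuous K -> measurable_fun setT K.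
Proof.
move=> cK.
pose q n (x : R) : R := (Num.floor (x * n.+1%:R))%:~R / n.+1%:R.
have qx (x : R) : q n x @[n --> \oo] --> x.
  apply/cvgrPdist_le => e e0; near=> n.
  have n0 : (0 : R) < n.+1%:R by [].
  have ne : e^-1 < n.+1%:R.
    apply: (@lt_le_trans _ _ n%:R); last by rewrite ler_nat.
    by near: n; exact: nbhs_infty_gtr.
  have -> : x - q n x = (x * n.+1%:R - (Num.floor (x * n.+1%:R))%:~R) / n.+1%:R.
    by rewrite mulrBl mulfK// gt_eqF.
  have /andP[f1 f2] := floor_itv (x * n.+1%:R).
  rewrite normrM normfV (gtr0_norm n0) ger0_norm ?subr_ge0//.
  rewrite ler_pdivrMr//; apply: (@le_trans _ _ 1).
    by rewrite lerBlDl; move: f2; rewrite intrD => /ltW; rewrite addrC [1 + _]addrC.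
  by rewrite -ler_pdivrMl// mulr1 ltW.
apply: (@measurable_fun_cvg _ _ R setT (fun n p => K (q n p.1, p.2))); last first.
  move=> [x y] _ /=.
  have cKy : continuous (fun z : R => K (z, y)).
    by apply: (cont_comp (f := fun z : R => (z, y)) (g := K)) => //; cont.
  exact: (continuous_cvg _ (cKy x) (qx x)).
move=> n _ Y mY; rewrite setTI.
have -> : (fun p : R * R => K (q n p.1, p.2)) @^-1` Y =
   \bigcup_(i : int) ([set x : R | Num.floor (x * n.+1%:R) = i] `*`
      ((fun y : R => K (i%:~R / n.+1%:R, y)) @^-1` Y)).
  apply/seteqP; split => [[x y] /= H|[x y] [i _ [/= <-]]//].
  by exists (Num.floor (x * n.+1%:R)).
apply: countable_bigcupT_measurable; first exact: countableP.
move=> i; apply: measurableX.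
  have n0 : (0 : R) < n.+1%:R by [].
  rewrite (_ : [set x : R | _] = `[i%:~R / n.+1%:R, (i + 1)%:~R / n.+1%:R[%classic).
    exact: measurable_itv.
  apply/seteqP; split => x /=; rewrite in_itv/= ler_pdivrMr// ltr_pdivlMr//.
    by move=> <-; exact: floor_itv.
  by move=> H; apply: floor_def.
have mK : measurable_fun setT (fun y : R => K (i%:~R / n.+1%:R, y)).
  apply: continuous_measurable_fun.
  pose c : R := i%:~R / n.+1%:R.
  by apply: (cont_comp (f := fun y : R => (c, y)) (g := K)) => //; cont.
by have := mK measurableT Y mY; rewrite setTI.
Unshelve. all: by end_near. Qed.

Lemma measurable_Rint_param d (T : measurableType d) (F : T * R -> R) (a b : R) :
  measurable_fun setT F ->
  measurable_fun setT (fun t => \int[mu]_(x in `[a, b]) F (t, x)).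
Proof.
move=> mF.
pose G (p : T * R) : \bar R := (if (a <= p.2) && (p.2 <= b) then F p else 0)%:E.
have mG : measurable_fun setT G.
  apply/measurable_EFinP; apply: measurable_fun_ifT => //.
  by apply: measurable_and; apply: measurable_fun_ler => //.
have mP := @measurable_fun_fubini_tonelli_F _ _ T (measurableTypeR R) R mu _
  (measurable_funepos mG) (fun=> funepos_ge0 _ _).
have mM := @measurable_fun_fubini_tonelli_F _ _ T (measurableTypeR R) R mu _
  (measurable_funeneg mG) (fun=> funeneg_ge0 _ _).
have -> : (fun t => \int[mu]_(x in `[a, b]) F (t, x)) =
   fine \o (fubini_F mu (G^\+)%E \- fubini_F mu (G^\-)%E)%E.
  apply/funext => t; rewrite Rintegral_mkcond /Rintegral /=; congr fine.
  transitivity (\int[mu]_x (G \o pair t) x)%E.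
    apply: eq_integral => x _; rewrite /G /= patchE mem_setE/= in_itv/=.
    by case: ifP.
  rewrite integralE; congr (_ - _)%E; apply: eq_integral => x _.
    by rewrite funepos_comp.
  by rewrite funeneg_comp.
apply: measurableT_comp => //.
exact: emeasurable_funB.
Qed.

Lemma Rint_swap (F : R * R -> R) (H : R -> R) (a b c d : R) : measurable_fun setT F ->
  mu.-integrable `[c, d] (EFin \o H) ->
  (forall x y, a <= x <= b -> c <= y <= d -> `|F (x, y)| <= H y) ->
  \int[mu]_(x in `[a, b]) (\int[mu]_(y in `[c, d]) F (x, y)) =
  \int[mu]_(y in `[c, d]) (\int[mu]_(x in `[a, b]) F (x, y)).
Proof.
move=> mF iH FH.
have mF1 x : measurable_fun setT (fun y => F (x, y)) by exact: measurableT_comp.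
have mF2 y : measurable_fun setT (fun x => F (x, y)) by exact: measurableT_comp.
have i1 x : a <= x <= b -> mu.-integrable `[c, d] (EFin \o (fun y => F (x, y))).
  move=> xab; apply: (int_dominated _ _ iH) => //; first exact: measurable_funTS.
  by move=> y /=; rewrite in_itv/= => ycd; exact: FH.
have i2 y : c <= y <= d -> mu.-integrable `[a, b] (EFin \o (fun x => F (x, y))).
  move=> ycd; apply: (int_dominated _ _ (int_cst a b (H y))) => //.
    exact: measurable_funTS.
  by move=> x /=; rewrite in_itv/= => xab; exact: FH.
pose G (p : R * R) : \bar R :=
  (if ((a <= p.1) && (p.1 <= b)) && ((c <= p.2) && (p.2 <= d)) then F p else 0)%:E.
have mG : measurable_fun setT G.
  apply/measurable_EFinP; apply: measurable_fun_ifT => //.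
  by apply: measurable_and; apply: measurable_and; apply: measurable_fun_ler => //.
have mGy y : measurable_fun setT (fun x : R => G (x, y)) by exact: (measurableT_comp mG).
have E1 x : (a <= x <= b) ->
    (\int[mu]_y G (x, y) = (\int[mu]_(y in `[c, d]) F (x, y))%:E)%E.
  move=> xab; rewrite /Rintegral fineK; last exact: integrable_fin_num (i1 x xab).
  rewrite [RHS]integral_mkcond; apply: eq_integral => y _.
  by rewrite /G/= xab/= patchE mem_setE/= in_itv/=; case: ifP.
have E1' x : (a <= x <= b) = false -> (\int[mu]_y G (x, y) = 0)%E.
  by move=> xab; rewrite integral0_eq// => y _; rewrite /G/= xab.
have E2 y : (c <= y <= d) ->
    (\int[mu]_x G (x, y) = (\int[mu]_(x in `[a, b]) F (x, y))%:E)%E.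
  move=> ycd; rewrite /Rintegral fineK; last exact: integrable_fin_num (i2 y ycd).
  rewrite [RHS]integral_mkcond; apply: eq_integral => x _.
  by rewrite /G/= ycd/= andbT patchE mem_setE/= in_itv/=; case: ifP.
have E2' y : (c <= y <= d) = false -> (\int[mu]_x G (x, y) = 0)%E.
  by move=> ycd; rewrite integral0_eq// => x _; rewrite /G/= ycd andbF.
have iG : (mu \x mu)%E.-integrable setT G.
  apply/(@integrable21ltyP _ _ (measurableTypeR R) (measurableTypeR R)) => //.
  apply: (@le_lt_trans _ _ (\int[mu]_y
    ((EFin \o (fun y => (`|H y| * `|b - a|)%R)) \_ `[c, d]) y)%E).
    apply: ge0_le_integral => //.
    - by move=> y _; exact: integral_ge0.
    - apply: (@measurable_fun_fubini_tonelli_G _ _ (measurableTypeR R) (measurableTypeR R) R mu (abse \o G)).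
        exact: measurableT_comp.
      by move=> x; exact: abse_ge0.
    - apply/(measurable_restrictT _ _).1 => //; apply/measurable_EFinP.
      apply: measurable_funM => //; apply: measurableT_comp => //; exact: int_measurable.
    - move=> y _; rewrite patchE mem_setE/= in_itv/=; case: ifP => ycd.
        apply: (@le_trans _ _ (\int[mu]_(x in `[a, b]) (`|H y|)%:E)%E).
          apply: (@le_trans _ _ (\int[mu]_(x in `[a, b]) `|(F (x, y))%:E|)%E).
            rewrite [leRHS]integral_mkcond le_eqVlt; apply/predU1P; left.
            apply: eq_integral => x _.
            rewrite patchE mem_setE/= in_itv/= andbT.
            by case: ifP => // _; rewrite normr0.
          apply: ge0_le_integral => //.
          + do 2 apply: measurableT_comp => //.
            exact: (measurable_funTS (mF2 y)).
          + move=> x /=; rewrite in_itv/= => xab.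
            by rewrite lee_fin (le_trans (FH x y xab ycd))// ler_norm.
        rewrite integral_cst//= lebesgue_measure_itv/= lte_fin EFinM lee_wpmul2l//.
        by case: ifP => _; rewrite lee_fin ?ler_norm.
      by rewrite integral0_eq// => x _; rewrite /= andbF normr0.
  rewrite -integral_mkcond.
  have /integrableP[_] := intZ (measurable_itv `[c, d]) (`|b - a|) (integrable_norm iH).
  apply: le_lt_trans; rewrite le_eqVlt; apply/predU1P; left.
  by apply: eq_integral => y _; rewrite /= normrM !normr_id mulrC.
have := @Fubini _ _ (measurableTypeR R) (measurableTypeR R) R mu mu G iG.
move=> FG; rewrite [LHS]/Rintegral [RHS]/Rintegral; congr fine.
rewrite integral_mkcond [RHS]integral_mkcond.
transitivity (\int[mu]_x \int[mu]_y G (x, y))%E.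
  apply: eq_integral => x _; rewrite patchE mem_setE/= in_itv/=.
  by case: ifP => xab; [rewrite E1|rewrite E1'].
rewrite FG; apply: eq_integral => y _; rewrite patchE mem_setE/= in_itv/=.
by case: ifP => ycd; [rewrite E2|rewrite E2'].
Qed.

End Joint.

(** * Time-dependent functions and Volterra operators *)
Section Fields.
Context {R : realType}.
Notation mu := (@lebesgue_measure R).
Notation I01 := (`[(0 : R), 1]%classic : set R).
Implicit Types (k : R * R -> R) (f g : R -> R -> R) (h : R -> R) (t x xi T : R).

(** Squares are integrable on [[0, T] x [0, 1]], and the slice at every
    single time is required to be in L2, so that the weak form makes sense at
    each time without exceptional sets. *)
Definition field f :=
  [/\ measurable_fun setT (fun p : R * R => f p.1 p.2),
      forall t, L2on I01 (f t) &
      forall T, mu.-integrable `[0, T] (EFin \o (fun t => \int[mu]_(x in I01) (f t x ^+ 2)))].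

Definition trace (tau : R -> R) := measurable_fun setT tau /\
  forall T, mu.-integrable `[0, T] (EFin \o (fun t => tau t ^+ 2)).

Lemma trace_L2on tau T : trace tau -> L2on `[0, T] tau.
Proof. by move=> [mt ti]; split => //; exact: measurable_funTS. Qed.

Lemma traceD tau tau' : trace tau -> trace tau' -> trace (fun t => tau t + tau' t).
Proof.
move=> ht ht'; split; first by apply: measurable_funD; [case: ht|case: ht'].
by move=> T; have [] := L2onD (trace_L2on T ht) (trace_L2on T ht').
Qed.

Lemma traceZ c tau : trace tau -> trace (fun t => c * tau t).
Proof.
move=> ht; split; first by apply: measurable_funM => //; case: ht.
by move=> T; have [] := L2onZ c (trace_L2on T ht).
Qed.

Lemma trace0P : trace (fun=> 0).
Proof.
split; first exact: measurable_cst.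
by move=> T; have [] := @L2on_cont R 0 T _ (@cst_continuous _ _ 0).
Qed.

Lemma sqnorm_measurable f : measurable_fun setT (fun p : R * R => f p.1 p.2) ->
  measurable_fun setT (fun t => \int[mu]_(x in I01) (f t x ^+ 2)).
Proof.
move=> mf; apply: (measurable_Rint_param (F := fun p => f p.1 p.2 ^+ 2)).
exact: measurable_funX.
Qed.

Lemma field_dominated f G : measurable_fun setT (fun p : R * R => f p.1 p.2) ->
  (forall t, L2on I01 (f t)) ->
  (forall T, mu.-integrable `[0, T] (EFin \o G)) ->
  (forall t, \int[mu]_(x in I01) (f t x ^+ 2) <= G t) -> field f.
Proof.
move=> mf Lf iG fG; split => // T.
apply: (int_dominated _ _ (iG T)) => //.
  by apply: measurable_funTS; exact: sqnorm_measurable.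
by move=> t _; rewrite ger0_norm ?fG// Rintegral_ge0// => x _; exact: sqr_ge0.
Qed.

Lemma fieldD f g : field f -> field g -> field (fun t x => f t x + g t x).
Proof.
move=> [mf Lf If] [mg Lg Ig].
apply: (@field_dominated _ (fun t => 2 * (\int[mu]_(x in I01) (f t x ^+ 2) + \int[mu]_(x in I01) (g t x ^+ 2)))).
- exact: measurable_funD.
- by move=> t; exact: L2onD.
- by move=> T; apply: intZ => //; exact: intD.
- move=> t; have [_ f2] := Lf t; have [_ g2] := Lg t; have [_ fg2] := L2onD (Lf t) (Lg t).
  rewrite -RintD// -RintZ//; last exact: intD.
  apply: Rint_le => //; first by apply: intZ => //; exact: intD.
  by move=> x _; rewrite -subr_ge0 (_ : _ - _ = (f t x - g t x) ^+ 2) ?sqr_ge0//; ring.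
Qed.

Lemma fieldM (a : R -> R) f : continuous a -> field f -> field (fun t x => a x * f t x).
Proof.
move=> ca [mf Lf If]; have [M M0 aM] := continuous_segment_bounded 0 1 ca.
apply: (@field_dominated _ (fun t => M ^+ 2 * \int[mu]_(x in I01) (f t x ^+ 2))).
- apply: measurable_funM => //.
  by apply: (measurableT_comp (f := a)) => //; exact: continuous_measurable_fun.
- by move=> t; exact: L2on_contM.
- by move=> T; exact: intZ.
- move=> t; have [_ f2] := Lf t; have [_ af2] := L2on_contM ca (Lf t).
  rewrite -RintZ//; apply: Rint_le => //; first exact: intZ.
  move=> x /=; rewrite in_itv/= => /aM ax.
  rewrite exprMn ler_wpM2r ?sqr_ge0// -real_normK ?num_real// ler_pXn2r ?nnegrE//.
Qed.

Lemma fieldZ c f : field f -> field (fun t x => c * f t x).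
Proof. by move=> Hf; apply: (fieldM (a := fun=> c)) => //; exact: cst_continuous. Qed.

Lemma fieldN f : field f -> field (fun t x => - f t x).
Proof.
move=> /(fieldZ (-1)); congr field; apply/funext => t; apply/funext => x.
by rewrite mulN1r.
Qed.

Lemma field_tensor (a : R -> R) tau : continuous a -> trace tau ->
  field (fun t x => a x * tau t).
Proof.
move=> ca [mt it].
have E t : \int[mu]_(x in I01) ((a x * tau t) ^+ 2) =
    (\int[mu]_(x in I01) (a x ^+ 2)) * tau t ^+ 2.
  have [_ a2] := @L2on_cont R 0 1 _ ca.
  rewrite mulrC -RintZ//; apply: eq_Rintegral => x _.
  by rewrite exprMn mulrC.
apply: (@field_dominated _ (fun t => (\int[mu]_(x in I01) (a x ^+ 2)) * tau t ^+ 2)).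
- apply: measurable_funM; last exact: measurableT_comp.
  by apply: (measurableT_comp (f := a)) => //; exact: continuous_measurable_fun.
- by move=> t; apply: L2on_contM => //; apply: L2on_cont; exact: cst_continuous.
- by move=> T; apply: intZ.
- by move=> t; rewrite E.
Qed.

Lemma field_pair_int (a : R * R -> R) f T : continuous a -> field f ->
  mu.-integrable `[0, T] (EFin \o (fun t => \int[mu]_(x in I01) (a (t, x) * f t x))).
Proof.
move=> ca [mf Lf If].
pose n t := \int[mu]_(x in I01) (f t x ^+ 2).
have ca1 t : continuous (fun x : R => a (t, x)).
  by apply: (cont_comp (f := fun x : R => (t, x)) (g := a)) => //; cont.
pose m t := \int[mu]_(x in I01) (a (t, x) ^+ 2).
have cm : continuous m.
  have cG : continuous (fun q : R * R => a (q.1, q.2) ^+ 2).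
    rewrite (_ : (fun q : R * R => _) = (fun q : R * R => a q * a q)).
      by apply: contM.
    by apply/funext => -[u v]; rewrite expr2.
  have cP := continuous_prim_param (G := fun t x => a (t, x) ^+ 2) cG.
  rewrite (_ : m = fun t => prim (fun x => a (t, x) ^+ 2) 1).
    by apply: (cont_comp (f := fun t : R => (t, 1 : R)) (g := fun q : R * R => prim (fun x => a (q.1, x) ^+ 2) q.2)) => //; cont.
  apply/funext => t; rewrite /m; have cGt := @continuous_section2 R R (fun t x => a (t, x) ^+ 2) t cG.
  by rewrite (prim_itv cGt ler01) prim0 subr0.
apply: (int_dominated _ _ (intD _ (continuous_int 0 T cm) (If T))) => //.
  apply: measurable_funTS.
  apply: (measurable_Rint_param (F := fun p => a (p.1, p.2) * f p.1 p.2)).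
  apply: measurable_funM => //.
  rewrite (_ : (fun p : R * R => _) = a); last by apply/funext => -[].
  exact: continuous2_measurable.
move=> t _; apply: (le_trans (cauchy_schwarz (L2on_cont _ _ (ca1 t)) (Lf t))).
rewrite -/(m t) -/(n t).
have m0 : 0 <= m t by apply: Rintegral_ge0 => x _; exact: sqr_ge0.
have n0 : 0 <= n t by apply: Rintegral_ge0 => x _; exact: sqr_ge0.
rewrite -{2}(sqr_sqrtr m0) -{2}(sqr_sqrtr n0).
by move: (Num.sqrt (m t)) (Num.sqrt (n t)) => u v; nra.
Qed.

(** ** Volterra operators *)
Definition vol k h x : R := \int[mu]_(xi in I01) (if xi <= x then k (x, xi) * h xi else 0).

Lemma square_bounded k : continuous k ->
  exists2 M : R, 0 <= M & forall x xi, 0 <= x <= 1 -> 0 <= xi <= 1 -> `|k (x, xi)| <= M.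
Proof.
move=> ck.
have cs := compact_setX (@segment_compact R 0 1) (@segment_compact R 0 1).
have := continuous_compact (continuous_subspaceT ck) cs.
move=> /compact_bounded[M [_ /(_ (`|M| + 1))H]]; exists (`|M| + 1) => //.
move=> x xi hx hxi; apply: H; first by rewrite (le_lt_trans (ler_norm M))// ltrDl.
by exists (x, xi).
Qed.

Lemma vol_int k h x : continuous k -> mu.-integrable I01 (EFin \o h) ->
  mu.-integrable I01 (EFin \o (fun xi => if xi <= x then k (x, xi) * h xi else 0)).
Proof.
move=> ck ih.
have ckx : continuous (fun xi : R => k (x, xi)).
  by apply: (cont_comp (f := fun xi : R => (x, xi)) (g := k)) => //; cont.
have ikh := int_contM ckx ih.
apply: (int_dominated _ _ (integrable_norm ikh)) => //.
  apply: measurable_fun_if => //.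
  - by apply: measurable_fun_ler.
  - by apply: measurable_funS (int_measurable ikh) => //; exact: subIsetl.
by move=> xi _ /=; case: ifP => _; rewrite ?normr0.
Qed.

Lemma vol_bound k M h x : continuous k ->
  (forall x xi, 0 <= x <= 1 -> 0 <= xi <= 1 -> `|k (x, xi)| <= M) ->
  L2on I01 h -> 0 <= x <= 1 -> `|vol k h x| <= M * l2norm I01 h.
Proof.
move=> ck kM Lh hx; have ih := L2on_int Lh.
have M0 : 0 <= M by apply: le_trans (kM 0 0 _ _); rewrite ?lexx ?ler01.
apply: (le_trans (le_normr_Rintegral _ (vol_int x ck ih))) => //.
apply: (@le_trans _ _ (\int[mu]_(xi in I01) (M * `|h xi|))).
  apply: Rint_le => //.
  - exact: integrable_norm (vol_int x ck ih).
  - by apply: intZ => //; exact: integrable_norm ih.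
  - move=> xi /=; rewrite in_itv/= => hxi; case: ifP => _.
      by rewrite normrM ler_wpM2r// kM.
    by rewrite normr0 mulr_ge0.
rewrite RintZ//; last exact: integrable_norm ih.
rewrite ler_wpM2l//.
have L1 : L2on I01 (fun=> 1 : R) by apply: L2on_cont; exact: cst_continuous.
have Ln : L2on I01 (fun xi => `|h xi|).
  have [mh h2] := Lh; split; first exact: measurableT_comp.
  by apply: eq_integrable h2 => // xi _ /=; rewrite real_normK ?num_real.
have := cauchy_schwarz L1 Ln.
under eq_Rintegral do rewrite mul1r.
under [X in _ * Num.sqrt X]eq_Rintegral do rewrite real_normK ?num_real//.
move=> H; apply: le_trans (ler_norm _) (le_trans H _).
rewrite Rintegral_cst//= lebesgue_measure_itv/= lte_fin ltr01/= oppr0 addr0.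
by rewrite expr1n mul1r sqrtr1 mul1r.
Qed.

End Fields.

Section Volterra.
Context {R : realType}.
Notation mu := (@lebesgue_measure R).
Notation I01 := (`[(0 : R), 1]%classic : set R).
Implicit Types (k : R * R -> R) (f g : R -> R -> R) (h : R -> R) (t x xi T : R).

Lemma cont_line1 k x : continuous k -> continuous (fun xi : R => k (x, xi)).
Proof. by move=> ck; apply: (cont_comp (f := fun xi : R => (x, xi)) (g := k)) => //; cont. Qed.

Lemma cont_line2 k xi : continuous k -> continuous (fun x : R => k (x, xi)).
Proof. by move=> ck; apply: (cont_comp (f := fun x : R => (x, xi)) (g := k)) => //; cont. Qed.

Lemma cont_diag k : continuous k -> continuous (fun x : R => k (x, x)).
Proof. by move=> ck; apply: (cont_comp (f := fun x : R => (x, x)) (g := k)) => //; cont. Qed.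

Lemma unit_Rint (c : R) : \int[mu]_(x in I01) c = c.
Proof.
by rewrite Rintegral_cst//= lebesgue_measure_itv/= lte_fin ltr01/= oppr0 addr0 mulr1.
Qed.

Lemma Rint_tail (g : R -> R) xi : 0 <= xi ->
  \int[mu]_(x in I01) (if xi <= x then g x else 0) = \int[mu]_(x in `[xi, 1]) g x.
Proof.
move=> xi0; rewrite Rintegral_mkcond [RHS]Rintegral_mkcond.
congr (Rintegral _ _ _); apply/funext => x.
rewrite !patchE !mem_setE/= !in_itv/=.
have [xix|xix] /= := leP xi x; last by case: ifP.
by rewrite (le_trans xi0 xix).
Qed.

Lemma vol_measurable k f : continuous k ->
  measurable_fun setT (fun p : R * R => f p.1 p.2) ->
  measurable_fun setT (fun p : R * R => vol k (f p.1) p.2).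
Proof.
move=> ck mf.
apply: (measurable_Rint_param (F := fun q : (R * R) * R =>
   if q.2 <= q.1.2 then k (q.1.2, q.2) * f q.1.1 q.2 else 0)).
have m12 : measurable_fun setT (fun q : (R * R) * R => q.1.2).
  by apply: (measurableT_comp (f := snd) (g := fst)).
have m11 : measurable_fun setT (fun q : (R * R) * R => q.1.1).
  by apply: (measurableT_comp (f := fst) (g := fst)).
apply: measurable_fun_ifT => //; first exact: measurable_fun_ler.
apply: measurable_funM.
  apply: (measurableT_comp (continuous2_measurable ck)).
  exact: measurable_fun_pair.
apply: (measurableT_comp mf (g := fun q : (R * R) * R => (q.1.1, q.2))).
exact: measurable_fun_pair.
Qed.

Definition restr01 h x := if (0 <= x) && (x <= 1) then h x else 0.

Lemma restr01_measurable h : measurable_fun I01 h -> measurable_fun setT (restr01 h).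
Proof.
move=> mh; apply: measurable_fun_if => //.
  by apply: measurable_and; apply: measurable_fun_ler.
by apply: measurable_funS mh => // x /= [_]; rewrite in_itv/=.
Qed.

Lemma eq_vol k h h' x : (forall xi, 0 <= xi <= 1 -> h xi = h' xi) -> vol k h x = vol k h' x.
Proof.
move=> E; apply: eq_Rintegral => xi; rewrite inE/= in_itv/= => /E ->.
by [].
Qed.

Lemma vol_restr k h x : vol k (restr01 h) x = vol k h x.
Proof. by apply: eq_vol => xi hxi; rewrite /restr01 hxi. Qed.

Lemma vol_L2on k h : continuous k -> L2on I01 h -> L2on I01 (vol k h).
Proof.
move=> ck Lh; have [M M0 kM] := square_bounded ck.
have mv : measurable_fun setT (vol k h).
  rewrite (_ : vol k h = vol k (restr01 h)); last by apply/funext => x; rewrite vol_restr.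
  have mh : measurable_fun setT (restr01 h) by apply: restr01_measurable; case: Lh.
  have H : measurable_fun setT (fun p : R * R => vol k (restr01 h) p.2).
    by apply: (vol_measurable (f := fun=> restr01 h)) => //; exact: measurableT_comp.
  by have := measurableT_comp H (pair1_measurable (0 : R)).
split; first exact: measurable_funTS.
apply: (int_dominated _ _ (int_cst 0 1 ((M * l2norm I01 h) ^+ 2))) => //.
  by apply: measurable_funX; exact: measurable_funTS.
move=> x /=; rewrite in_itv/= => x01; rewrite normrX ler_pXn2r// ?nnegrE ?mulr_ge0 ?l2norm_ge0//.
exact: vol_bound.
Qed.

Lemma field_vol k f : continuous k -> field f -> field (fun t => vol k (f t)).
Proof.
move=> ck [mf Lf If]; have [M M0 kM] := square_bounded ck.
apply: (@field_dominated _ _ (fun t => M ^+ 2 * \int[mu]_(x in I01) (f t x ^+ 2))).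
- exact: vol_measurable.
- by move=> t; exact: vol_L2on.
- by move=> T; exact: intZ.
- move=> t; have [_ v2] := vol_L2on ck (Lf t).
  rewrite -[leRHS]unit_Rint; apply: Rint_le => //; first exact: int_cst.
  move=> x /=; rewrite in_itv/= => x01.
  rewrite -(l2norm_sqr _ (f t)) -exprMn -[leLHS]real_normK ?num_real//.
  rewrite ler_pXn2r// ?nnegrE ?mulr_ge0 ?l2norm_ge0//; exact: vol_bound.
Qed.

(** Fubini's theorem on the triangle. *)
Lemma vol_swap k (a h : R -> R) (A : R) : continuous k -> measurable_fun setT a ->
  (forall x, 0 <= x <= 1 -> `|a x| <= A) -> L2on I01 h ->
  mu.-integrable I01 (EFin \o (fun xi => (\int[mu]_(x in `[xi, 1]) (k (x, xi) * a x)) * h xi)) /\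
  \int[mu]_(x in I01) (a x * vol k h x) =
  \int[mu]_(xi in I01) ((\int[mu]_(x in `[xi, 1]) (k (x, xi) * a x)) * h xi).
Proof.
move=> ck ma aA Lh; have [M M0 kM] := square_bounded ck.
have A0 : 0 <= A by apply: le_trans (aA 0 _); rewrite ?lexx ?ler01.
have mh : measurable_fun setT (restr01 h) by apply: restr01_measurable; case: Lh.
pose F (p : R * R) := if p.2 <= p.1 then a p.1 * (k p * restr01 h p.2) else 0.
have mF : measurable_fun setT F.
  apply: measurable_fun_ifT => //; first exact: measurable_fun_ler.
  apply: measurable_funM; first exact: measurableT_comp.
  by apply: measurable_funM; [exact: continuous2_measurable|exact: measurableT_comp].
have ih := L2on_int Lh.
have iH : mu.-integrable I01 (EFin \o (fun xi => A * M * `|h xi|)).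
  by apply: intZ => //; exact: integrable_norm ih.
have FH x xi : 0 <= x <= 1 -> 0 <= xi <= 1 -> `|F (x, xi)| <= A * M * `|h xi|.
  move=> hx hxi; rewrite /F/= /restr01 hxi; case: ifP => _; last first.
    by rewrite normr0 !mulr_ge0.
  by rewrite !normrM mulrA ler_wpM2r// ler_pM// ?aA ?kM.
have E xi : 0 <= xi <= 1 -> \int[mu]_(x in I01) F (x, xi) =
    (\int[mu]_(x in `[xi, 1]) (k (x, xi) * a x)) * h xi.
  move=> hxi; have xi0 : 0 <= xi by case/andP: hxi.
  rewrite -(Rint_tail (fun x => k (x, xi) * a x))// [RHS]mulrC -RintZ//; last first.
    apply: (int_dominated _ _ (int_cst 0 1 (M * A))) => //.
      apply: measurable_funTS; apply: measurable_fun_ifT => //.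
        by apply: measurable_fun_ler.
      apply: measurable_funM => //; apply: continuous_measurable_fun; exact: cont_line2.
    move=> x /=; rewrite in_itv/= => hx; case: ifP => _; last by rewrite normr0 mulr_ge0.
    by rewrite normrM ler_pM// ?kM ?aA.
  apply: eq_Rintegral => x _; rewrite /F/= /restr01 hxi; case: ifP => _; last by rewrite mulr0.
  by ring.
have iE : mu.-integrable I01 (EFin \o (fun xi => (\int[mu]_(x in `[xi, 1]) (k (x, xi) * a x)) * h xi)).
  apply: (int_dominated _ _ iH) => //.
    apply: (@eq_measurable_fun _ _ _ _ _ (fun xi => \int[mu]_(x in I01) F (x, xi))).
      by move=> xi; rewrite inE/= in_itv/= => /E.
    apply: measurable_funTS.
    apply: (measurable_Rint_param (F := fun p => F (p.2, p.1))).
    apply: (measurableT_comp mF (g := fun p => (p.2, p.1))); exact: measurable_fun_pair.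
  move=> xi /=; rewrite in_itv/= => hxi; rewrite -E//.
  have := @ler_norm_Rint R (fun x => F (x, xi)) 0 1 (A * M * `|h xi|) ler01.
  rewrite subr0 mulr1; apply.
    apply: (int_dominated _ _ (int_cst 0 1 (A * M * `|h xi|))) => //.
      apply: measurable_funTS; apply: (measurableT_comp mF (g := fun x => (x, xi))).
      exact: measurable_fun_pair.
    by move=> x /=; rewrite in_itv/= => hx; exact: FH.
  by move=> x hx; exact: FH.
split => //.
transitivity (\int[mu]_(x in I01) (\int[mu]_(xi in I01) F (x, xi))).
  apply: eq_Rintegral => x _; rewrite -RintZ//; last exact: vol_int.
  apply: eq_Rintegral => xi; rewrite inE/= in_itv/= => hxi.
  by rewrite /F/= /restr01 hxi; case: ifP => _; rewrite ?mulr0.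
rewrite (Rint_swap mF iH FH); apply: eq_Rintegral => xi; rewrite inE/= in_itv/= => hxi.
exact: E.
Qed.

End Volterra.

(** * Weak solutions of transport equations *)
Section Weak.
Context {R : realType}.
Notation mu := (@lebesgue_measure R).
Notation I01 := (`[(0 : R), 1]%classic : set R).
Implicit Types (k F : R * R -> R) (a f g phi : R -> R -> R) (h : R -> R) (t x xi T : R).

Definition cont2 a := continuous (fun p : R * R => a p.1 p.2).

Definition pairing T a f := \int[mu]_(t in `[0, T]) \int[mu]_(x in I01) (a t x * f t x).

Lemma cont2_section a t : cont2 a -> continuous (a t).
Proof. exact: continuous_section2. Qed.

Lemma pairing_int T a f : cont2 a -> field f ->
  mu.-integrable `[0, T] (EFin \o (fun t => \int[mu]_(x in I01) (a t x * f t x))).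
Proof. by move=> ca hf; apply: (field_pair_int T ca hf). Qed.

Lemma slice_int a f t : cont2 a -> field f ->
  mu.-integrable I01 (EFin \o (fun x => a t x * f t x)).
Proof.
by move=> ca [_ Lf _]; apply: L2on_intM => //; apply: L2on_cont; exact: cont2_section.
Qed.

Lemma eq_pairing T a f a' f' :
  (forall t, 0 <= t <= T -> \int[mu]_(x in I01) (a t x * f t x) = \int[mu]_(x in I01) (a' t x * f' t x)) ->
  pairing T a f = pairing T a' f'.
Proof. by move=> E; apply: eq_Rintegral => t; rewrite inE/= in_itv/=; exact: E. Qed.

Lemma pairingD T a f g : cont2 a -> field f -> field g ->
  pairing T a (fun t x => f t x + g t x) = pairing T a f + pairing T a g.
Proof.
move=> ca hf hg; rewrite -RintD//; [|exact: pairing_int..].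
apply: eq_Rintegral => t _; rewrite -RintD//; [|exact: slice_int..].
by apply: eq_Rintegral => x _; rewrite mulrDr.
Qed.

Lemma pairingZ T a c f : cont2 a -> field f ->
  pairing T a (fun t x => c * f t x) = c * pairing T a f.
Proof.
move=> ca hf; rewrite -RintZ//; last exact: pairing_int.
apply: eq_Rintegral => t _; rewrite -RintZ//; last exact: slice_int.
by apply: eq_Rintegral => x _; rewrite mulrCA.
Qed.

(** The boundary values are not those of a representative of [z] but
    additional data, which the identity itself ties to [z]. *)
Definition weak (v : R) f (z0 : R -> R) (z : R -> R -> R) (tau0 tau1 : R -> R) :=
  forall T phi, 0 <= T -> C1_test phi ->
    \int[mu]_(x in I01) (phi T x * z T x) - \int[mu]_(x in I01) (phi 0 x * z0 x)
    + v * (\int[mu]_(t in `[0, T]) (phi t 1 * tau1 t) - \int[mu]_(t in `[0, T]) (phi t 0 * tau0 t))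
    = pairing T (fun t x => dt phi t x + v * dx phi t x) z + pairing T phi f.

(** Besides the identity, all integrability that makes its terms finite, so
    that solutions can be added and transformed without further hypotheses. *)
Definition sol (v : R) f (z0 : R -> R) (z : R -> R -> R) (tau0 tau1 : R -> R) :=
  [/\ field z, field f, L2on I01 z0, trace tau0 /\ trace tau1 & weak v f z0 z tau0 tau1].

Lemma C1_cont2 phi : C1_test phi -> cont2 phi.
Proof. exact: C1_test_continuous. Qed.

Lemma C1_cont2D v phi : C1_test phi -> cont2 (fun t x => dt phi t x + v * dx phi t x).
Proof. by move=> [_ c1 c2]; apply: contD; [exact: c1|apply: contM; [exact: cont_cst|exact: c2]]. Qed.

Lemma trace_pair_int (b tau : R -> R) T : continuous b -> trace tau ->
  mu.-integrable `[0, T] (EFin \o (fun t => b t * tau t)).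
Proof.
move=> cb ht; apply: L2on_intM; last exact: trace_L2on.
by apply: L2on_cont.
Qed.

Lemma cont2_line a x : cont2 a -> continuous (fun t : R => a t x).
Proof. by move=> ca; apply: (cont_comp (f := fun t : R => (t, x)) (g := fun p => a p.1 p.2)) => //; cont. Qed.

Lemma sol_eq v f f' (z0 : R -> R) (z : R -> R -> R) (tau0 tau1 : R -> R) : field f' ->
  (forall t x, 0 <= t -> 0 <= x <= 1 -> f t x = f' t x) ->
  sol v f z0 z tau0 tau1 -> sol v f' z0 z tau0 tau1.
Proof.
move=> hf' E [hz hf h0 ht w]; split; [exact: hz|exact: hf'|exact: h0|exact: ht|].
move=> T phi T0 Cphi; rewrite (w T phi T0 Cphi); congr (_ + _).
apply: eq_pairing => t /andP[t0 _]; apply: eq_Rintegral => x; rewrite inE/= in_itv/= => hx.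
by rewrite E.
Qed.

Lemma solD v f f' (z0 z0' : R -> R) (z z' : R -> R -> R) (tau0 tau1 tau0' tau1' : R -> R) :
  sol v f z0 z tau0 tau1 -> sol v f' z0' z' tau0' tau1' ->
  sol v (fun t x => f t x + f' t x) (fun x => z0 x + z0' x) (fun t x => z t x + z' t x)
    (fun t => tau0 t + tau0' t) (fun t => tau1 t + tau1' t).
Proof.
move=> [hz hf h0 [ht0 ht1] w] [hz' hf' h0' [ht0' ht1'] w']; split.
- exact: fieldD.
- exact: fieldD.
- exact: L2onD.
- by split; exact: traceD.
- move=> T phi T0 Cphi.
  have cphi := C1_cont2 Cphi; have cD := C1_cont2D (v := v) Cphi.
  rewrite !pairingD//.
  have S t (u u' : R -> R) : L2on I01 u -> L2on I01 u' ->
      \int[mu]_(x in I01) (phi t x * (u x + u' x)) =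
      \int[mu]_(x in I01) (phi t x * u x) + \int[mu]_(x in I01) (phi t x * u' x).
    move=> hu hu'; rewrite -RintD//; first by apply: eq_Rintegral => x _; rewrite mulrDr.
      by apply: int_contM; [exact: cont2_section|exact: L2on_int].
    by apply: int_contM; [exact: cont2_section|exact: L2on_int].
  have Q x (u u' : R -> R) : trace u -> trace u' ->
      \int[mu]_(t in `[0, T]) (phi t x * (u t + u' t)) =
      \int[mu]_(t in `[0, T]) (phi t x * u t) + \int[mu]_(t in `[0, T]) (phi t x * u' t).
    move=> hu hu'; rewrite -RintD//; first by apply: eq_Rintegral => t _; rewrite mulrDr.
      by apply: trace_pair_int => //; exact: cont2_line.
    by apply: trace_pair_int => //; exact: cont2_line.
  have Lz : L2on I01 (z T) by case: hz.
  have Lz' : L2on I01 (z' T) by case: hz'.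
  rewrite !S// !Q//.
  by rewrite [RHS]addrACA -(w T phi T0 Cphi) -(w' T phi T0 Cphi); ring.
Qed.

Lemma solZ v c f (z0 : R -> R) (z : R -> R -> R) (tau0 tau1 : R -> R) : sol v f z0 z tau0 tau1 ->
  sol v (fun t x => c * f t x) (fun x => c * z0 x) (fun t x => c * z t x)
    (fun t => c * tau0 t) (fun t => c * tau1 t).
Proof.
move=> [hz hf h0 [ht0 ht1] w]; split.
- exact: fieldZ.
- exact: fieldZ.
- exact: L2onZ.
- by split; exact: traceZ.
- move=> T phi T0 Cphi.
  have cphi := C1_cont2 Cphi; have cD := C1_cont2D (v := v) Cphi.
  rewrite !pairingZ//.
  have S t (u : R -> R) : L2on I01 u ->
      \int[mu]_(x in I01) (phi t x * (c * u x)) = c * \int[mu]_(x in I01) (phi t x * u x).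
    move=> hu; rewrite -RintZ//; first by apply: eq_Rintegral => x _; rewrite mulrCA.
    by apply: int_contM; [exact: cont2_section|exact: L2on_int].
  have Q x (u : R -> R) : trace u ->
      \int[mu]_(t in `[0, T]) (phi t x * (c * u t)) = c * \int[mu]_(t in `[0, T]) (phi t x * u t).
    move=> hu; rewrite -RintZ//; first by apply: eq_Rintegral => t _; rewrite mulrCA.
    by apply: trace_pair_int => //; exact: cont2_line.
  have Lz : L2on I01 (z T) by case: hz.
  rewrite !S// !Q//.
  have := w T phi T0 Cphi; move: (pairing _ _ _) (pairing _ _ _) => u1 u2 E.
  by rewrite -mulrDr -E; ring.
Qed.

Lemma solB v f f' (z0 z0' : R -> R) (z z' : R -> R -> R) (tau0 tau1 tau0' tau1' : R -> R) :
  sol v f z0 z tau0 tau1 -> sol v f' z0' z' tau0' tau1' ->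
  sol v (fun t x => f t x - f' t x) (fun x => z0 x - z0' x) (fun t x => z t x - z' t x)
    (fun t => tau0 t - tau0' t) (fun t => tau1 t - tau1' t).
Proof.
move=> s /(solZ (-1)) s'; have := solD s s'.
have E (u u' : R -> R) : (fun t => u t + -1 * u' t) = (fun t => u t - u' t).
  by apply/funext => t; rewrite mulN1r.
have E2 (u u' : R -> R -> R) : (fun t x => u t x + -1 * u' t x) = (fun t x => u t x - u' t x).
  by apply/funext => t; exact: E.
by rewrite !E !E2.
Qed.

End Weak.

(** * Volterra transforms of weak solutions *)
Section VolSol.
Context {R : realType}.
Notation mu := (@lebesgue_measure R).
Notation I01 := (`[(0 : R), 1]%classic : set R).
Implicit Types (k F : R * R -> R) (a f g phi : R -> R -> R) (h : R -> R) (t x xi T : R).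

Lemma pairing_trace k (z : R -> R -> R) : continuous k -> field z ->
  trace (fun t => \int[mu]_(xi in I01) (k (1, xi) * z t xi)).
Proof.
move=> ck [mz Lz Iz].
have mtr : measurable_fun setT (fun t => \int[mu]_(xi in I01) (k (1, xi) * z t xi)).
  apply: (measurable_Rint_param (F := fun p => k (1, p.2) * z p.1 p.2)).
  apply: measurable_funM => //.
  apply: (measurableT_comp (f := fun xi => k (1, xi))) => //.
  by apply: continuous_measurable_fun; exact: cont_line1.
split => // T; have ck1 := cont_line1 (x := 1) ck.
pose A := \int[mu]_(xi in I01) (k (1, xi) ^+ 2).
apply: (int_dominated _ _ (intZ _ A (Iz T))) => //.
  by apply: measurable_funTS; exact: measurable_funX.
move=> t _; rewrite normrX.
have := cauchy_schwarz (L2on_cont 0 1 ck1) (Lz t).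
rewrite -(@ler_pXn2r _ 2)// ?nnegrE ?mulr_ge0 ?sqrtr_ge0// => /le_trans; apply.
by rewrite exprMn !sqr_sqrtr// Rintegral_ge0// => x _; exact: sqr_ge0.
Qed.

Let vol_sol_algebra (X1 X2 Y P0 p1 p2 p3 p4 d1 d2 : R) :
  X1 - X2 + d2 * (0 - P0) = (p1 + p2 + p3 - d1 * Y) + p4 ->
  X1 - X2 + d1 * (Y - 0) = p1 + (p3 + d2 * P0 + p2 + p4).
Proof.
move=> /(congr1 (fun r => r + d2 * P0 + d1 * Y)) E.
transitivity (X1 - X2 + d2 * (0 - P0) + d2 * P0 + d1 * Y); first by ring.
by rewrite E; ring.
Qed.

(** Test [vol k z] with [phi] and move [k] onto the test function: the
    adjoint test function of [phi] is admissible for [z], and it vanishes at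
    [x = 1], so that [tau1] disappears. The line integrals defining [F] turn
    the speed [d2] into [d1]. *)
Lemma vol_sol (d1 d2 c kappa : R) k F f (z0 : R -> R) (z : R -> R -> R) (tau0 tau1 : R -> R) :
  d2 != 0 -> d1 = c * d2 ->
  (forall x xi, triangle (x, xi) ->
    triangle ((x - c * xi) * (1 + c * kappa), (x - c * xi) * kappa)) ->
  continuous k -> continuous F -> along_characteristics d1 d2 k F ->
  sol d2 f z0 z tau0 tau1 ->
  sol d1 (fun t x => ((d1 - d2) * k (x, x)) * z t x + (d2 * k (x, 0)) * tau0 t
                     + vol F (z t) x + vol k (f t) x)
    (vol k z0) (fun t => vol k (z t)) (fun=> 0)
    (fun t => \int[mu]_(xi in I01) (k (1, xi) * z t xi)).
Proof.
move=> d20 d1E anchor ck cF kF [hz hf h0 [ht0 ht1] w].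
have hC : field (fun t x => ((d1 - d2) * k (x, x)) * z t x).
  by apply: fieldM => //; apply: contM; [exact: cont_cst|exact: cont_diag].
have h00 : field (fun t x => (d2 * k (x, 0)) * tau0 t).
  by apply: field_tensor => //; apply: contM; [exact: cont_cst|exact: cont_line2].
have hB : field (fun t => vol F (z t)) by exact: field_vol.
have hK : field (fun t => vol k (f t)) by exact: field_vol.
have hV : field (fun t => vol k (z t)) by exact: field_vol.
have htr : trace (fun t => \int[mu]_(xi in I01) (k (1, xi) * z t xi)).
  exact: pairing_trace.
split.
- exact: hV.
- exact: (fieldD (fieldD (fieldD hC h00) hB) hK).
- exact: vol_L2on.
- by split => //; exact: trace0P.
move=> T phi T0 Cphi.
have [Phi [CPhi PhiE]] := adjoint_test d20 d1E anchor (continuous_subspaceT ck) (continuous_subspaceT cF) kF Cphi.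
have cphi := C1_cont2 Cphi; have cPhi := C1_cont2 CPhi.
have cD := C1_cont2D (v := d1) Cphi; have cDP := C1_cont2D (v := d2) CPhi.
have swap (K : R * R -> R) a t h : continuous K -> cont2 a -> L2on I01 h ->
    mu.-integrable I01 (EFin \o (fun xi => (\int[mu]_(x in `[xi, 1]) (K (x, xi) * a t x)) * h xi)) /\
    \int[mu]_(x in I01) (a t x * vol K h x) =
    \int[mu]_(xi in I01) ((\int[mu]_(x in `[xi, 1]) (K (x, xi) * a t x)) * h xi).
  move=> cK ca Lh; have cat := cont2_section (t := t) ca.
  have [A A0 aA] := continuous_segment_bounded 0 1 cat.
  apply: (vol_swap (A := A)) => //; exact: continuous_measurable_fun.
have swapPhi t h : L2on I01 h ->
    \int[mu]_(x in I01) (phi t x * vol k h x) = \int[mu]_(xi in I01) (Phi t xi * h xi).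
  move=> Lh; have [_ ->] := swap k phi t h ck cphi Lh.
  apply: eq_Rintegral => xi; rewrite inE/= in_itv/= => /andP[xi0 xi1].
  by have [-> _] := PhiE t xi xi0 xi1.
have Lz t : L2on I01 (z t) by case: hz.
have Lf t : L2on I01 (f t) by case: hf.
have := w T Phi T0 CPhi.
rewrite -(swapPhi T _ (Lz T)) -(swapPhi 0 _ h0).
have Phi1 t : Phi t 1 = 0.
  by have [-> _] := PhiE t 1 ler01 (lexx 1); rewrite set_itv1 Rintegral_set1.
have -> : \int[mu]_(t in `[0, T]) (Phi t 1 * tau1 t) = 0.
  under eq_Rintegral do rewrite Phi1 mul0r.
  by rewrite Rintegral_cst//= mul0r.
have -> : pairing T Phi f = pairing T phi (fun t => vol k (f t)).
  by apply: eq_pairing => t _; rewrite swapPhi.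
have E0 : pairing T phi (fun t x => (d2 * k (x, 0)) * tau0 t) =
    d2 * \int[mu]_(t in `[0, T]) (Phi t 0 * tau0 t).
  rewrite -RintZ//; last first.
    by apply: trace_pair_int => //; exact: cont2_line.
  apply: eq_Rintegral => t _.
  have [-> _] := PhiE t 0 (lexx 0) ler01.
  rewrite [_ * tau0 t]mulrC mulrA -RintZ//; last first.
    apply: continuous_int; apply: contM; [exact: cont_line2|exact: cont2_section].
  by apply: eq_Rintegral => x _; ring.
pose tr t := \int[mu]_(xi in I01) (k (1, xi) * z t xi).
have ctr : cont2 (fun t x => d1 * (k (1, x) * phi t 1)).
  apply: contM; first exact: cont_cst.
  apply: contM.
    by apply: (cont_comp (f := snd) (g := fun x => k (1, x))); [exact: cont_snd|exact: cont_line1].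
  by apply: (cont_comp (f := fst) (g := fun t : R => phi t 1)); [exact: cont_fst|exact: cont2_line].
have Etr : pairing T (fun t x => d1 * (k (1, x) * phi t 1)) z =
    d1 * \int[mu]_(t in `[0, T]) (phi t 1 * tr t).
  rewrite -RintZ//; last by apply: trace_pair_int => //; exact: cont2_line.
  apply: eq_Rintegral => t _; rewrite mulrA -RintZ//; last first.
    by apply: int_contM; [exact: cont_line1|exact: L2on_int].
  by apply: eq_Rintegral => x _; ring.
have EJ : pairing T (fun t x => dt Phi t x + d2 * dx Phi t x) z =
    pairing T (fun t x => dt phi t x + d1 * dx phi t x) (fun t => vol k (z t))
    + pairing T phi (fun t => vol F (z t))
    + pairing T phi (fun t x => ((d1 - d2) * k (x, x)) * z t x)
    - pairing T (fun t x => d1 * (k (1, x) * phi t 1)) z.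
  have i1 := pairing_int T cD hV; have i2 := pairing_int T cphi hB.
  have i3 := pairing_int T cphi hC; have i4 := pairing_int T ctr hz.
  rewrite /pairing -(RintD _ i1 i2)// -(RintD _ (intD _ i1 i2) i3)// -(RintB _ (intD _ (intD _ i1 i2) i3) i4)//.
  apply: eq_Rintegral => t _.
  have [s1 ->] := swap k _ t _ ck cD (Lz t).
  have [s2 ->] := swap F _ t _ cF cphi (Lz t).
  have s3 := slice_int t cphi hC; have s4 := slice_int t ctr hz.
  rewrite -(RintD _ s1 s2)// -(RintD _ (intD _ s1 s2) s3)// -(RintB _ (intD _ (intD _ s1 s2) s3) s4)//.
  apply: eq_Rintegral => xi; rewrite inE/= in_itv/= => /andP[xi0 xi1].
  have [_ ->] := PhiE t xi xi0 xi1.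
  by ring.
rewrite EJ Etr => E.
rewrite (pairingD _ cphi (fieldD (fieldD hC h00) hB) hK).
rewrite (pairingD _ cphi (fieldD hC h00) hB) (pairingD _ cphi hC h00) E0.
have -> : \int[mu]_(t in `[0, T]) (phi t 0 * 0) = 0.
  under eq_Rintegral do rewrite mulr0.
  by rewrite Rintegral_cst//= mul0r.
exact: vol_sol_algebra E.
Qed.

End VolSol.

(** * Algebra of Volterra operators *)
Section VolAlgebra.
Context {R : realType}.
Notation mu := (@lebesgue_measure R).
Notation I01 := (`[(0 : R), 1]%classic : set R).
Implicit Types (k F : R * R -> R) (h : R -> R) (t x xi T : R).

Lemma volD k h h' x : continuous k -> L2on I01 h -> L2on I01 h' ->
  vol k (fun y => h y + h' y) x = vol k h x + vol k h' x.
Proof.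
move=> ck Lh Lh'; rewrite -RintD//; [|exact: vol_int x ck (L2on_int _)..].
by apply: eq_Rintegral => xi _; case: ifP => _; rewrite ?addr0 ?mulrDr.
Qed.

Lemma volZ k c h x : continuous k -> L2on I01 h ->
  vol k (fun y => c * h y) x = c * vol k h x.
Proof.
move=> ck Lh; rewrite -RintZ//; last exact: vol_int x ck (L2on_int _).
by apply: eq_Rintegral => xi _; case: ifP => _; rewrite ?mulr0// mulrCA.
Qed.

Lemma vol_kernelD k k' h x : continuous k -> continuous k' -> L2on I01 h ->
  vol (fun z => k z + k' z) h x = vol k h x + vol k' h x.
Proof.
move=> ck ck' Lh; have ih := L2on_int Lh.
rewrite -RintD//; [|exact: vol_int x ck ih|exact: vol_int x ck' ih].
by apply: eq_Rintegral => xi _; case: ifP => _; rewrite ?addr0 ?mulrDl.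
Qed.

Lemma vol_kernel_left (a : R -> R) k h x : continuous k -> L2on I01 h ->
  vol (fun z => a z.1 * k z) h x = a x * vol k h x.
Proof.
move=> ck Lh; rewrite -RintZ//; last exact: vol_int x ck (L2on_int _).
by apply: eq_Rintegral => xi _; case: ifP => _; rewrite ?mulr0// mulrA.
Qed.

Lemma vol_kernel_right (a : R -> R) k h x :
  vol (fun z => a z.2 * k z) h x = vol k (fun y => a y * h y) x.
Proof.
apply: eq_Rintegral => xi _; case: ifP => _ //=.
by rewrite [a xi * _]mulrC mulrA.
Qed.

Lemma eq_vol_kernel k k' h x :
  (forall xi, 0 <= xi -> xi <= x -> k (x, xi) = k' (x, xi)) -> vol k h x = vol k' h x.
Proof.
move=> E; apply: eq_Rintegral => xi; rewrite inE/= in_itv/= => /andP[xi0 _].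
by case: ifP => // xix; rewrite E.
Qed.

(** The kernel of the composition of the two Volterra operators. The
    difference of primitives, unlike the integral over [[xi, x]], is
    continuous and shifts well on the whole plane. *)
Definition star k k' (z : R * R) : R :=
  prim (fun s => k (z.1, s) * k' (s, z.2)) z.1 - prim (fun s => k (z.1, s) * k' (s, z.2)) z.2.

Lemma star_integrand_cont k k' : continuous k -> continuous k' ->
  continuous (fun q : (R * R) * R => k (q.1.1, q.2) * k' (q.2, q.1.2)).
Proof.
move=> ck ck'; apply: contM.
  by apply: (cont_comp (f := fun q : (R * R) * R => (q.1.1, q.2)) (g := k)) => //; cont.
by apply: (cont_comp (f := fun q : (R * R) * R => (q.2, q.1.2)) (g := k')) => //; cont.
Qed.

Lemma star_continuous k k' : continuous k -> continuous k' -> continuous (star k k').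
Proof.
move=> ck ck'; have cP := continuous_prim_param
  (G := fun (z : R * R) s => k (z.1, s) * k' (s, z.2)) (star_integrand_cont ck ck').
apply: contD; last apply: contN.
  by apply: (cont_comp (f := fun z : R * R => (z, z.1)) (g := fun q => prim (fun s => k (q.1.1, s) * k' (s, q.1.2)) q.2)) => //; cont.
by apply: (cont_comp (f := fun z : R * R => (z, z.2)) (g := fun q => prim (fun s => k (q.1.1, s) * k' (s, q.1.2)) q.2)) => //; cont.
Qed.

Lemma star_section_cont k k' x xi : continuous k -> continuous k' ->
  continuous (fun s : R => k (x, s) * k' (s, xi)).
Proof. by move=> ck ck'; apply: contM; [exact: cont_line1|exact: cont_line2]. Qed.

Lemma starE k k' x xi : continuous k -> continuous k' -> xi <= x ->
  star k k' (x, xi) = \int[mu]_(s in `[xi, x]) (k (x, s) * k' (s, xi)).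
Proof. by move=> ck ck' xix; rewrite prim_itv//; exact: star_section_cont. Qed.

Lemma Rint_head (g : R -> R) xi x : x <= 1 ->
  \int[mu]_(s in `[xi, 1]) (if s <= x then g s else 0) = \int[mu]_(s in `[xi, x]) g s.
Proof.
move=> x1; rewrite Rintegral_mkcond [RHS]Rintegral_mkcond.
congr (Rintegral _ _ _); apply/funext => s.
rewrite !patchE !mem_setE/= !in_itv/=.
have [sx|xs] := leP s x; first by rewrite (le_trans sx x1).
by rewrite andbF; case: ifP.
Qed.

Lemma vol_star k k' h x : continuous k -> continuous k' -> L2on I01 h -> 0 <= x <= 1 ->
  vol k (vol k' h) x = vol (star k k') h x.
Proof.
move=> ck ck' Lh /andP[x0 x1].
pose a s := if s <= x then k (x, s) else 0.
have ckx := cont_line1 (x := x) ck.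
have [A A0 kA] := continuous_segment_bounded 0 1 ckx.
have ma : measurable_fun setT a.
  apply: measurable_fun_ifT => //; first exact: measurable_fun_ler.
  exact: continuous_measurable_fun.
have aA s : 0 <= s <= 1 -> `|a s| <= A.
  by move=> hs; rewrite /a; case: ifP => _; rewrite ?normr0// kA.
have [_ E] := vol_swap ck' ma aA Lh.
transitivity (\int[mu]_(s in I01) (a s * vol k' h s)).
  by apply: eq_Rintegral => s _; rewrite /a; case: ifP => _; rewrite ?mul0r.
rewrite E; apply: eq_Rintegral => xi; rewrite inE/= in_itv/= => /andP[xi0 xi1].
have -> : \int[mu]_(s in `[xi, 1]) (k' (s, xi) * a s) =
    \int[mu]_(s in `[xi, x]) (k (x, s) * k' (s, xi)).
  rewrite -(Rint_head (fun s => k (x, s) * k' (s, xi)) xi x1).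
  apply: eq_Rintegral => s _; rewrite /a.
  by case: ifP => _; rewrite ?mulr0// mulrC.
case: ifP => [xix|/negbT]; first by rewrite starE.
rewrite -ltNge => xix; rewrite set_itv_ge ?Rintegral_set0 ?mul0r//.
by rewrite bnd_simp -ltNge.
Qed.

(** Run the characteristic backwards from its end point. *)
Lemma along_opp (d1 d2 : R) k F : continuous F ->
  along_characteristics d1 d2 k F ->
  along_characteristics (- d1) (- d2) k (fun z => - F z).
Proof.
move=> cF kF x xi s s0 T1 T2.
have Ex : (x + s * - d1) + s * d1 = x by ring.
have Exi : (xi + s * - d2) + s * d2 = xi by ring.
have := kF _ _ s s0 T2; rewrite Ex Exi => /(_ T1) ->.
pose u (tau : R) := F (x + tau * - d1, xi + tau * - d2).
have cu : continuous u.
  by apply: (cont_comp (f := fun tau : R => (x + tau * - d1, xi + tau * - d2)) (g := F)) => //; cont.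
have cu' : continuous (fun tau : R => u (s - tau)).
  by apply: (cont_comp (f := fun tau : R => s - tau) (g := u)) => //; cont.
have -> : \int[mu]_(tau in `[0, s]) F (x + s * - d1 + tau * d1, xi + s * - d2 + tau * d2) =
   \int[mu]_(tau in `[0, s]) u (s - tau).
  by apply: eq_Rintegral => tau _; rewrite /u; congr (F (_, _)); ring.
have -> : \int[mu]_(tau in `[0, s]) - F (x + tau * - d1, xi + tau * - d2) =
   - \int[mu]_(tau in `[0, s]) u tau.
  rewrite -[RHS]mulN1r -RintZ//; last exact: continuous_int.
  by apply: eq_Rintegral => tau _; rewrite mulN1r.
have dP (t : R) : is_derive t 1 (fun tau : R => - prim u (s - tau)) (u (s - t)).
  rewrite -[u _]opprK; apply: is_deriveN; rewrite -mulrN1.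
  apply: (is_derive1_comp (f := prim u) (g := fun tau : R => s - tau)).
    exact: is_derive_prim.
  by apply: is_derive_eq; rewrite add0r mul1r.
rewrite !prim_itv// (prim_unique _ _ cu' dP) subrr subr0 prim0; ring.
Qed.

End VolAlgebra.

(** * The resolvent of a Volterra kernel *)
Section Resolvent.
Context {R : realType}.
Notation mu := (@lebesgue_measure R).
Implicit Types (k F d : R * R -> R) (x xi s h : R).

Lemma primD (f g : R -> R) (x : R) : continuous f -> continuous g ->
  prim (fun s => f s + g s) x = prim f x + prim g x.
Proof.
move=> cf cg; rewrite /prim; case: ifPn => _; rewrite RintD// ?opprD//;
  exact: continuous_int.
Qed.

Lemma half_pow0 (C e : R) : 0 < e -> exists J : nat, C * 2^-1 ^+ J <= e.
Proof.
move=> e0; have : (C * 2^-1 ^+ n) @[n --> \oo] --> C * 0.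
  by apply: cvgM; [exact: cvg_cst|apply: cvg_expr; rewrite ger0_norm; lra].
rewrite mulr0 => /cvgrPdist_le/(_ _ e0)[J _ /(_ J (leqnn J))] /=.
by rewrite sub0r normrN => H; exists J; apply: le_trans H; exact: ler_norm.
Qed.

Lemma half_pow_eq0 (C r : R) : (forall J, `|r| <= C * 2^-1 ^+ J) -> r = 0.
Proof.
move=> H; apply/eqP; rewrite -normr_le0; apply/ler_addgt0Pl => e e0; rewrite addr0.
by have [J HJ] := half_pow0 C e0; exact: le_trans (H J) HJ.
Qed.

(** The suprema of the lower bounds given by a partial sum minus its tail
    estimate provide the limit; the explicit error, uniform in [z], is the
    form in which convergence is used afterwards. *)
Lemma geometric_sum (T : Type) (S : T -> Prop) (u : nat -> T -> R) (C : R) :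
  (forall j z, S z -> `|u j z| <= C * 2^-1 ^+ j) ->
  exists U : T -> R, forall J z, S z ->
    `|U z - \sum_(j < J) u j z| <= 2 * C * 2^-1 ^+ J.
Proof.
move=> uC; pose p J z := \sum_(j < J) u j z.
pose a z J := p J z - 2 * C * 2^-1 ^+ J; pose b z J := p J z + 2 * C * 2^-1 ^+ J.
have pS J z : p J.+1 z = p J z + u J z by rewrite /p big_ord_recr.
have aS z J : S z -> a z J <= a z J.+1.
  move=> Sz; rewrite /a pS exprS; have := uC J z Sz; rewrite ler_norml => /andP[h1 _].
  have -> : 2 * C * (2^-1 * 2^-1 ^+ J) = C * 2^-1 ^+ J by field.
  by move: h1; rewrite -mulrA; set w := C * _; lra.
have bS z J : S z -> b z J.+1 <= b z J.
  move=> Sz; rewrite /b pS exprS; have := uC J z Sz; rewrite ler_norml => /andP[_ h1].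
  have -> : 2 * C * (2^-1 * 2^-1 ^+ J) = C * 2^-1 ^+ J by field.
  by move: h1; rewrite -mulrA; set w := C * _; lra.
have C0 z : S z -> 0 <= C.
  by move=> Sz; have := uC 0 z Sz; rewrite expr0 mulr1; exact: le_trans.
have ab z J K : S z -> a z J <= b z K.
  move=> Sz; have am L : a z J <= a z (J + L)%N.
    by elim: L => [|L IH]; rewrite ?addn0// addnS (le_trans IH)// aS.
  have bm L : b z (K + L)%N <= b z K.
    by elim: L => [|L IH]; rewrite ?addn0// addnS (le_trans _ IH)// bS.
  have := bm J; have := am K; rewrite [(K + J)%N]addnC => h1 h2.
  have h3 : a z (J + K)%N <= b z (J + K)%N.
    have c0 := C0 z Sz; have w0 : 0 <= 2 * C * 2^-1 ^+ (J + K) :> R by rewrite !mulr_ge0// exprn_ge0.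
    by rewrite /a /b; move: w0; set w := 2 * C * _; lra.
  exact: le_trans h1 (le_trans h3 h2).
exists (fun z => sup (range (a z))) => J z Sz.
have ha : has_sup (range (a z)).
  split; first by exists (a z 0); exists 0.
  by exists (b z 0) => _ [K _ <-]; exact: ab.
have h1 : a z J <= sup (range (a z)) by apply: (ub_le_sup ha.2); exists J.
have h2 : sup (range (a z)) <= b z J.
  by apply: ge_sup; [exact: ha.1|move=> _ [K _ <-]; exact: ab].
by move: h1 h2; rewrite /a /b /p ler_norml; set w := 2 * C * _; lra.
Qed.

(** Against an exponential that grows in [x - xi], composition gains a factor
    [1 / lam], which is what makes the Neumann series converge for kernels of
    any size. *)
Lemma star_bound k k' (A B lam x xi : R) : continuous k -> continuous k' -> 0 < lam -> 0 <= B ->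
  (forall z, triangle z -> `|k z| <= A) ->
  (forall z, triangle z -> `|k' z| <= B * expR (lam * (z.1 - z.2))) ->
  triangle (x, xi) ->
  `|star k k' (x, xi)| <= A * B / lam * expR (lam * (x - xi)).
Proof.
move=> ck ck' lam0 B0 kA kB' T; have [/= xi0 [xix x1]] := T.
have A0 : 0 <= A by apply: le_trans (kA _ T).
pose u s := A * B * expR (lam * (s - xi)).
pose U s := A * B / lam * expR (lam * (s - xi)).
have dU (s : R) : is_derive s 1 U (u s).
  rewrite (_ : u s = (A * B / lam) *: (expR (lam * (s - xi)) * lam)); last first.
    by rewrite /u /GRing.scale/=; field; rewrite gt_eqF.
  apply: is_deriveZ.
  apply: (is_derive1_comp (f := expR) (g := fun s : R => lam * (s - xi))).
  by apply: is_derive_eq; rewrite /GRing.scale/=; ring.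
have cu : continuous u.
  apply: contM; first exact: cont_cst.
  by apply: (cont_comp (f := fun s : R => lam * (s - xi)) (g := expR)); [cont|exact: continuous_expR].
rewrite starE//.
have ci : mu.-integrable `[xi, x] (EFin \o (fun s => k (x, s) * k' (s, xi))).
  by apply: continuous_int; exact: star_section_cont.
apply: (le_trans (le_normr_Rintegral _ ci)) => //.
apply: (@le_trans _ _ (\int[mu]_(s in `[xi, x]) u s)).
  apply: Rint_le => //.
  - exact: integrable_norm ci.
  - exact: continuous_int.
  - move=> s /=; rewrite in_itv/= => /andP[xis sx]; rewrite normrM /u -mulrA.
    apply: ler_pM => //; first by apply: kA; split => //=; rewrite (le_trans xi0 xis).
    by apply: kB'; split => //=; split => //; exact: le_trans x1.
rewrite prim_itv// (prim_unique _ _ cu dU) lerBlDr /U lerDl.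
by rewrite !mulr_ge0// ?invr_ge0 ?expR_ge0// ltW.
Qed.

Definition diag_derivable v k F :=
  forall x xi h, is_derive h 1 (fun h => k (x + h, xi + h)) (v^-1 * F (x + h, xi + h)).

Lemma star_shift k k' x xi h : continuous k -> continuous k' ->
  star k k' (x + h, xi + h) =
    prim (fun s => k (x + h, s + h) * k' (s + h, xi + h)) x -
    prim (fun s => k (x + h, s + h) * k' (s + h, xi + h)) xi.
Proof.
move=> ck ck'; have cs := star_section_cont (x := x + h) (xi := xi + h) ck ck'.
have := prim_shift (- h) xi x cs; rewrite !opprK => E.
by rewrite /star /= E.
Qed.

(** A shift along the diagonal moves both kernels and the integration
    variable together, so the derivative falls on one kernel at a time. *)
Lemma star_diag_derivable v k F k' F' : continuous k -> continuous F ->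
  continuous k' -> continuous F' ->
  diag_derivable v k F -> diag_derivable v k' F' ->
  diag_derivable v (star k k') (fun z => star F k' z + star k F' z).
Proof.
move=> ck cF ck' cF' dk dk' x xi h.
pose G h s := k (x + h, s + h) * k' (s + h, xi + h).
pose GF h s := F (x + h, s + h) * k' (s + h, xi + h).
pose GF' h s := k (x + h, s + h) * F' (s + h, xi + h).
have cc (u w : R * R -> R) : continuous u -> continuous w ->
    continuous (fun q : R * R => u (x + q.1, q.2 + q.1) * w (q.2 + q.1, xi + q.1)).
  move=> cu cw; apply: contM.
    by apply: (cont_comp (f := fun q : R * R => (x + q.1, q.2 + q.1)) (g := u)) => //; cont.
  by apply: (cont_comp (f := fun q : R * R => (q.2 + q.1, xi + q.1)) (g := w)) => //; cont.
have cG : continuous (fun q : R * R => G q.1 q.2) by exact: cc.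
have cGF : continuous (fun q : R * R => GF q.1 q.2) by exact: cc.
have cGF' : continuous (fun q : R * R => GF' q.1 q.2) by exact: cc.
pose G' h s := v^-1 * (GF h s + GF' h s).
have cG' : continuous (fun q : R * R => G' q.1 q.2).
  by apply: contM; [exact: cont_cst|apply: contD].
have dG (p s : R) : is_derive p 1 (G ^~ s) (G' p s).
  apply: is_derive_eq (is_deriveM (dk x s p) (dk' s xi p)) _.
  by rewrite /G' /GF /GF' /GRing.scale/=; ring.
have E1 : (fun h => star k k' (x + h, xi + h)) = (fun h => prim (G h) x - prim (G h) xi).
  by apply/funext => p; rewrite star_shift.
have cs (u : R -> R -> R) (q : R) : continuous (fun q : R * R => u q.1 q.2) -> continuous (u q).
  by move=> cu; exact: continuous_section2 cu.
have primDZ y : prim (G' h) y = v^-1 * (prim (GF h) y + prim (GF' h) y).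
  rewrite /G' primZ; last by apply: contD; exact: cs.
  by rewrite primD//; exact: cs.
rewrite E1.
rewrite (_ : v^-1 * (star F k' (x + h, xi + h) + star k F' (x + h, xi + h)) =
   prim (G' h) x - prim (G' h) xi); last first.
  by rewrite !primDZ !star_shift//; rewrite -/(GF h) -/(GF' h); ring.
by apply: is_deriveB; exact: is_derive_prim_param.
Qed.

End Resolvent.

Section ResolventExistence.
Context {R : realType}.
Notation mu := (@lebesgue_measure R).
Implicit Types (k F d f : R * R -> R) (x xi s h : R).

Lemma starDr k f f' z : continuous k -> continuous f -> continuous f' ->
  star k (fun z => f z + f' z) z = star k f z + star k f' z.
Proof.
move=> ck cf cf'; case: z => x xi; rewrite /star/=.
have E y : prim (fun s => k (x, s) * (f (s, xi) + f' (s, xi))) y =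
    prim (fun s => k (x, s) * f (s, xi)) y + prim (fun s => k (x, s) * f' (s, xi)) y.
  rewrite -primD; [|exact: star_section_cont..].
  by congr (prim _ y); apply/funext => s; rewrite mulrDr.
by rewrite !E; ring.
Qed.

Lemma starZr k c f z : continuous k -> continuous f ->
  star k (fun z => c * f z) z = c * star k f z.
Proof.
move=> ck cf; case: z => x xi; rewrite /star/=.
have E y : prim (fun s => k (x, s) * (c * f (s, xi))) y =
    c * prim (fun s => k (x, s) * f (s, xi)) y.
  rewrite -primZ; last exact: star_section_cont.
  by congr (prim _ y); apply/funext => s; rewrite mulrCA.
by rewrite !E; ring.
Qed.

Lemma starBr k f f' z : continuous k -> continuous f -> continuous f' ->
  star k (fun z => f z - f' z) z = star k f z - star k f' z.
Proof.
move=> ck cf cf'; rewrite -mulN1r -starZr// -starDr//.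
  by congr (star k _ z); apply/funext => y; rewrite mulN1r.
by apply: contM => //; exact: cont_cst.
Qed.

Lemma star0r k z : continuous k -> star k (fun=> 0) z = 0.
Proof.
move=> ck; have := @starZr k 0 (fun=> 0) z ck (@cst_continuous _ _ 0).
rewrite [RHS]mul0r => E; rewrite -[RHS]E; congr (star k _ z).
by apply/funext => y; rewrite mul0r.
Qed.

Lemma eq_star k k' f f' x xi : continuous k -> continuous f -> continuous k' -> continuous f' ->
  (forall z, triangle z -> k z = k' z) -> (forall z, triangle z -> f z = f' z) ->
  triangle (x, xi) -> star k f (x, xi) = star k' f' (x, xi).
Proof.
move=> ck cf ck' cf' Ek Ef [/= xi0 [xix x1]]; rewrite !starE//.
apply: eq_Rintegral => s; rewrite inE/= in_itv/= => /andP[xis sx].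
rewrite Ek ?Ef//; first by split => //=; split => //; exact: le_trans x1.
by split => //=; rewrite (le_trans xi0 xis).
Qed.

Lemma uniform_limit_retract (S : nat -> R * R -> R) (U : R * R -> R) C :
  (forall J, continuous (S J)) ->
  (forall J z, triangle z -> `|U z - S J z| <= C * 2^-1 ^+ J) ->
  continuous (fun z => U (retract z)).
Proof.
move=> cS US z; apply/cvgrPdist_le => e e0.
have e3 : 0 < e / 3 by rewrite divr_gt0.
have [J HJ] := half_pow0 C e3.
have cSr : continuous (fun z => S J (retract z)).
  by apply: (cont_comp (g := S J)) => //; exact: retract_continuous.
have /cvgrPdist_le/(_ _ e3) := cSr z.
apply: filterS => y Hy.
have a1 := le_trans (US J _ (retract_triangle z)) HJ.
have a2 := le_trans (US J _ (retract_triangle y)) HJ.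
rewrite (_ : U (retract z) - U (retract y) = (U (retract z) - S J (retract z)) +
  (S J (retract z) - S J (retract y)) - (U (retract y) - S J (retract y))); last by ring.
apply: (le_trans (ler_normB _ _)); apply: (le_trans (lerD (ler_normD _ _) (lexx _))).
by move: a1 a2 Hy; move: (`|_|) (`|_|) (`|_|) => u1 u2 u3; lra.
Qed.

Lemma diag_derivable_along v k F : v != 0 -> continuous F -> diag_derivable v k F ->
  forall x xi s, 0 <= s -> k (x + s * v, xi + s * v) =
    k (x, xi) + \int[mu]_(tau in `[0, s]) F (x + tau * v, xi + tau * v).
Proof.
move=> v0 cF dk x xi s s0.
have cu : continuous (fun tau : R => F (x + tau * v, xi + tau * v)).
  by apply: (cont_comp (f := fun tau : R => (x + tau * v, xi + tau * v)) (g := F)) => //; cont.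
have dP (t : R) : is_derive t 1 (fun tau : R => k (x + tau * v, xi + tau * v))
    (F (x + t * v, xi + t * v)).
  rewrite (_ : F _ = (v^-1 * F (x + t * v, xi + t * v)) * v); last first.
    by rewrite mulrAC mulVf// mul1r.
  apply: (is_derive1_comp (f := fun h : R => k (x + h, xi + h)) (g := fun tau : R => tau * v)).
    exact: dk.
  by apply: is_derive_eq; rewrite /GRing.scale/=; ring.
by rewrite prim_itv// (prim_unique _ _ cu dP) !mul0r !addr0; ring.
Qed.

(** The Neumann series of [k], summed together with the series of the
    derivatives along the diagonal: composition commutes with diagonal
    shifts, so that the derivatives obey the Leibniz rule and their series is
    dominated in the same way. *)
Lemma resolvent v k F : v != 0 -> continuous k -> continuous F ->
  along_characteristics v v k F ->
  exists n e : R * R -> R,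
    [/\ continuous n, continuous e, along_characteristics v v n e,
        forall z, triangle z -> n z + star k n z = k z &
        forall z, triangle z -> e z + star k e z + star F n z = F z].
Proof.
move=> v0 ck cF kF.
have [g [cg dg gE]] : exists g : R -> R -> R,
    [/\ continuous (fun p : R * R => g p.1 p.2),
        forall xi y : R, is_derive xi 1 (g ^~ y) (v^-1 * F (retract (y + 1 * xi, xi))) &
        forall x xi, triangle (x, xi) -> k (x, xi) = g xi (x - 1 * xi)].
  apply: (@kernel_extension R v v 1 0 k F v0 _ _ (continuous_subspaceT ck) (continuous_subspaceT cF) kF).
    by rewrite mul1r.
  move=> x xi [/= h0 [h1 h2]]; rewrite !mul1r mulr0 addr0 mulr1.
  by split => //=; split; lra.
pose K (z : R * R) := g z.2 (z.1 - z.2); pose Fr (z : R * R) := F (retract z).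
have cK : continuous K.
  by apply: (cont_comp (f := fun z : R * R => (z.2, z.1 - z.2)) (g := fun p => g p.1 p.2)) => //; cont.
have cFr : continuous Fr by apply: (cont_comp (g := F)) => //; exact: retract_continuous.
have KE z : triangle z -> K z = k z by case: z => x xi T; rewrite /K/= gE// mul1r.
have FrE z : triangle z -> Fr z = F z by move=> T; rewrite /Fr retract_id.
have dK : diag_derivable v K Fr.
  move=> x xi h; rewrite /K/=.
  rewrite (_ : (fun h => _) = fun h => g (xi + h) (x - xi)); last first.
    by apply/funext => p; congr (g _ _); ring.
  rewrite -[v^-1 * _]mulr1.
  apply: (is_derive1_comp (f := g ^~ (x - xi)) (g := fun h : R => xi + h)).
    apply: is_derive_eq (dg (xi + h) (x - xi)) _.
    by rewrite /Fr mul1r; congr (_ * F (retract (_, _))); ring.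
  by apply: is_derive_eq; rewrite add0r mul1r.
pose step (p : (R * R -> R) * (R * R -> R)) :=
  ((fun z => -1 * star K p.1 z), (fun z => -1 * (star Fr p.1 z + star K p.2 z))).
pose d j := (iter j step (K, Fr)).1; pose eps j := (iter j step (K, Fr)).2.
have dS j : d j.+1 = fun z => -1 * star K (d j) z by [].
have eS j : eps j.+1 = fun z => -1 * (star Fr (d j) z + star K (eps j) z) by [].
have cde j : continuous (d j) /\ continuous (eps j).
  elim: j => [//|j [cd ce]]; rewrite dS eS; split.
    by apply: contM; [exact: cont_cst|exact: star_continuous].
  by apply: contM; [exact: cont_cst|apply: contD; exact: star_continuous].
have cd j : continuous (d j) := (cde j).1.
have ce j : continuous (eps j) := (cde j).2.
have dde j : diag_derivable v (d j) (eps j).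
  elim: j => [//|j IH]; rewrite dS eS => x xi h.
  have := @star_diag_derivable R v K Fr (d j) (eps j) cK cFr (cd j) (ce j) dK IH x xi h.
  by move=> H; rewrite mulrCA; apply: is_deriveZ.
have [M1 M10 KM] := square_bounded cK; have [M2 M20 FM] := square_bounded cFr.
(* With this weight a composition costs [A / lam <= 1/4]; the two terms of
   the Leibniz rule then cost 1/2 together, the ratio of both series. *)
pose A := M1 + M2; pose lam := 4 * A + 1.
have A0 : 0 <= A by rewrite addr_ge0.
have lam0 : 0 < lam by rewrite /lam; lra.
have tri01 z : triangle z -> (0 <= z.1 <= 1) /\ (0 <= z.2 <= 1).
  move=> [h0 [h1 h2]]; rewrite h0 h2 (le_trans h0 h1) (le_trans h1 h2).
  by [].
have KA z : triangle z -> `|K z| <= A.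
  case: z => x xi /tri01[h1 h2]; apply: (le_trans (KM x xi h1 h2)).
  by rewrite /A; lra.
have FA z : triangle z -> `|Fr z| <= A.
  case: z => x xi /tri01[h1 h2]; apply: (le_trans (FM x xi h1 h2)).
  by rewrite /A; lra.
have Alam : A / lam <= 4^-1.
  by rewrite ler_pdivrMr// /lam; lra.
have bnd j : (forall z, triangle z -> `|d j z| <= A * 2^-1 ^+ j * expR (lam * (z.1 - z.2))) /\
             (forall z, triangle z -> `|eps j z| <= A * 2^-1 ^+ j * expR (lam * (z.1 - z.2))).
  elim: j => [|j [IHd IHe]].
    split => z T; rewrite expr0 mulr1 -[leLHS]mulr1; apply: ler_pM => //;
      rewrite ?KA ?FA// -[leLHS]expR0 ler_expR mulr_ge0 ?(ltW lam0)//;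
      by case: T => _ []; rewrite subr_ge0.
  have B0 : 0 <= A * 2^-1 ^+ j by rewrite mulr_ge0// exprn_ge0// invr_ge0.
  have quarter (r : R) : 0 <= r -> A * (A * 2^-1 ^+ j) / lam * r <= A * 2^-1 ^+ j * (4^-1 * r).
    move=> r0; rewrite -!mulrA; rewrite mulrA [A * (2^-1 ^+ j * _)]mulrC.
    rewrite (_ : A * A * _ = A * 2^-1 ^+ j * ((A / lam) * r)); last by ring.
    rewrite (_ : 2^-1 ^+ j * (4^-1 * r) * A = A * 2^-1 ^+ j * (4^-1 * r)); last by ring.
    by apply: ler_wpM2l => //; apply: ler_wpM2r.
  split => -[x xi] T /=; have E0 := expR_ge0 (lam * (x - xi)).
    rewrite dS normrM normrN normr1 mul1r.
    apply: (le_trans (star_bound cK (cd j) lam0 B0 KA IHd T)).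
    apply: (le_trans (quarter _ E0)); rewrite exprS.
    rewrite (_ : A * (2^-1 * _) * _ = A * 2^-1 ^+ j * (2^-1 * expR (lam * (x - xi)))); last by ring.
    by apply: ler_wpM2l => //; apply: ler_wpM2r => //; lra.
  rewrite eS normrM normrN normr1 mul1r; apply: (le_trans (ler_normD _ _)).
  apply: (le_trans (lerD (star_bound cFr (cd j) lam0 B0 FA IHd T) (star_bound cK (ce j) lam0 B0 KA IHe T))).
  apply: (le_trans (lerD (quarter _ E0) (quarter _ E0))); rewrite exprS.
  rewrite (_ : A * (2^-1 * _) * _ = A * 2^-1 ^+ j * (2^-1 * expR (lam * (x - xi)))); last by ring.
  by rewrite -mulrDr; apply: ler_wpM2l => //; lra.
pose C := A * expR lam.
have C0 : 0 <= C by rewrite mulr_ge0// expR_ge0.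
have expC z : triangle z -> expR (lam * (z.1 - z.2)) <= expR lam.
  move=> [h0 [h1 h2]]; rewrite ler_expR -[leRHS]mulr1 ler_wpM2l ?(ltW lam0)//; lra.
have bC j (r : R * R -> R) z : triangle z -> `|r z| <= A * 2^-1 ^+ j * expR (lam * (z.1 - z.2)) ->
    `|r z| <= C * 2^-1 ^+ j.
  move=> T /le_trans; apply; rewrite /C mulrAC ler_wpM2r ?exprn_ge0 ?invr_ge0//.
  by rewrite ler_wpM2l// expC.
have [U HU] := @geometric_sum R (R * R)%type (@triangle R) d C (fun j z T => bC j (d j) z T ((bnd j).1 z T)).
have [V HV] := @geometric_sum R (R * R)%type (@triangle R) eps C (fun j z T => bC j (eps j) z T ((bnd j).2 z T)).
pose N J z := \sum_(j < J) d j z; pose E J z := \sum_(j < J) eps j z.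
have NS J : N J.+1 = fun z => N J z + d J z.
  by apply/funext => z; rewrite /N big_ord_recr.
have ES J : E J.+1 = fun z => E J z + eps J z.
  by apply/funext => z; rewrite /E big_ord_recr.
have N0 : N 0%N = fun=> 0 by apply/funext => z; rewrite /N big_ord0.
have E0 : E 0%N = fun=> 0 by apply/funext => z; rewrite /E big_ord0.
have cN J : continuous (N J).
  by elim: J => [|J IH]; rewrite ?N0 ?NS; [exact: cont_cst|exact: contD].
have cE J : continuous (E J).
  by elim: J => [|J IH]; rewrite ?E0 ?ES; [exact: cont_cst|exact: contD].
have dNE J : diag_derivable v (N J) (E J).
  elim: J => [|J IH] x xi h.
    by rewrite N0 E0 mulr0; exact: is_derive_cst.
  by rewrite NS ES mulrDr; apply: is_deriveD; [exact: IH|exact: dde].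
have NK J z : N J.+1 z = K z - star K (N J) z.
  elim: J => [|J IH]; first by rewrite NS N0 star0r// subr0 add0r.
  by rewrite NS IH dS [in RHS]NS starDr//; ring.
have EK J z : E J.+1 z = Fr z - star K (E J) z - star Fr (N J) z.
  elim: J => [|J IH]; first by rewrite ES E0 N0 !star0r// !subr0 add0r.
  by rewrite ES IH eS [in RHS]ES [in RHS]NS !starDr//; ring.
pose n z := U (retract z); pose e z := V (retract z).
have cn : continuous n by apply: uniform_limit_retract HU.
have cce : continuous e by apply: uniform_limit_retract HV.
have nN J z : triangle z -> `|n z - N J z| <= 2 * C * 2^-1 ^+ J.
  by move=> T; rewrite /n retract_id//; exact: HU.
have eE J z : triangle z -> `|e z - E J z| <= 2 * C * 2^-1 ^+ J.
  by move=> T; rewrite /e retract_id//; exact: HV.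
have sB (q f : R * R -> R) (B : R) z : continuous q -> continuous f -> 0 <= B ->
    (forall z, triangle z -> `|q z| <= A) -> (forall z, triangle z -> `|f z| <= B) ->
    triangle z -> `|star q f z| <= A * expR 1 * B.
  case: z => x xi cq cf B0 qA fB T.
  have := @star_bound R q f A B 1 x xi cq cf ltr01 B0 qA _ T.
  rewrite divr1 mul1r => H; apply: (le_trans (H _)) => [z Tz|].
    apply: (le_trans (fB z Tz)); rewrite -[leLHS]mulr1 ler_wpM2l// -[leLHS]expR0 ler_expR mul1r.
    by case: Tz => _ []; rewrite subr_ge0.
  rewrite [A * expR 1 * B]mulrAC ler_wpM2l ?mulr_ge0// ler_expR.
  by case: T => /= h0 [h1 h2]; lra.
have pow0 J : 0 <= 2 * C * 2^-1 ^+ J by rewrite !mulr_ge0// exprn_ge0// invr_ge0.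
have half1 J : 2 * C * 2^-1 ^+ J.+1 <= 2 * C * 2^-1 ^+ J.
  rewrite ler_wpM2l ?mulr_ge0// exprS -[leRHS]mul1r ler_wpM2r ?exprn_ge0 ?invr_ge0//; lra.
have cB (u w : R * R -> R) : continuous u -> continuous w -> continuous (fun z => u z - w z).
  by move=> cu cw; apply: contD => //; exact: contN.
exists n, e; split => //.
- move=> x xi s s0 T1 T2; apply/eqP; rewrite -subr_eq0; apply/eqP.
  apply: (@half_pow_eq0 R (2 * C * (2 + s))) => J.
  have := diag_derivable_along v0 (cE J) (dNE J) x xi s0 => HN.
  have cl (u : R * R -> R) : continuous u -> continuous (fun tau : R => u (x + tau * v, xi + tau * v)).
    by move=> cu; apply: (cont_comp (f := fun tau : R => (x + tau * v, xi + tau * v)) (g := u)) => //; cont.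
  have cint (u : R * R -> R) : continuous u -> mu.-integrable `[0, s] (EFin \o (fun tau => u (x + tau * v, xi + tau * v))).
    by move=> cu; apply: continuous_int; exact: cl.
  have bint : `|\int[mu]_(tau in `[0, s]) (e (x + tau * v, xi + tau * v) - E J (x + tau * v, xi + tau * v))|
      <= 2 * C * 2^-1 ^+ J * s.
    rewrite -[X in _ * X]subr0; apply: ler_norm_Rint => //; first exact: (cint _ (cB _ _ cce (cE J))).
    by move=> tau ht; apply: eE; exact: triangle_segment T1 T2.
  rewrite RintB// in bint; [|exact: cint..].
  have b1 := nN J _ T2; have b2 := nN J _ T1.
  rewrite (_ : _ - _ = (n (x + s * v, xi + s * v) - N J (x + s * v, xi + s * v)) -
      (n (x, xi) - N J (x, xi)) -
      (\int[mu]_(tau in `[0, s]) e (x + tau * v, xi + tau * v) -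
       \int[mu]_(tau in `[0, s]) E J (x + tau * v, xi + tau * v))); last by rewrite HN; ring.
  apply: (le_trans (ler_normB _ _)); apply: (le_trans (lerD (ler_normB _ _) (lexx _))).
  apply: (le_trans (lerD (lerD b1 b2) bint)).
  by rewrite le_eqVlt; apply/predU1P; left; ring.
- move=> z T; apply/eqP; rewrite -subr_eq0; apply/eqP.
  apply: (@half_pow_eq0 R (2 * C * (1 + A * expR 1))) => J.
  have -> : star k n z = star K n z.
    by case: z T => x xi T; apply: eq_star => // y Ty; rewrite KE.
  rewrite -KE// (_ : _ - _ = (n z - N J.+1 z) + star K (fun z => n z - N J z) z); last first.
    by rewrite starBr// NK; ring.
  have b1 := le_trans (nN J.+1 z T) (half1 J).
  have b2 := sB K _ _ z cK (cB _ _ cn (cN J)) (pow0 J) KA (nN J) T.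
  apply: (le_trans (ler_normD _ _)); apply: (le_trans (lerD b1 b2)).
  by rewrite le_eqVlt; apply/predU1P; left; ring.
- move=> z T; apply/eqP; rewrite -subr_eq0; apply/eqP.
  apply: (@half_pow_eq0 R (2 * C * (1 + 2 * (A * expR 1)))) => J.
  have -> : star k e z = star K e z.
    by case: z T => x xi T; apply: eq_star => // y Ty; rewrite KE.
  have -> : star F n z = star Fr n z.
    by case: z T => x xi T; apply: eq_star => // y Ty; rewrite FrE.
  rewrite -FrE// (_ : _ - _ = (e z - E J.+1 z) + star K (fun z => e z - E J z) z
      + star Fr (fun z => n z - N J z) z); last first.
    by rewrite !starBr// EK; ring.
  have b1 := le_trans (eE J.+1 z T) (half1 J).
  have b2 := sB K _ _ z cK (cB _ _ cce (cE J)) (pow0 J) KA (eE J) T.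
  have b3 := sB Fr _ _ z cFr (cB _ _ cn (cN J)) (pow0 J) FA (nN J) T.
  apply: (le_trans (ler_normD _ _)); apply: (le_trans (lerD (ler_normD _ _) (lexx _))).
  apply: (le_trans (lerD (lerD b1 b2) b3)).
  by rewrite le_eqVlt; apply/predU1P; left; ring.
Qed.

End ResolventExistence.

(** * Estimates for transport equations, by duality *)
Section Estimates.
Context {R : realType}.
Notation mu := (@lebesgue_measure R).
Notation I01 := (`[(0 : R), 1]%classic : set R).
Implicit Types (f g : R -> R -> R) (h : R -> R) (t x xi T : R).

(** The segments [[a, b]] and [[c, d]] are unrelated: what the substitution
    sends outside [[c, d]] does not count, and what it misses has a
    nonnegative integral. *)
Lemma affine_Rint_le (u : R -> R) (a b c d p q : R) : continuous u ->
  (forall y, 0 <= u y) -> (forall y, y <= c \/ d <= y -> u y = 0) ->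
  a <= b -> c <= d -> q != 0 ->
  \int[mu]_(x in `[a, b]) u (p + q * x) <= `|q|^-1 * \int[mu]_(y in `[c, d]) u y.
Proof.
move=> cu u0 uz ab cd q0.
have cu' : continuous (fun x : R => u (p + q * x)).
  by apply: (cont_comp (f := fun x : R => p + q * x) (g := u)) => //; cont.
have dP (t : R) : is_derive t 1 (fun x : R => q^-1 * prim u (p + q * x)) (u (p + q * t)).
  rewrite (_ : u _ = q^-1 * (u (p + q * t) * q)); last by rewrite mulrCA mulVf ?mulr1.
  apply: is_deriveZ.
  apply: (is_derive1_comp (f := prim u) (g := fun x : R => p + q * x)).
    exact: is_derive_prim.
  by apply: is_derive_eq; rewrite /GRing.scale/=; ring.
rewrite prim_itv// (prim_unique _ _ cu' dP) prim_itv// -mulrBr.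
have mono y y' : y <= y' -> prim u y <= prim u y'.
  move=> yy; rewrite -subr_ge0 -prim_itv//; exact: Rintegral_ge0.
have flat y y' : y <= y' -> (forall s, y <= s <= y' -> u s = 0) -> prim u y' = prim u y.
  move=> yy z; apply/eqP; rewrite -subr_eq0 -prim_itv//; apply/eqP.
  rewrite (_ : \int[mu]_(s in _) u s = \int[mu]_(s in `[y, y']) 0); first by rewrite Rintegral_cst//= mul0r.
  by apply: eq_Rintegral => s; rewrite inE/= in_itv/=; exact: z.
have lo y : prim u c <= prim u y.
  have [cy|yc] := leP c y; first exact: mono.
  rewrite (flat y c (ltW yc))// => s /andP[_ sc]; apply: uz; by left.
have hi y : prim u y <= prim u d.
  have [yd|dy] := leP y d; first exact: mono.
  rewrite (flat d y (ltW dy))// => s /andP[ds _]; apply: uz; by right.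
apply: le_trans (ler_norm _) _; rewrite normrM normfV ler_wpM2l ?invr_ge0//.
by rewrite ler_norml; move: (lo (p + q * a)) (lo (p + q * b)) (hi (p + q * a)) (hi (p + q * b)); lra.
Qed.

Lemma affine_l2norm_le (u : R -> R) (a b c d p q : R) : continuous u ->
  (forall y, y <= c \/ d <= y -> u y = 0) -> a <= b -> c <= d -> q != 0 ->
  l2norm `[a, b] (fun x => u (p + q * x)) <= Num.sqrt `|q|^-1 * l2norm `[c, d] u.
Proof.
move=> cu uz ab cd q0; rewrite /l2norm -sqrtrM ?invr_ge0//; apply: ler_wsqrtr.
apply: (affine_Rint_le (u := fun y => u y ^+ 2)) => //.
- by move=> y; apply: cvgM; exact: cu.
- by move=> y; exact: sqr_ge0.
- by move=> y /uz ->; rewrite expr0n.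
Qed.

Lemma Rint_CS (l r : R) (u w : R -> R) (U W : R) : L2on `[l, r] u -> L2on `[l, r] w ->
  l2norm `[l, r] u <= U -> l2norm `[l, r] w <= W ->
  `|\int[mu]_(x in `[l, r]) (u x * w x)| <= U * W.
Proof.
move=> Lu Lw uU wW; apply: (le_trans (cauchy_schwarz Lu Lw)).
by apply: ler_pM => //; exact: l2norm_ge0.
Qed.

Lemma is_derive_compose (u g : R -> R) (x a b : R) :
  is_derive (g x) 1 u a -> is_derive x 1 g b -> is_derive x 1 (fun y : R => u (g y)) (a * b).
Proof. exact: is_derive1_comp. Qed.

(** A test function constant along the characteristics has no interior term,
    so the state at time [T] is expressed through initial value, traces and
    source. All estimates start here, since a weak solution cannot be used as
    its own test function. *)
Lemma weak_transported v f (z0 : R -> R) (z : R -> R -> R) (tau0 tau1 : R -> R) T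
    (om om' : R -> R) :
  sol v f z0 z tau0 tau1 -> 0 <= T ->
  (forall y : R, is_derive y 1 om (om' y)) -> continuous om' ->
  \int[mu]_(x in I01) (om (x - v * T) * z T x) =
  \int[mu]_(x in I01) (om x * z0 x)
  - v * (\int[mu]_(t in `[0, T]) (om (1 - v * t) * tau1 t) - \int[mu]_(t in `[0, T]) (om (0 - v * t) * tau0 t))
  + pairing T (fun t x => om (x - v * t)) f.
Proof.
move=> [hz hf h0 ht w] T0 dom com.
pose phi t x := om (x - v * t).
have cline : continuous (fun p : R * R => p.2 - v * p.1) by cont.
have com2 : continuous (fun p : R * R => om' (p.2 - v * p.1)).
  by apply: (cont_comp (f := fun p : R * R => p.2 - v * p.1) (g := om')).
have [Cphi E1 E2] : [/\ C1_test phi, dt phi = (fun t x => - v * om' (x - v * t)) &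
    dx phi = (fun t x => om' (x - v * t))].
  apply: (@C1_testI _ phi).
  - move=> t x; rewrite [- v * _]mulrC.
    have dg : is_derive t 1 (fun t : R => x - v * t) (- v).
      by apply: is_derive_eq; rewrite /GRing.scale/=; ring.
    exact: (is_derive_compose (dom _) dg).
  - move=> t x; rewrite -[om' _]mulr1.
    have dg : is_derive x 1 (fun x : R => x - v * t) 1.
      by apply: is_derive_eq; rewrite subr0.
    exact: (is_derive_compose (dom _) dg).
  - by apply: contM; [exact: cont_cst|exact: com2].
  - exact: com2.
have := w T phi T0 Cphi.
have -> : pairing T (fun t x => dt phi t x + v * dx phi t x) z = 0.
  rewrite (@eq_pairing _ _ _ _ (fun _ _ => 0) z).
    rewrite /pairing; under eq_Rintegral do under eq_Rintegral do rewrite mul0r.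
    under eq_Rintegral do rewrite Rintegral_cst//= mul0r.
    by rewrite Rintegral_cst//= mul0r.
  move=> t _; apply: eq_Rintegral => x _; rewrite E1 E2; congr (_ * _); ring.
rewrite add0r => /(congr1 (fun r => r + \int[mu]_(x in I01) (phi 0 x * z0 x) -
  v * (\int[mu]_(t in `[0, T]) (phi t 1 * tau1 t) - \int[mu]_(t in `[0, T]) (phi t 0 * tau0 t)))) E.
have -> : \int[mu]_(x in I01) (om x * z0 x) = \int[mu]_(x in I01) (phi 0 x * z0 x).
  by apply: eq_Rintegral => x _; rewrite /phi mulr0 subr0.
move: E; set X := \int[mu]_(x in _) (phi T x * _); set Y := \int[mu]_(x in _) (phi 0 x * _).
set Z := v * _; set W := pairing _ _ _; move: X Y Z W => X Y Z W E.
by transitivity (X - Y + Z + Y - Z); [ring|rewrite E; ring].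
Qed.

End Estimates.

Section TransportNorm.
Context {R : realType}.
Notation mu := (@lebesgue_measure R).
Notation I01 := (`[(0 : R), 1]%classic : set R).
Implicit Types (f g : R -> R -> R) (h : R -> R) (t x xi T : R).

(** Characteristics enter at [0] for a positive speed and at [1] for a
    negative one; both directions are treated at once, and the outflow end is
    the inflow end for the speed [- v]. *)
Definition inflow (v b : R) (tau0 tau1 tin : R -> R) :=
  (0 < v /\ b = 0 /\ tin = tau0) \/ (v < 0 /\ b = 1 /\ tin = tau1).

Lemma inflow_neq0 v b tau0 tau1 tin : inflow v b tau0 tau1 tin -> v != 0.
Proof. by case=> -[h _]; [rewrite gt_eqF|rewrite lt_eqF]. Qed.

Definition wnorm (lam : R) h := l2norm I01 (fun x => expR (- (lam * x)) * h x).

Lemma expR_cont (a b : R) : continuous (fun x : R => expR (a + b * x)).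
Proof. by apply: (cont_comp (f := fun x : R => a + b * x) (g := expR)); [cont|exact: continuous_expR]. Qed.

Lemma weight_cont (lam : R) : continuous (fun x : R => expR (- (lam * x))).
Proof.
rewrite (_ : (fun x => _) = fun x : R => expR (0 + (- lam) * x)); first exact: expR_cont.
by apply/funext => x; rewrite add0r mulNr.
Qed.

Lemma weight_L2on lam h : L2on I01 h -> L2on I01 (fun x => expR (- (lam * x)) * h x).
Proof. by move=> Lh; apply: L2on_contM => //; exact: weight_cont. Qed.

Lemma is_derive_weight (lam x : R) :
  is_derive x 1 (fun x : R => expR (- (lam * x))) (- lam * expR (- (lam * x))).
Proof.
rewrite mulrC.
have dg : is_derive x 1 (fun x : R => - (lam * x)) (- lam).
  by apply: is_derive_eq; rewrite /GRing.scale/=; ring.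
exact: (is_derive_compose (is_derive_expR _) dg).
Qed.

(** By duality, with a test function that equals [expR (- (lam * x)) * chi x]
    at time [T]. Its support follows the characteristics back and never meets
    the outflow end, and the weight contributes the factor
    [expR (- (lam * v * (T - t)))]: a large [lam * v] damps what entered long
    ago. *)
Lemma transport_norm (v b lam nu : R) f (z0 : R -> R) (z : R -> R -> R) (tau0 tau1 tin : R -> R) T
    (A : R) (G : R -> R) :
  sol v f z0 z tau0 tau1 -> inflow v b tau0 tau1 tin -> 0 <= T -> 0 <= nu ->
  nu <= lam * v -> 0 <= A ->
  l2norm `[0, T] (fun t => expR (nu * t) * tin t) <= A ->
  mu.-integrable `[0, T] (EFin \o G) ->
  (forall t, 0 <= t <= T -> expR (nu * t) * wnorm lam (f t) <= G t) ->
  expR (nu * T) * wnorm lam (z T) <=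
    wnorm lam z0 + `|v| * Num.sqrt `|v|^-1 * expR `|lam| * A
    + \int[mu]_(t in `[0, T]) (expR (- ((lam * v - nu) * (T - t))) * G t).
Proof.
move=> Hs Hin T0 nu0 nulam A0 tA iG fG.
have v0 := inflow_neq0 Hin.
have [hz hf h0 [ht0 ht1] w] := Hs.
have Lz t : L2on I01 (z t) by case: hz.
have Lf t : L2on I01 (f t) by case: hf.
have htin : trace tin by case: Hin => -[_ [_ ->]].
set del := lam * v - nu; have del0 : 0 <= del by rewrite subr_ge0.
have cE : continuous (fun t : R => expR (- (del * (T - t)))).
  rewrite (_ : (fun t => _) = fun t : R => expR (- (del * T) + del * t)); first exact: expR_cont.
  by apply/funext => t; congr expR; ring.
have iEG : mu.-integrable `[0, T] (EFin \o (fun t => expR (- (del * (T - t))) * G t)).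
  exact: int_contM.
have G0 t : 0 <= t <= T -> 0 <= G t.
  by move=> ht; apply: le_trans (fG t ht); rewrite mulr_ge0 ?expR_ge0 ?l2norm_ge0.
set S := \int[mu]_(t in _) (_ * G t).
have S0 : 0 <= S.
  by apply: Rintegral_ge0 => t; rewrite /= in_itv/= => ht; rewrite mulr_ge0 ?expR_ge0 ?G0.
set cv := `|v| * _ * _; have cv0 : 0 <= cv by rewrite !mulr_ge0 ?expR_ge0 ?sqrtr_ge0.
set B := _ + _ + S; have B0 : 0 <= B by rewrite !addr_ge0 ?mulr_ge0 ?l2norm_ge0.
rewrite /wnorm -[expR _]ger0_norm ?expR_ge0// -l2normZ//; last exact: weight_L2on.
apply: L2_dual => //; first by apply: L2onZ; exact: weight_L2on.
move=> chi chi' dchi cchi' chi0.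
have cchi : continuous chi := continuous_is_derive dchi.
set n := l2norm _ chi; have n0 : 0 <= n := l2norm_ge0 _ _.
pose om y := expR (- (lam * (y + v * T))) * chi (y + v * T).
have dshift (y : R) : is_derive y 1 (fun y : R => y + v * T) 1.
  by apply: is_derive_eq; rewrite addr0.
pose om' y := expR (- (lam * (y + v * T))) * chi' (y + v * T)
   + chi (y + v * T) * (- lam * expR (- (lam * (y + v * T)))).
have dom (y : R) : is_derive y 1 om (om' y).
  apply: is_deriveM.
    rewrite -[- lam * _]mulr1.
    exact: (is_derive_compose (is_derive_weight _ _) (dshift y)).
  rewrite -[chi' _]mulr1.
  exact: (is_derive_compose (dchi _) (dshift y)).
have cs (u : R -> R) : continuous u -> continuous (fun y : R => u (y + v * T)).
  by move=> cu; apply: (cont_comp (f := fun y : R => y + v * T) (g := u)) => //; cont.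
have com' : continuous om'.
  have cw := cs (fun x => expR (- (lam * x))) (@weight_cont lam).
  exact: (contD (contM cw (cs _ cchi')) (contM (cs _ cchi) (contM (@cont_cst _ _ (- lam)) cw))).
have W := weak_transported Hs T0 dom com'.
have omE x t : om (x - v * t) = expR (- (lam * (x + v * (T - t)))) * chi (x + v * (T - t)).
  by rewrite /om (_ : x - v * t + v * T = x + v * (T - t))//; ring.
have vT t : t <= T -> (0 < v -> 0 <= v * (T - t)) /\ (v < 0 -> v * (T - t) <= 0).
  by move=> tT; split => h; [rewrite mulr_ge0 ?subr_ge0// ltW|rewrite mulr_le0_ge0 ?subr_ge0// ltW].
(* Carried back along the characteristics from time [T], the support of [chi]
   does not meet the outflow end. *)
have Wb : - (v * (\int[mu]_(t in `[0, T]) (om (1 - v * t) * tau1 t) -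
     \int[mu]_(t in `[0, T]) (om (0 - v * t) * tau0 t))) =
   `|v| * \int[mu]_(t in `[0, T]) (om (b - v * t) * tin t).
  have z0' (u : R -> R) (a : R -> R) : (forall t, 0 <= t <= T -> a t = 0) ->
      \int[mu]_(t in `[0, T]) (a t * u t) = 0.
    move=> az; rewrite (_ : \int[mu]_(t in _) _ = \int[mu]_(t in `[0, T]) 0).
      by rewrite Rintegral_cst//= mul0r.
    by apply: eq_Rintegral => t; rewrite inE/= in_itv/= => /az ->; rewrite mul0r.
  case: Hin => -[vs [-> ->]].
    rewrite [X in X - _]z0'; first by rewrite sub0r mulrN opprK gtr0_norm.
    move=> t /andP[_ tT]; rewrite omE chi0 ?mulr0//; right.
    by rewrite lerDl; exact: (vT t tT).1.
  rewrite [X in _ - X]z0'; first by rewrite subr0 ltr0_norm// mulNr.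
  move=> t /andP[_ tT]; rewrite omE chi0 ?mulr0//; left.
  by rewrite add0r; exact: (vT t tT).2.
rewrite [X in X + pairing _ _ _]addrC in W.
have -> : \int[mu]_(x in I01) (expR (nu * T) * (expR (- (lam * x)) * z T x) * chi x) =
    expR (nu * T) * \int[mu]_(x in I01) (om (x - v * T) * z T x).
  rewrite -RintZ//; last first.
    apply: int_contM; last exact: L2on_int.
    have com := continuous_is_derive dom.
    by apply: (cont_comp (f := fun x : R => x - v * T) (g := om)) => //; cont.
  by apply: eq_Rintegral => x _; rewrite omE subrr mulr0 addr0; ring.
rewrite W Wb.
have shiftn t : t <= T -> l2norm I01 (fun x => chi (x + v * (T - t))) <= n.
  move=> tT; have := @affine_l2norm_le R chi 0 1 0 1 (v * (T - t)) 1 cchi chi0 ler01 ler01 (oner_neq0 _).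
  rewrite normr1 invr1 sqrtr1 mul1r; apply: le_trans.
  by rewrite le_eqVlt; apply/predU1P; left; apply: eq_l2norm => x _; rewrite mul1r addrC.
have cshift t : continuous (fun x : R => chi (x + v * (T - t))).
  by apply: (cont_comp (f := fun x : R => x + v * (T - t)) (g := chi)) => //; cont.
have slice (u : R -> R) t : L2on I01 u -> t <= T ->
    `|\int[mu]_(x in I01) (om (x - v * t) * u x)| <= expR (- (lam * v * (T - t))) * (n * wnorm lam u).
  move=> Lu tT.
  rewrite (_ : \int[mu]_(x in I01) _ = expR (- (lam * v * (T - t))) *
      \int[mu]_(x in I01) (chi (x + v * (T - t)) * (expR (- (lam * x)) * u x))); last first.
    rewrite -RintZ//.
      apply: eq_Rintegral => x _; rewrite omE (_ : - (lam * (x + v * (T - t))) = - (lam * v * (T - t)) + - (lam * x)); last by ring.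
      by rewrite expRD; ring.
    by apply: int_contM => //; apply: L2on_int; exact: weight_L2on.
  rewrite normrM (ger0_norm (expR_ge0 _)) ler_wpM2l ?expR_ge0//.
  by apply: Rint_CS => //; [exact: L2on_cont|exact: weight_L2on|exact: shiftn].
have t1 : expR (nu * T) * \int[mu]_(x in I01) (om x * z0 x) <= n * wnorm lam z0.
  have := slice z0 0 h0 T0; rewrite subr0.
  rewrite (_ : \int[mu]_(x in I01) (om (x - v * 0) * z0 x) = \int[mu]_(x in I01) (om x * z0 x)); last first.
    by apply: eq_Rintegral => x _; rewrite mulr0 subr0.
  move=> /(le_trans (ler_norm _)) H.
  apply: (le_trans (ler_wpM2l (expR_ge0 (nu * T)) H)); rewrite [leLHS]mulrA -expRD.
  rewrite -[leRHS]mul1r ler_wpM2r ?mulr_ge0 ?l2norm_ge0// -[leRHS]expR0 ler_expR.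
  by rewrite (_ : _ + _ = - (del * T)) ?oppr_le0 ?mulr_ge0// /del; ring.
have t2 : expR (nu * T) * (`|v| * \int[mu]_(t in `[0, T]) (om (b - v * t) * tin t)) <= cv * A * n.
  pose q t := expR (- (lam * b) - del * (T - t)) * chi (b + v * (T - t)).
  have cq0 : continuous (fun t : R => chi (b + v * (T - t))).
    by apply: (cont_comp (f := fun t : R => b + v * (T - t)) (g := chi)) => //; cont.
  have ce0 : continuous (fun t : R => expR (- (lam * b) - del * (T - t))).
    rewrite (_ : (fun t => _) = fun t : R => expR ((- (lam * b) - del * T) + del * t)); first exact: expR_cont.
    by apply/funext => t; congr expR; ring.
  have cq : continuous q by apply: contM.
  have cet : continuous (fun t : R => expR (nu * t)).
    rewrite (_ : (fun t => _) = fun t : R => expR (0 + nu * t)); first exact: expR_cont.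
    by apply/funext => t; rewrite add0r.
  have Ltin := trace_L2on T htin.
  have -> : expR (nu * T) * (`|v| * \int[mu]_(t in `[0, T]) (om (b - v * t) * tin t)) =
      `|v| * \int[mu]_(t in `[0, T]) (q t * (expR (nu * t) * tin t)).
    rewrite mulrCA; congr (_ * _); rewrite -RintZ//; last first.
      apply: int_contM; last exact: L2on_int.
      have com := continuous_is_derive dom.
      by apply: (cont_comp (f := fun t : R => b - v * t) (g := om)) => //; cont.
    apply: eq_Rintegral => t _; rewrite omE /q.
    rewrite [LHS](_ : _ = (expR (nu * T) * expR (- (lam * (b + v * (T - t))))) * chi (b + v * (T - t)) * tin t); last by ring.
    rewrite [RHS](_ : _ = (expR (- (lam * b) - del * (T - t)) * expR (nu * t)) * chi (b + v * (T - t)) * tin t); last by ring.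
    by rewrite -!expRD; congr (expR _ * _ * _); rewrite /del; ring.
  have bb : `|lam * b| <= `|lam|.
    by case: Hin => -[_ [-> _]]; rewrite ?mulr0 ?normr0 ?mulr1.
  have qn : l2norm `[0, T] q <= expR `|lam| * (Num.sqrt `|v|^-1 * n).
    have Lc : L2on `[0, T] (fun t => chi (b + v * (T - t))) by exact: L2on_cont.
    apply: (@le_trans _ _ (l2norm `[0, T] (fun t => expR `|lam| * chi (b + v * (T - t))))).
      apply: l2norm_le; [exact: L2on_cont|exact: L2onZ|].
      move=> t /=; rewrite in_itv/= => /andP[_ tT]; rewrite !normrM ler_wpM2r// (ger0_norm (expR_ge0 _)) (ger0_norm (expR_ge0 _)).
      rewrite ler_expR.
      have : - (lam * b) <= `|lam| by apply: le_trans bb; rewrite -normrN ler_norm.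
      have d0 : 0 <= del * (T - t) by rewrite mulr_ge0// subr_ge0.
      by move=> h1; apply: (le_trans _ h1); rewrite gerBl.
    rewrite l2normZ// (ger0_norm (expR_ge0 _)) ler_wpM2l ?expR_ge0//.
    have Nv : - v != 0 by rewrite oppr_eq0.
    have := @affine_l2norm_le R chi 0 T 0 1 (b + v * T) (- v) cchi chi0 T0 ler01 Nv.
    rewrite normrN -/n => H; apply: le_trans H.
    by rewrite le_eqVlt; apply/predU1P; left; apply: eq_l2norm => t _; congr chi; ring.
  have LW : L2on `[0, T] (fun t => expR (nu * t) * tin t) by exact: L2on_contM.
  have := le_trans (ler_norm _) (Rint_CS (L2on_cont 0 T cq) LW qn tA).
  move=> /(ler_wpM2l (normr_ge0 v)) => H; apply: (le_trans H).
  by rewrite le_eqVlt /cv; apply/predU1P; left; ring.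
have com2 : cont2 (fun t x => om (x - v * t)).
  have com := continuous_is_derive dom.
  by apply: (cont_comp (f := fun p : R * R => p.2 - v * p.1) (g := om)) => //; cont.
have t3 : expR (nu * T) * pairing T (fun t x => om (x - v * t)) f <= S * n.
  have ip := pairing_int T com2 hf.
  rewrite /pairing -RintZ// [leRHS]mulrC -RintZ//; apply: Rint_le => //; [exact: intZ|exact: intZ|].
  move=> t /=; rewrite in_itv/= => ht; have /andP[t0 tT] := ht.
  have := slice (f t) t (Lf t) tT => /(le_trans (ler_norm _)) H.
  apply: (le_trans (ler_wpM2l (expR_ge0 _) H)).
  rewrite [leLHS](_ : _ = n * (expR (- (del * (T - t))) * (expR (nu * t) * wnorm lam (f t)))); last first.
    rewrite [LHS](_ : _ = (expR (nu * T) * expR (- (lam * v * (T - t)))) * (n * wnorm lam (f t))); last by ring.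
    rewrite [RHS](_ : _ = (expR (- (del * (T - t))) * expR (nu * t)) * (n * wnorm lam (f t))); last by ring.
    by rewrite -!expRD; congr (expR _ * _); rewrite /del; ring.
  by rewrite ler_wpM2l// ler_wpM2l ?expR_ge0// fG.
move: t1 t2 t3; rewrite /B; move: (\int[mu]_(x in I01) (om x * z0 x)) (`|v| * \int[mu]_(t in _) _) (pairing _ _ _) => u1 u2 u3 t1 t2 t3.
rewrite mulrDr [X in X + _ <= _]mulrDr addrC.
rewrite [leRHS](_ : _ = n * wnorm lam z0 + cv * A * n + S * n); last by ring.
by rewrite addrC; apply: lerD => //; rewrite addrC; apply: lerD.
Qed.

End TransportNorm.

Section TransportTrace.
Context {R : realType}.
Notation mu := (@lebesgue_measure R).
Notation I01 := (`[(0 : R), 1]%classic : set R).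
Implicit Types (f g : R -> R -> R) (h : R -> R) (t x xi T : R).

(** By duality in time: the test function is [chi] at the instant when the
    characteristic through the point reaches the outflow end. As [chi]
    vanishes at [T] and later, the state at time [T] does not contribute. The
    crossing takes at most [`|v|^-1], which explains [expR (nu / `|v|)]. *)
Lemma transport_trace (v b b' nu : R) f (z0 : R -> R) (z : R -> R -> R)
    (tau0 tau1 tin tout : R -> R) T (A : R) (G : R -> R) :
  sol v f z0 z tau0 tau1 -> inflow v b tau0 tau1 tin ->
  inflow (- v) b' tau0 tau1 tout -> 0 <= T -> 0 <= nu -> 0 <= A ->
  l2norm `[0, T] (fun t => expR (nu * t) * tin t) <= A ->
  mu.-integrable `[0, T] (EFin \o G) ->
  (forall t, 0 <= t <= T -> expR (nu * t) * l2norm I01 (f t) <= G t) ->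
  l2norm `[0, T] (fun t => expR (nu * t) * tout t) <=
    `|v|^-1 * (expR (nu / `|v|) * (Num.sqrt `|v| *
      (l2norm I01 z0 + \int[mu]_(t in `[0, T]) G t) + `|v| * A)).
Proof.
move=> Hs Hin Hout T0 nu0 A0 tA iG fG.
have v0 := inflow_neq0 Hin.
have nv0 : 0 < `|v| by rewrite normr_gt0.
have [hz hf h0 [ht0 ht1] w] := Hs.
have Lz t : L2on I01 (z t) by case: hz.
have Lf t : L2on I01 (f t) by case: hf.
have htin : trace tin by case: Hin => -[_ [_ ->]].
have htout : trace tout by case: Hout => -[_ [_ ->]].
have G0 t : 0 <= t <= T -> 0 <= G t.
  by move=> ht; apply: le_trans (fG t ht); rewrite mulr_ge0 ?expR_ge0 ?l2norm_ge0.
set S := \int[mu]_(t in `[0, T]) G t.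
have S0 : 0 <= S by apply: Rintegral_ge0 => t; rewrite /= in_itv/=; exact: G0.
have K0 : 0 <= `|v| by [].
set ev := expR (nu / `|v|); have ev0 : 0 <= ev := expR_ge0 _.
set sv := Num.sqrt `|v|; have sv0 : 0 <= sv := sqrtr_ge0 _.
have cet : continuous (fun t : R => expR (nu * t)).
  rewrite (_ : (fun t => _) = fun t : R => expR (0 + nu * t)); first exact: expR_cont.
  by apply/funext => t; rewrite add0r.
have Ltout := trace_L2on T htout; have Ltin := trace_L2on T htin.
apply: L2_dual => //.
- exact: L2on_contM.
- apply: mulr_ge0; first by rewrite invr_ge0.
  apply: mulr_ge0 => //; apply: addr_ge0; apply: mulr_ge0 => //.
  by rewrite addr_ge0 ?l2norm_ge0.
move=> chi chi' dchi cchi' chi0.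
have cchi : continuous chi := continuous_is_derive dchi.
set n := l2norm _ chi; have n0 : 0 <= n := l2norm_ge0 _ _.
(* The time at which the characteristic with label [y] reaches the outflow
   end. *)
pose s y := (b' - y) / v.
have ds (y : R) : is_derive y 1 s (- v^-1).
  rewrite (_ : s = fun y : R => b' / v + (- v^-1) * y); last by apply/funext => y'; rewrite /s; ring.
  by apply: is_derive_eq; rewrite /GRing.scale/=; ring.
pose om y := expR (nu * s y) * chi (s y).
pose om' y := expR (nu * s y) * (chi' (s y) * - v^-1) + chi (s y) * (expR (nu * s y) * (nu * - v^-1)).
have cs : continuous s := continuous_is_derive ds.
have cs' (u : R -> R) : continuous u -> continuous (fun y : R => u (s y)).
  by move=> cu; apply: (cont_comp (f := s) (g := u)).
have ces : continuous (fun y : R => expR (nu * s y)) := cs' (fun y => expR (nu * y)) cet.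
have dom (y : R) : is_derive y 1 om (om' y).
  have dn : is_derive y 1 (fun y : R => nu * s y) (nu * - v^-1) := is_deriveZ nu (ds y).
  exact: (is_deriveM (is_derive_compose (is_derive_expR _) dn) (is_derive_compose (dchi _) (ds y))).
have com' : continuous om'.
  exact: (contD (contM ces (contM (cs' _ cchi') (@cont_cst _ _ (- v^-1))))
    (contM (cs' _ cchi) (contM ces (@cont_cst _ _ (nu * - v^-1))))).
have com : continuous om := contM ces (cs' _ cchi).
have W := weak_transported Hs T0 dom com'.
have sE x t : s (x - v * t) = t + s x by rewrite /s; field.
have sx x : 0 <= x <= 1 -> 0 <= s x <= `|v|^-1.
  move=> /andP[x0 x1]; rewrite /s; case: Hout => -[vs [-> _]].
    have v1 : v < 0 by rewrite -oppr_gt0.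
    by rewrite sub0r ltr0_norm// mulNr -mulrN -invrN mulr_ge0 ?invr_ge0 ?(ltW vs)//= ler_piMl// invr_ge0 ltW.
  have v1 : 0 < v by rewrite -oppr_lt0.
  by rewrite gtr0_norm// mulr_ge0 ?subr_ge0 ?invr_ge0 ?(ltW v1)//= ler_piMl ?invr_ge0 ?(ltW v1)// lerBlDr lerDl.
have endT : \int[mu]_(x in I01) (om (x - v * T) * z T x) = 0.
  rewrite (_ : \int[mu]_(x in I01) _ = \int[mu]_(x in I01) 0); first by rewrite Rintegral_cst//= mul0r.
  apply: eq_Rintegral => x; rewrite inE/= in_itv/= => /sx/andP[s0 _].
  by rewrite /om sE chi0 ?mulr0 ?mul0r//; right; rewrite lerDl.
have sb t : s (b - v * t) = t + `|v|^-1 /\ s (b' - v * t) = t.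
  rewrite !sE /s subrr mul0r addr0; split => //; congr (_ + _).
  case: Hin => -[vs [-> _]]; case: Hout => -[vs' [-> _]].
  - by move: (lt_trans vs (etrans (esym (oppr_gt0 _)) vs')); rewrite ltxx.
  - by rewrite subr0 mul1r gtr0_norm.
  - by rewrite sub0r ltr0_norm// mulN1r invrN.
  - by move: vs'; rewrite oppr_lt0 ltNge (ltW vs).
set Iout := \int[mu]_(x in `[0, T]) _.
have Wb : v * (\int[mu]_(t in `[0, T]) (om (1 - v * t) * tau1 t) -
     \int[mu]_(t in `[0, T]) (om (0 - v * t) * tau0 t)) =
   `|v| * Iout - `|v| * \int[mu]_(t in `[0, T]) (om (b - v * t) * tin t).
  have -> : Iout = \int[mu]_(t in `[0, T]) (om (b' - v * t) * tout t).
    by apply: eq_Rintegral => t _; rewrite /om (sb t).2; ring.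
  clear - Hin Hout.
  case: Hin => -[vs [-> ->]]; case: Hout => -[vs' [-> ->]].
  - by exfalso; move: vs'; rewrite oppr_gt0 ltNge (ltW vs).
  - by rewrite gtr0_norm// mulrBr.
  - by rewrite ltr0_norm// mulrBr !mulNr opprK addrC.
  - by exfalso; move: vs'; rewrite oppr_lt0 ltNge (ltW vs).
move: W; rewrite endT Wb => W.
have key : `|v| * Iout = \int[mu]_(x in I01) (om x * z0 x)
   + `|v| * \int[mu]_(t in `[0, T]) (om (b - v * t) * tin t) + pairing T (fun t x => om (x - v * t)) f.
  move: W; move: (`|v| * Iout) (\int[mu]_(x in I01) _) (`|v| * _) (pairing _ _ _) => a1 a2 a3 a4 W.
  by apply/eqP; rewrite -subr_eq0; apply/eqP; rewrite -[RHS]oppr0 {2}W; ring.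
have cshift t : continuous (fun x : R => chi (t + s x)).
  apply: (cont_comp (f := fun x : R => t + s x) (g := chi)) => //.
  exact: contD (@cont_cst _ _ t) cs.
have shiftn t : l2norm I01 (fun x => chi (t + s x)) <= sv * n.
  have iv : - v^-1 != 0 by rewrite oppr_eq0 invr_eq0.
  have := @affine_l2norm_le R chi 0 1 0 T (t + b' / v) (- v^-1) cchi chi0 ler01 T0 iv.
  rewrite normrN normfV invrK -/n -/sv => H; apply: le_trans H.
  by rewrite le_eqVlt; apply/predU1P; left; apply: eq_l2norm => x _; congr chi; rewrite /s; ring.
have omE x t : om (x - v * t) = expR (nu * t) * (expR (nu * s x) * chi (t + s x)).
  by rewrite /om sE mulrDr expRD mulrA.
have slice (u : R -> R) t : L2on I01 u ->
    `|\int[mu]_(x in I01) (om (x - v * t) * u x)| <= (ev * (sv * n)) * (expR (nu * t) * l2norm I01 u).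
  move=> Lu.
  rewrite (_ : \int[mu]_(x in I01) _ = expR (nu * t) *
      \int[mu]_(x in I01) ((expR (nu * s x) * chi (t + s x)) * u x)); last first.
    rewrite -RintZ//; first by apply: eq_Rintegral => x _; rewrite omE [RHS]mulrA.
    by apply: int_contM => //; [exact: contM|exact: L2on_int].
  rewrite normrM (ger0_norm (expR_ge0 _)) [leRHS]mulrCA ler_wpM2l ?expR_ge0//.
  apply: Rint_CS => //.
    exact: (L2on_cont 0 1 (contM ces (cshift t))).
  apply: (@le_trans _ _ (l2norm I01 (fun x => ev * chi (t + s x)))).
    apply: l2norm_le; [exact: (L2on_cont 0 1 (contM ces (cshift t)))|exact: (L2onZ ev (L2on_cont 0 1 (cshift t)))|].
    move=> x /=; rewrite in_itv/= => /sx/andP[_ hs]; rewrite !normrM ler_wpM2r//.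
    by rewrite (ger0_norm (expR_ge0 _)) (ger0_norm ev0) ler_expR ler_wpM2l.
  rewrite l2normZ ?(ger0_norm ev0); last exact: (L2on_cont 0 1 (cshift t)).
  by rewrite ler_wpM2l.
have t1 : \int[mu]_(x in I01) (om x * z0 x) <= (ev * (sv * n)) * l2norm I01 z0.
  have := slice z0 0 h0; rewrite (mulr0 nu) expR0 mul1r.
  rewrite (_ : \int[mu]_(x in I01) (om (x - v * 0) * z0 x) = \int[mu]_(x in I01) (om x * z0 x)); last first.
    by apply: eq_Rintegral => x _; rewrite mulr0 subr0.
  by move=> /(le_trans (ler_norm _)).
have t2 : \int[mu]_(t in `[0, T]) (om (b - v * t) * tin t) <= ev * n * A.
  have cv : continuous (fun t : R => chi (`|v|^-1 + 1 * t)).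
    by apply: (cont_comp (f := fun t : R => `|v|^-1 + 1 * t) (g := chi)) => //; cont.
  have LW : L2on `[0, T] (fun t => expR (nu * t) * tin t) by exact: L2on_contM.
  have -> : \int[mu]_(t in `[0, T]) (om (b - v * t) * tin t) =
     ev * \int[mu]_(t in `[0, T]) (chi (`|v|^-1 + 1 * t) * (expR (nu * t) * tin t)).
    rewrite -RintZ//; last by apply: int_contM => //; exact: L2on_int.
    apply: eq_Rintegral => t _; rewrite /om (sb t).1 mulrDr expRD mul1r (addrC _ t) /ev; ring.
  rewrite -mulrA; apply: ler_wpM2l => //.
  apply: (le_trans (ler_norm _)); apply: Rint_CS => //; first exact: L2on_cont.
  have := @affine_l2norm_le R chi 0 T 0 T (`|v|^-1) 1 cchi chi0 T0 T0 (oner_neq0 _).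
  by rewrite normr1 invr1 sqrtr1 mul1r.
have com2 : cont2 (fun t x => om (x - v * t)).
  by apply: (cont_comp (f := fun p : R * R => p.2 - v * p.1) (g := om)) => //; cont.
have t3 : pairing T (fun t x => om (x - v * t)) f <= (ev * (sv * n)) * S.
  have ip := pairing_int T com2 hf.
  rewrite /pairing -RintZ//; apply: Rint_le => //; first exact: intZ.
  move=> t /=; rewrite in_itv/= => ht; have /andP[t0 tT] := ht.
  have := slice (f t) t (Lf t) => /(le_trans (ler_norm _)) H.
  by apply: (le_trans H); rewrite ler_wpM2l ?fG// !mulr_ge0.
rewrite -[leLHS](mulKf (lt0r_neq0 nv0)) -!mulrA ler_wpM2l ?invr_ge0// key.
move: t2 => /(ler_wpM2l K0); move: t1 t3.
move: (\int[mu]_(x in I01) _) (`|v| * \int[mu]_(x in _) _) (pairing _ _ _) => a1 a2 a3 t1 t3 t2.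
have := lerD (lerD t1 t2) t3 => H; apply: (le_trans H).
by rewrite le_eqVlt; apply/predU1P; left; ring.
Qed.

End TransportTrace.

(** * From unknowns with boundary traces to functions on the plane *)
Section FromUnknowns.
Context {R : realType}.
Notation mu := (@lebesgue_measure R).
Notation I01 := (`[(0 : R), 1]%classic : set R).
Implicit Types (f g : R -> R -> R) (h : R -> R) (t x xi T : R) (z : unknown R).

Lemma in_L2_measurable (D : set R) h : measurable D -> in_L2 D h -> measurable_fun D h.
Proof.
move=> mD; rewrite /in_L2 inE => /andP[]; rewrite inE/= => mh _.
by apply/(measurable_restrictT h mD).
Qed.

Lemma in_L2_L2on (D : set R) h : measurable D -> in_L2 D h -> L2on D h.
Proof.
move=> mD Lh; split; first exact: in_L2_measurable.
have := Lfun2_integrable_sqr Lh => ih.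
rewrite -[D]setTI; apply/integrable_restrict => //.
apply: eq_integrable ih => // x _ /=.
by rewrite /patch; case: ifPn => //; rewrite expr0n.
Qed.

Lemma L2normE h : L2on I01 h -> L2norm h = l2norm I01 h.
Proof.
move=> Lh; rewrite /L2norm /l2norm /Rintegral unlock.

have [_ ih2] := Lh.
rewrite (_ : \int[mu]_x _ = \int[mu]_(x in I01) ((h x ^+ 2)%:E))%E; last first.
  rewrite [RHS]integral_mkcond; apply: eq_integral => x _ /=.
  rewrite powR_mulrn// real_normK ?num_real// /patch.
  by case: ifPn => // _; rewrite expr0n.
have fin : (\int[mu]_(x in I01) (h x ^+ 2)%:E)%E \is a fin_num by exact: integrable_fin_num ih2.
rewrite -(fineK fin) poweR_EFin /= powR12_sqrt//.
by apply: fine_ge0; apply: integral_ge0 => x _; rewrite lee_fin sqr_ge0.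
Qed.

(** Extension by zero: the unknowns and their traces are only meaningful for
    [0 <= t] and [0 <= x <= 1], but functions measurable on the whole plane
    avoid restricting every domain. *)
Definition tcut (tau : R -> R) t := if 0 <= t then tau t else 0.

Definition txcut f t x := if [&& 0 <= t, 0 <= x & x <= 1] then f t x else 0.

Lemma tcut_trace (tau : R -> R) : (forall T, 0 <= T -> in_L2 `[0, T] tau) -> trace (tcut tau).
Proof.
move=> Lt.
have nneg : measurable [set t : R | 0 <= t].
  rewrite (_ : [set t : R | _] = `[0, +oo[%classic); first exact: measurable_itv.
  by apply/seteqP; split => t /=; rewrite in_itv/= andbT.
split.
  apply: measurable_fun_if => //.
    by apply: measurable_fun_ler => //.
  rewrite setTI.
  have E : (fun t : R => 0 <= t) @^-1` [set true] = \bigcup_n (`[0, n%:R]%classic : set R).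
    apply/seteqP; split => t /=.
      by move=> t0; exists (Num.truncn t).+1 => //=; rewrite in_itv/= t0 ltW// truncnS_gt.
    by move=> [n _]; rewrite /= in_itv/= => /andP[].
  rewrite E; apply/measurable_fun_bigcup; first by move=> n; exact: measurable_itv.
  by move=> n; apply: in_L2_measurable; [exact: measurable_itv|exact: Lt].
move=> T; have [T0|T0] := leP 0 T; last first.
  by rewrite set_itv_ge ?bnd_simp -?ltNge//; exact: integrable_set0.
have [_ i2] := in_L2_L2on (measurable_itv _) (Lt T T0).
apply: eq_integrable i2; first exact: measurable_itv.
by move=> t; rewrite inE/= in_itv/= /tcut => /andP[-> _].
Qed.

Lemma l2norm_cut f t : 0 <= t -> l2norm I01 (txcut f t) = l2norm I01 (f t).
Proof.
by move=> t0; apply: eq_l2norm => x; rewrite /= in_itv/= /txcut t0 => /andP[-> ->].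
Qed.

Lemma L2on_cut f t : 0 <= t -> L2on I01 (f t) -> L2on I01 (txcut f t).
Proof.
move=> t0; apply: eq_L2on => x; rewrite /= in_itv/= /txcut t0.
by move=> /andP[-> ->].
Qed.

(** Gives the boundedness on compact time intervals from which the small-gain
    argument of [coupled_decay] starts. *)
Lemma norm_continuous z : L2_regular z ->
  continuous (fun t : R => l2norm I01 (z (Num.max t 0))).
Proof.
move=> [_ Lz cz _ _].
have LL t : 0 <= t -> L2on I01 (z t).
  by move=> t0; apply: in_L2_L2on (Lz t t0); exact: measurable_itv.
have p0 (t : R) : 0 <= Num.max t 0 by rewrite le_max lexx orbT.
have tri s t : 0 <= s -> 0 <= t ->
    l2norm I01 (z s) <= l2norm I01 (z t) + l2norm I01 (fun x => z s x - z t x).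
  move=> s0 t0; have := l2normD (LL t t0) (L2onB (LL s s0) (LL t t0)) => H.
  apply: le_trans H; rewrite le_eqVlt; apply/predU1P; left.
  by apply: eq_l2norm => x _; rewrite addrC subrK.
have sym s t : l2norm I01 (fun x => z s x - z t x) = l2norm I01 (fun x => z t x - z s x).
  by congr Num.sqrt; apply: eq_Rintegral => x _; rewrite -sqrrN opprB.
move=> t; apply/cvgrPdist_le => e e0.
have := cz _ (p0 t) => /cvgrPdist_lt/(_ e e0) => H.
have cm : continuous (fun s : R => Num.max s 0) by exact: (cont_max (@cont_id _) (@cont_cst _ _ 0)).
have {H} := cm t _ H; rewrite nbhs_simpl /= => H.
near=> s.
have : 0 <= Num.max s 0 -> `|0 - L2norm (z (Num.max s 0) \- z (Num.max t 0))| < e by near: s; exact: H.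
move=> /(_ (p0 s)); rewrite L2normE; last exact: L2onB (LL _ (p0 s)) (LL _ (p0 t)).
rewrite sub0r normrN (ger0_norm (l2norm_ge0 _ _)) => /ltW He.
have h1 := tri _ _ (p0 s) (p0 t); have h2 := tri _ _ (p0 t) (p0 s).
rewrite sym in h2.
rewrite ler_distlC; apply/andP; split.
  rewrite lerBlDr; apply: (le_trans h2); exact: lerD.
by apply: (le_trans h1); exact: lerD.
Unshelve. all: by end_near. Qed.

Lemma cut_bounded z T : L2_regular z ->
  exists2 M : R, 0 <= M & forall t, 0 <= t <= T -> l2norm I01 (txcut z t) <= M.
Proof.
move=> rz; have [M M0 H] := continuous_segment_bounded 0 T (norm_continuous rz).
exists M => // t ht; have /andP[t0 _] := ht.
have := H t ht; rewrite (max_l t0) l2norm_cut//.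
exact: le_trans (ler_norm _).
Qed.

Lemma cut_field z : L2_regular z -> field (txcut z).
Proof.
move=> rz; have [mz Lz _ _ _] := rz.
have LL t : L2on I01 (txcut z t).
  have [t0|t0] := leP 0 t.
    by apply: L2on_cut => //; apply: in_L2_L2on (Lz t t0); exact: measurable_itv.
  apply: (eq_L2on (f := fun=> 0)); last exact: (L2on_cont 0 1 (@cont_cst _ _ 0)).
  by move=> x _; rewrite /txcut leNgt t0.
split => //.
  have mb : measurable_fun setT (fun p : R * R => [&& 0 <= p.1, 0 <= p.2 & p.2 <= 1]).
    apply: measurable_and; first exact: measurable_fun_ler.
    by apply: measurable_and; exact: measurable_fun_ler.
  have mS : measurable [set p : R * R | 0 <= p.1 /\ 0 <= p.2 <= 1].
    have mt : measurable [set true] by [].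
    have := mb measurableT _ mt; rewrite setTI; congr measurable.
    by apply/seteqP; split => p /=; [move=> /and3P[-> -> ->]|move=> [-> ->]].
  apply: measurable_fun_if => //.
  by apply: (measurable_funS mS) mz => p /= [_] /and3P[-> -> ->].
move=> T; have [T0|T0] := leP 0 T; last first.
  by rewrite set_itv_ge ?bnd_simp -?ltNge//; exact: integrable_set0.
have cN := norm_continuous rz.
have := continuous_int 0 T (contM cN cN); apply: eq_integrable; first exact: measurable_itv.
move=> t; rewrite inE/= in_itv/= => /andP[t0 _]; congr EFin.
by rewrite -expr2 (max_l t0) -(l2norm_cut _ t0) l2norm_sqr.
Qed.

Lemma ae_Rint (a b : R -> R) T : measurable_fun `[0, T] a -> measurable_fun `[0, T] b ->
  {ae mu, forall t, 0 < t -> a t = b t} ->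
  \int[mu]_(t in `[0, T]) a t = \int[mu]_(t in `[0, T]) b t.
Proof.
move=> ma mb ab; congr fine; apply: ae_eq_integral => //; [exact/measurable_EFinP..|].
have n0 : {ae mu, forall t : R, t != 0}.
  exists [set 0]; split; [exact: measurable_set1|exact: lebesgue_measure_set1|].
  by move=> t /= /negP; rewrite negbK => /eqP.
apply: (@filterS2 _ (almost_everywhere mu) _ _ _ _ _ ab n0) => t {}ab t0; rewrite /= in_itv/= => /andP[t1 _].
by rewrite ab// lt_def t0.
Qed.

(** The traces may be changed at negligible sets of times; choosing them well
    makes boundary relations, known almost everywhere, hold at every time. *)
Lemma transport_sol v f f' (z0 : R -> R) z (tau0 tau1 : R -> R) :
  weak_transport v f z0 z -> in_L2 I01 z0 -> field f' ->
  (forall t x, 0 <= t -> 0 <= x <= 1 -> f t x = f' t x) ->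
  trace tau0 -> trace tau1 ->
  {ae mu, forall t, 0 < t -> trace0 z t = tau0 t} ->
  {ae mu, forall t, 0 < t -> trace1 z t = tau1 t} ->
  sol v f' z0 (txcut z) tau0 tau1.
Proof.
move=> [rz w] Lz0 hf' ff ht0 ht1 e0 e1.
have hz := cut_field rz; have [_ _ _ Lt0 Lt1] := rz.
split => //; first by apply: in_L2_L2on Lz0; exact: measurable_itv.
move=> T phi T0 Cphi.
have cphi := C1_cont2 Cphi; have cD := C1_cont2D (v := v) Cphi.
have Z0 : L2on `[0, T] (trace0 z) by apply: in_L2_L2on (Lt0 T T0); exact: measurable_itv.
have Z1 : L2on `[0, T] (trace1 z) by apply: in_L2_L2on (Lt1 T T0); exact: measurable_itv.
have c0 := cont2_line (x := 0) cphi; have c1 := cont2_line (x := 1) cphi.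
have tr (b s s' : R -> R) : continuous b -> L2on `[0, T] s -> trace s' ->
    {ae mu, forall t, 0 < t -> s t = s' t} ->
    \int[mu]_(t in `[0, T]) (b t * s t) = \int[mu]_(t in `[0, T]) (b t * s' t).
  move=> cb Ls hs' ss; apply: ae_Rint.
  - by have [] := L2on_contM cb Ls.
  - by have [] := L2on_contM cb (trace_L2on T hs').
  - by apply: (@filterS _ (almost_everywhere mu) _ _ _ _ ss) => t {}ss /ss ->.
rewrite -(tr _ _ _ c1 Z1 ht1 e1) -(tr _ _ _ c0 Z0 ht0 e0).
have mT : measurable (`[0, T]%classic : set R) by exact: measurable_itv.
rewrite -(RintB mT (int_contM c1 (L2on_int Z1)) (int_contM c0 (L2on_int Z0))).
rewrite (_ : \int[mu]_(x in I01) (phi T x * txcut z T x) = \int[mu]_(x in I01) (phi T x * z T x)); last first.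
  by apply: eq_Rintegral => x; rewrite inE/= in_itv/= /txcut T0 => /andP[-> ->].
rewrite (w T phi T0 Cphi) -[RHS](RintD mT (pairing_int T cD hz) (pairing_int T cphi hf')).
apply: eq_Rintegral => t; rewrite inE/= in_itv/= => /andP[t0 _].
have mI : measurable I01 by exact: measurable_itv.
rewrite -[RHS](RintD mI (slice_int t cD hz) (slice_int t cphi hf')).
apply: eq_Rintegral => x; rewrite inE/= in_itv/= => hx.
by rewrite ff// /txcut t0 hx.
Qed.

End FromUnknowns.

(** * Exponentially weighted norms *)
Section Weights.
Context {R : realType}.
Notation mu := (@lebesgue_measure R).
Notation I01 := (`[(0 : R), 1]%classic : set R).
Implicit Types (k F : R * R -> R) (f g : R -> R -> R) (h : R -> R) (t x xi T lam nu : R).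

Let mI : measurable I01. Proof. exact: measurable_itv. Qed.

Lemma L2on_head (u : R -> R) x : continuous u ->
  L2on I01 (fun xi => if xi <= x then u xi else 0).
Proof.
move=> cu; have [mu1 u2] := L2on_cont 0 1 cu.
have mh : measurable_fun I01 (fun xi => if xi <= x then u xi else 0).
  apply: measurable_fun_if => //; first exact: measurable_fun_ler.
  by apply: measurable_funS mu1 => //; exact: subIsetl.
split => //; apply: (int_dominated mI (measurable_funX 2 mh) u2) => y _.
by case: ifP => _; rewrite ger0_norm ?sqr_ge0// expr0n sqr_ge0.
Qed.

Lemma l2norm_const (M : R) : 0 <= M -> l2norm I01 (fun=> M) = M.
Proof. by move=> M0; rewrite /l2norm unit_Rint sqrtr_sqr ger0_norm. Qed.

Lemma exp_Rint_le lam x : 0 < lam ->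
  \int[mu]_(xi in `[0, x]) expR (- (lam * (x - xi))) <= lam^-1.
Proof.
move=> lam0; have [x0|x0] := leP 0 x; last first.
  by rewrite set_itv_ge ?bnd_simp -?ltNge// Rintegral_set0 invr_ge0 ltW.
pose P y := lam^-1 * expR (- (lam * (x - y))).
have dP (y : R) : is_derive y 1 P (expR (- (lam * (x - y)))).
  rewrite [X in is_derive _ _ _ X](_ : _ = lam^-1 * (expR (- (lam * (x - y))) * lam)); last first.
    by rewrite mulrCA mulVf ?mulr1// gt_eqF.
  apply: is_deriveZ.
  have dn : is_derive y 1 (fun y : R => - (lam * (x - y))) lam.
    by apply: is_derive_eq; rewrite /GRing.scale/=; ring.
  exact: (is_derive_compose (is_derive_expR _) dn).
have ce : continuous (fun y : R => expR (- (lam * (x - y)))).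
  rewrite (_ : (fun y => _) = fun y : R => expR (- (lam * x) + lam * y)); first exact: expR_cont.
  by apply/funext => y; congr expR; ring.
rewrite prim_itv// (prim_unique _ _ ce dP) /P subrr mulr0 oppr0 expR0 mulr1.
by rewrite gerBl mulr_ge0 ?expR_ge0// invr_ge0 ltW.
Qed.

(** In the weighted norm the kernel becomes
    [expR (- (lam * (x - xi))) * k (x, xi)], and each of its rows has an L2
    norm of order [(2 * lam) ^ (-1/2)]. *)
Lemma wnorm_vol_le k M lam h : continuous k -> 0 < lam ->
  (forall x xi, 0 <= x <= 1 -> 0 <= xi <= 1 -> `|k (x, xi)| <= M) ->
  L2on I01 h -> wnorm lam (vol k h) <= M * Num.sqrt (2 * lam)^-1 * wnorm lam h.
Proof.
move=> ck lam0 kM Lh.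
have M0 : 0 <= M by apply: le_trans (kM 0 0 _ _); rewrite ?lexx ?ler01.
have W0 : 0 <= wnorm lam h := l2norm_ge0 _ _.
set B := _ * wnorm lam h; have B0 : 0 <= B by rewrite !mulr_ge0 ?sqrtr_ge0.
have LW := weight_L2on lam Lh.
rewrite -(l2norm_const B0); apply: l2norm_le.
- by apply: weight_L2on; exact: vol_L2on.
- exact: (L2on_cont 0 1 (@cont_cst _ _ B)).
move=> x; rewrite /= in_itv/= => hx; rewrite [leRHS]ger0_norm//.
pose u (xi : R) := expR (- (lam * (x - xi))) * k (x, xi).
have ce : continuous (fun y : R => expR (- (lam * (x - y)))).
  rewrite (_ : (fun y => _) = fun y : R => expR (- (lam * x) + lam * y)); first exact: expR_cont.
  by apply/funext => y; congr expR; ring.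
have ce2 : continuous (fun y : R => expR (- (2 * lam * (x - y)))).
  rewrite (_ : (fun y => _) = fun y : R => expR (- (2 * lam * x) + 2 * lam * y)); first exact: expR_cont.
  by apply/funext => y; congr expR; ring.
have cu : continuous u by exact: (contM ce (cont_line1 (x := x) ck)).
have Lu := L2on_head x cu.
have iv := vol_int x ck (L2on_int Lh).
have -> : expR (- (lam * x)) * vol k h x =
    \int[mu]_(xi in I01) ((if xi <= x then u xi else 0) * (expR (- (lam * xi)) * h xi)).
  rewrite -RintZ//; apply: eq_Rintegral => xi _; case: ifP => _; last by rewrite mulr0 mul0r.
  rewrite /u (_ : - (lam * x) = - (lam * (x - xi)) + - (lam * xi)); last by ring.
  by rewrite expRD; ring.
apply: (Rint_CS Lu LW) => //.
rewrite -[M]ger0_norm// -sqrtr_sqr -sqrtrM ?sqr_ge0//; apply: ler_wsqrtr.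
have -> : \int[mu]_(xi in I01) ((if xi <= x then u xi else 0) ^+ 2) =
    \int[mu]_(xi in `[0, x]) (u xi ^+ 2).
  have /andP[_ x1] := hx; rewrite -(Rint_head _ _ x1); apply: eq_Rintegral => xi _.
  by case: ifP => // _; rewrite expr0n.
have l2 : 0 < 2 * lam by rewrite mulr_gt0.
have m0x : measurable (`[0, x]%classic : set R) by exact: measurable_itv.
apply: (@le_trans _ _ (\int[mu]_(xi in `[0, x]) (M ^+ 2 * expR (- (2 * lam * (x - xi)))))).
  apply: (Rint_le m0x).
  - by have [] := L2on_cont 0 x cu.
  - exact: (intZ m0x _ (continuous_int 0 x ce2)).
  move=> xi; rewrite /= in_itv/= => /andP[xi0 xix].
  have xi1 : xi <= 1 by case/andP: hx => _; exact: le_trans.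
  have hk : `|k (x, xi)| <= M by apply: kM => //; rewrite xi0.
  rewrite /u exprMn mulrC; apply: ler_pM; rewrite ?sqr_ge0//.
    by rewrite -real_normK ?num_real// ler_pXn2r ?nnegrE.
  rewrite expr2 -expRD le_eqVlt; apply/predU1P; left; congr expR; ring.
rewrite (RintZ m0x _ (continuous_int 0 x ce2)) ler_wpM2l ?sqr_ge0//.
exact: exp_Rint_le.
Qed.

Lemma wnorm_ge0 lam h : 0 <= wnorm lam h.
Proof. exact: l2norm_ge0. Qed.

Lemma wnormD lam h h' : L2on I01 h -> L2on I01 h' ->
  wnorm lam (fun x => h x + h' x) <= wnorm lam h + wnorm lam h'.
Proof.
move=> Lh Lh'; apply: le_trans (l2normD (weight_L2on lam Lh) (weight_L2on lam Lh')).
by rewrite le_eqVlt; apply/predU1P; left; apply: eq_l2norm => x _; rewrite mulrDr.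
Qed.

Lemma eq_wnorm lam h h' : (forall x, 0 <= x <= 1 -> h x = h' x) -> wnorm lam h = wnorm lam h'.
Proof. by move=> E; apply: eq_l2norm => x; rewrite /= in_itv/= => /E ->. Qed.

Lemma wnormM lam (a : R -> R) M h : continuous a -> L2on I01 h ->
  (forall x, 0 <= x <= 1 -> `|a x| <= M) -> wnorm lam (fun x => a x * h x) <= M * wnorm lam h.
Proof.
move=> ca Lh aM.
have M0 : 0 <= M by apply: le_trans (aM 0 _) => //; rewrite lexx ler01.
have LW := weight_L2on lam Lh.
rewrite /wnorm -[M in leRHS]ger0_norm// -l2normZ//; apply: l2norm_le.
- by apply: weight_L2on; exact: L2on_contM.
- exact: L2onZ.
move=> x; rewrite /= in_itv/= => /aM aMx; rewrite mulrCA !normrM ler_wpM2r ?mulr_ge0//.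
by rewrite (ger0_norm M0).
Qed.

Lemma wnormZ lam c h : L2on I01 h -> wnorm lam (fun x => c * h x) = `|c| * wnorm lam h.
Proof.
move=> Lh; rewrite /wnorm -l2normZ; last exact: weight_L2on.
by apply: eq_l2norm => x _; rewrite mulrCA.
Qed.

Lemma wnorm_le_l2 lam h : L2on I01 h -> wnorm lam h <= expR `|lam| * l2norm I01 h.
Proof.
move=> Lh; rewrite -[expR `|lam|](ger0_norm (expR_ge0 _)) -(l2normZ _ Lh); apply: l2norm_le.
- exact: weight_L2on.
- exact: L2onZ.
move=> x; rewrite /= in_itv/= => /andP[x0 x1]; rewrite !normrM ler_wpM2r//.
rewrite (ger0_norm (expR_ge0 _)) (ger0_norm (expR_ge0 _)) ler_expR.
apply: (le_trans (ler_norm _)); rewrite normrN normrM ler_piMr//.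
by rewrite ger0_norm.
Qed.

Lemma l2_le_wnorm lam h : L2on I01 h -> l2norm I01 h <= expR `|lam| * wnorm lam h.
Proof.
move=> Lh; have LW := weight_L2on lam Lh.
rewrite -[expR `|lam|](ger0_norm (expR_ge0 _)) -(l2normZ _ LW); apply: l2norm_le => //.
  exact: L2onZ.
move=> x; rewrite /= in_itv/= => /andP[x0 x1]; rewrite mulrA [leRHS]normrM ler_peMl//.
rewrite -expRD ger0_norm ?expR_ge0// -expR0 ler_expR subr_ge0.
by apply: (le_trans (ler_norm _)); rewrite normrM ler_piMr// ger0_norm.
Qed.

Lemma wnorm0 h : wnorm 0 h = l2norm I01 h.
Proof. by apply: eq_l2norm => x _; rewrite mul0r oppr0 expR0 mul1r. Qed.

End Weights.

(** * Exponential decay of solutions of transport equations *)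
Section Decay.
Context {R : realType}.
Notation mu := (@lebesgue_measure R).
Notation I01 := (`[(0 : R), 1]%classic : set R).
Implicit Types (k F : R * R -> R) (f g : R -> R -> R) (h : R -> R) (t x xi T lam nu : R).

Let mI T : measurable (`[0, T]%classic : set R). Proof. exact: measurable_itv. Qed.

Definition decays nu (B : R) f := forall t, 0 <= t -> expR (nu * t) * l2norm I01 (f t) <= B.

(** Decay in the mean, required of sources: the estimates of transport
    equations only see the integral of a source in time. *)
Definition int_decays nu (B : R) f := forall T, 0 <= T ->
  \int[mu]_(t in `[0, T]) (expR (nu * t) * l2norm I01 (f t)) <= B.

Definition trace_decays nu (B : R) (tau : R -> R) := forall T, 0 <= T ->
  l2norm `[0, T] (fun t => expR (nu * t) * tau t) <= B.

Definition locally_bounded f := forall T, exists M : R,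
  forall t, 0 <= t <= T -> l2norm I01 (f t) <= M.

Lemma exp_cont nu : continuous (fun t : R => expR (nu * t)).
Proof.
rewrite (_ : (fun t => _) = fun t : R => expR (0 + nu * t)); first exact: expR_cont.
by apply/funext => t; rewrite add0r.
Qed.

Lemma field_norm_L2on f T : field f -> L2on `[0, T] (fun t => l2norm I01 (f t)).
Proof.
move=> [mf Lf If]; split.
  apply: measurable_funTS; apply: (measurableT_comp (f := @Num.sqrt R)).
    by apply: continuous_measurable_fun; exact: sqrt_continuous.
  exact: sqnorm_measurable.
by apply: eq_integrable (If T) => // t _ /=; rewrite l2norm_sqr.
Qed.

Lemma field_norm_int f nu T : field f ->
  mu.-integrable `[0, T] (EFin \o (fun t => expR (nu * t) * l2norm I01 (f t))).
Proof. by move=> hf; exact: (int_contM (@exp_cont nu) (L2on_int (field_norm_L2on T hf))). Qed.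

(** The time weight [expR (nu * t)] is compensated by the space weight with
    [lam * v = nu], and on a bounded interval the latter is equivalent to 1:
    the rate is not lost. *)
Lemma transport_decay (v b b' nu : R) : v != 0 -> 0 <= nu ->
  exists2 C : R, 0 <= C & forall f (z0 : R -> R) (z : R -> R -> R) (tau0 tau1 tin tout : R -> R) (A B : R),
    sol v f z0 z tau0 tau1 -> inflow v b tau0 tau1 tin -> inflow (- v) b' tau0 tau1 tout ->
    trace_decays nu A tin -> int_decays nu B f ->
    decays nu (C * (l2norm I01 z0 + A + B)) z /\
    trace_decays nu (C * (l2norm I01 z0 + A + B)) tout.
Proof.
move=> v0 nu0.
pose lam := nu / v; have lamv : lam * v = nu by rewrite /lam mulfVK.
set E := expR `|lam|; have E1 : 1 <= E by rewrite -expR0 ler_expR.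
have E0 : 0 <= E := le_trans ler01 E1.
pose c1 := `|v| * Num.sqrt `|v|^-1 * E.
have c10 : 0 <= c1 by rewrite !mulr_ge0 ?sqrtr_ge0.
pose d := `|v|^-1 * expR (nu / `|v|).
have d0 : 0 <= d by rewrite mulr_ge0 ?expR_ge0// invr_ge0.
pose C1 := E * (E + c1); pose C2 := d * (Num.sqrt `|v| + `|v|).
have C10 : 0 <= C1 by rewrite mulr_ge0 ?addr_ge0.
have C20 : 0 <= C2 by rewrite mulr_ge0 ?addr_ge0 ?sqrtr_ge0.
exists (C1 + C2); first exact: addr_ge0.
move=> f z0 z tau0 tau1 tin tout A B Hs Hin Hout tA fB.
have [hz hf h0 ht w] := Hs.
have A0 : 0 <= A := le_trans (l2norm_ge0 _ _) (tA 0 (lexx _)).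
have n0 : 0 <= l2norm I01 z0 := l2norm_ge0 _ _.
have B0 : 0 <= B.
  apply: le_trans (fB 0 (lexx _)); apply: Rintegral_ge0 => t _.
  by rewrite mulr_ge0 ?expR_ge0 ?l2norm_ge0.
split=> [T|T] T0.
- have Lf t : L2on I01 (f t) by case: hf.
  have Lz t : L2on I01 (z t) by case: hz.
  pose G t := E * (expR (nu * t) * l2norm I01 (f t)).
  have iG : mu.-integrable `[0, T] (EFin \o G) := intZ (mI T) E (field_norm_int nu T hf).
  have fG t : 0 <= t <= T -> expR (nu * t) * wnorm lam (f t) <= G t.
    move=> _; rewrite /G mulrCA; apply: (ler_wpM2l (expR_ge0 _)).
    exact: wnorm_le_l2.
  have nl : nu <= lam * v by rewrite lamv.
  have := transport_norm Hs Hin T0 nu0 nl A0 (tA T T0) iG fG.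
  rewrite lamv subrr (_ : \int[mu]_(t in `[0, T]) _ = E * \int[mu]_(t in `[0, T]) (expR (nu * t) * l2norm I01 (f t))); last first.
    rewrite -(RintZ (mI T) _ (field_norm_int nu T hf)); apply: eq_Rintegral => t _.
    by rewrite mul0r oppr0 expR0 mul1r.
  have := ler_wpM2l E0 (fB T T0); have := wnorm_le_l2 lam h0; rewrite -/E -/c1.
  have := ler_wpM2l (expR_ge0 (nu * T)) (l2_le_wnorm lam (Lz T)); rewrite -/E mulrCA.
  have := ler_wpM2l E0.
  move: (expR (nu * T) * wnorm lam (z T)) (wnorm lam z0) (expR (nu * T) * l2norm I01 (z T)) => a1 a2 a3.
  move: (l2norm I01 z0) n0 (\int[mu]_(t in _) _) => n n0 I mE h1 h2 h3 h4.
  apply: (le_trans h1); apply: (@le_trans _ _ (C1 * (n + A + B))); last first.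
    by rewrite ler_wpM2r ?addr_ge0// lerDl.
  rewrite -mulrA; apply: mE; apply: (le_trans h4).
  apply: (@le_trans _ _ (E * n + c1 * A + E * B)); first by rewrite !lerD.
  clear - E0 c10 n0 A0 B0.
  have := mulr_ge0 c10 n0; have := mulr_ge0 c10 B0; have := mulr_ge0 E0 A0; lra.
- have iG := field_norm_int nu T hf.
  have := transport_trace Hs Hin Hout T0 nu0 A0 (tA T T0) iG (fun t _ => lexx _).
  have := fB T T0; have s0 := sqrtr_ge0 `|v|; have v1 := normr_ge0 v.
  move: (l2norm I01 z0) n0 (\int[mu]_(t in _) _) => n n0 I hI h1; apply: (le_trans h1).
  apply: (@le_trans _ _ (C2 * (n + A + B))); last by rewrite ler_wpM2r ?addr_ge0// lerDr.
  rewrite mulrA -/d /C2 -mulrA; apply: (ler_wpM2l d0).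
  move: s0 v1; set s := Num.sqrt `|v|; set w0 := `|v| => s0 v1.
  clear - s0 v1 n0 A0 B0 hI.
  apply: (@le_trans _ _ (s * (n + B) + w0 * A)); first by rewrite lerD2r ler_wpM2l// lerD2l.
  have := mulr_ge0 s0 A0; have := mulr_ge0 v1 n0; have := mulr_ge0 v1 B0; lra.
Qed.

End Decay.

Section CoupledDecay.
Context {R : realType}.
Notation mu := (@lebesgue_measure R).
Notation I01 := (`[(0 : R), 1]%classic : set R).
Implicit Types (k F : R * R -> R) (f g : R -> R -> R) (h : R -> R) (t x xi T lam nu : R).

Let mI T : measurable (`[0, T]%classic : set R). Proof. exact: measurable_itv. Qed.

(** [S] bounds the coupling up to time [T]. In the weighted norm its
    contribution is integrated against [expR (- (4 * C + 1) * (T - t))],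
    hence multiplied by less than 1/4. *)
Lemma coupled_step (v nu lam C S A B : R) f (z0 : R -> R) (z : R -> R -> R) (tin tout : R -> R)
    (X eps : R -> R) T :
  0 < v -> 0 <= nu -> 0 <= C -> 0 <= S -> 0 <= A -> 0 <= T -> nu + (4 * C + 1) <= lam * v ->
  sol v f z0 z tin tout -> trace_decays nu A tin ->
  (forall T, mu.-integrable `[0, T] (EFin \o eps)) -> (forall t, 0 <= t -> 0 <= eps t) ->
  \int[mu]_(t in `[0, T]) (expR (nu * t) * eps t) <= B ->
  (forall t, 0 <= t <= T -> expR (nu * t) * X t <= S) ->
  (forall t, 0 <= t -> wnorm lam (f t) <= C * X t + eps t) ->
  expR (nu * T) * wnorm lam (z T) <=
    wnorm lam z0 + `|v| * Num.sqrt `|v|^-1 * expR `|lam| * A + B + S / 4.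
Proof.
move=> v0 nu0 C0 S0 A0 T0 lamv Hs tA ie e0 eB XS fX.
have Hin : inflow v 0 tin tout tin by left.
set del := lam * v - nu.
have delC : 4 * C + 1 <= del by rewrite /del lerBrDl.
have del0 : 0 < del by apply: lt_le_trans delC; rewrite ltr_wpDl// mulr_ge0.
have nl : nu <= lam * v by rewrite -subr_ge0 ltW.
pose G t := expR (nu * t) * eps t + C * S.
have ieps := int_contM (@exp_cont R nu) (ie T).
have iG : mu.-integrable `[0, T] (EFin \o G) := intD (mI T) ieps (int_cst 0 T (C * S)).
have fG t : 0 <= t <= T -> expR (nu * t) * wnorm lam (f t) <= G t.
  move=> ht; have /andP[t0 _] := ht.
  apply: (le_trans (ler_wpM2l (expR_ge0 _) (fX t t0))).
  rewrite mulrDr addrC lerD2l mulrCA; exact: (ler_wpM2l C0 (XS t ht)).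
have := transport_norm Hs Hin T0 nu0 nl A0 (tA T T0) iG fG; rewrite -/del.
move=> /le_trans; apply.
rewrite -[leRHS]addrA; apply: lerD => //.
have ce : continuous (fun t : R => expR (- (del * (T - t)))).
  rewrite (_ : (fun t => _) = fun t : R => expR (- (del * T) + del * t)); first exact: expR_cont.
  by apply/funext => t; congr expR; ring.
have i1 : mu.-integrable `[0, T] (EFin \o (fun t => expR (- (del * (T - t))) * (expR (nu * t) * eps t))).
  exact: int_contM.
have i2 := continuous_int 0 T ce.
rewrite (_ : \int[mu]_(t in _) _ = \int[mu]_(t in `[0, T]) (expR (- (del * (T - t))) * (expR (nu * t) * eps t))
   + (C * S) * \int[mu]_(t in `[0, T]) expR (- (del * (T - t)))); last first.
  rewrite -(RintZ (mI T) _ i2) -(RintD (mI T) i1 (intZ (mI T) _ i2)).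
  by apply: eq_Rintegral => t _; rewrite /G mulrDr [X in _ + X]mulrC.
apply: lerD.
  apply: le_trans eB; apply: (Rint_le (mI T) i1 ieps) => t; rewrite /= in_itv/= => /andP[t0 tT].
  rewrite ler_piMl ?mulr_ge0 ?expR_ge0 ?e0// -expR0 ler_expR oppr_le0 mulr_ge0 ?subr_ge0//.
have CS0 : 0 <= C * S by rewrite mulr_ge0.
apply: (le_trans (ler_wpM2l CS0 (exp_Rint_le T del0))).
have S4 : 0 <= S / 4 by rewrite divr_ge0.
rewrite ler_pdivrMr//; apply: le_trans (ler_wpM2l S4 delC).
rewrite (_ : S / 4 * (4 * C + 1) = C * S + S / 4); first by rewrite lerDl.
by clear; field.
Qed.

(** A small-gain argument on the supremum over [[0, T]]: by [coupled_step] it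
    is at most a constant plus half of itself, and it is finite because the
    solutions are locally bounded. The constant [C] of the coupling must not
    depend on the weight, which is chosen after it; [lam0] lets the weight be
    large enough for other purposes as well. *)
Lemma coupled_decay (v1 v2 nu C lam0 : R) : 0 < v1 -> 0 < v2 -> 0 <= nu -> 0 <= C ->
  exists lam D : R, [/\ 0 < lam, lam0 <= lam, 0 <= D &
    forall f1 f2 (z10 z20 : R -> R) (z1 z2 : R -> R -> R) (tin1 tin2 tout1 tout2 : R -> R) (eps : R -> R) (A B : R),
    sol v1 f1 z10 z1 tin1 tout1 -> sol v2 f2 z20 z2 tin2 tout2 ->
    locally_bounded z1 -> locally_bounded z2 ->
    trace_decays nu A tin1 -> trace_decays nu A tin2 ->
    (forall T, mu.-integrable `[0, T] (EFin \o eps)) -> (forall t, 0 <= t -> 0 <= eps t) ->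
    (forall T, 0 <= T -> \int[mu]_(t in `[0, T]) (expR (nu * t) * eps t) <= B) ->
    (forall t, 0 <= t -> wnorm lam (f1 t) <= C * (wnorm lam (z1 t) + wnorm lam (z2 t)) + eps t) ->
    (forall t, 0 <= t -> wnorm lam (f2 t) <= C * (wnorm lam (z1 t) + wnorm lam (z2 t)) + eps t) ->
    decays nu (D * (l2norm I01 z10 + l2norm I01 z20 + A + B)) z1 /\
    decays nu (D * (l2norm I01 z10 + l2norm I01 z20 + A + B)) z2].
Proof.
move=> v10 v20 nu0 C0.
pose e := nu + (4 * C + 1).
have e0 : 0 < e by rewrite /e ltr_wpDl// ltr_wpDl// mulr_ge0.
pose lam := Num.max lam0 (Num.max (e / v1) (e / v2)).
have l1 : e <= lam * v1 by rewrite -ler_pdivrMr// !le_max lexx orbT.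
have l2 : e <= lam * v2 by rewrite -ler_pdivrMr// !le_max lexx !orbT.
have lamp : 0 < lam by rewrite !lt_max divr_gt0 ?orbT.
set E := expR `|lam|; have E0 : 0 <= E := expR_ge0 _.
pose c1 := `|v1| * Num.sqrt `|v1|^-1 * E; pose c2 := `|v2| * Num.sqrt `|v2|^-1 * E.
have c10 : 0 <= c1 by rewrite !mulr_ge0 ?sqrtr_ge0.
have c20 : 0 <= c2 by rewrite !mulr_ge0 ?sqrtr_ge0.
pose D := E * (2 * (E + c1 + c2 + 2)).
exists lam, D; split => //.
- by rewrite !le_max lexx.
- by rewrite !mulr_ge0 ?addr_ge0.
move=> f1 f2 z10 z20 z1 z2 tin1 tin2 tout1 tout2 eps A B Hs1 Hs2 b1 b2 tA1 tA2 ie ep eB fX1 fX2.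
have [hz1 hf1 h10 _ _] := Hs1; have [hz2 hf2 h20 _ _] := Hs2.
have Lz1 t : L2on I01 (z1 t) by case: hz1.
have Lz2 t : L2on I01 (z2 t) by case: hz2.
have A0 : 0 <= A := le_trans (l2norm_ge0 _ _) (tA1 0 (lexx _)).
have B0 : 0 <= B.
  apply: le_trans (eB 0 (lexx _)); apply: Rintegral_ge0 => t; rewrite /= in_itv/= => /andP[t0 _].
  by rewrite mulr_ge0 ?expR_ge0 ?ep.
pose X t := wnorm lam (z1 t) + wnorm lam (z2 t).
have X0 t : 0 <= X t by rewrite addr_ge0 ?wnorm_ge0.
pose K := wnorm lam z10 + wnorm lam z20 + (c1 + c2) * A + 2 * B.
have key T : 0 <= T -> expR (nu * T) * X T <= 2 * K.
  move=> T0; have [M1 H1] := b1 T; have [M2 H2] := b2 T.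
  pose U : set R := [set y | exists2 t, 0 <= t <= T & y = expR (nu * t) * X t].
  have XU t : 0 <= t <= T -> U (expR (nu * t) * X t) by move=> ht; exists t.
  have T00 : 0 <= (0 : R) <= T by apply/andP; split.
  have TT : 0 <= T <= T by apply/andP; split.
  have hsU : has_sup U.
    split; first by exists (expR (nu * 0) * X 0); exact: XU.
    exists (expR (nu * T) * (E * M1 + E * M2)) => y [t ht ->].
    have /andP[t0 tT] := ht.
    apply: ler_pM; rewrite ?expR_ge0//; first by rewrite ler_expR ler_wpM2l.
    apply: lerD.
      exact: (le_trans (wnorm_le_l2 lam (Lz1 t)) (ler_wpM2l E0 (H1 t ht))).
    exact: (le_trans (wnorm_le_l2 lam (Lz2 t)) (ler_wpM2l E0 (H2 t ht))).
  pose S := sup U.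
  have XS t : 0 <= t <= T -> expR (nu * t) * X t <= S.
    by move=> ht; apply: (sup_upper_bound hsU); exact: XU.
  have S0 : 0 <= S by apply: le_trans (XS 0 T00); rewrite mulr_ge0 ?expR_ge0.
  have XK t : 0 <= t <= T -> expR (nu * t) * X t <= K + S / 2.
    move=> ht; have /andP[t0 tT] := ht.
    have XSt s : 0 <= s <= t -> expR (nu * s) * X s <= S.
      by move=> /andP[s0 st]; apply: XS; rewrite s0 (le_trans st).
    have e1 := coupled_step v10 nu0 C0 S0 A0 t0 l1 Hs1 tA1 ie ep (eB t t0) XSt fX1.
    have e2 := coupled_step v20 nu0 C0 S0 A0 t0 l2 Hs2 tA2 ie ep (eB t t0) XSt fX2.
    rewrite /X mulrDr; apply: (le_trans (lerD e1 e2)).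
    rewrite -/E -/c1 -/c2 /K le_eqVlt; apply/predU1P; left.
    by clear; field.
  (* A quarter from each of the two equations. *)
  have : S <= K + S / 2.
    apply: (ge_sup hsU.1) => y [t ht ->]; exact: XK.
  move: (XS T TT); move: (expR (nu * T) * X T) => a; clear; lra.
have w1 := wnorm_le_l2 lam h10; have w2 := wnorm_le_l2 lam h20.
have n1 : 0 <= l2norm I01 z10 := l2norm_ge0 _ _; have n2 : 0 <= l2norm I01 z20 := l2norm_ge0 _ _.
have KD : E * (2 * K) <= D * (l2norm I01 z10 + l2norm I01 z20 + A + B).
  rewrite /D -mulrA -mulrA; apply: (ler_wpM2l E0); apply: (ler_wpM2l (ler0n _ 2)); rewrite /K.
  move: w1 w2 n1 n2; rewrite -/E; move: (wnorm _ _) (wnorm _ _) (l2norm _ _) (l2norm _ _) => a1 a2 m1 m2 w1 w2 n1 n2.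
  clear - w1 w2 n1 n2 A0 B0 E0 c10 c20.
  have := mulr_ge0 E0 A0; have := mulr_ge0 E0 B0.
  have := mulr_ge0 (addr_ge0 c10 c20) (addr_ge0 (addr_ge0 n1 n2) B0).
  lra.
split=> t t0; apply: le_trans KD.
- apply: (le_trans (ler_wpM2l (expR_ge0 _) (l2_le_wnorm lam (Lz1 t)))); rewrite -/E mulrCA.
  apply: (ler_wpM2l E0); apply: le_trans (key t t0).
  by apply: (ler_wpM2l (expR_ge0 _)); rewrite lerDl wnorm_ge0.
- apply: (le_trans (ler_wpM2l (expR_ge0 _) (l2_le_wnorm lam (Lz2 t)))); rewrite -/E mulrCA.
  apply: (ler_wpM2l E0); apply: le_trans (key t t0).
  by apply: (ler_wpM2l (expR_ge0 _)); rewrite lerDr wnorm_ge0.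
Qed.

End CoupledDecay.

Section DecayAlgebra.
Context {R : realType}.
Notation mu := (@lebesgue_measure R).
Notation I01 := (`[(0 : R), 1]%classic : set R).
Implicit Types (k F : R * R -> R) (f g : R -> R -> R) (h a : R -> R) (t x xi T lam nu A B M : R).

Let mI T : measurable (`[0, T]%classic : set R). Proof. exact: measurable_itv. Qed.
Let field_L2on f t : field f -> L2on I01 (f t). Proof. by case. Qed.

Lemma decays_eq nu B f g : (forall t x, 0 <= t -> 0 <= x <= 1 -> f t x = g t x) ->
  decays nu B f -> decays nu B g.
Proof.
move=> E H t t0; rewrite -(@eq_l2norm _ 0 1 (f t) (g t)); first exact: H.
by move=> x; rewrite /= in_itv/=; exact: E.
Qed.

Lemma decays_le nu nu' B B' f : nu' <= nu -> B <= B' -> decays nu B f -> decays nu' B' f.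
Proof.
move=> nn BB H t t0; apply: le_trans (le_trans (H t t0) BB).
by rewrite ler_wpM2r ?l2norm_ge0// ler_expR ler_wpM2r.
Qed.

Lemma decaysD nu B B' f g : field f -> field g -> decays nu B f -> decays nu B' g ->
  decays nu (B + B') (fun t x => f t x + g t x).
Proof.
move=> hf hg H H' t t0; apply: le_trans (lerD (H t t0) (H' t t0)).
rewrite -mulrDr; apply: (ler_wpM2l (expR_ge0 _)).
exact: (l2normD (field_L2on t hf) (field_L2on t hg)).
Qed.

Lemma decaysM nu B M a f : continuous a -> field f ->
  (forall x, 0 <= x <= 1 -> `|a x| <= M) -> decays nu B f ->
  decays nu (M * B) (fun t x => a x * f t x).
Proof.
move=> ca hf aM H t t0.
have M0 : 0 <= M by apply: le_trans (aM 0 _) => //; rewrite lexx ler01.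
apply: le_trans (ler_wpM2l M0 (H t t0)); rewrite mulrCA; apply: (ler_wpM2l (expR_ge0 _)).
by rewrite -(wnorm0 (f t)) -wnorm0; apply: wnormM => //; exact: field_L2on.
Qed.

Lemma decaysZ nu B c f : field f -> decays nu B f -> decays nu (`|c| * B) (fun t x => c * f t x).
Proof. by move=> hf; apply: decaysM => //; exact: cont_cst. Qed.

Lemma l2norm_vol k M h : continuous k ->
  (forall x xi, 0 <= x <= 1 -> 0 <= xi <= 1 -> `|k (x, xi)| <= M) ->
  L2on I01 h -> l2norm I01 (vol k h) <= M * l2norm I01 h.
Proof.
move=> ck kM Lh.
have M0 : 0 <= M by apply: le_trans (kM 0 0 _ _); rewrite ?lexx ?ler01.
have B0 : 0 <= M * l2norm I01 h by rewrite mulr_ge0 ?l2norm_ge0.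
rewrite -(l2norm_const B0); apply: l2norm_le.
- exact: vol_L2on.
- exact: (L2on_cont 0 1 (@cont_cst _ _ _)).
move=> x; rewrite /= in_itv/= => hx; rewrite [leRHS]ger0_norm//.
exact: vol_bound.
Qed.

Lemma decays_vol nu B M k f : continuous k -> field f ->
  (forall x xi, 0 <= x <= 1 -> 0 <= xi <= 1 -> `|k (x, xi)| <= M) ->
  decays nu B f -> decays nu (M * B) (fun t => vol k (f t)).
Proof.
move=> ck hf kM H t t0.
have M0 : 0 <= M by apply: le_trans (kM 0 0 _ _); rewrite ?lexx ?ler01.
apply: le_trans (ler_wpM2l M0 (H t t0)); rewrite mulrCA; apply: (ler_wpM2l (expR_ge0 _)).
by apply: l2norm_vol => //; exact: field_L2on.
Qed.

Lemma exp_decay_Rint lam T : 0 < lam -> 0 <= T ->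
  \int[mu]_(t in `[0, T]) expR (- (lam * t)) <= lam^-1.
Proof.
move=> lam0 T0; pose P y := - lam^-1 * expR (- (lam * y)).
have dP (y : R) : is_derive y 1 P (expR (- (lam * y))).
  rewrite [X in is_derive _ _ _ X](_ : _ = - lam^-1 * (- lam * expR (- (lam * y)))).
    exact: is_deriveZ (is_derive_weight lam y).
  by rewrite mulrA mulrNN mulVf ?mul1r// gt_eqF.
have ce := @weight_cont R lam.
rewrite prim_itv// (prim_unique _ _ ce dP) /P mulr0 oppr0 expR0 mulr1 opprK mulNr.
by rewrite addrC gerBl mulr_ge0 ?expR_ge0// invr_ge0 ltW.
Qed.

(** The loss of rate that makes an exponential integrable on the half-line. *)
Lemma decays_int nu nu' B f : nu < nu' -> field f -> 0 <= B -> decays nu' B f ->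
  int_decays nu ((nu' - nu)^-1 * B) f.
Proof.
move=> nn hf B0 H T T0; have d0 : 0 < nu' - nu by rewrite subr_gt0.
have ie := continuous_int 0 T (@weight_cont R (nu' - nu)).
apply: (@le_trans _ _ (\int[mu]_(t in `[0, T]) (B * expR (- ((nu' - nu) * t))))).
  apply: (Rint_le (mI T) (field_norm_int nu T hf) (intZ (mI T) B ie)) => t.
  rewrite /= in_itv/= => /andP[t0 _]; rewrite (_ : nu * t = - ((nu' - nu) * t) + nu' * t); last by ring.
  by rewrite expRD -mulrA mulrC; apply: (ler_wpM2r (expR_ge0 _)); exact: H.
rewrite (RintZ (mI T) _ ie) mulrC; apply: (ler_wpM2r B0); exact: exp_decay_Rint.
Qed.

Lemma exp_l2norm lam T : 0 < lam -> 0 <= T ->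
  l2norm `[0, T] (fun t => expR (- (lam * t))) <= Num.sqrt (2 * lam)^-1.
Proof.
move=> lam0 T0; apply: ler_wsqrtr.
rewrite (_ : \int[mu]_(t in _) _ = \int[mu]_(t in `[0, T]) expR (- (2 * lam * t))).
  by apply: exp_decay_Rint => //; rewrite mulr_gt0.
by apply: eq_Rintegral => t _; rewrite expr2 -expRD; congr expR; ring.
Qed.

Lemma int_decays_tensor nu nu' A a (tau : R -> R) : nu < nu' -> continuous a -> trace tau ->
  trace_decays nu' A tau ->
  int_decays nu (l2norm I01 a * (Num.sqrt (2 * (nu' - nu))^-1 * A)) (fun t x => a x * tau t).
Proof.
move=> nn ca ht H T T0; have d0 : 0 < nu' - nu by rewrite subr_gt0.
have La := L2on_cont 0 1 ca.
pose w t := expR (nu' * t) * `|tau t|.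
have Lw0 : L2on `[0, T] (fun t => expR (nu' * t) * tau t).
  exact: (L2on_contM (@exp_cont R nu') (trace_L2on T ht)).
have Lw : L2on `[0, T] w.
  have [mw w2] := Lw0; split.
    apply: eq_measurable_fun (measurableT_comp (@normr_measurable R setT) mw) => t _ /=.
    by rewrite normrM ger0_norm ?expR_ge0.
  by apply: eq_integrable w2 => // t _ /=; rewrite /w !exprMn real_normK ?num_real.
have Le := L2on_cont 0 T (@weight_cont R (nu' - nu)).
rewrite (_ : \int[mu]_(t in _) _ = l2norm I01 a * \int[mu]_(t in `[0, T]) (expR (- ((nu' - nu) * t)) * w t)).
  apply: (ler_wpM2l (l2norm_ge0 _ _)); apply: (le_trans (ler_norm _)).
  apply: (Rint_CS Le Lw (exp_l2norm d0 T0)); apply: le_trans (H T T0).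
  rewrite le_eqVlt; apply/predU1P; left; congr Num.sqrt; apply: eq_Rintegral => t _.
  by rewrite /w !exprMn real_normK ?num_real.
rewrite -(RintZ (mI T) _ (L2on_intM Le Lw)); apply: eq_Rintegral => t _.
rewrite (_ : l2norm I01 (fun x => a x * tau t) = `|tau t| * l2norm I01 a).
  rewrite (_ : nu * t = - ((nu' - nu) * t) + nu' * t); last by ring.
  by rewrite expRD /w; ring.
by rewrite -(l2normZ _ La); apply: eq_l2norm => x _; rewrite mulrC.
Qed.

Lemma trace_decays_le nu nu' A B (tau : R -> R) : trace tau -> nu' <= nu -> A <= B ->
  trace_decays nu A tau -> trace_decays nu' B tau.
Proof.
move=> ht nn AB H T T0; apply: le_trans (le_trans (H T T0) AB).
have Lt := trace_L2on T ht.
apply: l2norm_le; [exact: (L2on_contM (@exp_cont R nu') Lt)|exact: (L2on_contM (@exp_cont R nu) Lt)|].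
move=> t; rewrite /= in_itv/= => /andP[t0 _]; rewrite !normrM; apply: (ler_wpM2r (normr_ge0 _)).
by rewrite !(ger0_norm (expR_ge0 _)) ler_expR ler_wpM2r.
Qed.

Lemma trace_decaysD nu A B (tau tau' : R -> R) : trace tau -> trace tau' ->
  trace_decays nu A tau -> trace_decays nu B tau' ->
  trace_decays nu (A + B) (fun t => tau t + tau' t).
Proof.
move=> ht ht' H H' T T0; apply: le_trans (lerD (H T T0) (H' T T0)).
have L := L2on_contM (@exp_cont R nu) (trace_L2on T ht).
have L' := L2on_contM (@exp_cont R nu) (trace_L2on T ht').
apply: le_trans (l2normD L L').
by rewrite le_eqVlt; apply/predU1P; left; apply: eq_l2norm => t _; rewrite mulrDr.
Qed.

Lemma trace_decaysZ nu A c (tau : R -> R) : trace tau -> trace_decays nu A tau ->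
  trace_decays nu (`|c| * A) (fun t => c * tau t).
Proof.
move=> ht H T T0; apply: le_trans (ler_wpM2l (normr_ge0 c) (H T T0)).
have L := L2on_contM (@exp_cont R nu) (trace_L2on T ht).
rewrite -(l2normZ _ L) le_eqVlt; apply/predU1P; left.
by apply: eq_l2norm => t _; rewrite mulrCA.
Qed.

Lemma trace_decays0 nu : trace_decays nu 0 (fun=> 0 : R).
Proof.
move=> T T0; rewrite /l2norm (_ : \int[mu]_(t in _) _ = \int[mu]_(t in `[0, T]) 0).
  by rewrite Rintegral_cst//= mul0r sqrtr0.
by apply: eq_Rintegral => t _; rewrite mulr0 expr0n.
Qed.

(** A pairing bounded in time by an exponential is square-integrable in time
    only against a smaller one. *)
Lemma trace_decays_pairing nu nu' B (b : R -> R) f : nu < nu' -> continuous b -> field f ->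
  0 <= B -> trace (fun t => \int[mu]_(x in I01) (b x * f t x)) -> decays nu' B f ->
  trace_decays nu (l2norm I01 b * (Num.sqrt (2 * (nu' - nu))^-1 * B))
    (fun t => \int[mu]_(x in I01) (b x * f t x)).
Proof.
move=> nn cb hf B0 ht H T T0; have d0 : 0 < nu' - nu by rewrite subr_gt0.
have Lb := L2on_cont 0 1 cb; have b0 := l2norm_ge0 I01 b.
have Le := L2on_cont 0 T (@weight_cont R (nu' - nu)).
have nB : 0 <= l2norm I01 b * B by rewrite mulr_ge0.
apply: (@le_trans _ _ (l2norm `[0, T] (fun t => (l2norm I01 b * B) * expR (- ((nu' - nu) * t))))).
  apply: l2norm_le; [exact: (L2on_contM (@exp_cont R nu) (trace_L2on T ht))|exact: L2onZ|].
  move=> t; rewrite /= in_itv/= => /andP[t0 _].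
  rewrite !normrM (ger0_norm b0) (ger0_norm B0) !(ger0_norm (expR_ge0 _)).
  apply: (le_trans (ler_wpM2l (expR_ge0 _) (cauchy_schwarz Lb (field_L2on t hf)))).
  rewrite -/(l2norm I01 b) -/(l2norm I01 (f t)).
  rewrite (_ : nu * t = - ((nu' - nu) * t) + nu' * t); last by ring.
  rewrite expRD; have := ler_wpM2l (mulr_ge0 b0 (expR_ge0 (- ((nu' - nu) * t)))) (H t t0).
  move: (l2norm _ _) (l2norm _ _) (expR _) (expR _) => a1 a2 a3 a4 h.
  by apply: (le_trans _ (le_trans h _)); rewrite le_eqVlt; apply/predU1P; left; ring.
rewrite (l2normZ _ Le) (ger0_norm nB) -mulrA [_ * B]mulrC; apply: (ler_wpM2l b0).
by apply: (ler_wpM2l B0); exact: exp_l2norm.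
Qed.

Lemma decays_ge0 nu B f : decays nu B f -> 0 <= B.
Proof. by move=> H; apply: le_trans (H 0 (lexx _)); rewrite mulr_ge0 ?expR_ge0 ?l2norm_ge0. Qed.

Lemma trace_decays_ge0 nu B (tau : R -> R) : trace_decays nu B tau -> 0 <= B.
Proof. by move=> H; apply: le_trans (H 0 (lexx _)); exact: l2norm_ge0. Qed.

Lemma locally_boundedD f g : field f -> field g -> locally_bounded f -> locally_bounded g ->
  locally_bounded (fun t x => f t x + g t x).
Proof.
move=> hf hg bf bg T; have [M1 H1] := bf T; have [M2 H2] := bg T.
exists (M1 + M2) => t ht; apply: le_trans (lerD (H1 t ht) (H2 t ht)).
exact: (l2normD (field_L2on t hf) (field_L2on t hg)).
Qed.

Lemma locally_boundedN f : field f -> locally_bounded f -> locally_bounded (fun t x => - f t x).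
Proof.
move=> hf bf T; have [M1 H1] := bf T; exists M1 => t ht; apply: le_trans (H1 t ht).
rewrite le_eqVlt; apply/predU1P; left; congr Num.sqrt; apply: eq_Rintegral => x _.
by rewrite sqrrN.
Qed.

Lemma locally_bounded_vol k f : continuous k -> field f -> locally_bounded f ->
  locally_bounded (fun t => vol k (f t)).
Proof.
move=> ck hf bf T; have [M1 H1] := bf T; have [M M0 kM] := square_bounded ck.
exists (M * M1) => t ht; apply: (le_trans (l2norm_vol ck kM (field_L2on t hf))).
by apply: (ler_wpM2l M0); exact: H1.
Qed.

End DecayAlgebra.

(** * Backstepping transformation of the observation error *)
Section Transformations.
Context {R : realType}.
Notation mu := (@lebesgue_measure R).
Notation I01 := (`[(0 : R), 1]%classic : set R).
Implicit Types (k F : R * R -> R) (f g : R -> R -> R) (h a : R -> R) (t x xi T : R).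

(** For speeds of opposite signs every characteristic crosses the triangle
    and meets the diagonal, where the integration starts. *)
Lemma vol_sol_transverse (d1 d2 : R) k F f (z0 : R -> R) (z : R -> R -> R) (tau0 tau1 : R -> R) :
  d1 * d2 < 0 ->
  continuous k -> continuous F -> along_characteristics d1 d2 k F ->
  sol d2 f z0 z tau0 tau1 ->
  sol d1 (fun t x => ((d1 - d2) * k (x, x)) * z t x + (d2 * k (x, 0)) * tau0 t
                     + vol F (z t) x + vol k (f t) x)
    (vol k z0) (fun t => vol k (z t)) (fun=> 0)
    (fun t => \int[mu]_(xi in I01) (k (1, xi) * z t xi)).
Proof.
move=> d12 ck cF kF Hs.
have d20 : d2 != 0 by apply/eqP => d2z; move: d12; rewrite d2z mulr0 ltxx.
pose c := d1 / d2.
have c0 : c < 0.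
  rewrite /c (_ : d1 / d2 = d1 * d2 * (d2 ^-1) ^+ 2); last by field.
  by rewrite nmulr_rlt0// exprn_even_gt0//= invr_eq0.
apply: (@vol_sol R d1 d2 c (1 - c)^-1 k F f z0 z tau0 tau1) => //; first by rewrite /c mulfVK.
move=> x xi [/= x0 [xix x1]].
have c1 : 0 < 1 - c by rewrite subr_gt0 (lt_trans c0).
have -> : 1 + c * (1 - c)^-1 = (1 - c)^-1 by field; rewrite gt_eqF.
split; rewrite /=.
  by rewrite divr_ge0 ?(ltW c1)// subr_ge0; apply: (le_trans _ (le_trans x0 xix)); rewrite mulr_le0_ge0// ltW.
split=> //; rewrite ler_pdivrMr// mul1r lerB//.
rewrite -[leLHS]mulr1 (ler_nM2l c0).
exact: le_trans x1.

Qed.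

(** For equal speeds the characteristics are parallel to the diagonal and
    start on the edge [xi = 0]. *)
Lemma vol_sol_parallel (v : R) k F f (z0 : R -> R) (z : R -> R -> R) (tau0 tau1 : R -> R) :
  v != 0 -> continuous k -> continuous F -> along_characteristics v v k F ->
  sol v f z0 z tau0 tau1 ->
  sol v (fun t x => ((v - v) * k (x, x)) * z t x + (v * k (x, 0)) * tau0 t
                     + vol F (z t) x + vol k (f t) x)
    (vol k z0) (fun t => vol k (z t)) (fun=> 0)
    (fun t => \int[mu]_(xi in I01) (k (1, xi) * z t xi)).
Proof.
move=> v0 ck cF kF Hs; apply: (@vol_sol R v v 1 0 k F f z0 z tau0 tau1) => //; first by rewrite mul1r.
move=> x xi [/= x0 [xix x1]]; rewrite !(mulr0, addr0, mulr1, mul1r); split => //=.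
split; first by rewrite subr_ge0.
by rewrite lerBlDr (le_trans x1)// lerDl.
Qed.

Lemma along_eq (d1 d2 : R) k k' F F' :
  (forall z, triangle z -> k z = k' z) -> (forall z, triangle z -> F z = F' z) ->
  along_characteristics d1 d2 k F -> along_characteristics d1 d2 k' F'.
Proof.
move=> kk FF kF x xi s s0 T1 T2; rewrite -!kk// (kF _ _ _ s0 T1 T2); congr (_ + _).
apply: eq_Rintegral => tau; rewrite inE/= in_itv/= => ht.
by rewrite FF//; exact: triangle_segment T1 T2.
Qed.

Lemma vol_one k h : vol k h 1 = \int[mu]_(xi in I01) (k (1, xi) * h xi).
Proof.
by apply: eq_Rintegral => xi; rewrite inE/= in_itv/= => /andP[_ ->].
Qed.

Section Resolvent.
Context (k F n e : R * R -> R) (ck : continuous k) (cF : continuous F).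
Context (cn : continuous n) (ce : continuous e).
Context (kn : forall z, triangle z -> n z + star k n z = k z).
Context (ke : forall z, triangle z -> e z + star k e z + star F n z = F z).

Lemma resolvent_vol h x : L2on I01 h -> 0 <= x <= 1 ->
  vol n h x + vol k (vol n h) x = vol k h x.
Proof.
move=> Lh hx; rewrite vol_star// -vol_kernelD//; last exact: star_continuous.
by apply: eq_vol_kernel => xi xi0 xix; apply: kn; split => //; split => //; case/andP: hx.
Qed.

(** The source that [n] creates is the one that [k] creates, seen through the
    inverse of the identity plus [vol k]. *)
Lemma resolvent_vol_source h x : L2on I01 h -> 0 <= x <= 1 ->
  vol e h x + vol k (vol e h) x = vol F (fun y => h y - vol n h y) x.
Proof.
move=> Lh hx; have Lv := vol_L2on cn Lh.
rewrite (_ : vol F (fun y => h y - vol n h y) x = vol F h x - vol F (vol n h) x); last first.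
  have Lv1 := L2onZ (-1) Lv.
  rewrite -[- vol F _ _]mulN1r -volZ// -volD//; apply: eq_vol => y _; ring.
rewrite vol_star// vol_star// -vol_kernelD//; last exact: star_continuous.
apply/eqP; rewrite eq_sym subr_eq; apply/eqP; rewrite -vol_kernelD//.
- apply: eq_vol_kernel => xi xi0 xix; rewrite ke//; split => //; split => //; by case/andP: hx.
- by apply: contD => //; exact: star_continuous.
- exact: star_continuous.
Qed.

(** A point injection at [0] acts through the column at [xi = 0] of the
    kernel, which obeys the resolvent identity by itself. *)
Lemma resolvent_column x : 0 <= x <= 1 ->
  n (x, 0) + vol k (fun y => n (y, 0)) x = k (x, 0).
Proof.
move=> /andP[x0 x1]; rewrite -kn; last by split.
by rewrite starE//; congr (_ + _); exact: (Rint_head (fun s => k (x, s) * n (s, 0)) 0 x1).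
Qed.

End Resolvent.

End Transformations.

Section ErrorSystem.
Context {R : realType}.
Notation mu := (@lebesgue_measure R).
Notation I01 := (`[(0 : R), 1]%classic : set R).
Implicit Types (k F : R * R -> R) (f g : R -> R -> R) (h a : R -> R) (t x xi T : R).

Context (m g1 g2 s11 s12 s21 s22 rho1 rho2 : R) (al th1 th2 : R -> R).
Context (m_gt0 : 0 < m) (g1_gt0 : 0 < g1) (g2_gt0 : 0 < g2).
Context (cal : continuous al) (cth1 : continuous th1) (cth2 : continuous th2).
Context (m1 m2 m3 : R * R -> R).
Context (cm1 : continuous m1) (cm2 : continuous m2) (cm3 : continuous m3).

Let Fo1 (z : R * R) := s11 * m1 z + s12 * m2 z + al z.1 * m3 z.
Let Fo2 (z : R * R) := s21 * m1 z + s22 * m2 z + al z.1 * m3 z.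
Let Fo3 (z : R * R) := th1 z.1 * m1 z + th2 z.1 * m2 z.

Context (along1 : along_characteristics g1 (- m) m1 Fo1).
Context (along2 : along_characteristics g2 (- m) m2 Fo2).
Context (along3 : along_characteristics (- m) (- m) m3 Fo3).
Context (diag1 : forall x, 0 <= x <= 1 -> m1 (x, x) = al x / (g1 + m)).
Context (diag2 : forall x, 0 <= x <= 1 -> m2 (x, x) = al x / (g2 + m)).
Context (edge : forall xi, 0 <= xi <= 1 -> m3 (1, xi) = rho1 * m1 (1, xi) + rho2 * m2 (1, xi)).

Let comp_fst (a : R -> R) : continuous a -> continuous (fun z : R * R => a z.1).
Proof. by move=> ca; apply: (cont_comp (f := fun z : R * R => z.1) (g := a)) => //; exact: cont_fst. Qed.

Lemma cont_Fo3 : continuous Fo3.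
Proof. exact: (contD (contM (comp_fst cth1) cm1) (contM (comp_fst cth2) cm2)). Qed.

Lemma vol_transport_source s s' h x : L2on I01 h ->
  vol (fun z => s * m1 z + s' * m2 z + al z.1 * m3 z) h x =
  s * vol m1 h x + s' * vol m2 h x + al x * vol m3 h x.
Proof.
move=> Lh.
have c1 : continuous (fun z => s * m1 z) by exact: contM (@cont_cst _ _ s) cm1.
have c2 : continuous (fun z => s' * m2 z) by exact: contM (@cont_cst _ _ s') cm2.
have c3 : continuous (fun z => al z.1 * m3 z) by exact: contM (comp_fst cal) cm3.
rewrite (vol_kernelD _ (contD c1 c2) c3 Lh) (vol_kernelD _ c1 c2 Lh).
rewrite (vol_kernel_left al _ cm3 Lh).
by rewrite (vol_kernel_left (fun=> s) _ cm1 Lh) (vol_kernel_left (fun=> s') _ cm2 Lh).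
Qed.

Lemma vol_boundary_source h x : L2on I01 h ->
  vol Fo3 h x = th1 x * vol m1 h x + th2 x * vol m2 h x.
Proof.
move=> Lh.
have c1 : continuous (fun z => th1 z.1 * m1 z) by exact: contM (comp_fst cth1) cm1.
have c2 : continuous (fun z => th2 z.1 * m2 z) by exact: contM (comp_fst cth2) cm2.
rewrite (vol_kernelD _ c1 c2 Lh).
by rewrite (vol_kernel_left th1 _ cm1 Lh) (vol_kernel_left th2 _ cm2 Lh).
Qed.

Context (n e : R * R -> R) (cn : continuous n) (ce : continuous e).
Context (along_n : along_characteristics (- m) (- m) n e).
Context (nE : forall z, triangle z -> n z + star m3 n z = m3 z).
Context (eE : forall z, triangle z -> e z + star m3 e z + star Fo3 n z = Fo3 z).

Let p1 x := - m * m1 (x, 0).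
Let p2 x := - m * m2 (x, 0).
Let p3 x := - m * m3 (x, 0).

Context (u10 u20 w0 : R -> R) (u1 u2 w : R -> R -> R) (tau tr1 tr2 : R -> R).
Let src1 (s s' : R) (p : R -> R) t x := s * u1 t x + s' * u2 t x + al x * w t x + p x * tau t.
Let src3 t x := th1 x * u1 t x + th2 x * u2 t x + p3 x * tau t.
Context (sol1 : sol g1 (src1 s11 s12 p1) u10 u1 (fun=> 0) tr1).
Context (sol2 : sol g2 (src1 s21 s22 p2) u20 u2 (fun=> 0) tr2).
Context (sol3 : sol (- m) src3 w0 w tau (fun t => rho1 * tr1 t + rho2 * tr2 t)).

(** The solution of [w = beta + vol m3 beta], [n] being the resolvent of
    [m3]. *)
Definition beta t x := w t x - vol n (w t) x.
(** The source term as it comes out of [vol_sol_parallel]; [beta_sourceE]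
    says what it is. *)
Definition beta_source t x :=
  src3 t x - (((- m - - m) * n (x, x)) * w t x + (- m * n (x, 0)) * tau t
     + vol e (w t) x + vol n (src3 t) x).
Definition ahat (k : R * R -> R) (u : R -> R -> R) t x := u t x - vol k (beta t) x.

Let Lw t : L2on I01 (w t). Proof. by case: sol3 => -[]. Qed.
Let Lu1 t : L2on I01 (u1 t). Proof. by case: sol1 => -[]. Qed.
Let Lu2 t : L2on I01 (u2 t). Proof. by case: sol2 => -[]. Qed.
Let Lsrc3 t : L2on I01 (src3 t). Proof. by case: sol3 => _ -[]. Qed.
Let m_neq0 : - m != 0. Proof. by rewrite oppr_eq0 gt_eqF. Qed.

Lemma beta_sol : sol (- m) beta_source (fun x => w0 x - vol n w0 x) beta
  (fun t => tau t - 0)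
  (fun t => (rho1 * tr1 t + rho2 * tr2 t) - \int[mu]_(xi in I01) (n (1, xi) * w t xi)).
Proof. exact: (solB sol3 (vol_sol_parallel m_neq0 cn ce along_n sol3)). Qed.

Let Lbeta t : L2on I01 (beta t). Proof. by case: beta_sol => -[]. Qed.
Let LG t : L2on I01 (beta_source t). Proof. by case: beta_sol => _ -[]. Qed.

Lemma beta_inverse t x : 0 <= x <= 1 -> beta t x + vol m3 (beta t) x = w t x.
Proof.
move=> hx; have Lv := vol_L2on cn (Lw t).
have -> : vol m3 (beta t) x = vol m3 (w t) x - vol m3 (vol n (w t)) x.
  have Lv1 := L2onZ (-1) Lv.
  rewrite -[- vol m3 _ _]mulN1r -volZ// -volD//; apply: eq_vol => y _.
  by rewrite /beta; ring.
by rewrite -(resolvent_vol cm3 cn nE (Lw t) hx) /beta; ring.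
Qed.

Let source_algebra (f vf vn vvn c n0 vn0 m30 ve vve B T : R) :
  vn + vvn = vf -> n0 + vn0 = m30 -> ve + vve = B -> f = T + (- m * m30) * c ->
  (f + (m * c) * n0 + -1 * ve + -1 * vn) +
  (vf + (m * c) * vn0 + -1 * vve + -1 * vvn) = T - B.
Proof. by move=> <- <- <- ->; ring. Qed.

(** The equation of the kernel [m3] is the cancellation, after composition
    with the identity plus [vol m3], of everything except the transformed
    states [ahat]; the gain of [w] removes [tau]. *)
Lemma beta_sourceE t x : 0 <= x <= 1 ->
  beta_source t x + vol m3 (beta_source t) x = th1 x * ahat m1 u1 t x + th2 x * ahat m2 u2 t x.
Proof.
move=> hx.
have cn0 := cont_line2 (xi := 0) cn.
have L1 : L2on I01 (fun y => (m * tau t) * n (y, 0)) := L2onZ _ (L2on_cont 0 1 cn0).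
have L2 : L2on I01 (fun y => -1 * vol e (w t) y) := L2onZ _ (vol_L2on ce (Lw t)).
have L3 : L2on I01 (fun y => -1 * vol n (src3 t) y) := L2onZ _ (vol_L2on cn (Lsrc3 t)).
have GE y : beta_source t y = src3 t y + (m * tau t) * n (y, 0) + -1 * vol e (w t) y + -1 * vol n (src3 t) y.
  by rewrite /beta_source subrr; move: (src3 t y) (vol e _ _) (vol n (src3 t) y) => A B C; ring.
have -> : vol m3 (beta_source t) x = vol m3 (src3 t) x + (m * tau t) * vol m3 (fun y => n (y, 0)) x
    + -1 * vol m3 (vol e (w t)) x + -1 * vol m3 (vol n (src3 t)) x.
  have L01 := L2onD (Lsrc3 t) L1; have L012 := L2onD L01 L2.
  rewrite (eq_vol m3 x (fun y _ => GE y)).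
  rewrite (volD x cm3 L012 L3) (volD x cm3 L01 L2) (volD x cm3 (Lsrc3 t) L1).
  rewrite (volZ _ x cm3 (L2on_cont 0 1 cn0)) (volZ _ x cm3 (vol_L2on ce (Lw t))).
  by rewrite (volZ _ x cm3 (vol_L2on cn (Lsrc3 t))).
rewrite GE (source_algebra (resolvent_vol cm3 cn nE (Lsrc3 t) hx) (resolvent_column cm3 cn nE hx)
  (resolvent_vol_source cm3 cont_Fo3 cn ce eE (Lw t) hx) (erefl _)).
rewrite -/(beta t) (vol_boundary_source x (Lbeta t)) /ahat.
by clear; ring.
Qed.

(** The condition on the edge [x = 1] matches the reflections of the error,
    so that the boundary relation survives the transformation. *)
Let edge_vol t : \int[mu]_(xi in I01) (n (1, xi) * w t xi) =
  rho1 * \int[mu]_(xi in I01) (m1 (1, xi) * beta t xi) + rho2 * \int[mu]_(xi in I01) (m2 (1, xi) * beta t xi).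
Proof.
have h1 : 0 <= (1 : R) <= 1 by rewrite ler01 lexx.
have E : vol n (w t) 1 = vol m3 (beta t) 1.
  have := beta_inverse t h1; rewrite {1}/beta.
  move: (vol n (w t) 1) (w t 1) (vol m3 _ 1) => a b d H.
  by apply: (addrI (b - a)); rewrite H subrK.
rewrite -vol_one E vol_one.
have c1 := cont_line1 (x := 1) cm1; have c2 := cont_line1 (x := 1) cm2.
have i1 := int_contM c1 (L2on_int (Lbeta t)); have i2 := int_contM c2 (L2on_int (Lbeta t)).
have mI : measurable I01 by exact: measurable_itv.
rewrite -(RintZ mI _ i1) -(RintZ mI _ i2) -(RintD mI (intZ mI rho1 i1) (intZ mI rho2 i2)).
apply: eq_Rintegral => xi; rewrite inE/= in_itv/= => hxi; rewrite edge//.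
by clear; ring.
Qed.

Lemma beta_trace1 t :
  (rho1 * tr1 t + rho2 * tr2 t) - \int[mu]_(xi in I01) (n (1, xi) * w t xi) =
  rho1 * (tr1 t - \int[mu]_(xi in I01) (m1 (1, xi) * beta t xi))
  + rho2 * (tr2 t - \int[mu]_(xi in I01) (m2 (1, xi) * beta t xi)).
Proof. by rewrite edge_vol; clear; ring. Qed.

Lemma ahat_field k u : continuous k -> field u -> field (ahat k u).
Proof.
move=> ck hu; apply: fieldD => //; apply: fieldN; apply: field_vol => //.
by case: beta_sol.
Qed.

(** The diagonal value of [k] cancels [al x * w t x], its equation the
    remaining coupling to [beta], and the gain the injection of [tau]; there
    remains a term with the source of [beta], which is itself controlled by
    [ahat]. *)
Lemma ahat_sol gi s s' k (u0 : R -> R) (u : R -> R -> R) (tr : R -> R) :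
  0 < gi -> continuous k ->
  along_characteristics gi (- m) k (fun z => s * m1 z + s' * m2 z + al z.1 * m3 z) ->
  (forall x, 0 <= x <= 1 -> k (x, x) = al x / (gi + m)) ->
  sol gi (src1 s s' (fun x => - m * k (x, 0))) u0 u (fun=> 0) tr ->
  sol gi (fun t x => s * ahat m1 u1 t x + s' * ahat m2 u2 t x - vol k (beta_source t) x)
    (fun x => u0 x - vol k (fun y => w0 y - vol n w0 y) x) (ahat k u) (fun=> 0)
    (fun t => tr t - \int[mu]_(xi in I01) (k (1, xi) * beta t xi)).
Proof.
move=> gi0 ck kF diag Hs.
have cF : continuous (fun z => s * m1 z + s' * m2 z + al z.1 * m3 z).
  exact: (contD (contD (contM (@cont_cst _ _ s) cm1) (contM (@cont_cst _ _ s') cm2)) (contM (comp_fst cal) cm3)).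
have neg : gi * - m < 0 by rewrite mulrN oppr_lt0 mulr_gt0.
have := solB Hs (vol_sol_transverse neg ck cF kF beta_sol).
have -> : (fun _ : R => 0 - 0) = (fun=> 0 : R) by apply/funext => _; rewrite subrr.
have hu1 : field u1 by case: sol1. have hu2 : field u2 by case: sol2.
have hG : field beta_source by case: beta_sol.
apply: sol_eq.
  exact: (fieldD (fieldD (fieldZ s (ahat_field cm1 hu1)) (fieldZ s' (ahat_field cm2 hu2))) (fieldN (field_vol ck hG))).
move=> t x _ hx; rewrite (vol_transport_source s s' x (Lbeta t)) diag// /src1 /ahat.
rewrite -(beta_inverse t hx); have gm : gi + m != 0 by rewrite gt_eqF// addr_gt0.
move: (vol m1 (beta t) x) (vol m2 (beta t) x) (vol m3 (beta t) x) (vol k _ x) (beta t x) (u1 t x) (u2 t x) (tau t) (al x) (k (x, 0)) => v1 v2 v3 vG b a1 a2 t1 a k0.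
by rewrite opprK; field.
Qed.

End ErrorSystem.

(** * Decay of the observation error *)
Section Cascade.
Context {R : realType}.
Notation mu := (@lebesgue_measure R).
Notation I01 := (`[(0 : R), 1]%classic : set R).
Implicit Types (k F : R * R -> R) (f g : R -> R -> R) (h a : R -> R) (t x xi T lam : R).

(** The largeness of the weight beyond which [wnorm_half] and
    [volterra_bound] apply. *)
Lemma small_weight (M : R) : 0 <= M -> exists2 lam0 : R, 0 < lam0 & forall lam, lam0 <= lam ->
  M * Num.sqrt (2 * lam)^-1 <= 2^-1 /\ Num.sqrt (2 * lam)^-1 <= 1.
Proof.
(* With this bound [2 * lam] is at least the square of [2 * (M + 1)]. *)
move=> M0; exists (2 * (M + 1) ^+ 2); first by rewrite mulr_gt0// exprn_gt0// ltr_wpDl.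
move=> lam hlam.
have M1 : 0 < M + 1 by rewrite ltr_wpDl.
have h4 : (2 * (M + 1)) ^+ 2 <= 2 * lam.
  apply: le_trans (ler_wpM2l (ler0n _ 2) hlam); rewrite le_eqVlt; apply/predU1P; left; ring.
have p4 : 0 < (2 * (M + 1)) ^+ 2 by rewrite exprn_gt0// mulr_gt0.
have l0 : 0 < 2 * lam := lt_le_trans p4 h4.
have sq : Num.sqrt (2 * lam)^-1 <= (2 * (M + 1))^-1.
  have i0 : 0 <= (2 * (M + 1))^-1 by rewrite invr_ge0 mulr_ge0// ltW.
  rewrite -[leRHS]ger0_norm// -sqrtr_sqr; apply: ler_wsqrtr.
  by rewrite exprVn lef_pV2 ?posrE.
split.
  apply: (le_trans (ler_wpM2l M0 sq)); rewrite invfM mulrCA ler_piMr// ler_pdivrMr// mul1r.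
  by rewrite lerDl.
apply: (le_trans sq); rewrite invf_le1 ?mulr_gt0//.
apply: (@le_trans _ _ (2 * 1)); first by rewrite mulr1 ler1n.
by rewrite ler_pM2l// lerDr.
Qed.

(** In this norm [vol k] has norm at most 1/2, which inverts the perturbed
    identity with a constant independent of [lam]. *)
Lemma wnorm_half k M lam h h' : continuous k -> 0 < lam ->
  (forall x xi, 0 <= x <= 1 -> 0 <= xi <= 1 -> `|k (x, xi)| <= M) ->
  M * Num.sqrt (2 * lam)^-1 <= 2^-1 -> L2on I01 h -> L2on I01 h' ->
  (forall x, 0 <= x <= 1 -> h x + vol k h x = h' x) ->
  wnorm lam h <= 2 * wnorm lam h'.
Proof.
move=> ck lam0 kM small Lh Lh' E; have Lv := vol_L2on ck Lh.
have H : wnorm lam h <= wnorm lam h' + 2^-1 * wnorm lam h.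
  rewrite [leLHS](@eq_wnorm _ lam h (fun x => h' x + -1 * vol k h x)); last first.
    by move=> x /E <-; ring.
  apply: (le_trans (wnormD lam Lh' (L2onZ (-1) Lv))); rewrite lerD2l wnormZ// normrN1 mul1r.
  apply: (le_trans (wnorm_vol_le ck lam0 kM Lh)).
  by rewrite ler_wpM2r ?wnorm_ge0.
by move: H; move: (wnorm lam h) (wnorm lam h') => a b; clear; lra.
Qed.

Lemma volterra_bound k M lam h : continuous k -> 0 < lam -> 0 <= M ->
  (forall x xi, 0 <= x <= 1 -> 0 <= xi <= 1 -> `|k (x, xi)| <= M) ->
  Num.sqrt (2 * lam)^-1 <= 1 -> L2on I01 h -> wnorm lam (vol k h) <= M * wnorm lam h.
Proof.
move=> ck lam0 M0 kM s1 Lh; apply: (le_trans (wnorm_vol_le ck lam0 kM Lh)).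
by rewrite ler_wpM2r ?wnorm_ge0// ler_piMr.
Qed.

Let source_algebra (s s' M A1 A2 n1 n2 nG C : R) : 0 <= s -> 0 <= s' -> 0 <= M ->
  0 <= A1 -> 0 <= A2 -> 0 <= n1 -> 0 <= n2 -> nG <= 2 * (A1 * n1 + A2 * n2) ->
  s + s' + M * (2 * (A1 + A2)) <= C -> s * n1 + s' * n2 + M * nG <= C * (n1 + n2).
Proof.
move=> s0 s'0 M0 A10 A20 n10 n20 hG hC.
have n12 := addr_ge0 n10 n20.
apply: le_trans (ler_wpM2r n12 hC).
have := ler_wpM2l M0 hG; have := mulr_ge0 s0 n20; have := mulr_ge0 s'0 n10.
have := mulr_ge0 (mulr_ge0 M0 A10) n20; have := mulr_ge0 (mulr_ge0 M0 A20) n10; lra.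
Qed.

(** The source [h] of [beta] is given implicitly by [a1] and [a2];
    eliminating it gives a constant [C] independent of [lam], as
    [coupled_decay] requires. *)
Lemma coupling_bound lam s s' k M (h a1 a2 : R -> R) A1 A2 (th1 th2 : R -> R) C k3 M3 :
  continuous k -> continuous k3 -> continuous th1 -> continuous th2 -> 0 < lam -> 0 <= M ->
  (forall x xi, 0 <= x <= 1 -> 0 <= xi <= 1 -> `|k (x, xi)| <= M) ->
  (forall x xi, 0 <= x <= 1 -> 0 <= xi <= 1 -> `|k3 (x, xi)| <= M3) ->
  (forall x, 0 <= x <= 1 -> `|th1 x| <= A1) -> (forall x, 0 <= x <= 1 -> `|th2 x| <= A2) ->
  M3 * Num.sqrt (2 * lam)^-1 <= 2^-1 -> Num.sqrt (2 * lam)^-1 <= 1 ->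
  L2on I01 h -> L2on I01 a1 -> L2on I01 a2 ->
  (forall x, 0 <= x <= 1 -> h x + vol k3 h x = th1 x * a1 x + th2 x * a2 x) ->
  `|s| + `|s'| + M * (2 * (A1 + A2)) <= C ->
  wnorm lam h <= 2 * (A1 * wnorm lam a1 + A2 * wnorm lam a2) /\
  wnorm lam (fun x => s * a1 x + s' * a2 x - vol k h x) <= C * (wnorm lam a1 + wnorm lam a2).
Proof.
move=> ck ck3 cth1 cth2 lam0 M0 kM k3M th1A th2A small s1 Lh La1 La2 E hC.
have z1 : 0 <= (0 : R) <= 1 by rewrite lexx ler01.
have A10 : 0 <= A1 := le_trans (normr_ge0 _) (th1A 0 z1).
have A20 : 0 <= A2 := le_trans (normr_ge0 _) (th2A 0 z1).
have L1 := L2on_contM cth1 La1; have L2 := L2on_contM cth2 La2.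
have nh : wnorm lam h <= 2 * (A1 * wnorm lam a1 + A2 * wnorm lam a2).
  apply: (le_trans (wnorm_half ck3 lam0 k3M small Lh (L2onD L1 L2) E)).
  apply: (ler_wpM2l (ler0n _ 2)); apply: (le_trans (wnormD lam L1 L2)).
  by apply: lerD; exact: wnormM.
split => //.
have Lv := vol_L2on ck Lh; have Lv1 := L2onZ (-1) Lv.
have Ls := L2onZ s La1; have Ls' := L2onZ s' La2.
rewrite (@eq_wnorm _ lam _ (fun x => (s * a1 x + s' * a2 x) + -1 * vol k h x)); last first.
  by move=> x _; rewrite mulN1r.
apply: (le_trans (wnormD lam (L2onD Ls Ls') Lv1)).
apply: (le_trans (lerD (wnormD lam Ls Ls') (lexx _))).
rewrite !wnormZ// normrN1 mul1r.
apply: (@le_trans _ _ (`|s| * wnorm lam a1 + `|s'| * wnorm lam a2 + M * wnorm lam h)).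
  by rewrite lerD2l; exact: volterra_bound.
by apply: (source_algebra (A1 := A1) (A2 := A2)) => //; exact: wnorm_ge0.
Qed.

End Cascade.

Section CascadeDecay.
Context {R : realType}.
Notation mu := (@lebesgue_measure R).
Notation I01 := (`[(0 : R), 1]%classic : set R).
Implicit Types (k F : R * R -> R) (f g : R -> R -> R) (h a : R -> R) (t x xi T lam : R).

Let plain_algebra (E lamn A1 A2 n1 n2 w1 w2 S nG : R) : 0 <= E -> 0 <= A1 -> 0 <= A2 ->
  0 <= lamn -> nG <= E * (2 * (A1 * w1 + A2 * w2)) -> w1 <= E * n1 -> w2 <= E * n2 ->
  lamn * n1 <= S -> lamn * n2 <= S ->
  lamn * nG <= E * (2 * (A1 * E + A2 * E)) * S.
Proof.
move=> E0 A10 A20 l0 hG h1 h2 s1 s2.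
have AE1 := mulr_ge0 A10 E0; have AE2 := mulr_ge0 A20 E0.
apply: (@le_trans _ _ (E * (2 * (A1 * E * (lamn * n1) + A2 * E * (lamn * n2))))); last first.
  rewrite -[leRHS]mulrA; apply: (ler_wpM2l E0); rewrite -[leRHS]mulrA; apply: (ler_wpM2l (ler0n _ 2)).
  by rewrite mulrDl; apply: lerD; [exact: (ler_wpM2l AE1)|exact: (ler_wpM2l AE2)].
apply: (le_trans (ler_wpM2l l0 hG)).
rewrite [leLHS](_ : _ = E * (2 * (lamn * (A1 * w1) + lamn * (A2 * w2)))); last by ring.
apply: (ler_wpM2l E0); apply: (ler_wpM2l (ler0n _ 2)).
rewrite (_ : A1 * E * (lamn * n1) = lamn * (A1 * (E * n1))); last by ring.
rewrite (_ : A2 * E * (lamn * n2) = lamn * (A2 * (E * n2))); last by ring.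
by apply: lerD; apply: (ler_wpM2l l0); [exact: (ler_wpM2l A10)|exact: (ler_wpM2l A20)].
Qed.

Lemma decays_source s s' k M (g1 g2 G : R -> R -> R) nu B BG : continuous k -> field g1 -> field g2 -> field G ->
  (forall x xi, 0 <= x <= 1 -> 0 <= xi <= 1 -> `|k (x, xi)| <= M) ->
  decays nu B g1 -> decays nu B g2 -> decays nu BG G ->
  decays nu (`|s| * B + `|s'| * B + M * BG)
    (fun t x => s * g1 t x + s' * g2 t x - vol k (G t) x).
Proof.
move=> ck h1 h2 hG kM d1 d2 dG.
have d := decaysD (fieldD (fieldZ s h1) (fieldZ s' h2)) (fieldZ (-1) (field_vol ck hG))
  (decaysD (fieldZ s h1) (fieldZ s' h2) (decaysZ s h1 d1) (decaysZ s' h2 d2))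
  (decaysZ (-1) (field_vol ck hG) (decays_vol ck hG kM dG)).
move: d; rewrite normrN1 mul1r; apply: decays_eq => t x _ _.
by rewrite mulN1r.
Qed.

(** The pair [a1], [a2] has no inflow and decays at rate 2; its traces and
    the source [G] decay in the mean at rate 1, and feed the equation of [b],
    whose state and outgoing trace keep this rate. *)
Lemma cascade_decay (m g1 g2 s11 s12 s21 s22 rho1 rho2 : R) (th1 th2 : R -> R) (m1 m2 m3 : R * R -> R) :
  0 < m -> 0 < g1 -> 0 < g2 -> continuous th1 -> continuous th2 ->
  continuous m1 -> continuous m2 -> continuous m3 ->
  exists2 C : R, 0 <= C & forall (a10 a20 b0 : R -> R) (a1 a2 b G : R -> R -> R) (tau t1 t2 : R -> R),
    sol g1 (fun t x => s11 * a1 t x + s12 * a2 t x - vol m1 (G t) x) a10 a1 (fun=> 0) t1 ->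
    sol g2 (fun t x => s21 * a1 t x + s22 * a2 t x - vol m2 (G t) x) a20 a2 (fun=> 0) t2 ->
    sol (- m) G b0 b tau (fun t => rho1 * t1 t + rho2 * t2 t) ->
    (forall t x, 0 <= x <= 1 -> G t x + vol m3 (G t) x = th1 x * a1 t x + th2 x * a2 t x) ->
    locally_bounded a1 -> locally_bounded a2 ->
    let B := C * (l2norm I01 a10 + l2norm I01 a20 + l2norm I01 b0) in
    [/\ decays 1 B a1, decays 1 B a2, decays 1 B b,
        trace_decays 1 B tau & trace_decays 1 B t1 /\ trace_decays 1 B t2].
Proof.
move=> m_gt0 g10 g20 cth1 cth2 cm1 cm2 cm3.
have [M1 M10 m1M] := square_bounded cm1; have [M2 M20 m2M] := square_bounded cm2.
have [M3 M30 m3M] := square_bounded cm3.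
have [A1 A10 th1A] := continuous_segment_bounded 0 1 cth1.
have [A2 A20 th2A] := continuous_segment_bounded 0 1 cth2.
have [lam0 lam00 small] := small_weight M30.
pose C1 := `|s11| + `|s12| + M1 * (2 * (A1 + A2)); pose C2 := `|s21| + `|s22| + M2 * (2 * (A1 + A2)).
have C10 : 0 <= C1 by rewrite !addr_ge0// mulr_ge0// mulr_ge0// addr_ge0.
have C20 : 0 <= C2 by rewrite !addr_ge0// mulr_ge0// mulr_ge0// addr_ge0.
have [lam [D [lamp lam0l D0 coupled]]] :=
  coupled_decay lam0 g10 g20 (ler0n R 2) (addr_ge0 C10 C20).
have [sm3 sm1] := small lam lam0l.
have m_neq0 : - m != 0 by rewrite oppr_eq0 gt_eqF.
have [T1 T10 tr1] := @transport_decay R g1 0 1 1 (lt0r_neq0 g10) ler01.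
have [T2 T20 tr2] := @transport_decay R g2 0 1 1 (lt0r_neq0 g20) ler01.
have [T3 T30 tr3] := @transport_decay R (- m) 1 0 1 m_neq0 ler01.
set E := expR `|lam|; have E0 : 0 <= E := expR_ge0 _.
pose cG := E * (2 * (A1 * E + A2 * E)) * D.
have cG0 : 0 <= cG by rewrite mulr_ge0// mulr_ge0// mulr_ge0// addr_ge0// mulr_ge0.
pose cs1 := `|s11| * D + `|s12| * D + M1 * cG; pose cs2 := `|s21| * D + `|s22| * D + M2 * cG.
have cs10 : 0 <= cs1 by rewrite !addr_ge0// mulr_ge0.
have cs20 : 0 <= cs2 by rewrite !addr_ge0// mulr_ge0.
pose ct1 := T1 * (1 + cs1); pose ct2 := T2 * (1 + cs2).
have ct10 : 0 <= ct1 by rewrite mulr_ge0// addr_ge0.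
have ct20 : 0 <= ct2 by rewrite mulr_ge0// addr_ge0.
pose cb := T3 * (1 + (`|rho1| * ct1 + `|rho2| * ct2) + cG).
pose C := Num.max (Num.max D (Num.max ct1 ct2)) cb.
have CD : D <= C by rewrite !le_max lexx.
have Cc1 : ct1 <= C by rewrite !le_max lexx !orbT.
have Cc2 : ct2 <= C by rewrite !le_max lexx !orbT.
have Ccb : cb <= C by rewrite !le_max lexx !orbT.
exists C; first exact: le_trans D0 CD.
move=> a10 a20 b0 a1 a2 b G tau t1 t2 Hs1 Hs2 Hs3 HG lb1 lb2 B.
have [h1 hf1 L10 [_ ht1] _] := Hs1; have [h2 hf2 L20 [_ ht2] _] := Hs2.
have [hb hG L30 [htau _] _] := Hs3.
have La1 t : L2on I01 (a1 t) by case: h1.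
have La2 t : L2on I01 (a2 t) by case: h2.
have LG t : L2on I01 (G t) by case: hG.
set N := l2norm I01 a10 + l2norm I01 a20 + l2norm I01 b0 in B *.
have n1 : 0 <= l2norm I01 a10 := l2norm_ge0 _ _.
have n2 : 0 <= l2norm I01 a20 := l2norm_ge0 _ _.
have n3 : 0 <= l2norm I01 b0 := l2norm_ge0 _ _.
have N0 : 0 <= N by rewrite !addr_ge0.
have N1 : l2norm I01 a10 <= N by rewrite /N -addrA lerDl addr_ge0.
have N2 : l2norm I01 a20 <= N by rewrite /N addrAC lerDr addr_ge0.
have N3 : l2norm I01 b0 <= N by rewrite /N lerDr addr_ge0.
have toB c : c <= C -> c * N <= B by move=> cC; exact: (ler_wpM2r N0).
have bd1 t : wnorm lam (G t) <= 2 * (A1 * wnorm lam (a1 t) + A2 * wnorm lam (a2 t)) /\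
    wnorm lam (fun x => s11 * a1 t x + s12 * a2 t x - vol m1 (G t) x) <= C1 * (wnorm lam (a1 t) + wnorm lam (a2 t)) := coupling_bound cm1 cm3 cth1 cth2 lamp M10 m1M m3M th1A th2A sm3 sm1 (LG t) (La1 t) (La2 t)
  (HG t) (lexx C1).
have bd2 t : wnorm lam (G t) <= 2 * (A1 * wnorm lam (a1 t) + A2 * wnorm lam (a2 t)) /\
    wnorm lam (fun x => s21 * a1 t x + s22 * a2 t x - vol m2 (G t) x) <= C2 * (wnorm lam (a1 t) + wnorm lam (a2 t)) := coupling_bound cm2 cm3 cth1 cth2 lamp M20 m2M m3M th1A th2A sm3 sm1 (LG t) (La1 t) (La2 t)
  (HG t) (lexx C2).
have [da1 da2] : decays 2 (D * N) a1 /\ decays 2 (D * N) a2.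
  have ie T : mu.-integrable `[0, T] (EFin \o (fun=> 0 : R)) := int_cst 0 T 0.
  have eB T : 0 <= T -> \int[mu]_(t in `[0, T]) (expR (2 * t) * 0) <= 0.
    move=> _; rewrite (_ : \int[mu]_(t in _) _ = \int[mu]_(t in `[0, T]) 0).
      by rewrite Rintegral_cst//= mul0r.
    by apply: eq_Rintegral => t _; rewrite mulr0.
  have b1 t : 0 <= t -> wnorm lam (fun x => s11 * a1 t x + s12 * a2 t x - vol m1 (G t) x) <=
      (C1 + C2) * (wnorm lam (a1 t) + wnorm lam (a2 t)) + 0.
    move=> _; rewrite addr0; apply: (le_trans (bd1 t).2).
    by rewrite ler_wpM2r ?addr_ge0 ?wnorm_ge0// lerDl.
  have b2 t : 0 <= t -> wnorm lam (fun x => s21 * a1 t x + s22 * a2 t x - vol m2 (G t) x) <=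
      (C1 + C2) * (wnorm lam (a1 t) + wnorm lam (a2 t)) + 0.
    move=> _; rewrite addr0; apply: (le_trans (bd2 t).2).
    by rewrite ler_wpM2r ?addr_ge0 ?wnorm_ge0// lerDr.
  have [d1 d2] := coupled _ _ _ _ _ _ _ _ _ _ (fun=> 0) 0 0 Hs1 Hs2 lb1 lb2 (@trace_decays0 R 2) (@trace_decays0 R 2)
    ie (fun _ _ => lexx _) eB b1 b2.
  have NN : D * (l2norm I01 a10 + l2norm I01 a20 + 0 + 0) <= D * N.
    by apply: (ler_wpM2l D0); rewrite !addr0 lerDl.
  by split; [exact: (decays_le (lexx _) NN d1)|exact: (decays_le (lexx _) NN d2)].
have dG : decays 2 (cG * N) G.
  move=> t t0; rewrite /cG -[_ * D * N]mulrA.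
  apply: (plain_algebra E0 A10 A20 (expR_ge0 _) _ (wnorm_le_l2 lam (La1 t)) (wnorm_le_l2 lam (La2 t)) (da1 t t0) (da2 t t0)).
  apply: (le_trans (l2_le_wnorm lam (LG t))); apply: (ler_wpM2l E0).
  exact: (bd1 t).1.
have one2 : (1 : R) < 2 by rewrite ltr1n.
have e21 : ((2 : R) - 1)^-1 = 1 by rewrite (_ : (2 : R) - 1 = 1) ?invr1//; ring.
have ds1 := decays_source s11 s12 cm1 h1 h2 hG m1M da1 da2 dG.
have ds2 := decays_source s21 s22 cm2 h1 h2 hG m2M da1 da2 dG.
have is1 := decays_int one2 hf1 (decays_ge0 ds1) ds1.
have is2 := decays_int one2 hf2 (decays_ge0 ds2) ds2.
have isG := decays_int one2 hG (decays_ge0 dG) dG.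
rewrite e21 mul1r in is1; rewrite e21 mul1r in is2; rewrite e21 mul1r in isG.
have in1 : inflow g1 0 (fun=> 0) t1 (fun=> 0) by left.
have in2 : inflow g2 0 (fun=> 0) t2 (fun=> 0) by left.
have ou1 : inflow (- g1) 1 (fun=> 0) t1 t1 by right; rewrite oppr_lt0.
have ou2 : inflow (- g2) 1 (fun=> 0) t2 t2 by right; rewrite oppr_lt0.
have [_ dt1'] := tr1 _ _ _ _ _ _ _ _ _ Hs1 in1 ou1 (@trace_decays0 R 1) is1.
have [_ dt2'] := tr2 _ _ _ _ _ _ _ _ _ Hs2 in2 ou2 (@trace_decays0 R 1) is2.
have dt1 : trace_decays 1 (ct1 * N) t1.
  apply: (trace_decays_le ht1 (lexx _) _ dt1'); rewrite /ct1 -mulrA; apply: (ler_wpM2l T10).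
  rewrite addr0 [leRHS]mulrDl [1 * N]mul1r; apply: lerD => //.
  by rewrite /cs1 le_eqVlt; apply/predU1P; left; ring.
have dt2 : trace_decays 1 (ct2 * N) t2.
  apply: (trace_decays_le ht2 (lexx _) _ dt2'); rewrite /ct2 -mulrA; apply: (ler_wpM2l T20).
  rewrite addr0 [leRHS]mulrDl [1 * N]mul1r; apply: lerD => //.
  by rewrite /cs2 le_eqVlt; apply/predU1P; left; ring.
have din := trace_decaysD (traceZ rho1 ht1) (traceZ rho2 ht2) (trace_decaysZ rho1 ht1 dt1) (trace_decaysZ rho2 ht2 dt2).
have in3 : inflow (- m) 1 tau (fun t => rho1 * t1 t + rho2 * t2 t) (fun t => rho1 * t1 t + rho2 * t2 t).
  by right; rewrite oppr_lt0.
have ou3 : inflow (- - m) 0 tau (fun t => rho1 * t1 t + rho2 * t2 t) tau by left; rewrite opprK.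
have [db' dtau'] := tr3 _ _ _ _ _ _ _ _ _ Hs3 in3 ou3 din isG.
have bB : T3 * (l2norm I01 b0 + (`|rho1| * (ct1 * N) + `|rho2| * (ct2 * N)) + cG * N) <= cb * N.
  rewrite /cb -mulrA; apply: (ler_wpM2l T30); rewrite !mulrDl mul1r !mulrA.
  by rewrite !lerD2r.
have one_le2 : (1 : R) <= 2 by rewrite ltW.
split.
- exact: (decays_le one_le2 (toB D CD) da1).
- exact: (decays_le one_le2 (toB D CD) da2).
- apply: (decays_le (lexx _) _ db'); exact: (le_trans bB (toB cb Ccb)).
- apply: (trace_decays_le htau (lexx _) _ dtau'); exact: (le_trans bB (toB cb Ccb)).
- by split; [exact: (trace_decays_le ht1 (lexx _) (toB ct1 Cc1) dt1)|exact: (trace_decays_le ht2 (lexx _) (toB ct2 Cc2) dt2)].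
Qed.

End CascadeDecay.

Section ErrorDecay.
Context {R : realType}.
Notation mu := (@lebesgue_measure R).
Notation I01 := (`[(0 : R), 1]%classic : set R).
Implicit Types (k F : R * R -> R) (f g : R -> R -> R) (h a : R -> R) (t x xi T lam : R).

Let initial_algebra (M1 M2 Mn u1 u2 w b a1 a2 : R) : 0 <= M1 -> 0 <= M2 -> 0 <= Mn ->
  0 <= u1 -> 0 <= u2 -> 0 <= w -> b <= w + Mn * w -> a1 <= u1 + M1 * b -> a2 <= u2 + M2 * b ->
  a1 + a2 + b <= (1 + (M1 + M2 + 1) * (1 + Mn)) * (u1 + u2 + w).
Proof.
move=> M10 M20 Mn0 u10 u20 w0 hb h1 h2.
have Z : 0 <= (M1 + M2 + 1) * (1 + Mn) by rewrite mulr_ge0 ?addr_ge0.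
have := mulr_ge0 Z u10; have := mulr_ge0 Z u20.
have := ler_wpM2l (addr_ge0 (addr_ge0 M10 M20) ler01) hb; lra.
Qed.

Lemma l2norm_volB k M h h' : continuous k ->
  (forall x xi, 0 <= x <= 1 -> 0 <= xi <= 1 -> `|k (x, xi)| <= M) ->
  L2on I01 h -> L2on I01 h' ->
  l2norm I01 (fun x => h x - vol k h' x) <= l2norm I01 h + M * l2norm I01 h'.
Proof.
move=> ck kM Lh Lh'; have Lv := vol_L2on ck Lh'; have Lv1 := L2onZ (-1) Lv.
rewrite (@eq_l2norm _ 0 1 _ (fun x => h x + -1 * vol k h' x)); last by move=> x _; rewrite mulN1r.
apply: (le_trans (l2normD Lh Lv1)); rewrite lerD2l (l2normZ _ Lv) normrN1 mul1r.
exact: l2norm_vol.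
Qed.

(** The trace loses a part of the rate, because the pairing with [b] is
    bounded at each time and has to be square-integrable in time. *)
Lemma recover_decay k M nu nu' S b u (tr : R -> R) : continuous k ->
  (forall x xi, 0 <= x <= 1 -> 0 <= xi <= 1 -> `|k (x, xi)| <= M) -> nu < nu' ->
  field b -> field u -> trace tr ->
  trace (fun t => tr t - \int[mu]_(xi in I01) (k (1, xi) * b t xi)) ->
  decays nu' S b -> decays nu' S (fun t x => u t x - vol k (b t) x) ->
  trace_decays nu' S (fun t => tr t - \int[mu]_(xi in I01) (k (1, xi) * b t xi)) ->
  decays nu' (S + M * S) u /\
  trace_decays nu (S + l2norm I01 (fun xi => k (1, xi)) * (Num.sqrt (2 * (nu' - nu))^-1 * S)) tr.
Proof.
move=> ck kM nn hb hu htr ht db da dt.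
have hv := field_vol ck hb.
have ha : field (fun t x => u t x - vol k (b t) x) by exact: fieldD hu (fieldN hv).
split.
  have := decaysD ha hv da (decays_vol ck hb kM db).
  by apply: decays_eq => t x _ _; rewrite subrK.
have hp : trace (fun t => \int[mu]_(xi in I01) (k (1, xi) * b t xi)).
  have := traceD htr (traceZ (-1) ht); congr trace; apply/funext => t.
  by rewrite mulN1r opprB addrC subrK.
have dp := trace_decays_pairing nn (cont_line1 (x := 1) ck) hb (decays_ge0 db) hp db.
have dt' := trace_decays_le ht (ltW nn) (lexx S) dt.
have := trace_decaysD ht hp dt' dp; congr trace_decays; apply/funext => t.
by rewrite subrK.
Qed.

(** The transformed error satisfies the hypotheses of [cascade_decay], and
    the transformation is bounded in both directions. *)
Lemma error_decay (m g1 g2 s11 s12 s21 s22 rho1 rho2 : R) (al th1 th2 : R -> R)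
    (m1 m2 m3 : R * R -> R) :
  0 < m -> 0 < g1 -> 0 < g2 -> continuous al -> continuous th1 -> continuous th2 ->
  continuous m1 -> continuous m2 -> continuous m3 ->
  along_characteristics g1 (- m) m1 (fun z => s11 * m1 z + s12 * m2 z + al z.1 * m3 z) ->
  along_characteristics g2 (- m) m2 (fun z => s21 * m1 z + s22 * m2 z + al z.1 * m3 z) ->
  along_characteristics (- m) (- m) m3 (fun z => th1 z.1 * m1 z + th2 z.1 * m2 z) ->
  (forall x, 0 <= x <= 1 -> m1 (x, x) = al x / (g1 + m)) ->
  (forall x, 0 <= x <= 1 -> m2 (x, x) = al x / (g2 + m)) ->
  (forall xi, 0 <= xi <= 1 -> m3 (1, xi) = rho1 * m1 (1, xi) + rho2 * m2 (1, xi)) ->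
  exists2 C : R, 0 <= C & forall (u10 u20 w0 : R -> R) (u1 u2 w : R -> R -> R) (tau tr1 tr2 : R -> R),
    sol g1 (fun t x => s11 * u1 t x + s12 * u2 t x + al x * w t x + (- m * m1 (x, 0)) * tau t)
      u10 u1 (fun=> 0) tr1 ->
    sol g2 (fun t x => s21 * u1 t x + s22 * u2 t x + al x * w t x + (- m * m2 (x, 0)) * tau t)
      u20 u2 (fun=> 0) tr2 ->
    sol (- m) (fun t x => th1 x * u1 t x + th2 x * u2 t x + (- m * m3 (x, 0)) * tau t)
      w0 w tau (fun t => rho1 * tr1 t + rho2 * tr2 t) ->
    locally_bounded u1 -> locally_bounded u2 -> locally_bounded w ->
    let B := C * (l2norm I01 u10 + l2norm I01 u20 + l2norm I01 w0) in
    [/\ decays 1 B u1, decays 1 B u2, decays 1 B w, trace_decays 1 B tau &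
        trace_decays 2^-1 B tr1 /\ trace_decays 2^-1 B tr2].
Proof.
move=> m0 g10 g20 cal cth1 cth2 cm1 cm2 cm3 al1 al2 al3 diag1 diag2 edge.
have m_neq0 : - m != 0 by rewrite oppr_eq0 gt_eqF.
have [n [e [cn ce al_n nE eE]]] := resolvent m_neq0 cm3 (cont_Fo3 cth1 cth2 cm1 cm2) al3.
have [C' C'0 cascade] := @cascade_decay R m g1 g2 s11 s12 s21 s22 rho1 rho2 th1 th2 m1 m2 m3
  m0 g10 g20 cth1 cth2 cm1 cm2 cm3.
have [M1 M10 m1M] := square_bounded cm1; have [M2 M20 m2M] := square_bounded cm2.
have [M3 M30 m3M] := square_bounded cm3; have [Mn Mn0 nM] := square_bounded cn.
pose K := 1 + (M1 + M2 + 1) * (1 + Mn).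
have K0 : 0 <= K by rewrite addr_ge0// mulr_ge0// !addr_ge0.
pose q := Num.sqrt (2 * (1 - 2^-1 : R))^-1; have q0 : 0 <= q := sqrtr_ge0 _.
set l1 := l2norm I01 (fun xi => m1 (1, xi)); set l2 := l2norm I01 (fun xi => m2 (1, xi)).
have l10 : 0 <= l1 := l2norm_ge0 _ _; have l20 : 0 <= l2 := l2norm_ge0 _ _.
have lq1 : 0 <= l1 * q by rewrite mulr_ge0.
have lq2 : 0 <= l2 * q by rewrite mulr_ge0.
pose L := 1 + Num.max (Num.max M1 (Num.max M2 M3)) (Num.max (l1 * q) (l2 * q)).
have [LM1 [LM2 LM3]] : 1 + M1 <= L /\ 1 + M2 <= L /\ 1 + M3 <= L.
  by rewrite !(lerD2l 1) !le_max !lexx ?orbT.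
have [Lq1 Lq2] : 1 + l1 * q <= L /\ 1 + l2 * q <= L.
  by rewrite !lerD2l !le_max !lexx ?orbT.
have L1 : 1 <= L by apply: le_trans LM1; rewrite lerDl.
have half1 : (2^-1 : R) < 1 by rewrite invf_lt1 ?ltr1n.
exists (L * (C' * K)); first by rewrite !mulr_ge0// (le_trans ler01).
move=> u10 u20 w0 u1 u2 w tau tr1 tr2 Hs1 Hs2 Hs3 lb1 lb2 lb3 B.
have [hu1 _ Lu10 [_ htr1] _] := Hs1; have [hu2 _ Lu20 [_ htr2] _] := Hs2.
have [hw _ Lw0 [htau _] _] := Hs3.
have Hb := beta_sol m0 cn ce al_n Hs3.
have Ha1 := ahat_sol m0 cal cm1 cm2 cm3 cn ce al_n nE Hs1 Hs2 Hs3 g10 cm1 al1 diag1 Hs1.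
have Ha2 := ahat_sol m0 cal cm1 cm2 cm3 cn ce al_n nE Hs1 Hs2 Hs3 g20 cm2 al2 diag2 Hs2.
have HG := beta_sourceE m0 cth1 cth2 cm1 cm2 cm3 cn ce al_n nE eE Hs3.
have Hinv := beta_inverse cm3 cn nE Hs3.
have Htr := beta_trace1 m0 cm1 cm2 cm3 edge cn ce al_n nE Hs3.
set b := beta n w in Hb Ha1 Ha2 HG Hinv Htr.
set G := beta_source m th1 th2 m3 n e u1 u2 w tau in Hb Ha1 Ha2 HG.
set a1 := ahat n w m1 u1 in Ha1 Ha2 HG; set a2 := ahat n w m2 u2 in Ha1 Ha2 HG.
have Eb : (fun t => tau t - 0) = tau by apply/funext => t; rewrite subr0.
rewrite Eb in Hb.
have Et := funext Htr; rewrite Et in Hb.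
have [hb hG Lb0 _ _] := Hb; have [ha1 _ La10 [_ hta1] _] := Ha1; have [ha2 _ La20 [_ hta2] _] := Ha2.
have lbb : locally_bounded b.
  have hv := field_vol cn hw.
  exact: (locally_boundedD hw (fieldN hv) lb3 (locally_boundedN hv (locally_bounded_vol cn hw lb3))).
have lba k u : continuous k -> field u -> locally_bounded u -> locally_bounded (ahat n w k u).
  move=> ck hu lbu; have hv := field_vol ck hb.
  exact: (locally_boundedD hu (fieldN hv) lbu (locally_boundedN hv (locally_bounded_vol ck hb lbb))).
have := cascade _ _ _ _ _ _ _ _ _ _ Ha1 Ha2 Hb HG (lba _ _ cm1 hu1 lb1) (lba _ _ cm2 hu2 lb2).
set N := l2norm I01 u10 + l2norm I01 u20 + l2norm I01 w0 in B *.
have NK : l2norm I01 (fun x => u10 x - vol m1 (fun y => w0 y - vol n w0 y) x) +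
    l2norm I01 (fun x => u20 x - vol m2 (fun y => w0 y - vol n w0 y) x) +
    l2norm I01 (fun y => w0 y - vol n w0 y) <= K * N.
  exact: (initial_algebra M10 M20 Mn0 (l2norm_ge0 _ _) (l2norm_ge0 _ _) (l2norm_ge0 _ _)
    (l2norm_volB cn nM Lw0 Lw0) (l2norm_volB cm1 m1M Lu10 Lb0) (l2norm_volB cm2 m2M Lu20 Lb0)).
move: NK; set N' := (X in X <= K * N) => NK; cbv zeta => -[da1 da2 db dtau [dt1 dt2]].
pose S := C' * (K * N).
have NS : C' * N' <= S by apply: (ler_wpM2l C'0).
have S0 : 0 <= S by rewrite !mulr_ge0// !addr_ge0 ?l2norm_ge0.
have {}da1 := decays_le (lexx _) NS da1. have {}da2 := decays_le (lexx _) NS da2.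
have {}db := decays_le (lexx _) NS db.
have {}dtau := trace_decays_le htau (lexx _) NS dtau.
have {}dt1 := trace_decays_le hta1 (lexx _) NS dt1.
have {}dt2 := trace_decays_le hta2 (lexx _) NS dt2.
have [du1 dtr1] := recover_decay cm1 m1M half1 hb hu1 htr1 hta1 db da1 dt1.
have [du2 dtr2] := recover_decay cm2 m2M half1 hb hu2 htr2 hta2 db da2 dt2.
have BS : B = L * S by rewrite /B /S !mulrA.
have toB c : 1 + c <= L -> S + c * S <= B.
  by move=> cL; rewrite BS -{1}[S]mul1r -mulrDl; exact: (ler_wpM2r S0).
split.
- exact: (decays_le (lexx _) (toB _ LM1) du1).
- exact: (decays_le (lexx _) (toB _ LM2) du2).
- have dw := decaysD hb (field_vol cm3 hb) db (decays_vol cm3 hb m3M db).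
  have {}dw := decays_le (lexx _) (toB _ LM3) dw.
  by apply: decays_eq dw => t x _ hx; exact: Hinv.
- apply: (trace_decays_le htau (lexx _) _ dtau).
  by rewrite BS -{1}[S]mul1r; exact: (ler_wpM2r S0).
- split.
    by apply: (trace_decays_le htr1 (lexx _) _ dtr1); rewrite -/q -/l1 mulrA; exact: toB.
  by apply: (trace_decays_le htr2 (lexx _) _ dtr2); rewrite -/q -/l2 mulrA; exact: toB.
Qed.

End ErrorDecay.

(** * Backstepping transformation of the observer state *)
Section ControllerTransform.
Context {R : realType}.
Notation mu := (@lebesgue_measure R).
Notation I01 := (`[(0 : R), 1]%classic : set R).
Implicit Types (k F : R * R -> R) (f g : R -> R -> R) (h a : R -> R) (t x xi T : R).

Context (m g1 g2 s11 s12 s21 s22 q1 q2 : R) (al th1 th2 : R -> R).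
Context (m_gt0 : 0 < m) (g1_gt0 : 0 < g1) (g2_gt0 : 0 < g2).
Context (cal : continuous al) (cth1 : continuous th1) (cth2 : continuous th2).
Context (k1 k2 k3 : R * R -> R).
Context (ck1 : continuous k1) (ck2 : continuous k2) (ck3 : continuous k3).

Let Fc1 (z : R * R) := - (s11 * k1 z + s21 * k2 z + th1 z.2 * k3 z).
Let Fc2 (z : R * R) := - (s12 * k1 z + s22 * k2 z + th2 z.2 * k3 z).
Let Fc3 (z : R * R) := - (al z.2 * k1 z + al z.2 * k2 z).

Context (along1 : along_characteristics (- m) g1 k1 Fc1).
Context (along2 : along_characteristics (- m) g2 k2 Fc2).
Context (along3 : along_characteristics (- m) (- m) k3 Fc3).
Context (diag1 : forall x, 0 <= x <= 1 -> k1 (x, x) = - (th1 x / (g1 + m))).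
Context (diag2 : forall x, 0 <= x <= 1 -> k2 (x, x) = - (th2 x / (g2 + m))).
Context (edge : forall x, 0 <= x <= 1 -> m * k3 (x, 0) = q1 * g1 * k1 (x, 0) + q2 * g2 * k2 (x, 0)).

Let comp_snd (a : R -> R) : continuous a -> continuous (fun z : R * R => a z.2).
Proof. by move=> ca; apply: (cont_comp (f := fun z : R * R => z.2) (g := a)) => //; exact: cont_snd. Qed.

Let comp_fst (a : R -> R) : continuous a -> continuous (fun z : R * R => a z.1).
Proof. by move=> ca; apply: (cont_comp (f := fun z : R * R => z.1) (g := a)) => //; exact: cont_fst. Qed.

Let cFlin s s' (th : R -> R) : continuous th -> continuous (fun z : R * R => - (s * k1 z + s' * k2 z + th z.2 * k3 z)).
Proof.
by move=> cth; exact: contN (contD (contD (contM (@cont_cst _ _ s) ck1) (contM (@cont_cst _ _ s') ck2)) (contM (comp_snd cth) ck3)).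
Qed.

Let cFc3 : continuous Fc3.
Proof. exact: contN (contD (contM (comp_snd cal) ck1) (contM (comp_snd cal) ck2)). Qed.

Let volN F h x : continuous F -> L2on I01 h -> vol (fun z => - F z) h x = - vol F h x.
Proof.
move=> cF Lh; rewrite -[RHS]mulN1r -(vol_kernel_left (fun=> -1) x cF Lh).
by apply: eq_vol_kernel => xi _ _; rewrite mulN1r.
Qed.

Let vol_controller_source s s' (th : R -> R) h x : continuous th -> L2on I01 h ->
  vol (fun z => - (s * k1 z + s' * k2 z + th z.2 * k3 z)) h x =
  - (s * vol k1 h x + s' * vol k2 h x + vol k3 (fun y => th y * h y) x).
Proof.
move=> cth Lh.
have c1 : continuous (fun z => s * k1 z) by exact: contM (@cont_cst _ _ s) ck1.
have c2 : continuous (fun z => s' * k2 z) by exact: contM (@cont_cst _ _ s') ck2.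
have c3 : continuous (fun z => th z.2 * k3 z) by exact: contM (comp_snd cth) ck3.
rewrite (volN x (contD (contD c1 c2) c3) Lh); congr (- _).
rewrite (vol_kernelD _ (contD c1 c2) c3 Lh) (vol_kernelD _ c1 c2 Lh).
rewrite (vol_kernel_left (fun=> s) _ ck1 Lh) (vol_kernel_left (fun=> s') _ ck2 Lh).
by rewrite vol_kernel_right.
Qed.

Let vol_boundary_controller h x : L2on I01 h ->
  vol Fc3 h x = - (vol k1 (fun y => al y * h y) x + vol k2 (fun y => al y * h y) x).
Proof.
move=> Lh.
have c1 : continuous (fun z => al z.2 * k1 z) by exact: contM (comp_snd cal) ck1.
have c2 : continuous (fun z => al z.2 * k2 z) by exact: contM (comp_snd cal) ck2.
rewrite (volN x (contD c1 c2) Lh); congr (- _).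
by rewrite (vol_kernelD _ c1 c2 Lh) !vol_kernel_right.
Qed.

(** Equal to [vol k p x] for [0 <= x <= 1]; written with [star] because it is
    then continuous on the line. *)
Definition column k (p : R -> R) x := star k (fun z => p z.1) (x, 0).

Lemma column_continuous k (p : R -> R) : continuous k -> continuous p -> continuous (column k p).
Proof.
move=> ck cp; have cs := star_continuous ck (comp_fst cp).
by apply: (cont_comp (f := fun x : R => (x, 0 : R)) (g := star k (fun z => p z.1))) => //; cont.
Qed.

Lemma vol_column k (p : R -> R) (c : R) x : continuous k -> continuous p -> 0 <= x <= 1 ->
  vol k (fun y => p y * c) x = column k p x * c.
Proof.
move=> ck cp /andP[x0 x1]; rewrite /column starE//; last exact: comp_fst.
have ->: vol k (fun y => p y * c) x = c * vol k p x.
  by rewrite -(volZ c x ck (L2on_cont 0 1 cp)); apply: eq_vol => y _; rewrite mulrC.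
by rewrite mulrC; congr (_ * _); exact: (Rint_head (fun s => k (x, s) * p s) 0 x1).
Qed.

Context (p1 p2 p3 : R -> R) (cp1 : continuous p1) (cp2 : continuous p2) (cp3 : continuous p3).

(** What the transformation leaves of the output injection: the direct term,
    the inflow term of [k3] and the images of the three gains. *)
Definition psi_gain x :=
  - p3 x - m * k3 (x, 0) + (column k1 p1 x + column k2 p2 x + column k3 p3 x).

Lemma psi_gain_continuous : continuous psi_gain.
Proof.
apply: contD; last first.
  exact: (contD (contD (column_continuous ck1 cp1) (column_continuous ck2 cp2)) (column_continuous ck3 cp3)).
exact: (contD (contN cp3) (contN (contM (@cont_cst _ _ m) (cont_line2 (xi := 0) ck3)))).
Qed.

Context (u10 u20 w0 : R -> R) (u1 u2 w : R -> R -> R) (tau om r1 r2 d : R -> R).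
Let src s s' (p : R -> R) t x := s * u1 t x + s' * u2 t x + al x * w t x - p x * tau t.
Let src3 t x := th1 x * u1 t x + th2 x * u2 t x - p3 x * tau t.
Context (sol1 : sol g1 (src s11 s12 p1) u10 u1 (fun t => q1 * (om t + tau t)) r1).
Context (sol2 : sol g2 (src s21 s22 p2) u20 u2 (fun t => q2 * (om t + tau t)) r2).
Context (sol3 : sol (- m) src3 w0 w om
  (fun t => \int[mu]_(xi in I01) (k1 (1, xi) * u1 t xi) + \int[mu]_(xi in I01) (k2 (1, xi) * u2 t xi)
    + \int[mu]_(xi in I01) (k3 (1, xi) * w t xi) + d t)).
Context (trace_tau : trace tau).

(** The feedback law is chosen so that only the disturbance [d] is left of it
    at [x = 1]. *)
Definition psi (z1 z2 z3 : R -> R) x := z3 x - vol k1 z1 x - vol k2 z2 x - vol k3 z3 x.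

Let Lw t : L2on I01 (w t). Proof. by case: sol3 => -[]. Qed.
Let Lu1 t : L2on I01 (u1 t). Proof. by case: sol1 => -[]. Qed.
Let Lu2 t : L2on I01 (u2 t). Proof. by case: sol2 => -[]. Qed.

Let vol_src k s s' (p : R -> R) t x : continuous k -> continuous p -> 0 <= x <= 1 ->
  vol k (src s s' p t) x = s * vol k (u1 t) x + s' * vol k (u2 t) x
    + vol k (fun y => al y * w t y) x - column k p x * tau t.
Proof.
move=> ck cp hx.
have L1 := L2onZ s (Lu1 t); have L2 := L2onZ s' (Lu2 t); have L3 := L2on_contM cal (Lw t).
have L4 : L2on I01 (fun y => p y * - tau t).
  by apply: L2on_cont; exact: (contM cp (@cont_cst _ _ (- tau t))).
have E y : 0 <= y <= 1 -> src s s' p t y = s * u1 t y + s' * u2 t y + al y * w t y + p y * - tau t.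
  by move=> _; rewrite /src mulrN.
rewrite (eq_vol k x E) (volD x ck (L2onD (L2onD L1 L2) L3) L4) (volD x ck (L2onD L1 L2) L3).
rewrite (volD x ck L1 L2) (volZ s x ck (Lu1 t)) (volZ s' x ck (Lu2 t)).
by rewrite vol_column// mulrN.
Qed.

Let vol_src3 t x : 0 <= x <= 1 ->
  vol k3 (src3 t) x = vol k3 (fun y => th1 y * u1 t y) x + vol k3 (fun y => th2 y * u2 t y) x
    - column k3 p3 x * tau t.
Proof.
move=> hx.
have L1 := L2on_contM cth1 (Lu1 t); have L2 := L2on_contM cth2 (Lu2 t).
have L4 : L2on I01 (fun y => p3 y * - tau t).
  by apply: L2on_cont; exact: (contM cp3 (@cont_cst _ _ (- tau t))).
have E y : 0 <= y <= 1 -> src3 t y = th1 y * u1 t y + th2 y * u2 t y + p3 y * - tau t.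
  by move=> _; rewrite /src3 mulrN.
rewrite (eq_vol k3 x E) (volD x ck3 (L2onD L1 L2) L4) (volD x ck3 L1 L2).
by rewrite vol_column// mulrN.
Qed.

Let psi_algebra (a1 a2 b1 b2 c1 c2 d1 d2 w' v1 v2 o t P3 K1 K2 K3 D3 G1 G2 A1 : R) :
  m * K3 = q1 * g1 * K1 + q2 * g2 * K2 ->
  (v1 + v2 - P3 * t) -
   ((v1 + (g1 * K1) * (q1 * (o + t)) + - (s11 * a1 + s21 * b1 + c1)
      + (s11 * a1 + s12 * a2 + d1 - G1 * t))) -
   ((v2 + (g2 * K2) * (q2 * (o + t)) + - (s12 * a2 + s22 * b2 + c2)
      + (s21 * b1 + s22 * b2 + d2 - G2 * t))) -
   ((0 * D3) * w' + (- m * K3) * o + - (d1 + d2) + (c1 + c2 - A1 * t)) =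
  (- P3 - m * K3 + (G1 + G2 + A1)) * t.
Proof.
move=> E.
rewrite [LHS](_ : _ = - P3 * t - (q1 * g1 * K1 + q2 * g2 * K2) * (o + t) + m * K3 * o + (G1 + G2 + A1) * t); last by ring.
by rewrite -E; ring.
Qed.

(** The controller kernel equations cancel the coupling to [u1], [u2] and
    [w]; the relation on the edge [xi = 0] cancels the trace [om], and only
    the part of the inflow that comes from [tau] is left. *)
Lemma psi_sol : sol (- m) (fun t x => psi_gain x * tau t) (psi u10 u20 w0)
  (fun t => psi (u1 t) (u2 t) (w t)) om d.
Proof.
have n1 : - m * g1 < 0 by rewrite mulNr oppr_lt0 mulr_gt0.
have n2 : - m * g2 < 0 by rewrite mulNr oppr_lt0 mulr_gt0.
have m_neq0 : - m != 0 by rewrite oppr_eq0 gt_eqF.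
have T1 := vol_sol_transverse n1 ck1 (cFlin cth1) along1 sol1.
have T2 := vol_sol_transverse n2 ck2 (cFlin cth2) along2 sol2.
have T3 := vol_sol_parallel m_neq0 ck3 cFc3 along3 sol3.
have := solB (solB (solB sol3 T1) T2) T3.
rewrite (_ : (fun t => om t - 0 - 0 - 0) = om); last by apply/funext => t; rewrite !subr0.
move=> S.
have Ed : (fun t => \int[mu]_(xi in I01) (k1 (1, xi) * u1 t xi) + \int[mu]_(xi in I01) (k2 (1, xi) * u2 t xi)
    + \int[mu]_(xi in I01) (k3 (1, xi) * w t xi) + d t
    - \int[mu]_(xi in I01) (k1 (1, xi) * u1 t xi) - \int[mu]_(xi in I01) (k2 (1, xi) * u2 t xi)
    - \int[mu]_(xi in I01) (k3 (1, xi) * w t xi)) = d.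
  apply/funext => t; move: (\int[mu]_(xi in I01) _) (\int[mu]_(xi in I01) _) (\int[mu]_(xi in I01) _) (d t) => a b c e.
  by ring.
rewrite Ed in S; apply: sol_eq S; first exact: (field_tensor psi_gain_continuous trace_tau).
move=> t x _ hx.
rewrite (vol_controller_source s11 s21 x cth1 (Lu1 t)) (vol_controller_source s12 s22 x cth2 (Lu2 t)).
rewrite (vol_boundary_controller x (Lw t)) (vol_src s11 s12 t ck1 cp1 hx) (vol_src s21 s22 t ck2 cp2 hx).
rewrite (vol_src3 t hx) diag1// diag2// subrr.
have gm1 : g1 + m != 0 by rewrite gt_eqF// addr_gt0.
have gm2 : g2 + m != 0 by rewrite gt_eqF// addr_gt0.
rewrite (_ : (- m - g1) * - (th1 x / (g1 + m)) = th1 x); last by field.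
rewrite (_ : (- m - g2) * - (th2 x / (g2 + m)) = th2 x); last by field.
exact: (psi_algebra _ _ _ _ _ _ _ _ _ _ _ _ _ _ _ _ _ _ (edge hx)).
Qed.

End ControllerTransform.

(** * Decay of the observer state *)
Section ControllerDecay.
Context {R : realType}.
Notation mu := (@lebesgue_measure R).
Notation I01 := (`[(0 : R), 1]%classic : set R).
Implicit Types (k F : R * R -> R) (f g : R -> R -> R) (h a : R -> R) (t x xi T lam : R).

(** The state [w] also enters [psi] through [vol k3 w], which the weight
    makes small enough to be absorbed. *)
Lemma wnorm_psi_inverse k1 k2 k3 M1 M2 M3 lam (u1 u2 w : R -> R) :
  continuous k1 -> continuous k2 -> continuous k3 -> 0 < lam -> 0 <= M1 -> 0 <= M2 ->
  (forall x xi, 0 <= x <= 1 -> 0 <= xi <= 1 -> `|k1 (x, xi)| <= M1) ->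
  (forall x xi, 0 <= x <= 1 -> 0 <= xi <= 1 -> `|k2 (x, xi)| <= M2) ->
  (forall x xi, 0 <= x <= 1 -> 0 <= xi <= 1 -> `|k3 (x, xi)| <= M3) ->
  M3 * Num.sqrt (2 * lam)^-1 <= 2^-1 -> Num.sqrt (2 * lam)^-1 <= 1 ->
  L2on I01 u1 -> L2on I01 u2 -> L2on I01 w ->
  wnorm lam w <= 2 * (wnorm lam (psi k1 k2 k3 u1 u2 w) + M1 * wnorm lam u1 + M2 * wnorm lam u2).
Proof.
move=> ck1 ck2 ck3 lam0 M10 M20 k1M k2M k3M small s1 L1 L2 Lw.
have V1 := vol_L2on ck1 L1; have V2 := vol_L2on ck2 L2; have V3 := vol_L2on ck3 Lw.
have Lp : L2on I01 (psi k1 k2 k3 u1 u2 w).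
  have L := L2onB (L2onB (L2onB Lw V1) V2) V3; exact: L.
have ckn : continuous (fun z => - k3 z) := contN ck3.
have knM x xi : 0 <= x <= 1 -> 0 <= xi <= 1 -> `|- k3 (x, xi)| <= M3.
  by rewrite normrN; exact: k3M.
have L12 := L2onD Lp V1; have L123 := L2onD L12 V2.
have E x : 0 <= x <= 1 -> w x + vol (fun z => - k3 z) w x =
    psi k1 k2 k3 u1 u2 w x + vol k1 u1 x + vol k2 u2 x.
  move=> _; rewrite (_ : vol (fun z => - k3 z) w x = - vol k3 w x); last first.
    rewrite -[RHS]mulN1r -(vol_kernel_left (fun=> -1) x ck3 Lw).
    by apply: eq_vol_kernel => xi _ _; rewrite mulN1r.
  by rewrite /psi; ring.
apply: (le_trans (wnorm_half ckn lam0 knM small Lw L123 E)); apply: (ler_wpM2l (ler0n _ 2)).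
apply: (le_trans (wnormD lam L12 V2)); apply: lerD; last exact: volterra_bound.
by apply: (le_trans (wnormD lam Lp V1)); rewrite lerD2l; exact: volterra_bound.
Qed.

Let source_algebra (s s' A M1 M2 w1 w2 wp ww C : R) : 0 <= s -> 0 <= s' -> 0 <= A ->
  0 <= M1 -> 0 <= M2 -> 0 <= w1 -> 0 <= w2 -> ww <= 2 * (wp + M1 * w1 + M2 * w2) ->
  s + s' + 2 * (A * (M1 + M2)) <= C ->
  s * w1 + s' * w2 + A * ww <= C * (w1 + w2) + 2 * (A * wp).
Proof.
move=> s0 s'0 A0 M10 M20 w10 w20 hw hC.
have := ler_wpM2r (addr_ge0 w10 w20) hC; have := ler_wpM2l A0 hw.
have := mulr_ge0 s0 w20; have := mulr_ge0 s'0 w10.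
have := mulr_ge0 (mulr_ge0 A0 M10) w20; have := mulr_ge0 (mulr_ge0 A0 M20) w10; lra.
Qed.

(** The constant of the coupling to [u1] and [u2] does not depend on [lam],
    as [coupled_decay] requires; the factor [expR `|lam|] only affects the
    exterior source. *)
Lemma controller_source_bound s s' A lam (al p : R -> R) (c : R) M1 M2 C wp (u1 u2 w : R -> R) :
  continuous al -> continuous p -> (forall x, 0 <= x <= 1 -> `|al x| <= A) ->
  0 <= A -> 0 <= M1 -> 0 <= M2 -> L2on I01 u1 -> L2on I01 u2 -> L2on I01 w ->
  wnorm lam w <= 2 * (wp + M1 * wnorm lam u1 + M2 * wnorm lam u2) ->
  `|s| + `|s'| + 2 * (A * (M1 + M2)) <= C ->
  wnorm lam (fun x => s * u1 x + s' * u2 x + al x * w x - p x * c) <=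
  C * (wnorm lam u1 + wnorm lam u2) + (2 * (A * wp) + expR `|lam| * l2norm I01 p * `|c|).
Proof.
move=> cal cp alA A0 M10 M20 L1 L2 Lw hw hC.
have Ls := L2onZ s L1; have Ls' := L2onZ s' L2; have La := L2on_contM cal Lw.
have Lp := L2on_cont 0 1 cp; have Lpc := L2onZ (- c) Lp.
rewrite (@eq_wnorm _ lam _ (fun x => s * u1 x + s' * u2 x + al x * w x + - c * p x)); last first.
  by move=> x _; rewrite mulNr [c * _]mulrC.
rewrite addrA; apply: (le_trans (wnormD lam (L2onD (L2onD Ls Ls') La) Lpc)).
apply: lerD; last first.
  rewrite (wnormZ lam _ Lp) normrN mulrC; apply: (ler_wpM2r (normr_ge0 _)).
  exact: wnorm_le_l2.
apply: (le_trans (wnormD lam (L2onD Ls Ls') La)).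
apply: (le_trans (lerD (wnormD lam Ls Ls') (wnormM lam cal Lw alA))).
rewrite (wnormZ lam s L1) (wnormZ lam s' L2).
by apply: (source_algebra _ _ _ M10 M20) => //; exact: wnorm_ge0.
Qed.

Lemma l2norm_psi k1 k2 k3 M1 M2 M3 (u1 u2 w : R -> R) :
  continuous k1 -> continuous k2 -> continuous k3 ->
  (forall x xi, 0 <= x <= 1 -> 0 <= xi <= 1 -> `|k1 (x, xi)| <= M1) ->
  (forall x xi, 0 <= x <= 1 -> 0 <= xi <= 1 -> `|k2 (x, xi)| <= M2) ->
  (forall x xi, 0 <= x <= 1 -> 0 <= xi <= 1 -> `|k3 (x, xi)| <= M3) ->
  L2on I01 u1 -> L2on I01 u2 -> L2on I01 w ->
  l2norm I01 (psi k1 k2 k3 u1 u2 w) <=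
    l2norm I01 w + M1 * l2norm I01 u1 + M2 * l2norm I01 u2 + M3 * l2norm I01 w.
Proof.
move=> ck1 ck2 ck3 k1M k2M k3M L1 L2 Lw.
have V1 := vol_L2on ck1 L1; have V2 := vol_L2on ck2 L2.
apply: (le_trans (l2norm_volB ck3 k3M (L2onB (L2onB Lw V1) V2) Lw)); rewrite lerD2r.
apply: (le_trans (l2norm_volB ck2 k2M (L2onB Lw V1) L2)); rewrite lerD2r.
exact: l2norm_volB.
Qed.

End ControllerDecay.

Section ControllerDecayTheorem.
Context {R : realType}.
Notation mu := (@lebesgue_measure R).
Notation I01 := (`[(0 : R), 1]%classic : set R).
Implicit Types (k F : R * R -> R) (f g : R -> R -> R) (h a : R -> R) (t x xi T lam : R).

Let final_algebra (E n w wp w1 w2 M1 M2 np n1 n2 Sp S1 : R) : 0 <= E -> 0 <= n -> 0 <= M1 -> 0 <= M2 ->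
  w <= E * (2 * (wp + M1 * w1 + M2 * w2)) -> wp <= E * np -> w1 <= E * n1 -> w2 <= E * n2 ->
  n * np <= Sp -> n * n1 <= S1 -> n * n2 <= S1 ->
  n * w <= E * (2 * (E * (Sp + (M1 + M2) * S1))).
Proof.
move=> E0 n0 M10 M20 hw hp h1 h2 sp s1 s2.
apply: (le_trans (ler_wpM2l n0 hw)); rewrite mulrCA; apply: (ler_wpM2l E0).
rewrite mulrCA; apply: (ler_wpM2l (ler0n _ 2)).
apply: (@le_trans _ _ (E * (n * np + M1 * (n * n1) + M2 * (n * n2)))); last first.
  apply: (ler_wpM2l E0); rewrite mulrDl addrA; apply: lerD; last exact: (ler_wpM2l M20).
  by apply: lerD => //; exact: (ler_wpM2l M10).
rewrite [leRHS](_ : _ = n * (E * np + M1 * (E * n1) + M2 * (E * n2))); last by ring.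
apply: (ler_wpM2l n0); apply: lerD; last exact: (ler_wpM2l M20).
by apply: lerD => //; exact: (ler_wpM2l M10).
Qed.

Let psi_initial_algebra (M1 M2 M3 u1 u2 w At Ad p : R) : 0 <= M1 -> 0 <= M2 -> 0 <= M3 ->
  0 <= u1 -> 0 <= u2 -> 0 <= w -> 0 <= At -> 0 <= Ad ->
  p <= w + M1 * u1 + M2 * u2 + M3 * w ->
  p <= (1 + M1 + M2 + M3) * (u1 + u2 + w + At + Ad).
Proof.
move=> a b c d e f g h H; apply: (le_trans H).
have := mulr_ge0 a e; have := mulr_ge0 a f; have := mulr_ge0 b d; have := mulr_ge0 b f.
have := mulr_ge0 c d; have := mulr_ge0 c e.
have := mulr_ge0 (addr_ge0 (addr_ge0 a b) c) g; have := mulr_ge0 (addr_ge0 (addr_ge0 a b) c) h.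
lra.
Qed.

Let total_algebra (a b c d e : R) : 0 <= a -> 0 <= b -> 0 <= c -> 0 <= d -> 0 <= e ->
  [/\ d <= a + b + c + d + e, e <= a + b + c + d + e & a + b <= a + b + c + d + e].
Proof. by move=> *; split; lra. Qed.

(** First [psi], whose source and inflow are data, together with its outgoing
    trace [om], which is the inflow of [u1] and [u2]; then this pair, in
    whose sources [w] is replaced by its bound through [psi]. *)
Lemma controller_decay (m g1 g2 s11 s12 s21 s22 q1 q2 : R) (al th1 th2 : R -> R)
    (k1 k2 k3 : R * R -> R) (p1 p2 p3 : R -> R) :
  0 < m -> 0 < g1 -> 0 < g2 -> continuous al -> continuous th1 -> continuous th2 ->
  continuous k1 -> continuous k2 -> continuous k3 ->
  along_characteristics (- m) g1 k1 (fun z => - (s11 * k1 z + s21 * k2 z + th1 z.2 * k3 z)) ->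
  along_characteristics (- m) g2 k2 (fun z => - (s12 * k1 z + s22 * k2 z + th2 z.2 * k3 z)) ->
  along_characteristics (- m) (- m) k3 (fun z => - (al z.2 * k1 z + al z.2 * k2 z)) ->
  (forall x, 0 <= x <= 1 -> k1 (x, x) = - (th1 x / (g1 + m))) ->
  (forall x, 0 <= x <= 1 -> k2 (x, x) = - (th2 x / (g2 + m))) ->
  (forall x, 0 <= x <= 1 -> m * k3 (x, 0) = q1 * g1 * k1 (x, 0) + q2 * g2 * k2 (x, 0)) ->
  continuous p1 -> continuous p2 -> continuous p3 ->
  exists2 C : R, 0 <= C & forall (u10 u20 w0 : R -> R) (u1 u2 w : R -> R -> R)
      (tau om r1 r2 d : R -> R) (At Ad : R),
    sol g1 (fun t x => s11 * u1 t x + s12 * u2 t x + al x * w t x - p1 x * tau t)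
      u10 u1 (fun t => q1 * (om t + tau t)) r1 ->
    sol g2 (fun t x => s21 * u1 t x + s22 * u2 t x + al x * w t x - p2 x * tau t)
      u20 u2 (fun t => q2 * (om t + tau t)) r2 ->
    sol (- m) (fun t x => th1 x * u1 t x + th2 x * u2 t x - p3 x * tau t) w0 w om
      (fun t => \int[mu]_(xi in I01) (k1 (1, xi) * u1 t xi) + \int[mu]_(xi in I01) (k2 (1, xi) * u2 t xi)
        + \int[mu]_(xi in I01) (k3 (1, xi) * w t xi) + d t) ->
    trace tau -> trace_decays 1 At tau -> trace_decays 2^-1 Ad d ->
    locally_bounded u1 -> locally_bounded u2 ->
    let B := C * (l2norm I01 u10 + l2norm I01 u20 + l2norm I01 w0 + At + Ad) in
    [/\ decays 4^-1 B u1, decays 4^-1 B u2 & decays 4^-1 B w].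
Proof.
move=> m0 g10 g20 cal cth1 cth2 ck1 ck2 ck3 al1 al2 al3 diag1 diag2 edge cp1 cp2 cp3.
have [M1 M10 k1M] := square_bounded ck1; have [M2 M20 k2M] := square_bounded ck2.
have [M3 M30 k3M] := square_bounded ck3.
have [A A0 alA] := continuous_segment_bounded 0 1 cal.
have cP : continuous (psi_gain m k1 k2 k3 p1 p2 p3) := psi_gain_continuous ck1 ck2 ck3 cp1 cp2 cp3.
have [lam0 lam00 small] := small_weight M30.
pose C1 := `|s11| + `|s12| + 2 * (A * (M1 + M2)); pose C2 := `|s21| + `|s22| + 2 * (A * (M1 + M2)).
have MM : 0 <= 2 * (A * (M1 + M2)) by rewrite mulr_ge0// mulr_ge0// addr_ge0.
have C10 : 0 <= C1 := addr_ge0 (addr_ge0 (normr_ge0 _) (normr_ge0 _)) MM.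
have C20 : 0 <= C2 := addr_ge0 (addr_ge0 (normr_ge0 _) (normr_ge0 _)) MM.
have nu40 : (0 : R) <= 4^-1 by rewrite invr_ge0.
have nu20 : (0 : R) <= 2^-1 by rewrite invr_ge0.
have half1 : (2^-1 : R) < 1 by rewrite invf_lt1 ?ltr1n.
have quarter1 : (4^-1 : R) < 1 by rewrite invf_lt1 ?ltr1n.
have quarter_half : (4^-1 : R) < 2^-1 by rewrite ltf_pV2 ?posrE ?ltr_nat.
have [lam [D [lamp lam0l D0 coupled]]] := coupled_decay lam0 g10 g20 nu40 (addr_ge0 C10 C20).
have [sm3 sm1] := small lam lam0l.
have m_neq0 : - m != 0 by rewrite oppr_eq0 gt_eqF.
have [T3 T30 tr3] := @transport_decay R (- m) 1 0 2^-1 m_neq0 nu20.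
set E := expR `|lam|; have E0 : 0 <= E := expR_ge0 _.
set nP := l2norm I01 (psi_gain m k1 k2 k3 p1 p2 p3); have nP0 : 0 <= nP := l2norm_ge0 _ _.
pose qa := Num.sqrt (2 * (1 - 2^-1 : R))^-1; have qa0 : 0 <= qa := sqrtr_ge0 _.
pose qb := Num.sqrt (2 * (1 - 4^-1 : R))^-1; have qb0 : 0 <= qb := sqrtr_ge0 _.
pose K := 1 + M1 + M2 + M3; have K0 : 0 <= K by rewrite !addr_ge0.
pose cps := T3 * (K + 1 + nP * qa).
have cps0 : 0 <= cps by rewrite mulr_ge0// !addr_ge0// mulr_ge0.
pose cA := (`|q1| + `|q2|) * (cps + 1).
have cA0 : 0 <= cA by rewrite mulr_ge0 ?addr_ge0.
pose e1 := 2 * (A * E); have e10 : 0 <= e1 by rewrite mulr_ge0// mulr_ge0.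
pose e2 := E * l2norm I01 p1 + E * l2norm I01 p2.
have e20 : 0 <= e2 by rewrite addr_ge0// mulr_ge0// l2norm_ge0.
pose one := l2norm I01 (fun=> 1 : R); have one0 : 0 <= one := l2norm_ge0 _ _.
pose r4 := ((2^-1 : R) - 4^-1)^-1.
have r40 : 0 <= r4 by rewrite invr_ge0 subr_ge0 ltW.
pose cE := e1 * (r4 * cps) + e2 * (one * qb).
have cE0 : 0 <= cE by rewrite addr_ge0// mulr_ge0// mulr_ge0.
pose cU := D * (1 + cA + cE).
have cU0 : 0 <= cU := mulr_ge0 D0 (addr_ge0 (addr_ge0 ler01 cA0) cE0).
pose cW := E * (2 * (E * (cps + (M1 + M2) * cU))).
pose C := Num.max cU cW.
have CU : cU <= C by rewrite le_max lexx.
have CW : cW <= C by rewrite le_max lexx orbT.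
exists C; first exact: le_trans cU0 CU.
move=> u10 u20 w0 u1 u2 w tau om r1 r2 d At Ad Hs1 Hs2 Hs3 htau dtau dd lb1 lb2 B.
have [hu1 hf1 Lu10 _ _] := Hs1; have [hu2 hf2 Lu20 _ _] := Hs2.
have [hw _ Lw0 [hom _] _] := Hs3.
have L1 t : L2on I01 (u1 t) by case: hu1.
have L2 t : L2on I01 (u2 t) by case: hu2.
have Lw t : L2on I01 (w t) by case: hw.
have At0 := trace_decays_ge0 dtau; have Ad0 := trace_decays_ge0 dd.
have n1 : 0 <= l2norm I01 u10 := l2norm_ge0 _ _.
have n2 : 0 <= l2norm I01 u20 := l2norm_ge0 _ _.
have n3 : 0 <= l2norm I01 w0 := l2norm_ge0 _ _.
set N := l2norm I01 u10 + l2norm I01 u20 + l2norm I01 w0 + At + Ad in B *.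
have N0 : 0 <= N by rewrite /N !addr_ge0.
have [NAt NAd N12] := total_algebra n1 n2 n3 At0 Ad0; rewrite -/N in NAt NAd N12.
have Hp := psi_sol m0 g10 g20 cal cth1 cth2 ck1 ck2 ck3 al1 al2 al3 diag1 diag2 edge cp1 cp2 cp3
  Hs1 Hs2 Hs3 htau.
have [hp hPt _ [_ hd] _] := Hp.
have is3 := int_decays_tensor half1 cP htau dtau; rewrite -/nP -/qa in is3.
have in3 : inflow (- m) 1 om d d by right; rewrite oppr_lt0.
have ou3 : inflow (- - m) 0 om d om by left; rewrite opprK.
have [dp' dom'] := tr3 _ _ _ _ _ _ _ _ _ Hp in3 ou3 dd is3.
have Np : T3 * (l2norm I01 (psi k1 k2 k3 u10 u20 w0) + Ad + nP * (qa * At)) <= cps * N.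
  rewrite /cps -mulrA; apply: (ler_wpM2l T30).
  have kN := psi_initial_algebra M10 M20 M30 n1 n2 n3 At0 Ad0
    (l2norm_psi ck1 ck2 ck3 k1M k2M k3M Lu10 Lu20 Lw0).
  rewrite -/N -/K in kN.
  have nqN : nP * (qa * At) <= nP * qa * N.
    by rewrite mulrA; apply: ler_wpM2l => //; rewrite mulr_ge0.
  rewrite (_ : (K + 1 + nP * qa) * N = K * N + N + nP * qa * N); last by ring.
  exact: lerD (lerD kN NAd) nqN.
have dp := decays_le (lexx _) Np dp'; have dom := trace_decays_le hom (lexx _) Np dom'.
have dtau4 := trace_decays_le htau (ltW quarter1) NAt dtau.
have dom4 := trace_decays_le hom (ltW quarter_half) (lexx _) dom.
have dot := trace_decaysD hom htau dom4 dtau4.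
have htot := traceD hom htau.
have dq q' : `|q'| <= `|q1| + `|q2| -> trace_decays 4^-1 (cA * N) (fun t => q' * (om t + tau t)).
  move=> qq; apply: (trace_decays_le (traceZ q' htot) (lexx _) _ (trace_decaysZ q' htot dot)).
  rewrite (_ : cA * N = (`|q1| + `|q2|) * (cps * N + N)); last by rewrite /cA; ring.
  by apply: ler_wpM2r => //; exact: (addr_ge0 (mulr_ge0 cps0 N0) N0).
have dq1 : trace_decays 4^-1 (cA * N) (fun t => q1 * (om t + tau t)) by apply: dq; rewrite lerDl.
have dq2 : trace_decays 4^-1 (cA * N) (fun t => q2 * (om t + tau t)) by apply: dq; rewrite lerDr.
have h1t : field (fun t x => 1 * tau t) := field_tensor (@cont_cst _ _ (1 : R)) htau.
have one_norm t : l2norm I01 (fun=> 1 * tau t) = `|tau t|.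
  by rewrite /l2norm unit_Rint sqrtr_sqr mul1r.
have ips := decays_int quarter_half hp (decays_ge0 dp) dp; rewrite -/r4 in ips.
have ita := int_decays_tensor quarter1 (@cont_cst _ _ (1 : R)) htau dtau; rewrite -/qb -/one in ita.
(* The part of the sources that does not come from [u1] and [u2]. *)
pose eps t := e1 * l2norm I01 (psi k1 k2 k3 (u1 t) (u2 t) (w t)) + e2 * l2norm I01 (fun=> 1 * tau t).
have mT T : measurable (`[0, T]%classic : set R) by exact: measurable_itv.
have iep T : mu.-integrable `[0, T] (EFin \o eps).
  exact: (intD (mT T) (intZ (mT T) e1 (L2on_int (field_norm_L2on T hp))) (intZ (mT T) e2 (L2on_int (field_norm_L2on T h1t)))).
have ep0 t : 0 <= t -> 0 <= eps t.
  by move=> _; apply: addr_ge0; rewrite mulr_ge0 ?l2norm_ge0.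
have epB T : 0 <= T -> \int[mu]_(t in `[0, T]) (expR (4^-1 * t) * eps t) <= cE * N.
  move=> T0; have i1 := field_norm_int 4^-1 T hp; have i2 := field_norm_int 4^-1 T h1t.
  rewrite (_ : \int[mu]_(t in _) _ = e1 * \int[mu]_(t in `[0, T]) (expR (4^-1 * t) * l2norm I01 (psi k1 k2 k3 (u1 t) (u2 t) (w t)))
      + e2 * \int[mu]_(t in `[0, T]) (expR (4^-1 * t) * l2norm I01 (fun=> 1 * tau t))); last first.
    rewrite -(RintZ (mT T) e1 i1) -(RintZ (mT T) e2 i2) -(RintD (mT T) (intZ (mT T) e1 i1) (intZ (mT T) e2 i2)).
    by apply: eq_Rintegral => t _; rewrite /eps mulrDr !(mulrCA (expR _)).
  rewrite (_ : cE * N = e1 * (r4 * (cps * N)) + e2 * (one * (qb * N))); last by rewrite /cE; ring.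
  apply: lerD; first by apply: (ler_wpM2l e10); exact: ips.
  apply: (ler_wpM2l e20); apply: (le_trans (ita T T0)).
  by apply: (ler_wpM2l one0); apply: (ler_wpM2l qb0).
have wb t := wnorm_psi_inverse ck1 ck2 ck3 lamp M10 M20 k1M k2M k3M sm3 sm1 (L1 t) (L2 t) (Lw t).
have Lp t : L2on I01 (psi k1 k2 k3 (u1 t) (u2 t) (w t)) by case: hp.
have pw t := wnorm_le_l2 lam (Lp t).
have src s s' p CC t : continuous p -> E * l2norm I01 p <= e2 -> CC <= C1 + C2 ->
    `|s| + `|s'| + 2 * (A * (M1 + M2)) <= CC ->
    wnorm lam (fun x => s * u1 t x + s' * u2 t x + al x * w t x - p x * tau t) <=
    (C1 + C2) * (wnorm lam (u1 t) + wnorm lam (u2 t)) + eps t.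
  move=> cp pe hCC hs.
  apply: (le_trans (controller_source_bound (tau t) cal cp alA A0 M10 M20 (L1 t) (L2 t) (Lw t) (wb t) hs)).
  apply: lerD; first by rewrite ler_wpM2r ?addr_ge0 ?wnorm_ge0.
  rewrite /eps one_norm; apply: lerD; last by rewrite ler_wpM2r.
  rewrite /e1 -mulrA; apply: (ler_wpM2l (ler0n _ 2)); rewrite -mulrA; apply: (ler_wpM2l A0).
  exact: pw.
have pe1 : E * l2norm I01 p1 <= e2 by rewrite lerDl mulr_ge0 ?l2norm_ge0.
have pe2 : E * l2norm I01 p2 <= e2 by rewrite lerDr mulr_ge0 ?l2norm_ge0.
have C1C : C1 <= C1 + C2 by rewrite lerDl.
have C2C : C2 <= C1 + C2 by rewrite lerDr.
have [d1' d2'] := coupled _ _ _ _ _ _ _ _ _ _ eps _ _ Hs1 Hs2 lb1 lb2 dq1 dq2 iep ep0 epB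
  (fun t _ => src s11 s12 p1 C1 t cp1 pe1 C1C (lexx _)) (fun t _ => src s21 s22 p2 C2 t cp2 pe2 C2C (lexx _)).
have NU : D * (l2norm I01 u10 + l2norm I01 u20 + cA * N + cE * N) <= cU * N.
  rewrite (_ : cU * N = D * (N + cA * N + cE * N)); last by rewrite /cU; ring.
  by apply: (ler_wpM2l D0); rewrite !lerD2r.
have d1 := decays_le (lexx _) NU d1'; have d2 := decays_le (lexx _) NU d2'.
have toB c : c <= C -> c * N <= B by move=> cC; exact: (ler_wpM2r N0).
split.
- exact: (decays_le (lexx _) (toB _ CU) d1).
- exact: (decays_le (lexx _) (toB _ CU) d2).
- have dp4 := decays_le (ltW quarter_half) (lexx _) dp.
  move=> t t0; apply: le_trans (toB _ CW).
  rewrite (_ : cW * N = E * (2 * (E * (cps * N + (M1 + M2) * (cU * N))))); last by rewrite /cW; ring.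
  apply: (final_algebra E0 (expR_ge0 _) M10 M20 _ (pw t) (wnorm_le_l2 lam (L1 t)) (wnorm_le_l2 lam (L2 t))
    (dp4 t t0) (d1 t t0) (d2 t t0)).
  apply: (le_trans (l2_le_wnorm lam (Lw t))); apply: (ler_wpM2l E0); exact: wb.
Qed.

End ControllerDecayTheorem.

(** * Extension of the kernels to the plane *)
Section Kernels.
Context {R : realType}.
Implicit Types (c : coefs R) (k F : R * R -> R) (x xi : R).

Lemma triangle_diag x : 0 <= x <= 1 -> triangle (x, x).
Proof. by move=> /andP[x0 x1]; split. Qed.

Lemma triangle_bottom x : 0 <= x <= 1 -> triangle (x, 0).
Proof. by move=> /andP[x0 x1]; split. Qed.

Lemma triangle_right xi : 0 <= xi <= 1 -> triangle (1, xi).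
Proof. by move=> /andP[x0 x1]; split. Qed.

Let ccomp1 (a : R -> R) : continuous a -> continuous (fun z : R * R => a z.1).
Proof. by move=> ca; apply: (cont_comp (f := fun z : R * R => z.1) (g := a)) => //; exact: cont_fst. Qed.

Let ccomp2 (a : R -> R) : continuous a -> continuous (fun z : R * R => a z.2).
Proof. by move=> ca; apply: (cont_comp (f := fun z : R * R => z.2) (g := a)) => //; exact: cont_snd. Qed.

Let extend (d1 d2 : R) k F F' : along_characteristics d1 d2 k F ->
  (forall z, triangle z -> F z = F' z) -> along_characteristics d1 d2 (fun z => k (retract z)) F'.
Proof. by move=> kF FF; apply: along_eq kF => // z /retract_id ->. Qed.

(** Kernels continuous on the plane and with the same values on the triangle
    avoid case distinctions in all integrals. The characteristics are run
    backwards because [vol_sol] expects as first component the speed [- mu]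
    of the transformed state. *)
Lemma controller_kernels_extension c q1 q2 k1 k2 k3 :
  continuous (alpha c) -> continuous (theta1 c) -> continuous (theta2 c) ->
  controller_kernels c q1 q2 k1 k2 k3 ->
  let k1' z := k1 (retract z) in let k2' z := k2 (retract z) in let k3' z := k3 (retract z) in
  [/\ [/\ continuous k1', continuous k2' & continuous k3'],
      [/\ along_characteristics (- mu c) (gamma1 c) k1'
            (fun z => - (sigma11 c * k1' z + sigma21 c * k2' z + theta1 c z.2 * k3' z)),
          along_characteristics (- mu c) (gamma2 c) k2'
            (fun z => - (sigma12 c * k1' z + sigma22 c * k2' z + theta2 c z.2 * k3' z)) &
          along_characteristics (- mu c) (- mu c) k3'
            (fun z => - (alpha c z.2 * k1' z + alpha c z.2 * k2' z))] &
      [/\ forall x, 0 <= x <= 1 -> k1' (x, x) = - (theta1 c x / (gamma1 c + mu c)),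
          forall x, 0 <= x <= 1 -> k2' (x, x) = - (theta2 c x / (gamma2 c + mu c)) &
          forall x, 0 <= x <= 1 ->
            mu c * k3' (x, 0) = q1 * gamma1 c * k1' (x, 0) + q2 * gamma2 c * k2' (x, 0)]].
Proof.
move=> cal cth1 cth2 [[ck1 ck2 ck3] [a1 a2 a3] bd] k1' k2' k3'.
have c1 : continuous k1' := continuous_retract ck1.
have c2 : continuous k2' := continuous_retract ck2.
have c3 : continuous k3' := continuous_retract ck3.
have cF s s' (th : R -> R) : continuous th ->
    continuous (fun z => s * k1' z + s' * k2' z + th z.2 * k3' z).
  by move=> cth; exact: (contD (contD (contM (@cont_cst _ _ s) c1) (contM (@cont_cst _ _ s') c2)) (contM (ccomp2 cth) c3)).
have cF3 : continuous (fun z => alpha c z.2 * k1' z + alpha c z.2 * k2' z).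
  exact: (contD (contM (ccomp2 cal) c1) (contM (ccomp2 cal) c2)).
split => //; split.
- rewrite -[gamma1 c]opprK; apply: (along_opp (cF _ _ _ cth1)); apply: extend a1 _ => z tz.
  by rewrite /k1' /k2' /k3' retract_id.
- rewrite -[gamma2 c]opprK; apply: (along_opp (cF _ _ _ cth2)); apply: extend a2 _ => z tz.
  by rewrite /k1' /k2' /k3' retract_id.
- apply: (along_opp cF3); apply: extend a3 _ => z tz.
  by rewrite /k1' /k2' retract_id.
- by move=> x hx; rewrite /k1' (retract_id (triangle_diag hx)); case: (bd x hx).
- by move=> x hx; rewrite /k2' (retract_id (triangle_diag hx)); case: (bd x hx).
- by move=> x hx; rewrite /k1' /k2' /k3' (retract_id (triangle_bottom hx)); case: (bd x hx).
Qed.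

(** Of the three kernels only the last has its characteristics reversed: [m3]
    acts on states of speed [- mu]. *)
Lemma observer_kernels_extension c rho1 rho2 m1 m2 m3 :
  continuous (alpha c) -> continuous (theta1 c) -> continuous (theta2 c) ->
  observer_kernels c rho1 rho2 m1 m2 m3 ->
  let m1' z := m1 (retract z) in let m2' z := m2 (retract z) in let m3' z := m3 (retract z) in
  [/\ [/\ continuous m1', continuous m2' & continuous m3'],
      [/\ along_characteristics (gamma1 c) (- mu c) m1'
            (fun z => sigma11 c * m1' z + sigma12 c * m2' z + alpha c z.1 * m3' z),
          along_characteristics (gamma2 c) (- mu c) m2'
            (fun z => sigma21 c * m1' z + sigma22 c * m2' z + alpha c z.1 * m3' z) &
          along_characteristics (- mu c) (- mu c) m3'
            (fun z => theta1 c z.1 * m1' z + theta2 c z.1 * m2' z)] &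
      [/\ forall x, 0 <= x <= 1 -> m1' (x, x) = alpha c x / (gamma1 c + mu c),
          forall x, 0 <= x <= 1 -> m2' (x, x) = alpha c x / (gamma2 c + mu c) &
          forall xi, 0 <= xi <= 1 ->
            m3' (1, xi) = rho1 * m1' (1, xi) + rho2 * m2' (1, xi)]].
Proof.
move=> cal cth1 cth2 [[cm1 cm2 cm3] [a1 a2 a3] bd] m1' m2' m3'.
have c1 : continuous m1' := continuous_retract cm1.
have c2 : continuous m2' := continuous_retract cm2.
have c3 : continuous m3' := continuous_retract cm3.
have cF3 : continuous (fun z => - (theta1 c z.1 * m1' z) - theta2 c z.1 * m2' z).
  exact: (contD (contN (contM (ccomp1 cth1) c1)) (contN (contM (ccomp1 cth2) c2))).
split => //; split.
- by apply: extend a1 _ => z tz; rewrite /m1' /m2' /m3' retract_id.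
- by apply: extend a2 _ => z tz; rewrite /m1' /m2' /m3' retract_id.
- have a3' : along_characteristics (mu c) (mu c) m3'
      (fun z => - (theta1 c z.1 * m1' z) - theta2 c z.1 * m2' z).
    by apply: extend a3 _ => z tz; rewrite /m1' /m2' retract_id.
  by apply: along_eq (along_opp cF3 a3') => // z _; rewrite opprD !opprK.
- by move=> x hx; rewrite /m1' (retract_id (triangle_diag hx)); case: (bd x hx).
- by move=> x hx; rewrite /m2' (retract_id (triangle_diag hx)); case: (bd x hx).
- by move=> x hx; rewrite /m1' /m2' /m3' (retract_id (triangle_right hx)); case: (bd x hx).
Qed.

End Kernels.

(** * Decay of the closed loop *)
Section ClosedLoop.
Context {R : realType}.
Notation leb := (@lebesgue_measure R).
Notation I01 := (`[(0 : R), 1]%classic : set R).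
Implicit Types (k F : R * R -> R) (f g : R -> R -> R) (h a : R -> R) (t x xi T : R).

Lemma locally_bounded_cut (z : unknown R) : L2_regular z -> locally_bounded (txcut z).
Proof. by move=> rz T; have [M _ H] := cut_bounded T rz; exists M. Qed.

Lemma feedback_integral k1 k2 k3 (z1 z2 z3 : unknown R) t :
  {within @triangle R, continuous k1} -> {within @triangle R, continuous k2} ->
  {within @triangle R, continuous k3} ->
  L2_regular z1 -> L2_regular z2 -> L2_regular z3 -> 0 <= t ->
  \int[leb]_(xi in I01) (k1 (1, xi) * z1 t xi + k2 (1, xi) * z2 t xi + k3 (1, xi) * z3 t xi) =
  \int[leb]_(xi in I01) (k1 (retract (1, xi)) * txcut z1 t xi)
  + \int[leb]_(xi in I01) (k2 (retract (1, xi)) * txcut z2 t xi)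
  + \int[leb]_(xi in I01) (k3 (retract (1, xi)) * txcut z3 t xi).
Proof.
move=> ck1 ck2 ck3 r1 r2 r3 t0.
have mI : measurable I01 by exact: measurable_itv.
have int k (z : unknown R) : {within @triangle R, continuous k} -> L2_regular z ->
    leb.-integrable I01 (EFin \o (fun xi => k (retract (1, xi)) * txcut z t xi)).
  move=> ck rz; have c := cont_line1 (x := 1) (continuous_retract ck).
  by apply: (int_contM c); apply: L2on_int; case: (cut_field rz).
have i1 := int _ _ ck1 r1; have i2 := int _ _ ck2 r2; have i3 := int _ _ ck3 r3.
rewrite -(RintD mI i1 i2) -(RintD mI (intD mI i1 i2) i3).
apply: eq_Rintegral => xi; rewrite inE/= in_itv/= => hxi.
by rewrite (retract_id (triangle_right hxi)) /txcut t0 hxi.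
Qed.

Lemma tcut_pos (tau : R -> R) t : 0 < t -> tcut tau t = tau t.
Proof. by move=> /ltW t0; rewrite /tcut t0. Qed.

End ClosedLoop.

Section ClosedLoopDecay.
Context {R : realType}.
Notation leb := (@lebesgue_measure R).
Notation I01 := (`[(0 : R), 1]%classic : set R).
Implicit Types (k F : R * R -> R) (f g : R -> R -> R) (h a : R -> R) (t x xi T : R).

Let rate_algebra (C1 C2 r n1 n2 n3 n4 n5 n6 B1 B2 : R) : 0 <= C1 -> 0 <= C2 -> 0 <= r ->
  0 <= n1 -> 0 <= n2 -> 0 <= n3 -> 0 <= n4 -> 0 <= n5 -> 0 <= n6 ->
  B1 <= C1 * (n1 + n2 + n3 + n4 + n5 + n6) ->
  B2 = C2 * (n4 + n5 + n6 + B1 + r * B1) ->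
  B1 + B2 <= (C1 + C2 * (1 + C1 + r * C1)) * (n1 + n2 + n3 + n4 + n5 + n6).
Proof.
move=> C10 C20 r0 h1 h2 h3 h4 h5 h6 hB ->.
set S := n1 + _ + _ + _ + _ + _ in hB *.
have S3 : n4 + n5 + n6 <= S by rewrite /S; lra.
rewrite (_ : (C1 + _) * S = C1 * S + C2 * (S + C1 * S + r * (C1 * S))); last by ring.
apply: lerD => //; apply: (ler_wpM2l C20); apply: lerD; last exact: (ler_wpM2l r0).
exact: lerD.
Qed.

Let error_initial_algebra (C n1 n2 n3 n4 n5 n6 e1 e2 e3 : R) : 0 <= C ->
  e1 <= n1 + n4 -> e2 <= n2 + n5 -> e3 <= n3 + n6 ->
  C * (e1 + e2 + e3) <= C * (n1 + n2 + n3 + n4 + n5 + n6).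
Proof. by move=> C0 h1 h2 h3; apply: (ler_wpM2l C0); lra. Qed.

Let l2normB_le h h' : L2on I01 h -> L2on I01 h' ->
  l2norm I01 (fun x => h x - h' x) <= l2norm I01 h + l2norm I01 h'.
Proof.
move=> Lh Lh'; have L := L2onZ (-1) Lh'.
rewrite (@eq_l2norm _ 0 1 _ (fun x => h x + -1 * h' x)); last by move=> x _; rewrite mulN1r.
by apply: (le_trans (l2normD Lh L)); rewrite lerD2l (l2normZ _ Lh') normrN1 mul1r.
Qed.

(** [controller_decay] applied to the observer, with the innovation and the
    outgoing traces of the error, bounded by [error_decay], as data. *)
Lemma closed_loop_decay (c : coefs R) (q1 q2 rho1 rho2 : R) (k1 k2 k3 m1 m2 m3 : R * R -> R) :
  0 < mu c -> 0 < gamma1 c -> 0 < gamma2 c ->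
  continuous (alpha c) -> continuous (theta1 c) -> continuous (theta2 c) ->
  controller_kernels c q1 q2 k1 k2 k3 -> observer_kernels c rho1 rho2 m1 m2 m3 ->
  exists2 C : R, 0 <= C &
    forall (u10 u20 w0 uh10 uh20 wh0 : R -> R) (u1 u2 w uh1 uh2 wh : unknown R),
    in_L2 I01 u10 -> in_L2 I01 u20 -> in_L2 I01 w0 ->
    in_L2 I01 uh10 -> in_L2 I01 uh20 -> in_L2 I01 wh0 ->
    let U := control_law rho1 rho2 k1 k2 k3 u1 u2 uh1 uh2 wh in
    plant_solution c q1 q2 rho1 rho2 U u10 u20 w0 u1 u2 w ->
    observer_solution c q1 q2 rho1 rho2 (observer_gain c m1) (observer_gain c m2) (observer_gain c m3)
      U (trace0 w) uh10 uh20 wh0 uh1 uh2 wh ->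
    let B := C * (l2norm I01 u10 + l2norm I01 u20 + l2norm I01 w0
                  + l2norm I01 uh10 + l2norm I01 uh20 + l2norm I01 wh0) in
    [/\ decays 4^-1 B (txcut u1), decays 4^-1 B (txcut u2), decays 4^-1 B (txcut w) &
      [/\ decays 4^-1 B (txcut uh1), decays 4^-1 B (txcut uh2) & decays 4^-1 B (txcut wh)]].
Proof.
move=> m0 g10 g20 cal cth1 cth2 hk hm.
have [[ck1 ck2 ck3] _ _] := hk.
have [[c1 c2 c3] [ak1 ak2 ak3] [dk1 dk2 ek]] := controller_kernels_extension cal cth1 cth2 hk.
have [[d1 d2 d3] [am1 am2 am3] [dm1 dm2 em]] := observer_kernels_extension cal cth1 cth2 hm.
have [C1 C10 error] := error_decay m0 g10 g20 cal cth1 cth2 d1 d2 d3 am1 am2 am3 dm1 dm2 em.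
pose P (m : R * R -> R) x := - mu c * m (retract (x, 0)).
have cP m : continuous (fun z => m (retract z)) -> continuous (P m).
  by move=> cm; exact: (contM (@cont_cst _ _ (- mu c)) (cont_line2 (xi := 0) cm)).
have [C2 C20 controller] := controller_decay m0 g10 g20 cal cth1 cth2 c1 c2 c3 ak1 ak2 ak3 dk1 dk2 ek
  (cP _ d1) (cP _ d2) (cP _ d3).
pose r := `|rho1| + `|rho2|; have r0 : 0 <= r by rewrite addr_ge0.
exists (C1 + C2 * (1 + C1 + r * C1)).
  by apply: addr_ge0 => //; apply: mulr_ge0 => //; apply: addr_ge0; [exact: addr_ge0|exact: mulr_ge0].
move=> u10 u20 w0 uh10 uh20 wh0 u1 u2 w uh1 uh2 wh L1 L2 L3 L4 L5 L6 U [Hu1 Hu2 Hw Hbd] [Huh1 Huh2 Hwh Hbdh] B.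
have [ru1 _] := Hu1; have [ru2 _] := Hu2; have [rw _] := Hw.
have [ruh1 _] := Huh1; have [ruh2 _] := Huh2; have [rwh _] := Hwh.
have fu1 := cut_field ru1; have fu2 := cut_field ru2; have fw := cut_field rw.
have fuh1 := cut_field ruh1; have fuh2 := cut_field ruh2; have fwh := cut_field rwh.
have tr0 (z : unknown R) : L2_regular z -> trace (tcut (trace0 z)).
  by move=> [_ _ _ h _]; exact: tcut_trace.
have tr1 (z : unknown R) : L2_regular z -> trace (tcut (trace1 z)).
  by move=> [_ _ _ _ h]; exact: tcut_trace.
pose y := tcut (trace0 w); pose om := tcut (trace0 wh).
pose tau t := y t + -1 * om t.
have ty : trace y := tr0 _ rw. have tom : trace om := tr0 _ rwh.
have ttau : trace tau := traceD ty (traceZ (-1) tom).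
have toty : trace (fun t => om t + tau t) := traceD tom ttau.
pose e1 t := tcut (trace1 u1) t - tcut (trace1 uh1) t.
pose e2 t := tcut (trace1 u2) t - tcut (trace1 uh2) t.
have subtr (s s' : R -> R) : trace s -> trace s' -> trace (fun t => s t - s' t).
  move=> hs hs'; have := traceD hs (traceZ (-1) hs'); congr trace; apply/funext => t.
  by rewrite mulN1r.
have te1 : trace e1 := subtr _ _ (tr1 _ ru1) (tr1 _ ruh1).
have te2 : trace e2 := subtr _ _ (tr1 _ ru2) (tr1 _ ruh2).
(* The control cancels the reflections of the plant; at the boundary of the
   observer the difference with its own reflections is left. *)
pose d t := - rho1 * e1 t + - rho2 * e2 t.
have td : trace d := traceD (traceZ _ te1) (traceZ _ te2).
pose kap t := \int[leb]_(xi in I01) (k1 (retract (1, xi)) * txcut uh1 t xi)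
  + \int[leb]_(xi in I01) (k2 (retract (1, xi)) * txcut uh2 t xi)
  + \int[leb]_(xi in I01) (k3 (retract (1, xi)) * txcut wh t xi).
have tkap : trace kap.
  exact: (traceD (traceD (pairing_trace c1 fuh1) (pairing_trace c2 fuh2)) (pairing_trace c3 fwh)).
have Ukap t : 0 < t -> U t = - rho1 * trace1 u1 t - rho2 * trace1 u2 t + kap t.
  by move=> t0; rewrite /U /control_law (feedback_integral ck1 ck2 ck3 ruh1 ruh2 rwh (ltW t0)).
have aeS (A A' : R -> Prop) : (forall t, A t -> A' t) -> {ae leb, forall t, A t} -> {ae leb, forall t, A' t}.
  by move=> H; apply: (@filterS _ (almost_everywhere leb)) => t; exact: H.
have ae_refl (s : R -> R) : {ae leb, forall t, 0 < t -> s t = tcut s t}.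
  by apply: (@filterE _ (almost_everywhere leb)) => t t0; rewrite tcut_pos.
have otau t : om t + tau t = y t by rewrite /tau; ring.
have cutE f t x : 0 <= t -> 0 <= x <= 1 -> txcut f t x = f t x by move=> t0 hx; rewrite /txcut t0 hx.
have fsrc (s s' : R) (a : R -> R) f f' g : continuous a -> field f -> field f' -> field g ->
    field (fun t x => s * f t x + s' * f' t x + a x * g t x).
  by move=> ca hf hf' hg; exact: (fieldD (fieldD (fieldZ s hf) (fieldZ s' hf')) (fieldM ca hg)).
have fsrc3 f f' : field f -> field f' -> field (fun t x => theta1 c x * f t x + theta2 c x * f' t x).
  by move=> hf hf'; exact: (fieldD (fieldM cth1 hf) (fieldM cth2 hf')).
have ftau m : continuous (P m) -> field (fun t x => - (P m x * tau t)).
  by move=> cm; exact: (fieldN (field_tensor cm ttau)).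
have PE m x : 0 <= x <= 1 -> P m x = observer_gain c m x.
  by move=> hx; rewrite /P (retract_id (triangle_bottom hx)).
have ytau t : 0 <= t -> tau t = trace0 w t - trace0 wh t.
  by move=> t0; rewrite /tau /y /om /tcut t0 mulN1r.
(* The output [y] is written [om + tau], so that the inflow traces of the
   plant and of the observer are the same functions at every time. *)
have S1 : sol (gamma1 c) (fun t x => sigma11 c * txcut u1 t x + sigma12 c * txcut u2 t x + alpha c x * txcut w t x)
    u10 (txcut u1) (fun t => q1 * (om t + tau t)) (tcut (trace1 u1)).
  apply: (transport_sol Hu1 L1 (fsrc _ _ _ _ _ _ cal fu1 fu2 fw) _ (traceZ q1 toty) (tr1 _ ru1) _ (ae_refl _)).
    by move=> t x t0 hx; rewrite !cutE.
  by apply: aeS Hbd => t H t0; have [-> _ _] := H t0; rewrite otau /y tcut_pos.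
have S2 : sol (gamma2 c) (fun t x => sigma21 c * txcut u1 t x + sigma22 c * txcut u2 t x + alpha c x * txcut w t x)
    u20 (txcut u2) (fun t => q2 * (om t + tau t)) (tcut (trace1 u2)).
  apply: (transport_sol Hu2 L2 (fsrc _ _ _ _ _ _ cal fu1 fu2 fw) _ (traceZ q2 toty) (tr1 _ ru2) _ (ae_refl _)).
    by move=> t x t0 hx; rewrite !cutE.
  by apply: aeS Hbd => t H t0; have [_ -> _] := H t0; rewrite otau /y tcut_pos.
have S3 : sol (- mu c) (fun t x => theta1 c x * txcut u1 t x + theta2 c x * txcut u2 t x)
    w0 (txcut w) y kap.
  apply: (transport_sol Hw L3 (fsrc3 _ _ fu1 fu2) _ ty tkap (ae_refl _)).
    by move=> t x t0 hx; rewrite !cutE.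
  by apply: aeS Hbd => t H t0; have [_ _ ->] := H t0; rewrite Ukap//; ring.
have T1 : sol (gamma1 c) (fun t x => sigma11 c * txcut uh1 t x + sigma12 c * txcut uh2 t x
      + alpha c x * txcut wh t x - P m1 x * tau t)
    uh10 (txcut uh1) (fun t => q1 * (om t + tau t)) (tcut (trace1 uh1)).
  apply: (transport_sol Huh1 L4 (fieldD (fsrc _ _ _ _ _ _ cal fuh1 fuh2 fwh) (ftau _ (cP _ d1))) _ (traceZ q1 toty) (tr1 _ ruh1) _ (ae_refl _)).
    by move=> t x t0 hx; rewrite !cutE// PE// ytau.
  by apply: aeS Hbdh => t H t0; have [-> _ _] := H t0; rewrite otau /y tcut_pos.
have T2 : sol (gamma2 c) (fun t x => sigma21 c * txcut uh1 t x + sigma22 c * txcut uh2 t x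
      + alpha c x * txcut wh t x - P m2 x * tau t)
    uh20 (txcut uh2) (fun t => q2 * (om t + tau t)) (tcut (trace1 uh2)).
  apply: (transport_sol Huh2 L5 (fieldD (fsrc _ _ _ _ _ _ cal fuh1 fuh2 fwh) (ftau _ (cP _ d2))) _ (traceZ q2 toty) (tr1 _ ruh2) _ (ae_refl _)).
    by move=> t x t0 hx; rewrite !cutE// PE// ytau.
  by apply: aeS Hbdh => t H t0; have [_ -> _] := H t0; rewrite otau /y tcut_pos.
have T3 : sol (- mu c) (fun t x => theta1 c x * txcut uh1 t x + theta2 c x * txcut uh2 t x - P m3 x * tau t)
    wh0 (txcut wh) om (fun t => kap t + d t).
  apply: (transport_sol Hwh L6 (fieldD (fsrc3 _ _ fuh1 fuh2) (ftau _ (cP _ d3))) _ tom (traceD tkap td) (ae_refl _)).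
    by move=> t x t0 hx; rewrite !cutE// PE// ytau.
  apply: aeS Hbdh => t H t0; have [_ _ ->] := H t0; rewrite Ukap// /d /e1 /e2 !tcut_pos//; ring.
(* The common inflow traces cancel in the difference of plant and observer. *)
have fD f f' : field f -> field f' -> field (fun t x => f t x - f' t x).
  by move=> hf hf'; exact: (fieldD hf (fieldN hf')).
have fe1 := fD _ _ fu1 fuh1; have fe2 := fD _ _ fu2 fuh2; have few := fD _ _ fw fwh.
have z0 q' : (fun t => q' * (om t + tau t) - q' * (om t + tau t)) = (fun=> 0).
  by apply/funext => t; rewrite subrr.
have E1 := solB S1 T1; rewrite z0 in E1.
have {}E1 := sol_eq (fieldD (fsrc (sigma11 c) (sigma12 c) _ _ _ _ cal fe1 fe2 few) (field_tensor (cP _ d1) ttau)) _ E1.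
have {}E1 := E1 (fun t x _ _ => ltac:(ring)).
have E2 := solB S2 T2; rewrite z0 in E2.
have {}E2 := sol_eq (fieldD (fsrc (sigma21 c) (sigma22 c) _ _ _ _ cal fe1 fe2 few) (field_tensor (cP _ d2) ttau)) _ E2.
have {}E2 := E2 (fun t x _ _ => ltac:(ring)).
have ztau : (fun t => y t - om t) = tau by apply/funext => t; rewrite /tau mulN1r.
have zd : (fun t => kap t - (kap t + d t)) = (fun t => rho1 * e1 t + rho2 * e2 t).
  by apply/funext => t; rewrite /d; ring.
have E3 := solB S3 T3; rewrite ztau zd in E3.
have {}E3 := sol_eq (fieldD (fsrc3 _ _ fe1 fe2) (field_tensor (cP _ d3) ttau)) _ E3.
have {}E3 := E3 (fun t x _ _ => ltac:(ring)).
have b1 := locally_bounded_cut ru1; have b2 := locally_bounded_cut ru2; have b3 := locally_bounded_cut rw.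
have bh1 := locally_bounded_cut ruh1; have bh2 := locally_bounded_cut ruh2; have bh3 := locally_bounded_cut rwh.
have bD f f' : field f -> field f' -> locally_bounded f -> locally_bounded f' ->
    locally_bounded (fun t x => f t x - f' t x).
  by move=> hf hf' bf bf'; exact: (locally_boundedD hf (fieldN hf') bf (locally_boundedN hf' bf')).
have := error _ _ _ _ _ _ _ _ _ E1 E2 E3 (bD _ _ fu1 fuh1 b1 bh1) (bD _ _ fu2 fuh2 b2 bh2) (bD _ _ fw fwh b3 bh3).
set B1 := C1 * _; cbv zeta => -[de1 de2 de3 dtau [dt1 dt2]].
have dd : trace_decays 2^-1 (r * B1) d.
  have := trace_decaysD (traceZ (- rho1) te1) (traceZ (- rho2) te2)
    (trace_decaysZ (- rho1) te1 dt1) (trace_decaysZ (- rho2) te2 dt2).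
  by rewrite !normrN -mulrDl.
have := controller _ _ _ _ _ _ _ _ _ _ _ _ _ T1 T2 T3 ttau dtau dd bh1 bh2.
set B2 := C2 * _; cbv zeta => -[dh1 dh2 dh3].
have mI : measurable I01 by exact: measurable_itv.
have M1 := in_L2_L2on mI L1; have M2 := in_L2_L2on mI L2; have M3 := in_L2_L2on mI L3.
have M4 := in_L2_L2on mI L4; have M5 := in_L2_L2on mI L5; have M6 := in_L2_L2on mI L6.
have hB1 : B1 <= C1 * (l2norm I01 u10 + l2norm I01 u20 + l2norm I01 w0
                  + l2norm I01 uh10 + l2norm I01 uh20 + l2norm I01 wh0).
  exact: (error_initial_algebra C10 (l2normB_le M1 M4) (l2normB_le M2 M5) (l2normB_le M3 M6)).
have BB : B1 + B2 <= B.
  exact: (rate_algebra C10 C20 r0 (l2norm_ge0 _ _) (l2norm_ge0 _ _) (l2norm_ge0 _ _)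
    (l2norm_ge0 _ _) (l2norm_ge0 _ _) (l2norm_ge0 _ _) hB1 (erefl _)).
have B10 := decays_ge0 de1; have B20 := decays_ge0 dh1.
have B2B : B2 <= B by apply: le_trans BB; rewrite lerDr.
have quarter1 : (4^-1 : R) <= 1 by rewrite invf_le1 ?ler1n.
have add f f' : field f -> field f' -> decays 1 B1 (fun t x => f t x - f' t x) ->
    decays 4^-1 B2 f' -> decays 4^-1 B f.
  move=> hf hf' de dh; have de4 := decays_le quarter1 (lexx _) de.
  have := decays_le (lexx _) BB (decaysD (fD _ _ hf hf') hf' de4 dh).
  by apply: decays_eq => t x _ _; rewrite subrK.
split; [exact: (add _ _ fu1 fuh1 de1 dh1)|exact: (add _ _ fu2 fuh2 de2 dh2)|exact: (add _ _ fw fwh de3 dh3)|].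
split; [exact: (decays_le (lexx _) B2B dh1)|exact: (decays_le (lexx _) B2B dh2)|exact: (decays_le (lexx _) B2B dh3)].
Qed.

Lemma state_norm_le_sum (s : seq (R -> R)) : state_norm s <= \sum_(h <- s) `|L2norm h|.
Proof.
have S0 : 0 <= \sum_(h <- s) `|L2norm h| by apply: sumr_ge0.
rewrite /state_norm -[leRHS]ger0_norm// -sqrtr_sqr; apply: ler_wsqrtr.
elim: s {S0} => [|h s IH]; first by rewrite !big_nil expr0n.
rewrite !big_cons sqrrD real_normK ?num_real//.
rewrite -addrA lerD2l; apply: (le_trans IH); rewrite lerDr mulrn_wge0// mulr_ge0//.
exact: sumr_ge0.
Qed.

End ClosedLoopDecay.

Section SixComponents.
Context {R : realType}.
Notation I01 := (`[(0 : R), 1]%classic : set R).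

Let abs_le_sqrt (a S : R) : a ^+ 2 <= S -> `|a| <= Num.sqrt S.
Proof. by move=> h; rewrite -sqrtr_sqr; exact: ler_wsqrtr. Qed.

Lemma sum_le_state_norm (f1 f2 f3 f4 f5 f6 : R -> R) :
  `|L2norm f1| + `|L2norm f2| + `|L2norm f3| + `|L2norm f4| + `|L2norm f5| + `|L2norm f6|
  <= 6 * state_norm [:: f1; f2; f3; f4; f5; f6].
Proof.
rewrite /state_norm !big_cons big_nil.
move: (L2norm f1) (L2norm f2) (L2norm f3) (L2norm f4) (L2norm f5) (L2norm f6) => a1 a2 a3 a4 a5 a6.
have h1 := sqr_ge0 a1; have h2 := sqr_ge0 a2; have h3 := sqr_ge0 a3.
have h4 := sqr_ge0 a4; have h5 := sqr_ge0 a5; have h6 := sqr_ge0 a6.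
set S := a1 ^+ 2 + _.
have l1 : `|a1| <= Num.sqrt S by apply: abs_le_sqrt; rewrite /S; lra.
have l2 : `|a2| <= Num.sqrt S by apply: abs_le_sqrt; rewrite /S; lra.
have l3 : `|a3| <= Num.sqrt S by apply: abs_le_sqrt; rewrite /S; lra.
have l4 : `|a4| <= Num.sqrt S by apply: abs_le_sqrt; rewrite /S; lra.
have l5 : `|a5| <= Num.sqrt S by apply: abs_le_sqrt; rewrite /S; lra.
have l6 : `|a6| <= Num.sqrt S by apply: abs_le_sqrt; rewrite /S; lra.
rewrite (_ : 6 * Num.sqrt S = Num.sqrt S + Num.sqrt S + Num.sqrt S + Num.sqrt S + Num.sqrt S + Num.sqrt S); last by ring.
exact: lerD (lerD (lerD (lerD (lerD l1 l2) l3) l4) l5) l6.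
Qed.

Lemma in_L2_norm (h : R -> R) : in_L2 I01 h -> l2norm I01 h = `|L2norm h|.
Proof.
move=> Lh; rewrite (L2normE (in_L2_L2on (measurable_itv _) Lh)) ger0_norm//.
exact: l2norm_ge0.
Qed.

Lemma decays_L2norm nu B (z : unknown R) t : L2_regular z -> 0 <= t ->
  decays nu B (txcut z) -> `|L2norm (z t)| <= expR (- nu * t) * B.
Proof.
move=> [_ Lz _ _ _] t0 d; rewrite -(in_L2_norm (Lz t t0)) -(l2norm_cut _ t0).
apply: le_trans (ler_wpM2l (expR_ge0 _) (d t t0)).
by rewrite mulrA -expRD mulNr addNr expR0 mul1r.
Qed.

Lemma exponential_profile_continuous (a b d : R) : continuous (fun x : R => a * expR (b * x / d)).
Proof.
rewrite (_ : (fun x => _) = fun x : R => a * expR (0 + (b / d) * x)).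
  by apply: contM; [exact: cont_cst|exact: expR_cont].
by apply/funext => x; rewrite add0r mulrAC.
Qed.

End SixComponents.

Theorem theorem3 (R : realType) (g a Cf H V : R)
    (g_gt0 : 0 < g) (a_gt0 : 0 < a) (Cf_gt0 : 0 < Cf)
    (H_gt0 : 0 < H) (V_gt0 : 0 < V)
    (Fr_neq1 : froude g H V < 1 \/ 1 < froude g H V)
    (l1 l2 l3 : R) (l1_lt0 : l1 < 0) (l2_gt0 : 0 < l2) (l23 : l2 < l3)
    (l1P : eigenvalue (sve_matrix g a H V) l1)
    (l2P : eigenvalue (sve_matrix g a H V) l2)
    (l3P : eigenvalue (sve_matrix g a H V) l3)
    (q1 q2 rho1 rho2 : R)
    (k1 k2 k3 m1 m2 m3 : R * R -> R) :
  let c := sve_coefs Cf H V l1 l2 l3 in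
  controller_kernels c q1 q2 k1 k2 k3 ->
  observer_kernels c rho1 rho2 m1 m2 m3 ->
  let p1 := observer_gain c m1 in
  let p2 := observer_gain c m2 in
  let p3 := observer_gain c m3 in
  exists C nu : R, 0 < C /\ 0 < nu /\
    forall u10 u20 w0 uh10 uh20 wh0 : R -> R,
      in_L2 `[0, 1] u10 -> in_L2 `[0, 1] u20 -> in_L2 `[0, 1] w0 ->
      in_L2 `[0, 1] uh10 -> in_L2 `[0, 1] uh20 -> in_L2 `[0, 1] wh0 ->
    forall u1 u2 w uh1 uh2 wh : unknown R,
      let U := control_law rho1 rho2 k1 k2 k3 u1 u2 uh1 uh2 wh in
      let y := trace0 w in
      plant_solution c q1 q2 rho1 rho2 U u10 u20 w0 u1 u2 w ->
      observer_solution c q1 q2 rho1 rho2 p1 p2 p3 U y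
        uh10 uh20 wh0 uh1 uh2 wh ->
    forall t : R, 0 <= t ->
      state_norm [:: u1 t; u2 t; w t; uh1 t; uh2 t; wh t]
      <= C * expR (- nu * t) * state_norm [:: u10; u20; w0; uh10; uh20; wh0].
Proof.
move=> c hk hm p1 p2 p3.
have mu0 : 0 < mu c by rewrite /= oppr_gt0.
have g20 : 0 < gamma2 c := lt_trans l2_gt0 l23.
have ca : continuous (alpha c) by exact: exponential_profile_continuous.
have c1 : continuous (theta1 c) by exact: exponential_profile_continuous.
have c2 : continuous (theta2 c) by exact: exponential_profile_continuous.
have [C C0 decay] := closed_loop_decay mu0 l2_gt0 g20 ca c1 c2 hk hm.
(* Comparing the norm of the state with the sum of its six components costs a
   factor 6 at each end, and adding 1 makes the constant positive. *)
exists (36 * C + 1), 4^-1; split; first by rewrite ltr_wpDl// mulr_ge0.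
split; first by rewrite invr_gt0.
move=> u10 u20 w0 uh10 uh20 wh0 L1 L2 L3 L4 L5 L6 u1 u2 w uh1 uh2 wh U y hp ho t t0.
have [d1 d2 d3 [d4 d5 d6]] := decay _ _ _ _ _ _ _ _ _ _ _ _ L1 L2 L3 L4 L5 L6 hp ho.
have [[r1 _] [r2 _] [r3 _] _] := hp; have [[r4 _] [r5 _] [r6 _] _] := ho.
have := sum_le_state_norm u10 u20 w0 uh10 uh20 wh0.
move: d1 d2 d3 d4 d5 d6; rewrite !in_L2_norm//.
set S := _ + _ + _ + _ + _ + `|L2norm wh0|; set S0 := state_norm _ => d1 d2 d3 d4 d5 d6 hS.
have S00 : 0 <= S0 := sqrtr_ge0 _.
apply: (le_trans (state_norm_le_sum _)); rewrite !big_cons big_nil.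
set X := expR (- 4^-1 * t) * (C * S).
have e1 : `|L2norm (u1 t)| <= X := decays_L2norm r1 t0 d1.
have e2 : `|L2norm (u2 t)| <= X := decays_L2norm r2 t0 d2.
have e3 : `|L2norm (w t)| <= X := decays_L2norm r3 t0 d3.
have e4 : `|L2norm (uh1 t)| <= X := decays_L2norm r4 t0 d4.
have e5 : `|L2norm (uh2 t)| <= X := decays_L2norm r5 t0 d5.
have e6 : `|L2norm (wh t)| <= X := decays_L2norm r6 t0 d6.
apply: (@le_trans _ _ (6 * X)).
  rewrite (_ : 6 * X = X + (X + (X + (X + (X + (X + 0)))))); last by ring.
  exact: lerD e1 (lerD e2 (lerD e3 (lerD e4 (lerD e5 (lerD e6 (lexx _)))))).
have E0 : 0 <= expR (- 4^-1 * t) := expR_ge0 _.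
apply: (@le_trans _ _ (6 * (expR (- 4^-1 * t) * (C * (6 * S0))))).
  by apply: (ler_wpM2l (ler0n _ 6)); apply: (ler_wpM2l E0); exact: (ler_wpM2l C0).
rewrite (_ : 6 * _ = 36 * C * expR (- 4^-1 * t) * S0); last by ring.
by apply: (ler_wpM2r S00); apply: (ler_wpM2r E0); rewrite lerDl.
Qed.
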